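(* Let $b_1,b_2$ be smooth functions from $\mathbb R^2$ to $\mathbb R^2$, with associated vector fields $A_j=\sum_{i=1}^2b_{j,i}(x)\partial_{x_i}$ and transposes ${}^tA_j=A_j+\mathrm{div}(b_j)=\sum_{i=1}^2\partial_{x_i}\circ b_{j,i}$, acting componentwise on vector-valued measures. For $j,k\in\{1,2\}$ let $H_{jk}$ be $C^\infty$ functions on $\mathbb R^2$ with values in real $m_j\times m_k$ matrices. Let $\mu=(\mu_1,\mu_2)\in\mathcal M_{loc}(\mathbb R^2,\mathbb R^{m_1+m_2})$ solve $$\begin{pmatrix}{}^tA_1&0\\0&{}^tA_2\end{pmatrix}\begin{pmatrix}\mu_1\\\mu_2\end{pmatrix}+\begin{pmatrix}H_{11}&H_{12}\\H_{21}&H_{22}\end{pmatrix}\begin{pmatrix}\mu_1\\\mu_2\end{pmatrix}=0$$ in the sense of distributions. Assume that the vector fields $A_1$ and $A_2$ are linearly independent at each point $x\in\mathbb R^2$. Then for $j\in\{1,2\}$ the set $$Z_j=\Bigl\{\Bigl(x,\frac{d\mu_j}{d|\mu_j|}(x)\Bigr),\ x\in\mathbb R^2\Bigr\}$$ is $|\mu_{j,s}|$-a.e. invariant by the flow $$(x_0,\omega_0)\mapsto\Bigl(x_j(s),\frac{\omega_j(s)}{\|\omega_j(s)\|}\Bigr),$$ where $$\dot x_j(s)=b_j(x_j(s)),\quad x_j(0)=x_0,\qquad\dot\omega_j(s)=-H_{jj}(x_j(s))\,\omega_j(s),\quad\omega_j(0)=\omega_0.$$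
   Context: $\mathcal M_{loc}(\mathbb R^2,\mathbb R^m)$ is the space of $\mathbb R^m$-valued locally bounded Radon measures. For such a measure $\mu_j$, $|\mu_j|$ is the total variation, $\frac{d\mu_j}{d|\mu_j|}$ the polar function, $\mu_{j,s}$ the singular part with respect to Lebesgue measure, and $|\mu_{j,s}|=|\mu_j|_s$. ''$Z_j$ is $|\mu_{j,s}|$-a.e. invariant by the flow'' means: for every $s\in\mathbb R$, for $|\mu_{j,s}|$-almost every $x_0$ (for which $x_j(\cdot)$ is defined up to time $s$), if $\omega_0=\frac{d\mu_j}{d|\mu_j|}(x_0)$, then $\frac{d\mu_j}{d|\mu_j|}(x_j(s))=\frac{\omega_j(s)}{\|\omega_j(s)\|}$. *)

(* Defs.v *)
From HB Require Import structures.
From mathcomp Require Import all_boot all_order all_algebra.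
From mathcomp Require Import all_classical all_reals all_analysis.
From mathcomp Require Import ring.

Set Implicit Arguments.
Unset Strict Implicit.
Unset Printing Implicit Defensive.
Import Order.TTheory GRing.Theory Num.Theory.
Import numFieldNormedType.Exports.

Local Open Scope classical_set_scope.
Local Open Scope ring_scope.

(* [R * R] carries the library's product topology and product (= Borel)
   sigma-algebra. *)
Notation plane R := (R * R)%type.

Section smooth.
Context {R : realType} {W : normedModType R}.

Definition d1 (f : plane R -> W) (x : plane R) : W :=
  'D_((1, 0) : plane R) f x.
Definition d2 (f : plane R -> W) (x : plane R) : W :=
  'D_((0, 1) : plane R) f x.

Fixpoint Cn (n : nat) (f : plane R -> W) : Prop :=
  match n with
  | 0 => continuous f
  | n'.+1 => [/\ continuous f,
      forall x, derivable f x ((1, 0) : plane R),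
      forall x, derivable f x ((0, 1) : plane R),
      Cn n' (d1 f) & Cn n' (d2 f)]
  end.

Definition smooth (f : plane R -> W) : Prop := forall n, Cn n f.

End smooth.

Definition test_function {R : realType} (phi : plane R -> R) : Prop :=
  smooth phi /\
  exists2 K : set (plane R), compact K & forall x, ~ K x -> phi x = 0.

Definition vfield {R : realType} (b : plane R -> plane R) (phi : plane R -> R)
    (x : plane R) : R :=
  (b x).1 * d1 phi x + (b x).2 * d2 phi x.

Definition bounded_borel {R : realType} : set (set (plane R)) :=
  [set A : set (plane R) | measurable A /\ bounded_set A].

(* Euclidean norm: the library's norm on matrices is the sup norm. *)
Definition enorm {R : realType} {m : nat} (v : 'cV[R]_m) : R :=
  Num.sqrt (\sum_i v i 0 ^+ 2).

(* An R^m-valued, locally bounded Radon measure on R^2 is a set function on the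
   bounded Borel sets whose restriction to every bounded Borel set is countably
   additive. The values of [vm] on other sets are meaningless. *)
Record vradon (R : realType) (m : nat) := VRadon {
  vm :> set (plane R) -> 'cV[R]_m ;
  vm_sigma_additive : forall (B : set (plane R)) (i : 'I_m), bounded_borel B ->
    semi_sigma_additive (fun A : set (plane R) => (vm (A `&` B) i 0)%:E) }.

Section variation.
Context {R : realType}.
Implicit Types (g : set (plane R) -> R) (A B : set (plane R))
  (F : (set (plane R))^nat).

Definition packing A : set ((set (plane R))^nat) :=
  [set F | [/\ forall k, bounded_borel (F k), trivIset setT F &
                forall k, F k `<=` A]].

(* For Borel A and the functions [g] used below (subadditive, nonnegative), the
   supremum over countable disjoint families of bounded Borel subsets of A is the
   supremum over countable partitions of A into bounded Borel sets. *)
Definition variation g A : \bar R :=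
  ereal_sup [set (\sum_(0 <= k <oo) (g (F k))%:E)%E | F in packing A].

End variation.

(* total variation measure |mu| *)
Definition tv {R : realType} {m : nat} (mu : vradon R m) :
    set (plane R) -> \bar R :=
  variation (fun A => enorm (mu A)).

(* positive and negative parts of the i-th component of mu *)
Definition posv {R : realType} {m : nat} (mu : vradon R m) (i : 'I_m) :
    set (plane R) -> \bar R :=
  variation (fun A => Num.max (mu A i 0) 0).
Definition negv {R : realType} {m : nat} (mu : vradon R m) (i : 'I_m) :
    set (plane R) -> \bar R :=
  variation (fun A => Num.max (- mu A i 0) 0).

Section variation_measure.
Context {R : realType} (g : set (plane R) -> R).
Hypothesis g0 : g set0 = 0.
Hypothesis g_ge0 : forall A, 0 <= g A.
Hypothesis g_sub : forall F : (set (plane R))^nat,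
  (forall k, measurable (F k)) -> trivIset setT F ->
  bounded_borel (\bigcup_k F k) ->
  ((g (\bigcup_k F k))%:E <= \sum_(0 <= k <oo) (g (F k))%:E)%E.

Lemma bounded_borel0 : bounded_borel (set0 : set (plane R)).
Proof.
split; first exact: measurable0.
by exists 0; split=> // M _ x [].
Qed.

Lemma bounded_borelI (A B : set (plane R)) :
  bounded_borel A -> measurable B -> bounded_borel (A `&` B).
Proof.
move=> [mA bA] mB; split; first exact: measurableI.
case: bA => M [Mr bA]; exists M; split=> // r Mr' x [Ax _]; exact: bA Ax.
Qed.

Let gE A : (0 <= (g A)%:E)%E. Proof. by rewrite lee_fin. Qed.

Lemma variation_ge0 A : (0 <= variation g A)%E.
Proof.
apply: ereal_sup_ubound; exists (fun=> set0).
  split=> [k|i j _ _ [x []]//|k x []].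
  exact: bounded_borel0.
by rewrite eseries0// => k _ _; rewrite g0.
Qed.

Lemma variation0 : variation g set0 = 0%E.
Proof.
apply/eqP; rewrite eq_le variation_ge0 andbT.
apply: ge_ereal_sup => _ [F [_ _ F0] <-].
rewrite eseries0// => k _ _.
by rewrite (_ : F k = set0) ?g0 -?classical_sets.subset0.
Qed.

Lemma le_variation A B : A `<=` B -> (variation g A <= variation g B)%E.
Proof.
move=> AB; apply: ge_ereal_sup => _ [F [bF tF FA] <-].
apply: ereal_sup_ubound; exists F => //; split=> // k x /FA; exact: AB.
Qed.

Let packing_cat A B (F G : (set (plane R))^nat) n :
  A `&` B = set0 -> packing A F -> packing B G ->
  (\sum_(0 <= k < n) (g (F k))%:E + \sum_(0 <= k <oo) (g (G k))%:E
    <= variation g (A `|` B))%E.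
Proof.
move=> AB0 [bF tF FA] [bG tG GB].
pose H k := if (k < n)%N then F k else G (k - n)%N.
have HE : (\sum_(0 <= k < n) (g (F k))%:E + \sum_(0 <= k <oo) (g (G k))%:E
           = \sum_(0 <= k <oo) (g (H k))%:E)%E.
  rewrite [RHS](nneseries_split 0 n); last by move=> k _; exact: gE.
  rewrite add0n; congr +%E.
    by apply: eq_big_nat => k /andP[_ kn]; rewrite /H kn.
  rewrite -[RHS]nneseries_addn; last by move=> k; exact: gE.
  by apply: eq_eseriesr => k _; rewrite /H ltnNge leq_addl /= addnK.
rewrite HE; apply: ereal_sup_ubound; exists H => //; split.
- by move=> k; rewrite /H; case: ifP.
- move=> i j _ _; rewrite /H; case: ifPn => hi; case: ifPn => hj.
  + exact: tF.
  + move=> [x [Fx Gx]]; suff: (A `&` B) x by rewrite AB0.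
    by split; [exact: FA Fx|exact: GB Gx].
  + move=> [x [Gx Fx]]; suff: (A `&` B) x by rewrite AB0.
    by split; [exact: FA Fx|exact: GB Gx].
  + move=> /(tG _ _ I I) /eqP; rewrite -!leqNgt in hi hj.
    by rewrite -(eqn_add2r n) !subnK// => /eqP.
- move=> k; rewrite /H; case: ifP => _ x.
  + by move=> /FA; left.
  + by move=> /GB; right.
Qed.

Let variationU_ge A B : A `&` B = set0 ->
  (variation g A + variation g B <= variation g (A `|` B))%E.
Proof.
move=> AB0; have [->|] := eqVneq (variation g (A `|` B)) +oo%E.
  by rewrite leey.
rewrite -ltey => Voo.
have Vfin : variation g (A `|` B) \is a fin_num.
  by rewrite ge0_fin_numE// variation_ge0.
have VAfin : variation g A \is a fin_num.
  rewrite ge0_fin_numE ?variation_ge0//; apply: le_lt_trans Voo.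
  by apply: le_variation; exact: subsetUl.
have VBfin : variation g B \is a fin_num.
  rewrite ge0_fin_numE ?variation_ge0//; apply: le_lt_trans Voo.
  by apply: le_variation; exact: subsetUr.
have sfin C F : variation g C \is a fin_num -> packing C F ->
    (\sum_(0 <= k <oo) (g (F k))%:E)%E \is a fin_num.
  move=> Cfin pF; rewrite ge0_fin_numE ?nneseries_ge0//.
  have : (\sum_(0 <= k <oo) (g (F k))%:E <= variation g C)%E.
    by apply: ereal_sup_ubound; exists F.
  by move=> /le_lt_trans; apply; rewrite ltey_eq Cfin.
rewrite -leeBrDr//; apply: ge_ereal_sup => _ [F pF <-].
have Ffin := sfin _ _ VAfin pF.
rewrite leeBrDr// addeC -leeBrDr//.
apply: ge_ereal_sup => _ [G pG <-].
have Gfin := sfin _ _ VBfin pG.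
rewrite leeBrDr// addeC -leeBrDr//.
apply: lime_le; first by apply: is_cvg_nneseries => k _ _; exact: gE.
apply: nearW => n; rewrite leeBrDr//; exact: packing_cat.
Qed.

Let variation_bigcup_ge (A : (set (plane R))^nat) : trivIset setT A ->
  (\sum_(0 <= n <oo) variation g (A n) <= variation g (\bigcup_n A n))%E.
Proof.
move=> tA; apply: lime_le.
  by apply: is_cvg_nneseries => k _ _; exact: variation_ge0.
apply: nearW => n.
apply: (@le_trans _ _ (variation g (\big[setU/set0]_(k < n) A k))); last first.
  by apply: le_variation; exact: bigsetU_bigcup.
elim: n => [|n ih]; first by rewrite !big_ord0 big_geq ?variation_ge0.
rewrite big_nat_recr//= big_ord_recr/=; apply: le_trans (variationU_ge _).
  by rewrite leeD2r.
rewrite -classical_sets.subset0 => x [].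
rewrite -bigcup_mkord => -[k /= kn Akx] Anx.
by have := tA k n I I (ex_intro _ x (conj Akx Anx)) => kE; rewrite kE ltnn in kn.
Qed.

Let variation_bigcup_le (A : (set (plane R))^nat) :
  (forall n, measurable (A n)) -> trivIset setT A ->
  (variation g (\bigcup_n A n) <= \sum_(0 <= n <oo) variation g (A n))%E.
Proof.
move=> mA tA; apply: ge_ereal_sup => _ [F [bF tF FA] <-].
have FE k : F k = \bigcup_n (F k `&` A n).
  by rewrite -setI_bigcupr; apply/esym/classical_sets.setIidPl; exact: FA.
apply: (@le_trans _ _
    (\sum_(0 <= k <oo) \sum_(0 <= n <oo) (g (F k `&` A n))%:E)%E).
  apply: lee_nneseries => [k _ _|k _]; first exact: gE.
  rewrite [in leLHS](FE k); apply: g_sub.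
  - by move=> n; apply: measurableI => //; case: (bF k).
  - exact: trivIset_setIl.
  - by rewrite -FE; exact: bF.
rewrite nneseries_interchange; last by move=> *; exact: gE.
apply: lee_nneseries => [n _ _|n _].
  by apply: nneseries_ge0 => k _ _; exact: gE.
apply: ereal_sup_ubound; exists (fun k => F k `&` A n) => //; split.
- by move=> k; exact: bounded_borelI.
- exact: trivIset_setIr.
- by move=> k x [].
Qed.

Lemma variation_semi_sigma_additive : semi_sigma_additive (variation g).
Proof.
move=> A mA tA _.
have -> : variation g (\bigcup_n A n) = (\sum_(0 <= n <oo) variation g (A n))%E.
  by apply/eqP; rewrite eq_le variation_bigcup_le// variation_bigcup_ge.
by apply: is_cvg_nneseries => n _ _; exact: variation_ge0.
Qed.

End variation_measure.

Section vradon_facts.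
Context {R : realType} {m : nat}.
Implicit Types (mu : vradon R m) (i : 'I_m).

Lemma vm_bigcup mu i (F : (set (plane R))^nat) :
  (forall k, measurable (F k)) -> trivIset setT F ->
  bounded_borel (\bigcup_k F k) ->
  series (fun k => mu (F k) i 0) @ \oo --> mu (\bigcup_k F k) i 0.
Proof.
move=> mF tF bF; have := @vm_sigma_additive _ _ mu _ i bF F mF tF bF.1.
rewrite setIid => /fine_cvgP[_]; apply: cvg_trans.
apply: near_eq_cvg; apply: nearW => n /=.
rewrite sumEFin /= /series/=; apply: eq_bigr => k _.
by rewrite (@setIidl _ (F k))//; exact: bigcup_sup.
Qed.

Lemma vm0 mu : mu set0 = 0.
Proof.
apply/matrixP => i j; rewrite ord1 mxE.
have : series (fun k : nat => mu set0 i 0) @ \oo --> mu set0 i 0.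
  have := @vm_bigcup mu i (fun=> set0); rewrite bigcup0//; apply.
  - by move=> k; exact: measurable0.
  - by move=> j1 j2 _ _ [x []].
  - exact: bounded_borel0.
move=> /cvgP /cvg_series_cvg_0 h.
exact: (cvg_unique _ (cvg_cst (mu set0 i 0)) h).
Qed.

Lemma enorm0 : enorm (0 : 'cV[R]_m) = 0.
Proof. by rewrite /enorm big1 ?sqrtr0// => i _; rewrite mxE expr0n. Qed.

Lemma enorm_ge0 (v : 'cV[R]_m) : 0 <= enorm v.
Proof. exact: sqrtr_ge0. Qed.

Lemma cauchy_schwarz (u v : 'cV[R]_m) :
  (\sum_i u i 0 * v i 0) ^+ 2 <= (\sum_i u i 0 ^+ 2) * (\sum_i v i 0 ^+ 2).
Proof.
set a := \sum_i u i 0 ^+ 2; set b := \sum_i u i 0 * v i 0.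
set c := \sum_i v i 0 ^+ 2.
have a0 : 0 <= a by apply: sumr_ge0 => i _; exact: sqr_ge0.
have h : 0 <= a * (a * c - b ^+ 2).
  have -> : a * (a * c - b ^+ 2) = \sum_i (a * v i 0 - b * u i 0) ^+ 2.
    under eq_bigr => i _.
      rewrite (_ : _ ^+ 2 = a ^+ 2 * v i 0 ^+ 2 - (a * b *+ 2) * (u i 0 * v i 0)
        + b ^+ 2 * u i 0 ^+ 2); last by ring.
      over.
    rewrite big_split/= sumrB -!mulr_sumr -/a -/b -/c; ring.
  by apply: sumr_ge0 => i _; exact: sqr_ge0.
move: a0; rewrite le_eqVlt => /orP[/eqP a0|a0].
  have u0 i : u i 0 = 0.
    apply/eqP; rewrite -sqrf_eq0; apply/eqP.
    apply: (@psumr_eq0P R _ xpredT (fun i => u i 0 ^+ 2)) => //.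
    by move=> k _; exact: sqr_ge0.
  by rewrite /b big1 ?expr0n -?a0 ?mul0r// => i _; rewrite u0 mul0r.
by rewrite pmulr_rge0// subr_ge0 in h.
Qed.

Lemma ler_enormD (u v : 'cV[R]_m) : enorm (u + v) <= enorm u + enorm v.
Proof.
rewrite -(@ler_pXn2r _ 2)// ?nnegrE ?addr_ge0 ?enorm_ge0//.
rewrite sqrrD /enorm !sqr_sqrtr; try by apply: sumr_ge0 => i _; exact: sqr_ge0.
under eq_bigr do rewrite mxE sqrrD.
rewrite !big_split/= lerD2r lerD2l -mulr2n lerMn2r/=.
rewrite -sqrtrM; last by apply: sumr_ge0 => i _; exact: sqr_ge0.
apply: le_trans (ler_norm _) _.
by rewrite -sqrtr_sqr; apply: ler_wsqrtr; exact: cauchy_schwarz.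
Qed.

Lemma enorm_bigcup mu (F : (set (plane R))^nat) :
  (forall k, measurable (F k)) -> trivIset setT F ->
  bounded_borel (\bigcup_k F k) ->
  ((enorm (mu (\bigcup_k F k)))%:E
    <= \sum_(0 <= k <oo) (enorm (mu (F k)))%:E)%E.
Proof.
move=> mF tF bF.
pose S n := \sum_(0 <= k < n) mu (F k).
have SE : enorm (S n) @[n --> \oo] --> enorm (mu (\bigcup_k F k)).
  apply: (@continuous_cvg _ _ _ _ _ _ Num.sqrt); first exact: sqrt_continuous.
  apply: cvg_big => [|i _]; first exact: add_continuous.
  have h : S n i 0 @[n --> \oo] --> mu (\bigcup_k F k) i 0.
    have := @vm_bigcup mu i F mF tF bF; apply: cvg_trans.
    by apply: near_eq_cvg; apply: nearW => n; rewrite /S summxE.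
  exact: (cvgM h h).
have /cvg_lim <- // : (enorm (S n))%:E @[n --> \oo]
    --> (enorm (mu (\bigcup_k F k)))%:E by apply: cvg_EFin; [exact: nearW|].
apply: lime_le; first by apply/cvg_ex; eexists; apply: cvg_EFin SE; exact: nearW.
apply: nearW => n.
apply: (@le_trans _ _ (\sum_(0 <= k < n) (enorm (mu (F k)))%:E)%E).
  rewrite sumEFin lee_fin /S; elim/big_ind2 : _ => //; first by rewrite enorm0.
  by move=> u x v y ux vy; apply: le_trans (ler_enormD _ _) _; exact: lerD.
by apply: nneseries_lim_ge => k _; rewrite lee_fin enorm_ge0.
Qed.

Lemma max_bigcup (c : R) mu i (F : (set (plane R))^nat) :
  (forall k, measurable (F k)) -> trivIset setT F ->
  bounded_borel (\bigcup_k F k) ->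
  ((Num.max (c * mu (\bigcup_k F k) i 0) 0)%:E
    <= \sum_(0 <= k <oo) (Num.max (c * mu (F k) i 0) 0)%:E)%E.
Proof.
move=> mF tF bF.
have t0 k : (0 <= (Num.max (c * mu (F k) i 0) 0)%:E)%E.
  by rewrite lee_fin le_max lexx orbT.
rewrite EFin_max ge_max; apply/andP; split; last exact: nneseries_ge0.
have h : (c * series (fun k => mu (F k) i 0) n)%:E @[n --> \oo]
    --> (c * mu (\bigcup_k F k) i 0)%:E.
  by apply: cvg_EFin; [exact: nearW|apply: cvgMl_tmp; exact: vm_bigcup].
rewrite -(cvg_lim _ h)//; apply: lime_le; first by apply/cvg_ex; eexists; exact: h.
apply: nearW => n.
apply: (@le_trans _ _ (\sum_(0 <= k < n) (Num.max (c * mu (F k) i 0) 0)%:E)%E).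
  rewrite sumEFin lee_fin /series/= mulr_sumr; apply: ler_sum => k _.
  by rewrite le_max lexx.
by apply: nneseries_lim_ge.
Qed.

Lemma posv_bigcup mu i (F : (set (plane R))^nat) :
  (forall k, measurable (F k)) -> trivIset setT F ->
  bounded_borel (\bigcup_k F k) ->
  ((Num.max (mu (\bigcup_k F k) i 0) 0)%:E
    <= \sum_(0 <= k <oo) (Num.max (mu (F k) i 0) 0)%:E)%E.
Proof.
move=> mF tF bF; have := @max_bigcup 1 mu i F mF tF bF.
by under eq_eseriesr do rewrite mul1r; rewrite mul1r.
Qed.

Lemma negv_bigcup mu i (F : (set (plane R))^nat) :
  (forall k, measurable (F k)) -> trivIset setT F ->
  bounded_borel (\bigcup_k F k) ->
  ((Num.max (- mu (\bigcup_k F k) i 0) 0)%:E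
    <= \sum_(0 <= k <oo) (Num.max (- mu (F k) i 0) 0)%:E)%E.
Proof.
move=> mF tF bF; have := @max_bigcup (-1) mu i F mF tF bF.
by under eq_eseriesr do rewrite mulN1r; rewrite mulN1r.
Qed.

Let enorm_vm0 mu : enorm (mu set0) = 0. Proof. by rewrite vm0 enorm0. Qed.

Let max_pos0 mu i : Num.max (mu set0 i 0) 0 = 0.
Proof. by rewrite vm0 mxE maxxx. Qed.

Let max_neg0 mu i : Num.max (- mu set0 i 0) 0 = 0.
Proof. by rewrite vm0 mxE oppr0 maxxx. Qed.

Let max_ge0 (x : R) : 0 <= Num.max x 0.
Proof. by rewrite le_max lexx orbT. Qed.

HB.instance Definition _ mu := isMeasure.Build _ _ _ (tv mu)
  (@variation0 _ (fun A => enorm (mu A)) (enorm_vm0 mu))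
  (@variation_ge0 _ (fun A => enorm (mu A)) (enorm_vm0 mu))
  (@variation_semi_sigma_additive _ (fun A => enorm (mu A)) (enorm_vm0 mu)
     (fun=> enorm_ge0 _) (@enorm_bigcup mu)).

HB.instance Definition _ mu i := isMeasure.Build _ _ _ (posv mu i)
  (@variation0 _ (fun A => Num.max (mu A i 0) 0) (max_pos0 mu i))
  (@variation_ge0 _ (fun A => Num.max (mu A i 0) 0) (max_pos0 mu i))
  (@variation_semi_sigma_additive _ (fun A => Num.max (mu A i 0) 0) (max_pos0 mu i)
     (fun=> max_ge0 _) (@posv_bigcup mu i)).

HB.instance Definition _ mu i := isMeasure.Build _ _ _ (negv mu i)
  (@variation0 _ (fun A => Num.max (- mu A i 0) 0) (max_neg0 mu i))
  (@variation_ge0 _ (fun A => Num.max (- mu A i 0) 0) (max_neg0 mu i))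
  (@variation_semi_sigma_additive _ (fun A => Num.max (- mu A i 0) 0) (max_neg0 mu i)
     (fun=> max_ge0 _) (@negv_bigcup mu i)).

End vradon_facts.

(* integral of [f] against the i-th component of [mu], through its Jordan
   decomposition *)
Definition vint {R : realType} {m : nat} (mu : vradon R m) (i : 'I_m)
    (f : plane R -> R) : R :=
  \int[posv mu i]_x f x - \int[negv mu i]_x f x.

(* [diag(tA_1, tA_2) mu + H mu = 0] in the sense of distributions, tested on
   each component: since tA_j = sum_i d_i o b_(j,i), the pairing of tA_j mu_j
   with phi is - \int A_j phi dmu_j. *)
Definition weak_solution {R : realType} {m : 'I_2 -> nat}
    (b : 'I_2 -> plane R -> plane R)
    (H : forall j k, plane R -> 'M[R]_(m j, m k))
    (mu : forall j, vradon R (m j)) : Prop :=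
  forall (j : 'I_2) (i : 'I_(m j)) (phi : plane R -> R), test_function phi ->
    - vint (mu j) i (vfield (b j) phi)
    + \sum_k \sum_l vint (mu k) l (fun x => H j k x i l * phi x) = 0.

(* [sigma] is a version of the polar function dmu/d|mu| *)
Definition polar {R : realType} {m : nat} (mu : vradon R m)
    (sigma : plane R -> 'cV[R]_m) : Prop :=
  (forall i, measurable_fun [set: plane R] (fun x => sigma x i 0)) /\
  forall (A : set (plane R)) i, bounded_borel A ->
    (\int[tv mu]_(x in A) (sigma x i 0)%:E = (mu A i 0)%:E)%E.

Definition lebesgue2 {R : realType} : set (plane R) -> \bar R :=
  (lebesgue_measure \x lebesgue_measure)%E.

Definition singular_part {R : realType} {m : nat} (mu mus : vradon R m) : Prop :=
  exists mua : vradon R m,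
    [/\ forall A : set (plane R), bounded_borel A -> mu A = mua A + mus A,
        tv mua `<< lebesgue2 &
        exists N : set (plane R),
          [/\ measurable N, lebesgue2 N = 0%E & tv mus (~` N) = 0%E]].

Definition flow_line {R : realType} {n : nat} (b : plane R -> plane R)
    (H : plane R -> 'M[R]_n) (x0 : plane R) (w0 : 'cV[R]_n) (t0 t1 : R)
    (x : R -> plane R) (w : R -> 'cV[R]_n) : Prop :=
  [/\ x 0 = x0, w 0 = w0 &
    forall t : R, t0 < t < t1 ->
      is_derive t (1 : R) x (b (x t)) /\
      is_derive t (1 : R) w (- (H (x t) *m w t))].

(* The flow need not be complete: for each s, only the initial points whose flow
   line is defined on an open interval containing 0 and s are considered. *)
Definition ae_flow_invariant {R : realType} {n : nat}
    (lambda : set (plane R) -> \bar R) (b : plane R -> plane R)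
    (H : plane R -> 'M[R]_n) (Z : set (plane R * 'cV[R]_n)) : Prop :=
  forall s : R, {ae lambda, forall x0 : plane R,
    forall (w0 : 'cV[R]_n), Z (x0, w0) ->
    forall (t0 t1 : R) (x : R -> plane R) (w : R -> 'cV[R]_n),
      t0 < 0 < t1 -> t0 < s < t1 -> flow_line b H x0 w0 t0 t1 x w ->
      Z (x s, (enorm (w s))^-1 *: w s)}.

(* Main.v *)
(* Let phi be the flow of b_j and W the resolvent of w' = - H_jj(phi) w, so that
   omega_j(t) = W_t(x_0) omega_0. Testing the j-th equation against
   x |-> g(phi_t x) W_t(x) and differentiating in t shows that the integral of
   W_t sigma_j against |mu_j| over phi_t^-1(B) does not depend on t as long as
   |mu_k|(phi_t^-1(B)) = 0 for almost every t, where k <> j.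

   For a Lebesgue-null set B that last condition always holds. Averaging the
   measures over times t of the flow of b_j and q of the flow of b_k gives a measure
   for which squares of side e have mass O(e^2), because (t, q) |-> phi_t(phi'_q x)
   is locally expanding when b_j and b_k are independent; hence it is absolutely
   continuous. The average over q can then be removed: by the first step applied to
   the k-th equation, a set which is null for the translates of |mu_j| and |mu_k|
   along b_k for almost every small q is null for |mu_k|.

   If N is a Lebesgue-null set carrying the singular part, then on N the flow phi_t
   carries the vector measure W_t sigma_j |mu_j| to sigma_j |mu_j|, and uniqueness
   of the polar decomposition gives
   sigma_j(phi_t x) = W_t sigma_j(x) / |W_t sigma_j(x)|.

   All of this takes place in a box, outside which b and H are replaced by bounded
   Lipschitz extensions. *)

From HB Require Import structures.
From mathcomp Require Import all_boot all_order all_algebra.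
From mathcomp Require Import all_classical all_reals all_analysis.
From mathcomp Require Import measurable_realfun ring lra.
Require Import Defs.
Set Implicit Arguments.
Unset Strict Implicit.
Unset Printing Implicit Defensive.
Import Order.TTheory GRing.Theory Num.Theory.
Import numFieldNormedType.Exports.
Local Open Scope classical_set_scope.
Local Open Scope ring_scope.
(** * Flows of bounded Lipschitz vector fields *)

(** The function x |-> g(phi_t x) W_t(x) is only Lipschitz: it is not a test function and has no
    gradient at hand. It does have a derivative along b, which the group law of phi and the cocycle
    law of W turn into a derivative in time. The weak equation contains no other derivative of the
    test function, and mollification at scale e moves this one by O(e). So everything rests on
    uniform second-order expansions in time, never on smoothness of the flow in the initial point.
    The variation in time of the pairing with g is bounded by a constant, independent of g, times an
    integral of |g| over time and space. That uniformity allows g to approach the indicator of a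
    Borel set, and the time integral is the reason why null sets are controlled for almost every t
    only. Absolute continuity needs no change of variables: a finite measure giving mass O(e^2) to
    every square of side of order e is compared with Lebesgue measure by averaging Lipschitz
    functions over squares. The polar function has norm 1 almost everywhere only and may be
    unbounded elsewhere; it is replaced by a version bounded everywhere, and its norm is recovered
    from the definition of the total variation. *)

Section geometric_limits.
Context {R : realType}.
Implicit Types (a b c C : R).

Lemma ltr_expn2 (n : nat) : n%:R < 2 ^+ n :> R.
Proof. by rewrite -natrX ltr_nat ltn_expl. Qed.

Lemma le_geometric_error a b C : (forall n : nat, a <= b + C * 2 ^- n) -> a <= b.
Proof.
move=> h; rewrite leNgt; apply/negP => ba.
have C0 : 0 < C.
  rewrite ltNge; apply/negP => C0; have := h 0%N.
  rewrite expr0 invr1 mulr1 => h0; lra.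
have d0 : 0 < C / (a - b) by rewrite divr_gt0// subr_gt0.
have [n nC] : exists n : nat, C / (a - b) < n%:R.
  by exists (Num.bound (C / (a - b))); apply: archi_boundP; exact: ltW.
have := h n; apply/negP; rewrite -ltNge -ltrBrDl ltr_pdivrMr ?exprn_gt0//.
rewrite -ltr_pdivrMl ?subr_gt0// mulrC.
exact: lt_trans nC (ltr_expn2 n).
Qed.

(** The index [2 ^ n - 1] turns it into the geometric version. It serves for subdivisions of a time
    interval into equal steps. *)
Lemma le_harmonic_error a b C : (forall n : nat, a <= b + C / n.+1%:R) -> a <= b.
Proof.
move=> h; apply: (@le_geometric_error _ _ `|C|) => n.
have := h ((2 ^ n).-1); rewrite prednK ?expn_gt0// natrX => /le_trans; apply.
by rewrite lerD2l ler_wpM2r ?invr_ge0 ?exprn_ge0// ler_norm.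
Qed.

(* All the completeness that the dyadic Euler scheme needs, in a form that passes
   to products and matrices. *)
Definition geo_complete (E : normedModType R) :=
  forall (u : nat -> E) (C : R), (forall n, `|u n.+1 - u n| <= C * 2 ^- n) ->
  exists l, forall n, `|u n - l| <= 2 * C * 2 ^- n.

(** The intervals with centre [u n] and radius [2 * C * 2 ^- n] are nested; the supremum of their
    left ends lies in all of them. *)
Lemma geo_complete_real : geo_complete R.
Proof.
move=> u C h.
have C0 : 0 <= C.
  by have := h 0%N; rewrite expr0 invr1 mulr1; apply: le_trans.
have e2 n : 2 ^- n.+1 = 2 ^- n / 2 :> R by rewrite exprS invfM mulrC.
have p2 n : 0 < 2 ^- n :> R by rewrite invr_gt0 exprn_gt0.
pose v n := u n - 2 * C * 2 ^- n; pose w n := u n + 2 * C * 2 ^- n.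
have vS n : v n <= v n.+1.
  have := h n; rewrite ler_norml /v e2 => /andP[]; set p := 2 ^- n; lra.
have wS n : w n.+1 <= w n.
  have := h n; rewrite ler_norml /w e2 => /andP[]; set p := 2 ^- n; lra.
have vD n k : v n <= v (n + k)%N.
  by elim: k => [|k ih]; rewrite ?addn0// addnS (le_trans ih).
have wD n k : w (n + k)%N <= w n.
  by elim: k => [|k]; rewrite ?addn0// addnS; exact: le_trans.
have vw n : v n <= w n.
  have : 0 <= C * 2 ^- n by rewrite mulr_ge0// ltW.
  by rewrite /v /w; set p := 2 ^- n; lra.
have vw' n k : v n <= w k.
  by rewrite (le_trans (vD n k))// (le_trans (vw _))// addnC.
have ub : has_ubound (range v) by exists (w 0%N) => _ [k _ <-].
exists (sup (range v)) => n; rewrite ler_distlC.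
apply/andP; split.
  by apply: (ub_le_sup ub); exists n.
by apply: ge_sup; [exists (v 0%N), 0%N|move=> _ [k _ <-]; exact: vw'].
Qed.

Lemma geo_complete_pair (E1 E2 : normedModType R) :
  geo_complete E1 -> geo_complete E2 -> geo_complete (E1 * E2)%type.
Proof.
move=> c1 c2 u C h.
have h' n : `|(u n.+1).1 - (u n).1| <= C * 2 ^- n /\
            `|(u n.+1).2 - (u n).2| <= C * 2 ^- n.
  by move: (h n); rewrite prod_normE/= ge_max => /andP.
have [l1 hl1] := c1 (fst \o u) C (fun n => (h' n).1).
have [l2 hl2] := c2 (snd \o u) C (fun n => (h' n).2).
by exists (l1, l2) => n; rewrite prod_normE/= ge_max hl1 hl2.
Qed.

Lemma mx_norm_entry m n (A : 'M[R]_(m, n)) i j : `|A i j| <= `|A|.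
Proof.
rewrite -[leRHS]/(mx_norm A) mx_normE -[leLHS]nngE num_le.
exact: (le_bigmax _ (fun i : 'I_m * 'I_n => `|A i.1 i.2|%:nng) (i, j)).
Qed.

Lemma le_mx_norm m n (A : 'M[R]_(m, n)) c :
  0 <= c -> (forall i j, `|A i j| <= c) -> `|A| <= c.
Proof.
move=> c0 h; rewrite -[leLHS]/(mx_norm A).
have [->//|/mx_norm_neq0[[i j] ->]] := eqVneq (mx_norm A) 0; exact: h.
Qed.

Lemma geo_complete_matrix m n : geo_complete 'M[R]_(m, n).
Proof.
move=> u C h.
have C0 : 0 <= C.
  by have := h 0%N; rewrite expr0 invr1 mulr1; apply: le_trans.
have ex i j : exists l, forall k, `|u k i j - l| <= 2 * C * 2 ^- k.
  apply: (geo_complete_real (u := fun k => u k i j)) => k.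
  by have := mx_norm_entry (u k.+1 - u k) i j; rewrite !mxE => /le_trans; apply.
exists (\matrix_(i, j) sval (cid (ex i j))) => k; apply: le_mx_norm.
  by rewrite !mulr_ge0// invr_ge0 exprn_ge0.
by move=> i j; rewrite !mxE; case: cid => /= l; apply.
Qed.

End geometric_limits.

Lemma nat_eq_or_succ (a c : nat) : (a < c.+1)%N -> (c < a.+2)%N -> c = a \/ c = a.+1.
Proof. by rewrite !ltnS => ac; rewrite leq_eqVlt ltnS => /orP[/eqP|ca]; [right|left; apply/eqP; rewrite eqn_leq ca]. Qed.

Section semiflow.
Context {R : realType} {E : normedModType R} (F : E -> E) (M L : R).
Hypothesis cE : geo_complete E.
Hypothesis L0 : 0 <= L.
Hypothesis FM : forall x, `|F x| <= M.
Hypothesis FL : forall x y, `|F x - F y| <= L * `|x - y|.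
Implicit Types (x y : E) (h t s : R).

Let M0 : 0 <= M. Proof. exact: le_trans (normr_ge0 _) (FM 0). Qed.

Definition euler_step h x : E := x + h *: F x.

Let step_lip h x y : 0 <= h ->
  `|euler_step h x - euler_step h y| <= (1 + h * L) * `|x - y|.
Proof.
move=> h0; rewrite /euler_step opprD addrACA -scalerBr mulrDl mul1r.
rewrite (le_trans (ler_normD _ _))// lerD2l normrZ ger0_norm// -mulrA.
by rewrite ler_wpM2l.
Qed.

Let iter_lip h k x y : 0 <= h ->
  `|iter k (euler_step h) x - iter k (euler_step h) y|
    <= expR (k%:R * h * L) * `|x - y|.
Proof.
move=> h0; elim: k => [|k ih]; first by rewrite !mul0r expR0 mul1r.
rewrite !iterS (le_trans (step_lip _ _ h0))//.
have -> : k.+1%:R * h * L = h * L + k%:R * h * L by rewrite -natr1; ring.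
rewrite expRD -mulrA ler_pM// ?addr_ge0// ?mulr_ge0//; exact: expR_ge1Dx.
Qed.

Let iter_dist h k x : 0 <= h ->
  `|iter k (euler_step h) x - x| <= k%:R * h * M.
Proof.
move=> h0; elim: k => [|k ih]; first by rewrite subrr normr0 !mul0r.
rewrite iterS {1}/euler_step addrAC -natr1 !mulrDl mul1r.
rewrite (le_trans (ler_normD _ _))// lerD// normrZ ger0_norm//.
by rewrite ler_wpM2l.
Qed.

Let iter_exp h k x : 0 <= h ->
  `|iter k (euler_step h) x - x - (k%:R * h) *: F x| <= L * M * (k%:R * h) ^+ 2.
Proof.
move=> h0; elim: k => [|k ih].
  by rewrite mul0r scale0r subrr subr0 normr0 expr0n mulr0.
rewrite iterS -natr1 mulrDl mul1r.
set y := iter k _ x in ih *; have yx : `|y - x| <= k%:R * h * M by exact: iter_dist.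
have -> : euler_step h y - x - (k%:R * h + h) *: F x
        = (y - x - (k%:R * h) *: F x) + h *: (F y - F x).
  rewrite /euler_step scalerDl scalerBr !opprD !addrA; congr (_ - _).
  by rewrite -!addrA; congr (_ + _); rewrite addrC -addrA.
rewrite (le_trans (ler_normD _ _))// (le_trans (lerD ih (lexx _)))// normrZ ger0_norm//.
have : h * `|F y - F x| <= h * (L * (k%:R * h * M)).
  by rewrite ler_wpM2l// (le_trans (FL _ _))// ler_wpM2l.
have k0 : 0 <= k%:R :> R by [].
have e : 0 <= L * M * h * h by rewrite !mulr_ge0.
have e' : 0 <= L * M * k%:R * h * h by rewrite !mulr_ge0.
nra.
Qed.

Let step2 h x : 0 <= h ->
  `|euler_step h (euler_step h x) - euler_step (h *+ 2) x| <= L * M * h ^+ 2.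
Proof.
move=> h0; have -> : euler_step h (euler_step h x) - euler_step (h *+ 2) x
   = h *: (F (euler_step h x) - F x).
  rewrite [euler_step h]lock /euler_step -lock scalerBr mulr2n scalerDl.
  by rewrite addrA [_ + h *: F (_)]addrC addrKA.
rewrite normrZ ger0_norm// (le_trans (ler_wpM2l h0 (FL _ _)))//.
rewrite /euler_step addrAC subrr add0r normrZ ger0_norm//.
have -> : L * M * h ^+ 2 = h * (L * (h * M)) by ring.
by rewrite !ler_wpM2l.
Qed.

(** Two steps of size h miss one step of size 2h by the defect of [step2]. The remaining steps
    amplify each such defect by at most the Lipschitz constant of the iterates, and there are k of
    them. *)
Let refine h k x : 0 <= h ->
  `|iter (k.*2) (euler_step h) x - iter k (euler_step (h *+ 2)) x|
    <= k%:R * (expR (k.*2%:R * h * L) * (L * M * h ^+ 2)).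
Proof.
move=> h0; elim: k x => [|k ih] x; first by rewrite subrr normr0 mul0r.
rewrite doubleS !iterSr (le_trans (ler_distD (iter k.*2 (euler_step h) (euler_step (h *+ 2) x)) _ _))//.
have e : expR (k.*2%:R * h * L) <= expR (k.*2.+2%:R * h * L).
  by rewrite ler_expR !ler_wpM2r// ler_nat (leq_trans (leqnSn _)).
have c : 0 <= L * M * h ^+ 2 by rewrite !mulr_ge0.
rewrite -natr1 [leRHS]mulrDl mul1r addrC lerD//.
  by rewrite (le_trans (ih _))// ler_wpM2l// ler_wpM2r.
by rewrite (le_trans (iter_lip _ _ _ h0))// ler_pM ?expR_ge0//; exact: step2.
Qed.

Definition euler n t x : E := iter (Num.truncn (t * 2 ^+ n)) (euler_step (2 ^- n)) x.

(** The first term collects the defects of [refine] when the step is halved; the second pays for the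
    one extra step that truncation of [t * 2 ^+ n.+1] may add. *)
Definition euler_const t := `|t| * expR (`|t| * L) * L * M + M.

Let p2 n : 0 < 2 ^- n :> R. Proof. by rewrite invr_gt0 exprn_gt0. Qed.
Let p2' n : 0 < 2 ^+ n :> R. Proof. by rewrite exprn_gt0. Qed.

Let truncn_le n t : 0 <= t -> (Num.truncn (t * 2 ^+ n))%:R * 2 ^- n <= t.
Proof.
move=> t0; rewrite ler_pdivrMr//.
by case/andP: (@truncn_itv _ (t * 2 ^+ n) (mulr_ge0 t0 (ltW (p2' n)))).
Qed.

Let truncn_gt n t : 0 <= t -> t < (Num.truncn (t * 2 ^+ n))%:R * 2 ^- n + 2 ^- n.
Proof.
move=> t0; rewrite -{2}[2 ^- n]mul1r -mulrDl natr1 ltr_pdivlMr//.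
by case/andP: (@truncn_itv _ (t * 2 ^+ n) (mulr_ge0 t0 (ltW (p2' n)))).
Qed.

Let euler_neg n t x : t <= 0 -> euler n t x = x.
Proof.
move=> t0; rewrite /euler; have [->|] := eqVneq (t * 2 ^+ n) 0; first by rewrite truncn0.
by move=> h; rewrite truncn_floor lt_geF// lt_neqAle h/= pmulr_lle0.
Qed.

Let euler_succ t x n :
  `|euler n.+1 t x - euler n t x| <= euler_const t * 2 ^- n.
Proof.
have c0 : 0 <= euler_const t.
  by rewrite addr_ge0// !mulr_ge0// expR_ge0.
have [t0|t0] := leP t 0; first by rewrite !euler_neg// subrr normr0 mulr_ge0// ltW.
rewrite /euler; set k := Num.truncn _; set k' := Num.truncn _.
set h : R := 2 ^- n.+1.
have hE : 2 ^- n = h *+ 2 by rewrite /h exprS invfM -mulr_natr; field; rewrite gt_eqF.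
have h0 : 0 < h by exact: p2.
rewrite hE.
have kt : k'%:R * h *+ 2 <= t.
  by have := truncn_le n (ltW t0); rewrite hE -mulrnAr.
have main : `|iter k'.*2 (euler_step h) x - iter k' (euler_step (h *+ 2)) x| <=
    `|t| * h *+ 2 * (expR (`|t| * L) * (L * M)).
  rewrite (le_trans (refine _ _ (ltW h0)))//.
  have e : expR (k'.*2%:R * h * L) <= expR (`|t| * L).
    by rewrite ler_expR ler_wpM2r// gtr0_norm// -muln2 natrM mulrAC mulr_natr.
  have -> : k'%:R * (expR (k'.*2%:R * h * L) * (L * M * h ^+ 2)) =
    (k'%:R * h) * h * (expR (k'.*2%:R * h * L) * (L * M)) by ring.
  have kh0 : 0 <= k'%:R * h by rewrite mulr_ge0// ltW.
  apply: ler_pM; rewrite ?mulr_ge0 ?expR_ge0// ?(ltW h0)//; last first.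
    by rewrite ler_wpM2r// mulr_ge0.
  rewrite -mulrnAl ler_pM2r// gtr0_norm//.
  rewrite (le_trans _ (le_trans kt _))//; first by rewrite mulr2n lerDl.
  by rewrite mulr2n lerDl ltW.
have Mh : 0 <= M * h by rewrite mulr_ge0// ltW.
have cE' : euler_const t * h *+ 2 = `|t| * h *+ 2 * (expR (`|t| * L) * (L * M)) + M * h *+ 2.
  by rewrite /euler_const; ring.
rewrite mulrnAr cE'.
(* Doubling the resolution doubles the number of steps, up to one extra step of length at most
   [M * h]. *)
have [->|->] : k = k'.*2 \/ k = k'.*2.+1.
- have /andP[a1 a2] := @truncn_itv _ (t * 2 ^+ n.+1) (mulr_ge0 (ltW t0) (ltW (p2' _))).
  have /andP[b1 b2] := @truncn_itv _ (t * 2 ^+ n) (mulr_ge0 (ltW t0) (ltW (p2' _))).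
  rewrite -/k -/k' in a1 a2 b1 b2.
  rewrite exprS mulrCA in a1 a2.
  have l1 : (k < k'.*2.+2)%N.
    rewrite -(ltr_nat R) (le_lt_trans a1)//.
    by rewrite -doubleS -muln2 natrM mulrC ltr_pM2r.
  have l2 : (k'.*2 < k.+1)%N.
    rewrite -(ltr_nat R) (le_lt_trans _ a2)//.
    by rewrite -muln2 natrM mulrC ler_pM2l.
  exact: nat_eq_or_succ.
- by rewrite (le_trans main)// lerDl mulrn_wge0.
- rewrite iterS; set y := iter k'.*2 _ _ in main *.
  rewrite (le_trans (ler_distD y _ _))// addrC lerD//.
  rewrite {1}/euler_step addrAC subrr add0r normrZ gtr0_norm//.
  rewrite (le_trans (ler_wpM2l (ltW h0) (FM y)))// mulrC mulr2n.
  by rewrite lerDl.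
Qed.

Let semiflow_ex t x := cid (cE (euler_succ t x)).

(** For [t <= 0] the truncated number of steps is 0 and the value is x. This is why [flow] takes
    negative times from the semiflow of the opposite field. *)
Definition semiflow t x : E := sval (semiflow_ex t x).

Lemma semiflow_euler n t x : `|euler n t x - semiflow t x| <= 2 * euler_const t * 2 ^- n.
Proof. by rewrite /semiflow; case: semiflow_ex. Qed.

Lemma semiflow_le0 t x : t <= 0 -> semiflow t x = x.
Proof.
move=> t0; apply/eqP; rewrite -subr_eq0 -normr_le0 distrC; apply/le_geometric_error => n.
by rewrite add0r; have := semiflow_euler n t x; rewrite euler_neg//; exact.
Qed.

Let kt0 t n : 0 <= t -> (Num.truncn (t * 2 ^+ n))%:R * 2 ^- n * L <= t * L.
Proof. by move=> t0; rewrite ler_wpM2r// truncn_le. Qed.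

Lemma semiflow_lip t x y : 0 <= t ->
  `|semiflow t x - semiflow t y| <= expR (t * L) * `|x - y|.
Proof.
move=> t0; apply: (@le_geometric_error _ _ _ (4 * euler_const t)) => n.
have h1 := semiflow_euler n t x; have h2 := semiflow_euler n t y.
rewrite (le_trans (ler_distD (euler n t x) _ _))//.
rewrite (le_trans (lerD (lexx _) (ler_distD (euler n t y) _ _)))//.
have : `|euler n t x - euler n t y| <= expR (t * L) * `|x - y|.
  rewrite (le_trans (iter_lip _ _ _ (ltW (p2 n))))// ler_wpM2r// ler_expR.
  exact: kt0.
move: h1 h2; rewrite distrC; move=> h1 h2 h3.
rewrite (le_trans (lerD h1 (lerD h3 h2)))//.
by set e := 2 ^- n; lra.
Qed.

Lemma semiflow_dist t x : 0 <= t -> `|semiflow t x - x| <= t * M.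
Proof.
move=> t0; apply: (@le_geometric_error _ _ _ (2 * euler_const t)) => n.
rewrite (le_trans (ler_distD (euler n t x) _ _))// addrC lerD//.
  by rewrite (le_trans (iter_dist _ _ (ltW (p2 n))))// ler_wpM2r// truncn_le.
by rewrite distrC; exact: semiflow_euler.
Qed.

Lemma semiflow_exp t x : 0 <= t -> `|semiflow t x - x - t *: F x| <= L * M * t ^+ 2.
Proof.
move=> t0; apply: (@le_geometric_error _ _ _ (2 * euler_const t + M)) => n.
set k : R := (Num.truncn (t * 2 ^+ n))%:R * 2 ^- n.
have -> : semiflow t x - x - t *: F x = (semiflow t x - euler n t x) +
   (euler n t x - x - k *: F x) + (k - t) *: F x.
  by rewrite scalerBl -!addrA addKr [- (k *: _) + _]addrA addNr add0r.
have kt : k <= t by exact: truncn_le.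
have k0 : 0 <= k by rewrite mulr_ge0// ltW.
have h3 : `|(k - t) *: F x| <= 2 ^- n * M.
  rewrite normrZ ler_pM// ler0_norm ?subr_le0// opprB lerBlDl.
  by apply/ltW/truncn_gt.
have h1 := semiflow_euler n t x; rewrite distrC in h1.
have h2 : `|euler n t x - x - k *: F x| <= L * M * t ^+ 2.
  rewrite (le_trans (iter_exp _ _ (ltW (p2 n))))//.
  by rewrite ler_wpM2l ?mulr_ge0// lerXn2r// nnegrE.
rewrite (le_trans (ler_normD _ _))// (le_trans (lerD (ler_normD _ _) (lexx _)))//.
by rewrite (le_trans (lerD (lerD h1 h2) h3))//; set e := 2 ^- n; lra.
Qed.

Lemma semiflow_add s t x : 0 <= s -> 0 <= t ->
  semiflow (s + t) x = semiflow t (semiflow s x).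
Proof.
move=> s0 t0; apply/eqP; rewrite -subr_eq0 -normr_le0.
apply: (@le_geometric_error _ _ _ (2 * euler_const (s + t) + M +
  2 * euler_const t + expR (t * L) * (2 * euler_const s))) => n.
rewrite add0r (le_trans (ler_distD (euler n (s + t) x) _ _))//.
rewrite (le_trans (lerD (lexx _) (ler_distD (euler n t (euler n s x)) _ _)))//.
rewrite (le_trans (lerD (lexx _) (lerD (lexx _) (ler_distD (semiflow t (euler n s x)) _ _))))//.
have h1 := semiflow_euler n (s + t) x; rewrite distrC in h1.
have h2 := semiflow_euler n t (euler n s x).
have h3 := semiflow_lip (euler n s x) (semiflow s x) t0.
have h3' : `|semiflow t (euler n s x) - semiflow t (semiflow s x)| <=
   expR (t * L) * (2 * euler_const s * 2 ^- n).
  by rewrite (le_trans h3)// ler_wpM2l ?expR_ge0// semiflow_euler.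
have h4 : `|euler n (s + t) x - euler n t (euler n s x)| <= 2 ^- n * M.
  rewrite /euler -iterD.
  set a := Num.truncn (t * _); set b := Num.truncn (s * _); set c := Num.truncn _.
  have st0 : 0 <= s + t by exact: addr_ge0.
  (* Truncation is additive up to one unit, so the two schemes differ by at most one Euler step. *)
  have [->|->] : c = (a + b)%N \/ c = (a + b).+1.
  - have /andP[a1 a2] := @truncn_itv _ (t * 2 ^+ n) (mulr_ge0 t0 (ltW (p2' n))).
    have /andP[b1 b2] := @truncn_itv _ (s * 2 ^+ n) (mulr_ge0 s0 (ltW (p2' n))).
    have /andP[c1 c2] := @truncn_itv _ ((s + t) * 2 ^+ n) (mulr_ge0 st0 (ltW (p2' n))).
    rewrite -/a -/b -/c mulrDl in a1 a2 b1 b2 c1 c2.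
    have l1 : (c < a.+1 + b.+1)%N.
      by rewrite -(ltr_nat R) (le_lt_trans c1)// natrD addrC ltrD.
    have l2 : (a + b < c.+1)%N.
      by rewrite -(ltr_nat R) (le_lt_trans _ c2)// natrD addrC lerD.
    by apply: nat_eq_or_succ; rewrite // -addSn -addnS.
  - by rewrite subrr normr0 mulr_ge0// ltW.
  - rewrite iterS {1}/euler_step addrAC subrr add0r normrZ gtr0_norm//.
    by rewrite ler_wpM2l// ltW.
rewrite (le_trans (lerD h1 (lerD h4 (lerD h2 h3'))))//.
by set e := 2 ^- n; set f := expR _; lra.
Qed.
End semiflow.

Section semiflow_inverse.
Context {R : realType} {E : normedModType R} (F G : E -> E) (M L : R).
Hypothesis cE : geo_complete E.
Hypothesis L0 : 0 <= L.
Hypothesis FM : forall x, `|F x| <= M.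
Hypothesis FL : forall x y, `|F x - F y| <= L * `|x - y|.
Hypothesis GM : forall x, `|G x| <= M.
Hypothesis GL : forall x y, `|G x - G y| <= L * `|x - y|.
Hypothesis GE : forall x, G x = - F x.
Implicit Types (x y : E) (h t s : R).

Let M0 : 0 <= M. Proof. exact: le_trans (normr_ge0 _) (FM 0). Qed.

Let fwd := semiflow cE L0 FM FL.
Let bwd := semiflow cE L0 GM GL.

Let bwd_fwd1 t x : 0 <= t -> `|bwd t (fwd t x) - x| <= 3 * (L * M) * t ^+ 2.
Proof.
move=> t0; have h1 := semiflow_exp cE L0 GM GL (fwd t x) t0.
have h2 := semiflow_exp cE L0 FM FL x t0.
have h3 : `|t *: (F (fwd t x) - F x)| <= t * (L * (t * M)).
  rewrite normrZ ger0_norm// ler_wpM2l// (le_trans (FL _ _))// ler_wpM2l//.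
  exact: semiflow_dist.
have -> : bwd t (fwd t x) - x = (bwd t (fwd t x) - fwd t x - t *: G (fwd t x))
   + (fwd t x - x - t *: F x) - t *: (F (fwd t x) - F x).
  rewrite GE scalerN opprK scalerBr opprB -[RHS]addrA [_ - t *: F x + _]addrA subrK.
  by rewrite addrACA subrr addr0 addrA subrK.
rewrite (le_trans (ler_normB _ _))// (le_trans (lerD (ler_normD _ _) (lexx _)))//.
rewrite (le_trans (lerD (lerD h1 h2) h3))//; lra.
Qed.

Let bwd_fwdn t x n : 0 <= t ->
  `|bwd (n%:R * t) (fwd (n%:R * t) x) - x| <= n%:R * (expR (n%:R * t * L) * (3 * (L * M) * t ^+ 2)).
Proof.
move=> t0; have c0 : 0 <= 3 * (L * M) * t ^+ 2 by rewrite !mulr_ge0.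
elim: n x => [|n ih] x.
  by rewrite !mul0r /bwd /fwd !semiflow_le0// subrr normr0.
have nt : 0 <= n%:R * t by rewrite mulr_ge0.
rewrite -natr1 mulrDl mul1r /fwd semiflow_add// -/fwd.
rewrite /bwd [X in semiflow _ _ _ _ X]addrC semiflow_add// -/bwd.
rewrite (le_trans (ler_distD (bwd (n%:R * t) (fwd (n%:R * t) x)) _ _))//.
rewrite [leRHS]mulrDl mul1r addrC lerD//.
  rewrite (le_trans (ih _))// ler_wpM2l// ler_wpM2r// ler_expR ler_wpM2r//.
  by rewrite lerDl.
rewrite (le_trans (semiflow_lip cE L0 GM GL _ _ nt))//.
rewrite ler_pM ?expR_ge0//; first by rewrite ler_expR ler_wpM2r// lerDl.
exact: bwd_fwd1.
Qed.

(** Over a time t / n, going forward and then backward misses the identity by O(t^2 / n^2). Nesting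
    n such pairs and propagating the errors by the Lipschitz bound leaves O(1 / n). The opposite
    field G is kept separate from F so that the statement can be used in both orders. *)
Lemma semiflow_inverse t x : 0 <= t -> bwd t (fwd t x) = x.
Proof.
move=> t0; apply/eqP; rewrite -subr_eq0 -normr_le0.
apply: (@le_harmonic_error _ _ _ (expR (t * L) * (3 * (L * M) * t ^+ 2))) => n.
have n0 : (n.+1%:R : R) != 0 by [].
have := @bwd_fwdn (t / n.+1%:R) x n.+1; rewrite mulrCA divff// mulr1 add0r.
move=> /(_ (divr_ge0 t0 (ler0n _ _)))/le_trans; apply.
by rewrite le_eqVlt; apply/orP; left; apply/eqP; field.
Qed.

End semiflow_inverse.

Lemma is_derive_quadratic {R : realType} {E : normedModType R} (f : R -> E) (t : R) (d : E) C :
  (forall h, `|f (t + h) - f t - h *: d| <= C * h ^+ 2) -> is_derive t (1 : R) f d.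
Proof.
move=> hf.
have C0 : 0 <= C by have := hf 1; rewrite expr1n mulr1; apply: le_trans.
have cv : h^-1 *: (f (h *: (1 : R) + t) - f t) @[h --> 0^'] --> d.
  have C1 : 0 < C + 1 by rewrite ltr_pwDr.
  apply/cvgrPdist_le => e e0.
  have e1 : 0 < e / (C + 1) by exact: divr_gt0.
  near=> h.
  have h0 : h != 0 by near: h; exact: nbhs_dnbhs_neq.
  have -> : d = h^-1 *: (h *: d) by rewrite scalerA mulVf// scale1r.
  rewrite -scalerBr normrZ normfV ler_pdivrMl ?normr_gt0// distrC.
  rewrite [h *: (1 : R)]mulr1 addrC [_ + t]addrC (le_trans _ (_ : C * `|h| ^+ 2 <= _))//.
    by rewrite addrC real_normK ?num_real.
  rewrite expr2 mulrCA ler_wpM2l//.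
  rewrite (@le_trans _ _ ((C + 1) * `|h|))//; first by rewrite ler_wpM2r// lerDl.
  rewrite mulrC -ler_pdivlMr//.
    by near: h; apply: dnbhs0_le.
by split; [apply/cvg_ex; exists d|exact: cvg_lim cv].
Unshelve. all: by end_near. Qed.

(** The mean value theorem is available for real functions only, so it is applied to the distance
    from [f u] to [f s], whose derivative vanishes as well by the reverse triangle inequality. *)
Lemma derive0_cst {R : realType} {E : normedModType R} (f : R -> E) (a b : R) :
  (forall t, a < t < b -> is_derive t (1 : R) f 0) ->
  forall s t, a < s < b -> a < t < b -> f s = f t.
Proof.
move=> f0.
have key s t : a < s < b -> a < t < b -> s <= t -> f s = f t.
  move=> /andP[as_ sb] /andP[at_ tb]; rewrite le_eqVlt => /predU1P[->//|st].
  pose N u := `|f u - f s|.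
  have dN u : a < u < b -> is_derive u (1 : R) N 0.
    move=> /f0 [df fE].
    have cv : h^-1 *: (N (h *: (1 : R) + u) - N u) @[h --> 0^'] --> (0 : R).
      have /cvgrPdist_le h1 : h^-1 *: (f (h *: (1 : R) + u) - f u) @[h --> 0^'] --> (0 : E).
        by rewrite -fE; exact: df.
      apply/cvgrPdist_le => e /h1; apply: filterS => h; rewrite !sub0r !normrN.
      apply: le_trans; rewrite !normrZ ler_wpM2l// (le_trans (ler_dist_dist _ _))//.
      by rewrite opprB addrA subrK.
    by split; [apply/cvg_ex; exists 0|exact: cvg_lim cv].
  have [||c cst] := @MVT R N (fun=> 0) s t st.
  - move=> u; rewrite in_itv/= => /andP[su ut]; apply: dN.
    by rewrite (lt_trans as_)//= (lt_trans ut).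
  - apply: derivable_within_continuous => u; rewrite in_itv/= => /andP[su ut].
    by apply: ex_derive; apply: dN; rewrite (lt_le_trans as_)//= (le_lt_trans ut).
  rewrite mul0r /N subrr normr0 subr0 => /normr0_eq0/eqP.
  by rewrite subr_eq0 => /eqP.
move=> s t hs ht; have [|/ltW] := leP s t; first exact: key.
by move=> ts; rewrite (key t s).
Qed.

(** Meant for curves such as [flow (s - t) (y t)]: nothing is known about their differentiability,
    but their increments are dominated by the first-order error of the differentiable curve y plus a
    quadratic term. *)
Lemma is_derive0_dominated {R : realType} {E E' : normedModType R} (g : R -> E) (y : R -> E')
    (t : R) (d : E') (K C e0 : R) : is_derive t (1 : R) y d -> 0 <= K -> 0 <= C -> 0 < e0 ->
  (forall h, `|h| <= e0 ->
    `|g (t + h) - g t| <= K * (`|y (t + h) - y t - h *: d| + C * h ^+ 2)) ->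
  is_derive t (1 : R) g 0.
Proof.
move=> [dyt yE] K0 C0 e00 gy.
have cv : h^-1 *: (g (h *: (1 : R) + t) - g t) @[h --> 0^'] --> (0 : E).
  have C1 : 0 < C + 1 by rewrite ltr_pwDr.
  have K1 : 0 < K + 1 by rewrite ltr_pwDr.
  apply/cvgrPdist_le => e epos.
  have e1 : 0 < e / 2 / (K + 1) by rewrite !divr_gt0.
  have e2 : 0 < e / 2 / (K + 1) / (C + 1) by rewrite !divr_gt0.
  near=> h.
  have h0 : h != 0 by near: h; exact: nbhs_dnbhs_neq.
  have h1 : `|h| <= e0 by near: h; apply: dnbhs0_le.
  rewrite sub0r normrN normrZ normfV ler_pdivrMl ?normr_gt0//.
  rewrite [h *: _]mulr1 [h + t]addrC (le_trans (gy _ h1))//.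
  rewrite (@le_trans _ _ ((K + 1) * (`|y (t + h) - y t - h *: d| + C * h ^+ 2)))//.
    by rewrite ler_wpM2r ?lerDl// addr_ge0// mulr_ge0// sqr_ge0.
  rewrite -ler_pdivlMl//.
  have a1 : `|y (t + h) - y t - h *: d| <= `|h| * (e / 2 / (K + 1)).
    have -> : y (t + h) - y t - h *: d = h *: (h^-1 *: (y (h *: (1 : R) + t) - y t) - d).
      by rewrite scalerBr scalerA mulfV// scale1r [h *: (1 : R)]mulr1 [h + t]addrC.
    rewrite normrZ ler_wpM2l// distrC; near: h.
    by rewrite -yE; move/cvgrPdist_le : dyt; apply.
  have a2 : C * h ^+ 2 <= `|h| * (e / 2 / (K + 1)).
    rewrite -real_normK ?num_real// expr2 mulrCA ler_wpM2l//.
    rewrite (@le_trans _ _ ((C + 1) * `|h|))//; first by rewrite ler_wpM2r// lerDl.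
    rewrite mulrC -ler_pdivlMr//.
    by near: h; apply: dnbhs0_le.
  rewrite (le_trans (lerD a1 a2))// -mulrDr -mulrDl -splitr.
  by rewrite mulrA mulrC.
by split; [apply/cvg_ex; exists 0|exact: cvg_lim cv].
Unshelve. all: by end_near. Qed.

Section flow.
Context {R : realType} {E : normedModType R} (F : E -> E) (M L : R).
Hypothesis cE : geo_complete E.
Hypothesis L0 : 0 <= L.
Hypothesis FM : forall x, `|F x| <= M.
Hypothesis FL : forall x y, `|F x - F y| <= L * `|x - y|.
Implicit Types (x y : E) (h t s : R).

Let M0 : 0 <= M. Proof. exact: le_trans (normr_ge0 _) (FM 0). Qed.

Let G x := - F x.
Let GM x : `|G x| <= M. Proof. by rewrite normrN. Qed.
Let GL x y : `|G x - G y| <= L * `|x - y|.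
Proof. by rewrite /G opprK addrC distrC. Qed.

Let fwd := semiflow cE L0 FM FL.
Let bwd := semiflow cE L0 GM GL.

Definition flow t x : E := if 0 <= t then fwd t x else bwd (- t) x.

Let flow_ge0 t x : 0 <= t -> flow t x = fwd t x.
Proof. by rewrite /flow => ->. Qed.

Let flow_le0 t x : t <= 0 -> flow t x = bwd (- t) x.
Proof.
rewrite /flow; case: ifPn => // t0 t0'; have -> : t = 0 by apply/eqP; rewrite eq_le t0 t0'.
by rewrite oppr0 /fwd /bwd !semiflow_le0.
Qed.

Lemma flow0 x : flow 0 x = x.
Proof. by rewrite flow_ge0// /fwd semiflow_le0. Qed.

Lemma flow_lip t x y : `|flow t x - flow t y| <= expR (`|t| * L) * `|x - y|.
Proof.
have [t0|/ltW t0] := leP 0 t.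
  by rewrite !flow_ge0// ger0_norm// semiflow_lip.
by rewrite !flow_le0// ler0_norm// semiflow_lip// oppr_ge0.
Qed.

Lemma flow_dist t x : `|flow t x - x| <= `|t| * M.
Proof.
have [t0|/ltW t0] := leP 0 t.
  by rewrite !flow_ge0// ger0_norm// semiflow_dist.
by rewrite !flow_le0// ler0_norm// semiflow_dist// oppr_ge0.
Qed.

Lemma flow_exp t x : `|flow t x - x - t *: F x| <= L * M * t ^+ 2.
Proof.
have [t0|/ltW t0] := leP 0 t.
  by rewrite flow_ge0//; exact: semiflow_exp.
rewrite flow_le0//; have := semiflow_exp cE L0 GM GL x (t := - t).
by rewrite oppr_ge0 sqrrN scaleNr -scalerN opprK; exact.
Qed.

Let bf t x : 0 <= t -> bwd t (fwd t x) = x.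
Proof. exact: semiflow_inverse. Qed.

Let fb t x : 0 <= t -> fwd t (bwd t x) = x.
Proof. by apply: semiflow_inverse => y; rewrite opprK. Qed.

Lemma flowD s t x : flow (s + t) x = flow t (flow s x).
Proof.
have [s0|/ltW s0] := leP 0 s; have [t0|/ltW t0] := leP 0 t.
- by rewrite !flow_ge0 ?addr_ge0// /fwd semiflow_add.
- rewrite (flow_ge0 _ s0) (flow_le0 _ t0); have t0' : 0 <= - t by rewrite oppr_ge0.
  have [st|/ltW st] := leP 0 (s + t).
    have -> : fwd s x = fwd (- t) (fwd (s + t) x).
      by rewrite /fwd -semiflow_add//; congr semiflow; ring.
    by rewrite flow_ge0// bf.
  have st' : 0 <= - (s + t) by rewrite oppr_ge0.
  have -> y : bwd (- t) y = bwd (- (s + t)) (bwd s y).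
    by rewrite /bwd -semiflow_add//; congr semiflow; ring.
  by rewrite flow_le0// bf.
- rewrite (flow_le0 _ s0) (flow_ge0 _ t0); have s0' : 0 <= - s by rewrite oppr_ge0.
  have [st|/ltW st] := leP 0 (s + t).
    have -> y : fwd t y = fwd (s + t) (fwd (- s) y).
      by rewrite /fwd -semiflow_add//; congr semiflow; ring.
    by rewrite flow_ge0// fb.
  have st' : 0 <= - (s + t) by rewrite oppr_ge0.
  have -> : bwd (- s) x = bwd t (bwd (- (s + t)) x).
    by rewrite /bwd -semiflow_add//; congr semiflow; ring.
  by rewrite flow_le0// fb.
- rewrite !flow_le0//; last by rewrite -(addr0 0) lerD.
  by rewrite opprD /bwd semiflow_add ?oppr_ge0.
Qed.

Lemma flow_time s t x : `|flow t x - flow s x| <= `|t - s| * M.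
Proof.
have -> : flow t x = flow (t - s) (flow s x) by rewrite -flowD addrC subrK.
exact: flow_dist.
Qed.

(** The curve [flow (s - t) (y t)] joins [flow s (y 0)] at t = 0 to [y s] at t = s. Its increments
    are images of [y (t + h)] and [flow h (y t)] under one Lipschitz map, and these two points agree
    to first order, so its derivative is 0. *)
Lemma flow_unique (y : R -> E) a b : a < 0 < b ->
  (forall t, a < t < b -> is_derive t (1 : R) y (F (y t))) ->
  forall s, a < s < b -> y s = flow s (y 0).
Proof.
move=> ab dy s sab.
pose g t := flow (s - t) (y t).
suff dg t : a < t < b -> is_derive t (1 : R) g 0.
  have := derive0_cst dg ab sab; by rewrite /g subr0 subrr flow0 => ->.
move=> /dy yt.
apply: (is_derive0_dominated yt (K := expR ((`|s - t| + 1) * L)) (C := L * M)).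
- by rewrite expR_ge0.
- by rewrite mulr_ge0.
- exact: ltr01.
move=> h h1.
have -> : g (t + h) - g t =
   flow (s - t - h) (y (t + h)) - flow (s - t - h) (flow h (y t)).
  rewrite /g -flowD; congr (flow _ _ - flow _ _); ring.
rewrite (le_trans (flow_lip _ _ _))//.
rewrite (@le_trans _ _ (expR ((`|s - t| + 1) * L) * `|y (t + h) - flow h (y t)|))//.
  rewrite ler_wpM2r// ler_expR ler_wpM2r// (le_trans (ler_normB _ _))//.
  by rewrite lerD2l.
rewrite ler_wpM2l ?expR_ge0// (le_trans (ler_distD (y t + h *: F (y t)) _ _))//.
rewrite opprD addrA lerD2l distrC opprD addrA; exact: flow_exp.
Qed.

End flow.

(** * Characteristics on a box *)

Section clip.
Context {R : realType}.
Implicit Types (r a b : R).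

Definition clip r a := Num.max (- r) (Num.min r a).

Lemma clip_le r a : 0 <= r -> `|clip r a| <= r.
Proof.
by move=> r0; rewrite /clip ler_norml; apply/andP; split;
  [rewrite le_max lexx|rewrite ge_max ge0_cp// ge_min lexx].
Qed.

Lemma clip_norm r a : 0 <= r -> `|clip r a| <= `|a|.
Proof.
move=> r0; rewrite /clip /Num.max /Num.min.
case: ifPn => [|/negbTE]; case: ifPn => // ra; rewrite ?normrN ?(ger0_norm r0).
- by move=> _; rewrite (le_trans (ltW ra))// ler_norm.
- by move=> _ ; rewrite (le_trans (ltW ra))// ler_norm.
- rewrite -leNgt in ra => /negbT; rewrite -leNgt => h.
  by rewrite ler_normr [_ <= - a]lerNr h orbT.
Qed.

Lemma clip_id r a : `|a| <= r -> clip r a = a.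
Proof.
rewrite ler_norml => /andP[h1 h2]; rewrite /clip (min_idPr h2).
by apply/max_idPr.
Qed.

Lemma clip_lip r a b : `|clip r a - clip r b| <= `|a - b|.
Proof.
have h x y : x <= y -> `|clip r x - clip r y| <= `|x - y|.
  move=> xy; have m1 : clip r x <= clip r y.
    rewrite /clip ge_max le_max lexx/= le_max; apply/orP; right.
    by rewrite le_min ge_min lexx/= ge_min xy orbT.
  rewrite distrC [leRHS]distrC !ger0_norm ?subr_ge0//.
  rewrite /clip /Num.max /Num.min.
  by case: ifPn; rewrite -?leNgt; case: ifPn; rewrite -?leNgt; case: ifPn;
     rewrite -?leNgt; case: ifPn; rewrite -?leNgt; lra.
by have [/h//|/ltW/h] := leP a b; rewrite distrC [leRHS]distrC.
Qed.

(** For the sup norm of the plane this retraction onto the box is 1-Lipschitz. Composing with it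
    makes a function that is Lipschitz on the box bounded and globally Lipschitz, without changing
    it on the box. *)
Definition clip2 r (x : plane R) : plane R := (clip r x.1, clip r x.2).

Lemma pair_normE (x : plane R) : `|x| = Num.max `|x.1| `|x.2|.
Proof. by rewrite prod_normE. Qed.

Lemma le_pair_norm (x : plane R) c : (`|x| <= c) = (`|x.1| <= c) && (`|x.2| <= c).
Proof. by rewrite pair_normE ge_max. Qed.

Lemma pair_norm1 (x : plane R) : `|x.1| <= `|x|.
Proof. by rewrite pair_normE le_max lexx. Qed.

Lemma pair_norm2 (x : plane R) : `|x.2| <= `|x|.
Proof. by rewrite pair_normE le_max lexx orbT. Qed.

Lemma clip2_le r x : 0 <= r -> `|clip2 r x| <= r.
Proof. by move=> r0; rewrite le_pair_norm !clip_le. Qed.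

Lemma clip2_id r x : `|x| <= r -> clip2 r x = x.
Proof.
by rewrite le_pair_norm => /andP[h1 h2]; rewrite /clip2 !clip_id//; case: x {h1 h2}.
Qed.

Lemma clip2_lip r x y : `|clip2 r x - clip2 r y| <= `|x - y|.
Proof.
rewrite le_pair_norm/=; apply/andP; split; apply: le_trans (clip_lip _ _ _) _.
- exact: (pair_norm1 (x - y)).
- exact: (pair_norm2 (x - y)).
Qed.

Lemma compact_box r : compact [set x : plane R | `|x| <= r].
Proof.
have -> : [set x : plane R | `|x| <= r] = `[- r, r] `*` `[- r, r].
  by apply/seteqP; split => [x|x]; rewrite /= le_pair_norm !in_itv/= -!ler_norml;
    [move=> /andP|move=> [-> ->]].
by apply: compact_setX; exact: segment_compact.
Qed.

Lemma compact_norm_bound {T : topologicalType} {V : normedModType R} (K : set T) (f : T -> V) :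
  compact K -> continuous f -> exists2 C, 0 <= C & forall x, K x -> `|f x| <= C.
Proof.
move=> cK cf; have := compact_bounded (@continuous_compact _ _ f K (continuous_subspaceT cf) cK).
move=> [M [_ h]]; exists (`|M| + 1); first by rewrite addr_ge0.
move=> x Kx; apply: (h (`|M| + 1)); last by exists x.
by rewrite (le_lt_trans (ler_norm _))// ltrDl.
Qed.

End clip.

Section lipschitz_box.
Context {R : realType}.

Lemma is_derive_comp_linear {V W : normedModType R} (l : V -> W) (U : normedModType R)
    (f : U -> V) (x v : U) :
  continuous l -> (forall u w, l (u - w) = l u - l w) -> (forall (a : R) u, l (a *: u) = a *: l u) ->
  derivable f x v -> is_derive x v (l \o f) (l ('D_v f x)).
Proof.
move=> cl lB lZ df.
have cv : h^-1 *: ((l \o f) (h *: v + x) - (l \o f) x) @[h --> 0^'] --> l ('D_v f x).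
  have := @continuous_cvg _ _ _ _ _ _ l _ (@cl _) df => /(_ _).
  apply: cvg_trans; apply: near_eq_cvg; apply: nearW => h; by rewrite /= lZ lB.
by split; [apply/cvg_ex; eexists; exact: cv|exact: cvg_lim cv].
Qed.

Lemma derivable_slice1 {W : normedModType R} (f : plane R -> W) a c :
  derivable f (a, c) (1, 0) -> is_derive a (1 : R) (fun t => f (t, c)) (d1 f (a, c)).
Proof.
move=> df.
have cv : h^-1 *: (f (h *: (1 : R) + a, c) - f (a, c)) @[h --> 0^'] --> d1 f (a, c).
  apply: cvg_trans df; apply: near_eq_cvg; apply: nearW => h /=.
  congr (_ *: (f _ - _)); congr pair; rewrite /=.
  by rewrite -[RHS]add0r; congr (_ + _); rewrite scaler0.
by split; [apply/cvg_ex; eexists; exact: cv|exact: cvg_lim cv].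
Qed.

Lemma derivable_slice2 {W : normedModType R} (f : plane R -> W) a c :
  derivable f (c, a) (0, 1) -> is_derive a (1 : R) (fun t => f (c, t)) (d2 f (c, a)).
Proof.
move=> df.
have cv : h^-1 *: (f (c, h *: (1 : R) + a) - f (c, a)) @[h --> 0^'] --> d2 f (c, a).
  apply: cvg_trans df; apply: near_eq_cvg; apply: nearW => h /=.
  congr (_ *: (f _ - _)); congr pair; rewrite /=.
  by rewrite -[RHS]add0r; congr (_ + _); rewrite scaler0.
by split; [apply/cvg_ex; eexists; exact: cv|exact: cvg_lim cv].
Qed.

Lemma MVT_itv (f df : R -> R) (a b : R) :
  (forall x, is_derive x (1 : R) f (df x)) ->
  exists2 c, Num.min a b <= c <= Num.max a b & f b - f a = df c * (b - a).
Proof.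
move=> hf.
have key x y : x < y -> exists2 c, x <= c <= y & f y - f x = df c * (y - x).
  move=> xy; have [|c] := @MVT R f df x y xy.
    by apply: derivable_within_continuous => z _; apply: ex_derive.
  by rewrite in_itv/= => /andP[h1 h2] ?; exists c => //; rewrite !ltW.
have [ab|ba|->] := ltgtP a b.
- exact: key.
- have [c hc e] := key _ _ ba; exists c => //.
  by rewrite -opprB e; ring.
- by exists b; rewrite ?lexx// !subrr mulr0.
Qed.

Lemma norm_between (a b c r : R) : `|a| <= r -> `|b| <= r ->
  Num.min a b <= c <= Num.max a b -> `|c| <= r.
Proof.
rewrite !ler_norml => /andP[a1 a2] /andP[b1 b2] /andP[h1 h2].
by rewrite (le_trans _ h1) ?(le_trans h2)// ?le_min ?ge_max ?a1 ?a2.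
Qed.

(** [Cn] provides derivatives along the axes only, so the two points are joined by a horizontal and
    a vertical segment. Both stay in the box, where the partial derivatives are bounded by
    compactness. *)
Lemma Cn1_lipschitz (f : plane R -> R) r : Cn 1 f ->
  exists2 L, 0 <= L & forall x y, `|x| <= r -> `|y| <= r -> `|f x - f y| <= L * `|x - y|.
Proof.
move=> [cf D1 D2 c1 c2].
have [C1 C10 h1] := compact_norm_bound (@compact_box R r) c1.
have [C2 C20 h2] := compact_norm_bound (@compact_box R r) c2.
exists (C1 + C2); first exact: addr_ge0.
move=> [x1 x2] [y1 y2]; rewrite !le_pair_norm/= => /andP[xr1 xr2] /andP[yr1 yr2].
have [c cr e1] := MVT_itv y1 x1 (fun a => derivable_slice1 (D1 (a, x2))).
have [d dr e2] := MVT_itv y2 x2 (fun a => derivable_slice2 (D2 (y1, a))).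
have -> : f (x1, x2) - f (y1, y2) = d1 f (c, x2) * (x1 - y1) + d2 f (y1, d) * (x2 - y2).
  by rewrite -e1 -e2 addrA subrK.
rewrite (le_trans (ler_normD _ _))// !normrM mulrDl lerD//.
  rewrite ler_pM//; first by apply: h1; rewrite /= le_pair_norm xr2 (norm_between _ _ cr).
  exact: (pair_norm1 ((x1, x2) - (y1, y2))).
rewrite ler_pM//; first by apply: h2; rewrite /= le_pair_norm yr1 (norm_between _ _ dr).
exact: (pair_norm2 ((x1, x2) - (y1, y2))).
Qed.

Lemma Cn1_comp_linear {V : normedModType R} (l : V -> R) (f : plane R -> V) :
  continuous l -> (forall u w, l (u - w) = l u - l w) -> (forall (a : R) u, l (a *: u) = a *: l u) ->
  Cn 1 f -> Cn 1 (l \o f).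
Proof.
move=> cl lB lZ [cf D1 D2 c1 c2].
have E1 x := is_derive_comp_linear cl lB lZ (D1 x).
have E2 x := is_derive_comp_linear cl lB lZ (D2 x).
split.
- by move=> x; apply: continuous_comp; [exact: cf|exact: cl].
- by move=> x; have [] := E1 x.
- by move=> x; have [] := E2 x.
- rewrite /= (_ : d1 _ = l \o d1 f); last by apply/funext => x; rewrite /d1 derive_val.
  by move=> x; apply: continuous_comp; [exact: c1|exact: cl].
- rewrite /= (_ : d2 _ = l \o d2 f); last by apply/funext => x; rewrite /d2 derive_val.
  by move=> x; apply: continuous_comp; [exact: c2|exact: cl].
Qed.

Lemma Cn1_lipschitz_plane (f : plane R -> plane R) r : Cn 1 f ->
  exists2 L, 0 <= L & forall x y, `|x| <= r -> `|y| <= r -> `|f x - f y| <= L * `|x - y|.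
Proof.
move=> Cf.
have C1 : Cn 1 (fst \o f).
  by apply: Cn1_comp_linear => // x; exact: cvg_fst.
have C2 : Cn 1 (snd \o f).
  by apply: Cn1_comp_linear => // x; exact: cvg_snd.
have [L1 L10 h1] := Cn1_lipschitz r C1.
have [L2 L20 h2] := Cn1_lipschitz r C2.
exists (L1 + L2) => [|x y xr yr]; first exact: addr_ge0.
rewrite le_pair_norm; apply/andP; split.
  by rewrite (le_trans (h1 _ _ xr yr))// ler_wpM2r// lerDl.
by rewrite (le_trans (h2 _ _ xr yr))// ler_wpM2r// lerDr.
Qed.

Lemma Cn1_lipschitz_matrix m n (f : plane R -> 'M[R]_(m, n)) r : Cn 1 f ->
  exists2 L, 0 <= L & forall x y, `|x| <= r -> `|y| <= r -> `|f x - f y| <= L * `|x - y|.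
Proof.
move=> Cf.
have h i j : exists L, 0 <= L /\ forall x y, `|x| <= r -> `|y| <= r ->
    `|f x i j - f y i j| <= L * `|x - y|.
  have Cij : Cn 1 ((fun M : 'M[R]_(m, n) => M i j) \o f).
    apply: Cn1_comp_linear => //.
    - exact: coord_continuous.
    - by move=> u w; rewrite !mxE.
    - by move=> a u; rewrite !mxE.
  by have [L L0 h] := Cn1_lipschitz r Cij; exists L.
pose L i j := sval (cid (h i j)).
have LP i j : 0 <= L i j /\ forall x y, `|x| <= r -> `|y| <= r ->
    `|f x i j - f y i j| <= L i j * `|x - y| by rewrite /L; case: cid.
have L0 i j : 0 <= L i j by have [] := LP i j.
exists (\sum_i \sum_j L i j) => [|x y xr yr].
  by apply: sumr_ge0 => i _; exact: sumr_ge0.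
apply: le_mx_norm => [|i j].
  by rewrite mulr_ge0//; apply: sumr_ge0 => i _; exact: sumr_ge0.
rewrite !mxE; have [_ /(_ _ _ xr yr)/le_trans] := LP i j; apply.
rewrite ler_wpM2r// (bigD1 i)//= (bigD1 j)//= -addrA lerDl addr_ge0//.
  exact: sumr_ge0.
by apply: sumr_ge0 => k _; exact: sumr_ge0.
Qed.

Lemma mulmx_norm m n p (A : 'M[R]_(m, n)) (B : 'M[R]_(n, p)) :
  `|A *m B| <= n%:R * `|A| * `|B|.
Proof.
apply: le_mx_norm => [|i j]; first by rewrite !mulr_ge0.
rewrite mxE (le_trans (ler_norm_sum _ _ _))//.
rewrite (@le_trans _ _ (\sum_(k < n) `|A| * `|B|))//.
  by apply: ler_sum => k _; rewrite normrM ler_pM// mx_norm_entry.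
by rewrite sumr_const card_ord -mulrA mulr_natl.
Qed.

End lipschitz_box.

(** With n + 1 equal steps the quadratic errors sum to O(1 / n), and the products of [1 + c * h]
    stay below the exponential. No derivative of f is involved, so f may be the norm of a curve. *)
Lemma discrete_gronwall {R : realType} (f : R -> R) (c C T : R) :
  0 <= c -> 0 <= C -> 0 <= T -> (forall t, 0 <= f t) ->
  (forall t h, 0 <= t -> 0 <= h -> f (t + h) <= (1 + c * h) * f t + C * h ^+ 2) ->
  f T <= expR (c * T) * f 0.
Proof.
move=> c0 C0 T0 f0 hf.
have key h k : 0 <= h -> f (k%:R * h) <= expR (c * (k%:R * h)) * (f 0 + k%:R * (C * h ^+ 2)).
  move=> h0; have Ch : 0 <= C * h ^+ 2 by rewrite mulr_ge0// sqr_ge0.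
  elim: k => [|k ih]; first by rewrite !mul0r mulr0 expR0 mul1r addr0.
  have -> : k.+1%:R * h = k%:R * h + h by rewrite -natr1; ring.
  have kh : 0 <= k%:R * h by rewrite mulr_ge0.
  rewrite (le_trans (hf _ _ kh h0))//.
  have -> : expR (c * (k%:R * h + h)) = expR (c * (k%:R * h)) * expR (c * h).
    by rewrite mulrDr expRD.
  have e1 : 1 + c * h <= expR (c * h) by exact: expR_ge1Dx.
  have e2 : 1 <= expR (c * (k%:R * h)) * expR (c * h).
    by rewrite -expRD -expR0 ler_expR addr_ge0 ?mulr_ge0.
  rewrite -natr1 [leRHS](_ : _ =
    expR (c * h) * (expR (c * (k%:R * h)) * (f 0 + k%:R * (C * h ^+ 2))) +
    expR (c * (k%:R * h)) * expR (c * h) * (C * h ^+ 2)); last by ring.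
  rewrite lerD//; last by rewrite ler_peMl.
  by rewrite ler_pM// addr_ge0// mulr_ge0.
apply: (@le_harmonic_error _ _ _ (expR (c * T) * (C * T ^+ 2))) => n.
have n0 : (n.+1%:R : R) != 0 by [].
have := @key (T / n.+1%:R) n.+1 (divr_ge0 T0 (ler0n _ _)).
rewrite mulrCA divff// mulr1 => /le_trans; apply.
by rewrite le_eqVlt; apply/orP; left; apply/eqP; field.
Qed.

(* [phi] is the flow of [b \o clip2 r], and [W t x] the resolvent at time [t] of
   [w' = - H (clip2 r (phi t x)) *m w]. Both equations are recorded as uniform
   second-order expansions; [W] is only controlled for [`|t| <= T]. *)
Record characteristics {R : realType} {n : nat} (b : plane R -> plane R)
    (H : plane R -> 'M[R]_n) (r T : R) (phi : R -> plane R -> plane R)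
    (W : R -> plane R -> 'M[R]_n) (L M C : R) := Characteristics {
  char_L0 : 0 <= L ;
  char_M0 : 0 <= M ;
  char_C0 : 0 <= C ;
  char0 : forall x, phi 0 x = x ;
  charD : forall s t x, phi (s + t) x = phi t (phi s x) ;
  char_lip : forall t x y, `|phi t x - phi t y| <= expR (`|t| * L) * `|x - y| ;
  char_time : forall s t x, `|phi t x - phi s x| <= `|t - s| * M ;
  char_exp : forall t h x,
    `|phi (t + h) x - phi t x - h *: b (clip2 r (phi t x))| <= C * h ^+ 2 ;
  char_unique : forall (y : R -> plane R) (t0 t1 : R), t0 < 0 < t1 ->
    (forall t, t0 < t < t1 -> is_derive t (1 : R) y (b (clip2 r (y t)))) ->
    forall s, t0 < s < t1 -> y s = phi s (y 0) ;
  charW0 : forall x, W 0 x = 1%:M ;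
  charW_bound : forall t x, `|t| <= T -> `|W t x| <= C ;
  charW_lip : forall t x y, `|t| <= T -> `|W t x - W t y| <= C * `|x - y| ;
  charWD : forall s t x, `|s| <= T -> `|t| <= T ->
    W (s + t) x = W t (phi s x) *m W s x ;
  charW_exp : forall t h x, `|t| <= T ->
    `|W (t + h) x - W t x + h *: (H (clip2 r (phi t x)) *m W t x)| <= C * h ^+ 2 }.

Section characteristics_exist.
Context {R : realType} {n : nat} (b : plane R -> plane R) (H : plane R -> 'M[R]_n) (r T : R).
Context (Lb Mb LH MH : R).
Hypotheses (r0 : 0 <= r) (T0 : 0 <= T).
Hypotheses (Lb0 : 0 <= Lb) (LH0 : 0 <= LH).
Hypothesis bL : forall x y, `|x| <= r -> `|y| <= r -> `|b x - b y| <= Lb * `|x - y|.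
Hypothesis HL : forall x y, `|x| <= r -> `|y| <= r -> `|H x - H y| <= LH * `|x - y|.
Hypothesis bM : forall x, `|x| <= r -> `|b x| <= Mb.
Hypothesis HM : forall x, `|x| <= r -> `|H x| <= MH.
Implicit Types (x y : plane R) (V W : 'M[R]_n).

Let E : normedModType R := (plane R * 'M[R]_n)%type.
Let Mb0 : 0 <= Mb. Proof. by apply: le_trans (bM (x := 0) _); rewrite ?normr0. Qed.
Let MH0 : 0 <= MH. Proof. by apply: le_trans (HM (x := 0) _); rewrite ?normr0. Qed.
Let c := n%:R * MH.
Let c0 : 0 <= c. Proof. by rewrite mulr_ge0. Qed.
(** Truncation level for the matrix entries. It must dominate [W s x] for times up to T + 1, and
    also [W s x *m V] when V has norm at most [expR (c * T)]: the exponents T + 1 and T add up to 2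
    T + 1, and the factor n comes from [mulmx_norm]. *)
Let K := n.+1%:R * expR (c * (2 * T + 1)).
Let K0 : 0 <= K. Proof. by rewrite mulr_ge0// expR_ge0. Qed.

Let clipm V : 'M[R]_n := map_mx (clip K) V.
Let clipm_le V : `|clipm V| <= K.
Proof. by apply: le_mx_norm => // i j; rewrite mxE clip_le. Qed.
Let clipm_norm V : `|clipm V| <= `|V|.
Proof.
by apply: le_mx_norm => // i j; rewrite mxE (le_trans (clip_norm _ _))// mx_norm_entry.
Qed.
Let clipm_lip V W : `|clipm V - clipm W| <= `|V - W|.
Proof.
apply: le_mx_norm => // i j; rewrite !mxE (le_trans (clip_lip _ _ _))//.
by have := mx_norm_entry (V - W) i j; rewrite !mxE.
Qed.
Let clipm_id V : `|V| <= K -> clipm V = V.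
Proof.
by move=> VK; apply/matrixP => i j; rewrite mxE clip_id// (le_trans (mx_norm_entry _ _ _)).
Qed.

Let bt x := b (clip2 r x).
Let Ht x := H (clip2 r x).
Let btM x : `|bt x| <= Mb. Proof. by apply: bM; exact: clip2_le. Qed.
Let HtM x : `|Ht x| <= MH. Proof. by apply: HM; exact: clip2_le. Qed.
Let btL x y : `|bt x - bt y| <= Lb * `|x - y|.
Proof.
by rewrite (le_trans (bL _ _))// ?clip2_le// ler_wpM2l// clip2_lip.
Qed.
Let HtL x y : `|Ht x - Ht y| <= LH * `|x - y|.
Proof.
by rewrite (le_trans (HL _ _))// ?clip2_le// ler_wpM2l// clip2_lip.
Qed.

(** Base point and matrix are moved by a single field. The matrix equation is linear, hence
    unbounded; truncating the entries makes the field bounded, as the Euler scheme requires. *)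
Let F (z : E) : E := (bt z.1, - (Ht z.1 *m clipm z.2)).

Let MF := Mb + n%:R * MH * K.
Let LF := Lb + n%:R * (LH * K + MH).
Let LF0 : 0 <= LF. Proof. by rewrite addr_ge0// mulr_ge0// addr_ge0// mulr_ge0. Qed.

Let le_Enorm (z : E) (a : R) : (`|z| <= a) = (`|z.1| <= a) && (`|z.2| <= a).
Proof. by rewrite prod_normE ge_max. Qed.
Let Enorm1 (z : E) : `|z.1| <= `|z|.
Proof. by have := lexx `|z|; rewrite le_Enorm => /andP[]. Qed.
Let Enorm2 (z : E) : `|z.2| <= `|z|.
Proof. by have := lexx `|z|; rewrite le_Enorm => /andP[]. Qed.

Let FM z : `|F z| <= MF.
Proof.
rewrite le_Enorm/= normrN; apply/andP; split.
  by rewrite (le_trans (btM _))// lerDl mulr_ge0// mulr_ge0.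
rewrite (le_trans (mulmx_norm _ _))// ler_wpDl// -!mulrA ler_wpM2l//.
by rewrite ler_pM.
Qed.

Let FL z w : `|F z - F w| <= LF * `|z - w|.
Proof.
rewrite le_Enorm/=; apply/andP; split.
  rewrite (le_trans (btL _ _))// ler_pM//; last exact: (Enorm1 (z - w)).
  by rewrite lerDl mulr_ge0// addr_ge0// mulr_ge0.
have -> : - (Ht z.1 *m clipm z.2) - - (Ht w.1 *m clipm w.2) =
   - ((Ht z.1 - Ht w.1) *m clipm z.2 + Ht w.1 *m (clipm z.2 - clipm w.2)).
  by rewrite mulmxBl mulmxBr addrA subrK opprB opprK addrC.
rewrite normrN (le_trans (ler_normD _ _))// mulrDl ler_wpDl ?mulr_ge0//.
rewrite -mulrA mulrDl mulrDr lerD//.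
  rewrite (le_trans (mulmx_norm _ _))// -mulrA ler_wpM2l// mulrAC ler_pM//.
  rewrite (le_trans (HtL _ _))// ler_wpM2l//; exact: (Enorm1 (z - w)).
rewrite (le_trans (mulmx_norm _ _))// -mulrA ler_wpM2l// ler_pM//.
rewrite (le_trans (clipm_lip _ _))//; exact: (Enorm2 (z - w)).
Qed.

Let cP : geo_complete (plane R) := geo_complete_pair geo_complete_real geo_complete_real.
Let cE : geo_complete E := geo_complete_pair cP (@geo_complete_matrix R n n).

Let phi := flow cP Lb0 btM btL.
Let psi := flow cE LF0 FM FL.
Let CF := LF * MF.
Let MF0 : 0 <= MF. Proof. by rewrite addr_ge0// !mulr_ge0. Qed.
Let CF0 : 0 <= CF. Proof. exact: mulr_ge0. Qed.
Let W t x := (psi t (x, 1%:M)).2.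

Let psi_exp t h z : `|psi (t + h) z - psi t z - h *: F (psi t z)| <= CF * h ^+ 2.
Proof. by rewrite /psi flowD flow_exp. Qed.

Let psi1 t x V : (psi t (x, V)).1 = phi t x.
Proof.
have {2}-> : x = (psi 0 (x, V)).1 by rewrite /psi flow0.
have T1 : `|t| < `|t| + 1 by rewrite ltrDl.
apply: (@flow_unique _ _ _ _ _ cP Lb0 btM btL (fun s => (psi s (x, V)).1) (- (`|t| + 1)) (`|t| + 1)).
- by rewrite oppr_lt0 ltr_pwDr.
- move=> s _; apply: (@is_derive_quadratic _ _ _ _ _ CF) => h.
  exact: le_trans (Enorm1 (psi (s + h) _ - psi s _ - h *: F _)) (psi_exp _ _ _).
- by rewrite -ltr_norml.
Qed.

Let psiE t x : psi t (x, 1%:M) = (phi t x, W t x).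
Proof. by rewrite /W -(psi1 t x 1%:M); case: (psi _ _). Qed.

Let psi2_exp t h z :
  `|(psi (t + h) z).2 - (psi t z).2 + h *: (Ht (psi t z).1 *m clipm (psi t z).2)| <= CF * h ^+ 2.
Proof.
have := le_trans (Enorm2 _) (psi_exp t h z).
by rewrite /= scalerN opprK.
Qed.

(** Truncation does not increase norms, so the matrix grows at rate at most [c], as in the linear
    equation. Negative times are handled by running the curve backward. *)
Let psi2_bound t z : `|(psi t z).2| <= expR (c * `|t|) * `|z.2|.
Proof.
have step s h : `|(psi (s + h) z).2| <= (1 + c * `|h|) * `|(psi s z).2| + CF * h ^+ 2.
  have := psi2_exp s h z; set A := _.2; set B := _.2; set D := h *: _ => hA.
  have -> : A = (A - B + D) + B - D by rewrite addrAC addrK subrK.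
  rewrite (le_trans (ler_normB _ _))// (le_trans (lerD (ler_normD _ _) (lexx _)))//.
  have : `|D| <= c * `|h| * `|B|.
    rewrite /D normrZ [c * _]mulrC -mulrA ler_wpM2l// (le_trans (mulmx_norm _ _))//.
    by rewrite /c ler_pM ?mulr_ge0// ler_wpM2l.
  by move: hA; set u := `|A - B + D|; set v := `|B|; set w := `|D|; set cv := c * _ * _; rewrite mulrDl mul1r -/cv; lra.
have [t0|/ltW t0] := leP 0 t.
  rewrite ger0_norm//; have := @discrete_gronwall _ (fun s => `|(psi s z).2|) c CF t c0 CF0 t0.
  have -> : psi 0 z = z by rewrite /psi flow0.
  apply => // s h s0 h0.
  by have := step s h; rewrite (ger0_norm h0).
have t0' : 0 <= - t by rewrite oppr_ge0.
rewrite ler0_norm//.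
have := @discrete_gronwall _ (fun s => `|(psi (- s) z).2|) c CF (- t) c0 CF0 t0'.
rewrite opprK oppr0; have -> : psi 0 z = z by rewrite /psi flow0.
apply => // s h s0 h0.
by have := step (- s) (- h); rewrite -opprD normrN (ger0_norm h0) sqrrN.
Qed.

Let norm1 : `|1%:M : 'M[R]_n| <= 1.
Proof.
by apply: le_mx_norm => // i j; rewrite mxE; case: eqP; rewrite ?normr1 ?normr0.
Qed.

Let W_bound t x : `|W t x| <= expR (c * `|t|).
Proof. by rewrite /W (le_trans (psi2_bound _ _))//= ler_piMr ?expR_ge0. Qed.

Let W_exp t h x : `|t| <= T + 1 ->
  `|W (t + h) x - W t x + h *: (Ht (phi t x) *m W t x)| <= CF * h ^+ 2.
Proof.
move=> tT; have := psi2_exp t h (x, 1%:M); rewrite !psiE/= clipm_id//.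
rewrite (le_trans (W_bound _ _))// /K (@le_trans _ _ (expR (c * (2 * T + 1))))//.
  by rewrite ler_expR ler_wpM2l// (le_trans tT)// lerD2r ler_peMl// ler1n.
by rewrite ler_peMl ?expR_ge0// ler1n.
Qed.

(** Truncation destroys linearity in V, but for these times and this V the product [W s x *m V]
    stays below K. It therefore solves the truncated equation too, and uniqueness identifies the
    two. The cocycle law of W follows. *)
Let psi_linear t x V : `|t| <= T -> `|V| <= expR (c * T) ->
  psi t (x, V) = (phi t x, W t x *m V).
Proof.
move=> tT VT; apply/esym.
pose y s : E := (phi s x, W s x *m V).
have y0 : y 0 = (x, V) by rewrite /y /phi flow0 /W /psi flow0 mul1mx.
rewrite -/(y t) -y0.
apply: (@flow_unique _ _ _ _ _ cE LF0 FM FL y (- (T + 1)) (T + 1)).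
- by rewrite oppr_lt0 ltr_wpDl.
- move=> s; rewrite -ltr_norml => /ltW sT.
  apply: (@is_derive_quadratic _ _ _ _ _ (Lb * Mb + CF * (n%:R * `|V|))) => h.
  rewrite le_Enorm/=; apply/andP; split.
    rewrite mulrDl ler_wpDr//; first by apply: mulr_ge0; [rewrite !mulr_ge0|exact: sqr_ge0].
    by rewrite /phi flowD flow_exp.
  have WV : `|W s x *m V| <= K.
    rewrite (le_trans (mulmx_norm _ _))// /K -mulrA ler_pM//.
      by rewrite ler_nat.
    rewrite (le_trans (ler_pM _ _ (W_bound s x) VT))// -expRD ler_expR -mulrDr ler_wpM2l//.
    rewrite (le_trans (lerD sT (lexx _)))//; lra.
  rewrite clipm_id// scalerN opprK mulmxA scalemxAl -mulmxBl -mulmxDl.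
  rewrite (le_trans (mulmx_norm _ _))// mulrDl ler_wpDl//; first by apply: mulr_ge0; [rewrite !mulr_ge0|exact: sqr_ge0].
  rewrite [leRHS](_ : _ = n%:R * (CF * h ^+ 2) * `|V|); last by ring.
  by rewrite ler_wpM2r// ler_wpM2l// W_exp.
- by rewrite -ltr_norml (le_lt_trans tT)// ltrDl.
Qed.

Lemma characteristics_box :
  exists phi Wt L M C, characteristics b H r T phi Wt L M C.
Proof.
exists phi, W, Lb, Mb, (Lb * Mb + CF + expR (c * T) + expR (T * LF)).
have e1 := expR_ge0 (c * T); have e2 := expR_ge0 (T * LF).
have b0 : 0 <= Lb * Mb by exact: mulr_ge0.
have bf t h x : `|phi (t + h) x - phi t x - h *: b (clip2 r (phi t x))| <= (Lb * Mb) * h ^+ 2.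
  by rewrite /phi flowD flow_exp.
split => //.
- by rewrite !addr_ge0.
- by move=> x; rewrite /phi flow0.
- by move=> s t x; rewrite /phi flowD.
- by move=> t x y; rewrite /phi flow_lip.
- by move=> s t x; rewrite /phi flow_time.
- move=> t h x; rewrite (le_trans (bf _ _ _))// ler_wpM2r ?sqr_ge0//.
  by rewrite -!addrA lerDl !addr_ge0.
- by move=> y t0 t1 ht hy s hs; exact: (flow_unique cP Lb0 btM btL ht hy hs).
- by move=> x; rewrite /W /psi flow0.
- move=> t x tT; rewrite (le_trans (W_bound _ _))//.
  rewrite (@le_trans _ _ (expR (c * T)))//; first by rewrite ler_expR ler_wpM2l.
  by rewrite -addrA addrCA lerDl !addr_ge0.
- move=> t x y tT; rewrite (le_trans (Enorm2 (psi t (x, 1%:M) - psi t (y, 1%:M))))//.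
  rewrite /psi (le_trans (flow_lip _ _ _ _ _ _ _))// ler_pM ?expR_ge0//; last first.
    by rewrite le_Enorm/= subrr normr0 lexx/=.
  rewrite (@le_trans _ _ (expR (T * LF)))//; first by rewrite ler_expR ler_wpM2r.
  by rewrite lerDr !addr_ge0.
- move=> s t x sT tT; rewrite {1}/W /psi flowD -/psi psiE psi_linear//.
  by rewrite (le_trans (W_bound _ _))// ler_expR ler_wpM2l.
- move=> t h x tT; rewrite (le_trans (W_exp _ _ _))//.
    by rewrite (le_trans tT)// lerDl.
  by rewrite ler_wpM2r ?sqr_ge0// -!addrA addrCA lerDl !addr_ge0.
Qed.

End characteristics_exist.

Section characteristics_theory.
Context {R : realType} {n : nat} {b : plane R -> plane R} {H : plane R -> 'M[R]_n}.
Context {r T : R} {phi : R -> plane R -> plane R} {W : R -> plane R -> 'M[R]_n} {L M C : R}.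
Hypothesis ch : characteristics b H r T phi W L M C.

Lemma charK t x : phi (- t) (phi t x) = x.
Proof. by rewrite -(charD ch) subrr (char0 ch). Qed.

Lemma charNK t x : phi t (phi (- t) x) = x.
Proof. by rewrite -(charD ch) addNr (char0 ch). Qed.

Lemma charW_inv t x : `|t| <= T -> W t x *m W (- t) (phi t x) = 1%:M.
Proof.
by move=> tT; have := @charWD _ _ _ _ _ _ _ _ _ _ _ ch (- t) t (phi t x);
  rewrite normrN addNr charK (charW0 ch) => ->.
Qed.

(** While the line stays in the box the clipped field is the true one, so x is given by uniqueness.
    For w, the vector [v t] undoes the resolvent; it starts at w0 and is constant. *)
Lemma char_flow_line x0 w0 t0 t1 x w s : t0 < 0 < t1 -> t0 < s < t1 ->
  - T <= t0 -> t1 <= T -> flow_line b H x0 w0 t0 t1 x w ->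
  (forall t, t0 < t < t1 -> `|x t| <= r) ->
  x s = phi s x0 /\ w s = W s x0 *m w0.
Proof.
move=> ht hs t0T t1T [x00 w00 hd] xr.
have xE t : t0 < t < t1 -> x t = phi t x0.
  rewrite -x00; apply: (char_unique ch) => // u hu.
  by rewrite clip2_id ?xr//; exact: (hd _ hu).1.
have tT t : t0 < t < t1 -> `|t| <= T.
  move=> /andP[h1 h2]; rewrite ler_norml.
  by rewrite (le_trans t0T (ltW h1)) (le_trans (ltW h2) t1T).
split; first exact: xE.
pose v t := W (- t) (phi t x0) *m w t.
suff dv t : t0 < t < t1 -> is_derive t (1 : R) v 0.
  have := derive0_cst dv ht hs; rewrite /v oppr0 (charW0 ch) mul1mx w00 => ->.
  by rewrite mulmxA charW_inv ?mul1mx// tT.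
move=> htt; have [_ dw] := hd _ htt.
have C0 := char_C0 ch.
have e0 : 0 < Num.min (t - t0) (t1 - t).
  by case/andP: htt => h1 h2; rewrite lt_min !subr_gt0 h1.
apply: (is_derive0_dominated dw (K := n%:R * C) (C := n%:R * C * `|w t|) _ _ (divr_gt0 e0 (ltr0Sn _ 1))).
- by rewrite mulr_ge0.
- by rewrite !mulr_ge0.
move=> h he.
have [h1 h2] : `|h| < t - t0 /\ `|h| < t1 - t.
  have hm : `|h| < Num.min (t - t0) (t1 - t).
    by rewrite (le_lt_trans he)// ltr_pdivrMr// ltr_pMr// ltr1n.
  by move: hm; rewrite lt_min => /andP.
have hth : t0 < t + h < t1.
  by move: h1 h2; rewrite !ltr_norml => /andP[+ _] /andP[_]; lra.
have hh : `|h| <= T.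
  have e2 : `|h| + `|h| < T + T.
    by rewrite (lt_le_trans (ltrD h1 h2))// addrC addrA subrK lerD// lerNl.
  by move: e2; lra.
(* The cocycle law writes both values of v with the same left factor. Their difference then reduces
   to [w (t + h) - W h (x t) *m w t], where only the expansion of W at time 0 is needed. *)
have e : W (- t) (phi t x0) = W (- (t + h)) (phi (t + h) x0) *m W h (phi t x0).
  have := @charWD _ _ _ _ _ _ _ _ _ _ _ ch h (- (t + h)) (phi t x0) hh.
  by rewrite normrN tT// -(charD ch) opprD addrCA subrr addr0 => ->.
rewrite /v e -mulmxA -mulmxBr (le_trans (mulmx_norm _ _))// ler_pM ?mulr_ge0//.
  by rewrite ler_wpM2l// (charW_bound ch)// normrN tT.
have := charW_exp ch h (phi t x0) (t := 0).
rewrite normr0 add0r (char0 ch) (charW0 ch) mulmx1 -(xE _ htt) clip2_id ?xr//.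
move=> /(_ (le_trans (normr_ge0 _) hh)) We.
have -> : w (t + h) - W h (x t) *m w t = (w (t + h) - w t - h *: - (H (x t) *m w t)) -
    (W h (x t) - 1%:M + h *: H (x t)) *m w t.
  rewrite scalerN opprK mulmxDl mulmxBl mul1mx -scalemxAl opprD opprB addrACA.
  by rewrite subrr addr0 addrA subrK.
rewrite (le_trans (ler_normB _ _))// lerD2l (le_trans (mulmx_norm _ _))//.
rewrite [leRHS](_ : _ = n%:R * (C * h ^+ 2) * `|w t|); last by ring.
by rewrite ler_wpM2r// ler_wpM2l.
Qed.

End characteristics_theory.

(** * Bounded measurable functions and planar Lebesgue measure *)

Section measurable_basis.

(** A countable family of measurable sets that refines all neighbourhoods. Being stable under
    products, it shows that open sets are measurable for the product sigma-algebras used below, and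
    so that continuous functions are measurable. *)
Definition measurable_basis (T : Type) (nb : T -> set (set T)) (ms : set (set T)) :=
  exists D : nat -> set T, (forall n, ms (D n)) /\
    forall x A, nb x A -> exists n, D n x /\ D n `<=` A.

Lemma measurable_basis_open d (T : measurableType d) (nb : T -> set (set T)) (O : set T) :
  measurable_basis nb measurable -> (forall x, O x -> nb x O) -> measurable O.
Proof.
move=> [D [mD DP]] Oo.
have -> : O = \bigcup_(n in [set n | D n `<=` O]) D n.
  apply/seteqP; split => [x Ox|x [n /= DO Dx]]; last exact: DO.
  by have [n [Dx DO]] := DP _ _ (Oo _ Ox); exists n.
by apply: bigcup_measurable => n _; exact: mD.
Qed.

Lemma measurable_basis_prod d1 d2 (T1 : measurableType d1) (T2 : measurableType d2)
    (nb1 : T1 -> set (set T1)) (nb2 : T2 -> set (set T2)) :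
  measurable_basis nb1 measurable -> measurable_basis nb2 measurable ->
  measurable_basis (fun x : T1 * T2 => filter_prod (nb1 x.1) (nb2 x.2)) measurable.
Proof.
move=> [D1 [mD1 P1]] [D2 [mD2 P2]].
exists (fun n => if (unpickle n : option (nat * nat)) is Some p then D1 p.1 `*` D2 p.2 else set0); split.
  by move=> n; case: unpickle => [p|] //; exact: measurableX.
move=> x A [[B1 B2] [/= /P1[n1 [x1 s1]] /P2[n2 [x2 s2]]] sA].
exists (pickle (n1, n2)); rewrite pickleK/=; split=> // y [/= y1 y2].
by apply: sA; split; [exact: s1|exact: s2].
Qed.

Context {R : realType}.

Lemma measurable_basisR : measurable_basis (@nbhs R R) (@measurable _ R).
Proof.
exists (fun n => if (unpickle n : option (rat * rat)) is Some p then `]ratr p.1, ratr p.2[%classic else set0).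
split; first by move=> n; case: unpickle => [p|] //; exact: measurable_itv.
move=> x A /nbhs_ballP[e /= e0 eA].
have [q1] : exists q : rat, ratr q \in `]x - e, x[ by apply: rat_in_itvoo; rewrite ltrBlDr ltrDl.
have [q2] : exists q : rat, ratr q \in `]x, x + e[ by apply: rat_in_itvoo; rewrite ltrDl.
rewrite !in_itv/= => /andP[a1 a2] /andP[b1 b2].
exists (pickle (q1, q2)); rewrite pickleK/= in_itv/= b2 a1; split=> // y.
rewrite /= in_itv/= => /andP[y1 y2]; apply: eA.
by rewrite /ball/= ltr_distlC (lt_trans b1 y1)/= (lt_trans y2).
Qed.

Lemma measurable_basis_plane : measurable_basis (@nbhs (plane R) (plane R)) (@measurable _ (plane R)).
Proof. exact: measurable_basis_prod measurable_basisR measurable_basisR. Qed.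

Lemma measurable_basis_Rplane :
  measurable_basis (@nbhs (R * plane R)%type (R * plane R)%type) (@measurable _ (R * plane R)%type).
Proof. exact: measurable_basis_prod measurable_basisR measurable_basis_plane. Qed.

Lemma open_measurable_plane (O : set (plane R)) : open O -> measurable O.
Proof.
rewrite openE => oO; apply: (measurable_basis_open measurable_basis_plane).
by move=> x /oO.
Qed.

Lemma continuous_measurable_plane (f : plane R -> R) : continuous f -> measurable_fun setT f.
Proof.
move=> /continuousP cf; apply: (measurability _ (RGenOpens.measurableE R)).
move=> _ [_ [a [b ->] <-]]; rewrite setTI; apply: open_measurable_plane.
exact/cf/interval_open.
Qed.

Lemma continuous_measurable_Rplane (f : (R * plane R)%type -> R) :
  continuous f -> measurable_fun setT f.
Proof.
move=> /continuousP cf; apply: (measurability _ (RGenOpens.measurableE R)).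
move=> _ [_ [a [b ->] <-]]; rewrite setTI.
apply: (measurable_basis_open measurable_basis_Rplane) => x.
have : open (f @^-1` `]a, b[) by exact/cf/interval_open.
by rewrite openE => h /h.
Qed.

End measurable_basis.

Section bounded_measurable.
Context d (T : measurableType d) (R : realType).
Implicit Types (f g : T -> R).

(** These functions are integrable for every finite measure, so that the rules below for real-valued
    integrals carry no integrability condition. *)
Definition bmeas f := measurable_fun setT f /\ exists C, forall x, `|f x| <= C.

Lemma bmeas_meas f : bmeas f -> measurable_fun setT f. Proof. by case. Qed.

Lemma bmeas_bound f : bmeas f -> exists2 C, 0 <= C & forall x, `|f x| <= C.
Proof.
move=> [_ [C h]]; exists `|C| => // x.
by rewrite (le_trans (h x))// ler_norm.
Qed.

Lemma bmeas_cst c : bmeas (fun=> c).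
Proof. by split=> //; exists `|c|. Qed.

Lemma bmeasD f g : bmeas f -> bmeas g -> bmeas (fun x => f x + g x).
Proof.
move=> [mf [C hf]] [mg [D hg]]; split; first exact: measurable_funD.
by exists (C + D) => x; rewrite (le_trans (ler_normD _ _))// lerD.
Qed.

Lemma bmeasN f : bmeas f -> bmeas (fun x => - f x).
Proof.
by move=> [mf [C hf]]; split; [exact: measurableT_comp|exists C => x; rewrite normrN].
Qed.

Lemma bmeasB f g : bmeas f -> bmeas g -> bmeas (fun x => f x - g x).
Proof. by move=> bf bg; apply: bmeasD => //; exact: bmeasN. Qed.

Lemma bmeasM f g : bmeas f -> bmeas g -> bmeas (fun x => f x * g x).
Proof.
move=> [mf [C hf]] [mg [D hg]]; split; first exact: measurable_funM.
by exists (C * D) => x; rewrite normrM ler_pM.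
Qed.

Lemma bmeasZ c f : bmeas f -> bmeas (fun x => c * f x).
Proof. by apply: bmeasM; exact: bmeas_cst. Qed.

Lemma bmeas_norm f : bmeas f -> bmeas (fun x => `|f x|).
Proof.
by move=> [mf [C hf]]; split; [exact: measurableT_comp|exists C => x; rewrite normr_id].
Qed.

Lemma bmeas_indic (A : set T) : measurable A -> bmeas (\1_A).
Proof.
move=> mA; split; first exact: measurable_indic.
by exists 1 => x; rewrite indicE; case: (_ \in _); rewrite ?normr1 ?normr0.
Qed.

Lemma bmeas_sum (I : Type) (r : seq I) (P : pred I) (F : I -> T -> R) :
  (forall i, bmeas (F i)) -> bmeas (fun x => \sum_(i <- r | P i) F i x).
Proof.
move=> bF; elim: r => [|i r ih].
  by under eq_fun do rewrite big_nil; exact: bmeas_cst.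
under eq_fun do rewrite big_cons.
by case: (P i) => //; exact: bmeasD.
Qed.

Variable m : {finite_measure set T -> \bar R}.

Lemma bmeas_integrable f : bmeas f -> m.-integrable setT (EFin \o f).
Proof.
move=> [mf [C hf]]; apply: measurable_bounded_integrable => //.
  by rewrite ltey_eq fin_num_measure.
exists C; split; first exact: num_real.
by move=> M CM x _ /=; rewrite (le_trans (hf x))// ltW.
Qed.

Lemma bRintD f g : bmeas f -> bmeas g ->
  \int[m]_x (f x + g x) = \int[m]_x f x + \int[m]_x g x.
Proof. by move=> bf bg; rewrite RintegralD//; exact: bmeas_integrable. Qed.

Lemma bRintB f g : bmeas f -> bmeas g ->
  \int[m]_x (f x - g x) = \int[m]_x f x - \int[m]_x g x.
Proof. by move=> bf bg; rewrite RintegralB//; exact: bmeas_integrable. Qed.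

Lemma bRintZ c f : bmeas f -> \int[m]_x (c * f x) = c * \int[m]_x f x.
Proof. by move=> bf; rewrite RintegralZl//; exact: bmeas_integrable. Qed.

Lemma bRint0 : \int[m]_x (0 : R) = 0.
Proof. by rewrite Rintegral_cst// mul0r. Qed.

Lemma bRint_sum (I : Type) (r : seq I) (P : pred I) (F : I -> T -> R) :
  (forall i, bmeas (F i)) ->
  \int[m]_x (\sum_(i <- r | P i) F i x) = \sum_(i <- r | P i) \int[m]_x F i x.
Proof.
move=> bF; elim: r => [|i r ih].
  by rewrite big_nil; under eq_Rintegral do rewrite big_nil; exact: bRint0.
rewrite big_cons -ih; under eq_Rintegral do rewrite big_cons.
by case: (P i) => //; rewrite bRintD//; exact: bmeas_sum.
Qed.

Lemma bRint_le f g : bmeas f -> bmeas g -> (forall x, f x <= g x) ->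
  \int[m]_x f x <= \int[m]_x g x.
Proof. by move=> bf bg fg; apply: le_Rintegral => //; exact: bmeas_integrable. Qed.

Lemma bRint_ge0 f : (forall x, 0 <= f x) -> 0 <= \int[m]_x f x.
Proof. by move=> f0; exact: Rintegral_ge0. Qed.

Lemma bRint_norm f : bmeas f -> `|\int[m]_x f x| <= \int[m]_x `|f x|.
Proof. by move=> bf; apply: le_normr_Rintegral => //; exact: bmeas_integrable. Qed.

Lemma bRint_norm_le f g : bmeas f -> bmeas g -> (forall x, `|f x| <= g x) ->
  `|\int[m]_x f x| <= \int[m]_x g x.
Proof.
move=> bf bg fg; apply: le_trans (bRint_norm bf) _; apply: bRint_le => //.
exact: bmeas_norm.
Qed.

Lemma bRint_bound f C : bmeas f -> (forall x, `|f x| <= C) ->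
  `|\int[m]_x f x| <= C * fine (m setT).
Proof.
move=> bf fC; rewrite -[leRHS]Rintegral_cst//; apply: bRint_norm_le => //.
exact: bmeas_cst.
Qed.

Lemma bRint_EFin f : bmeas f -> (\int[m]_x f x)%:E = (\int[m]_x (f x)%:E)%E.
Proof. by move=> bf; rewrite fineK//; apply: integrable_fin_num => //; exact: bmeas_integrable. Qed.

Lemma bRint_indic (A : set T) : measurable A -> (\int[m]_x (\1_A x : R))%:E = m A.
Proof.
move=> mA; rewrite bRint_EFin; last exact: bmeas_indic.
by rewrite integral_indic// setIT.
Qed.

Lemma bRint_cvg (f_ : (T -> R)^nat) f C : (forall n, measurable_fun setT (f_ n)) ->
  measurable_fun setT f -> (forall n x, `|f_ n x| <= C) ->
  (forall x, f_ n x @[n --> \oo] --> f x) ->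
  \int[m]_x f_ n x @[n --> \oo] --> \int[m]_x f x.
Proof.
move=> mf_ mf fC cf.
have fx x : `|f x| <= C.
  by apply: (cvgr_to_le (cvg_norm (cf x))); apply: nearW => n; exact: fC.
have bf : bmeas f by split=> //; exists C.
have bfn n : bmeas (f_ n) by split=> //; exists C.
have [|||||_ _ h] := @dominated_convergence _ _ _ m setT measurableT
    (fun n => EFin \o f_ n) (EFin \o f) (EFin \o (fun=> C)).
- by move=> n; apply/measurable_EFinP.
- exact/measurable_EFinP.
- apply: aeW => x _; apply: cvg_EFin; first exact: nearW.
  exact: cf.
- exact/bmeas_integrable/bmeas_cst.
- by apply: aeW => x n _; rewrite /= lee_fin.
move: h; rewrite /= -bRint_EFin// => /fine_cvgP[_]; apply: cvg_trans.
by apply: near_eq_cvg; apply: nearW => n /=.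
Qed.

End bounded_measurable.

(** * Smooth compactly supported functions on the line *)

Section smooth_line.
Context {R : realType}.
Implicit Types (u v : R -> R) (t : R).

Fixpoint Cn_line (n : nat) u : Prop :=
  match n with
  | 0 => continuous u
  | n'.+1 => (forall t, derivable u t 1) /\ Cn_line n' (derive1 u)
  end.

Definition smooth_line u := forall n, Cn_line n u.

Lemma Cn_lineW n u : Cn_line n.+1 u -> Cn_line n u.
Proof.
elim: n u => [|n ih] u [du cu].
  by move=> t; exact/differentiable_continuous/derivable1_diffP.
by split=> //; exact: ih.
Qed.

Lemma Cn_lineD n u v : Cn_line n u -> Cn_line n v -> Cn_line n (u \+ v).
Proof.
elim: n u v => [|n ih] u v; first by move=> cu cv t; exact: (cvgD (cu t) (cv t)).
move=> [du cu] [dv cv]; split; first by move=> t; exact: derivableD.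
rewrite (_ : derive1 _ = (derive1 u) \+ (derive1 v)); first exact: ih.
by apply/funext => t; rewrite /= !derive1E deriveD.
Qed.

Lemma Cn_lineM n u v : Cn_line n u -> Cn_line n v -> Cn_line n (u \* v).
Proof.
elim: n u v => [|n ih] u v; first by move=> cu cv t; exact: (cvgM (cu t) (cv t)).
move=> cu cv; have [du cu'] := cu; have [dv cv'] := cv.
split; first by move=> t; exact: derivableM.
rewrite (_ : derive1 _ = (u \* (derive1 v)) \+ (v \* (derive1 u))).
  by apply: Cn_lineD; apply: ih => //; exact: Cn_lineW.
by apply/funext => t; rewrite /= !derive1E deriveM.
Qed.

Lemma Cn_line_cst n (c : R) : Cn_line n (cst c).
Proof.
elim: n c => [|n ih] c; first by move=> t; exact: cvg_cst.
by split=> //; rewrite (_ : derive1 _ = cst 0)//; apply/funext => t; rewrite derive1_cst.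
Qed.

Lemma Cn_line_affine n u (c a : R) : Cn_line n u -> Cn_line n (fun t => u (c * t + a)).
Proof.
elim: n u => [|n ih] u.
  move=> cu t; apply: continuous_comp; last exact: cu.
  by apply: cvgD; [apply: cvgM; [exact: cvg_cst|exact: cvg_id]|exact: cvg_cst].
move=> [du cu].
have dA t : is_derive t (1 : R) (fun t => c * t + a) c.
  apply: (@is_derive_quadratic _ _ _ _ _ 0) => h; rewrite mul0r.
  by rewrite (_ : _ - _ = 0) ?normr0// /GRing.scale/=; ring.
have dU t : is_derive t (1 : R) (fun t => u (c * t + a)) (c * (derive1 u) (c * t + a)).
  have := @is_derive1_comp R u (fun t => c * t + a) t _ _ (derivableP (du (c * t + a))) (dA t).
  by rewrite derive1E mulrC; apply.
split; first by move=> t; have [] := dU t.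
rewrite (_ : derive1 _ = (cst c) \* (fun t => (derive1 u) (c * t + a))).
  apply: Cn_lineM; last exact: ih.
  exact: Cn_line_cst.
by apply/funext => t; rewrite derive1E derive_val.
Qed.

(** Induction on p with the rate halved: half of the exponential bounds the polynomial of lower
    degree, the other half absorbs the factor x through [1 + y <= expR y]. *)
Lemma poly_le_expR (p : {poly R}) (a : R) : 0 < a ->
  exists2 C, 0 <= C & forall x, 0 <= x -> `|p.[x]| <= C * expR (a * x).
Proof.
elim/poly_ind: p a => [|p c ih] a a0.
  by exists 0 => // x _; rewrite horner0 normr0 mul0r.
have a20 : 0 < a / 2 by rewrite divr_gt0.
have [C C0 hC] := ih _ a20.
exists (C * (2 / a) + `|c|); first by rewrite addr_ge0// mulr_ge0// ltW// divr_gt0.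
move=> x x0; rewrite hornerMXaddC (le_trans (ler_normD _ _))// mulrDl lerD//.
  have e2 : expR (a * x) = expR (a / 2 * x) * expR (a / 2 * x).
    by rewrite -expRD -mulrDl -splitr.
  rewrite normrM (ger0_norm x0) e2 [leRHS](_ : _ = (C * expR (a / 2 * x)) * (2 / a * expR (a / 2 * x))); last by ring.
  apply: ler_pM => //; first exact: hC.
  rewrite -ler_pdivrMl ?divr_gt0// invf_div.
  by rewrite (le_trans _ (expR_ge1Dx _))// lerDr.
by rewrite ler_peMr// -expR0 ler_expR mulr_ge0// ltW.
Qed.

(* The derivative of [flat p] is again of this form, whence smoothness. *)
Definition flat (p : {poly R}) (t : R) : R := if 0 < t then p.[t^-1] * expR (- t^-1) else 0.

(** In the variable 1 / t this says that the exponential dominates the polynomial [p * 'X^k]. *)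
Lemma flat_bound p (k : nat) : exists2 C, 0 <= C & forall t, `|flat p t| <= C * `|t| ^+ k.
Proof.
have [C C0 hC] := poly_le_expR (p * 'X^k) (@ltr01 R).
exists C => // t; rewrite /flat. case: ifPn => t0; last by rewrite normr0 mulr_ge0// exprn_ge0.
have /hC : 0 <= t^-1 by rewrite invr_ge0 ltW.
have tk : 0 <= t^-1 ^+ k by rewrite exprn_ge0// invr_ge0 ltW.
rewrite hornerM hornerXn mul1r normrM (ger0_norm tk).
rewrite exprVn ler_pdivrMr ?exprn_gt0// => h.
rewrite normrM (ger0_norm (expR_ge0 _)) expRN ler_pdivrMr ?expR_gt0//.
by rewrite (le_trans h)// gtr0_norm// mulrAC.
Qed.

Lemma is_derive_flat p t : is_derive t (1 : R) (flat p) (flat ('X^2 * (p - p^`())) t).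
Proof.
have [t0|t0|->] := ltgtP t 0.
- rewrite [flat _ t]/flat ltNge ltW//=.
  apply: (@near_eq_is_derive _ _ _ (cst 0)) => //.
  near=> s; rewrite /flat ltNge ltW//.
  by near: s; exact: lt_nbhsl.
- have dI : is_derive t (1 : R) (fun s => s^-1) (- t ^- 2).
    have := @is_deriveV R id t 1 1; rewrite /= scaleNr [_ *: _]mulr1; apply.
    by rewrite gt_eqF.
  have dE : is_derive t (1 : R) (fun s => expR (- s^-1)) (t ^- 2 * expR (- t^-1)).
    have := @is_derive1_comp R expR (fun s => - s^-1) t _ _ (is_derive_expR _) (is_deriveN dI).
    by rewrite opprK mulrC; apply.
  have dP : is_derive t (1 : R) (fun s => p.[s^-1]) (- t ^- 2 * p^`().[t^-1]).
    have := @is_derive1_comp R (horner p) (fun s => s^-1) t _ _ (is_derive_poly p _) dI.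
    by rewrite mulrC; apply.
  apply: (@near_eq_is_derive _ R R (fun s : R => p.[s^-1] * expR (- s^-1))).
  + near=> s; rewrite /flat ifT//.
    by near: s; exact: lt_nbhsr.
  + have := @is_deriveM R R (fun s : R => p.[s^-1]) (fun s : R => expR (- s^-1)) t 1 _ _ dP dE.
    rewrite (_ : _ *: _ + _ = flat ('X^2 * (p - p^`())) t)//.
    rewrite /flat t0 !hornerE/= /GRing.scale/= -exprVn; ring.
- rewrite [flat _ 0]/flat ltxx.
  (* At the gluing point the function is O(t^2), hence has derivative 0. *)
  have [C C0 hC] := flat_bound p 2.
  apply: (@is_derive_quadratic _ _ _ _ _ C) => h.
  rewrite add0r scaler0 subr0 {2}/flat ltxx subr0.
  by rewrite (le_trans (hC h))// real_normK ?num_real.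
Unshelve. all: by end_near. Qed.

Lemma smooth_flat p : smooth_line (flat p).
Proof.
move=> n; elim: n p => [|n ih] p.
  move=> t; have [dt _] := is_derive_flat p t.
  exact/differentiable_continuous/derivable1_diffP.
split; first by move=> t; have [] := is_derive_flat p t.
rewrite (_ : derive1 _ = flat ('X^2 * (p - p^`())))//.
by apply/funext => t; rewrite derive1E; have [_] := is_derive_flat p t.
Qed.

Definition compact_smooth_line (e : R) u :=
  smooth_line u /\ forall t, e < `|t| -> u t = 0.

Lemma compact_smooth_line_derive e u : compact_smooth_line e u -> compact_smooth_line e (derive1 u).
Proof.
move=> [su u0]; split; first by move=> n; have [] := su n.+1.
move=> t et; rewrite derive1E.
suff : is_derive t (1 : R) u 0 by move=> [].
apply: (@near_eq_is_derive _ _ _ (cst 0)) => //.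
near=> s; apply/esym/u0; near: s.
exact: (cvgr_norm_gt t cvg_id).
Unshelve. all: by end_near. Qed.

Definition smooth_bump (e t : R) : R := flat 1 (e + t) * flat 1 (e - t).

Lemma smooth_bump_ge0 e t : 0 <= smooth_bump e t.
Proof.
by rewrite mulr_ge0// /flat; case: ifPn => // _; rewrite hornerC mul1r expR_ge0.
Qed.

Lemma compact_smooth_bump e : compact_smooth_line e (smooth_bump e).
Proof.
split.
  move=> n; rewrite /smooth_bump; apply: Cn_lineM.
    have := @Cn_line_affine n _ 1 e (@smooth_flat 1 n).
    by under eq_fun do rewrite mul1r addrC.
  have := @Cn_line_affine n _ (-1) e (@smooth_flat 1 n).
  by under eq_fun do rewrite mulN1r addrC.
move=> t; rewrite ltr_normr /smooth_bump /flat => /orP[h|h].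
  by rewrite [X in _ * X]ifF ?mulr0//; apply/negbTE; rewrite -leNgt; lra.
by rewrite [X in X * _]ifF ?mul0r//; apply/negbTE; rewrite -leNgt; lra.
Qed.

End smooth_line.

Section lebesgue_plane.
Context {R : realType}.
Implicit Types (x y a : plane R).

(* [lebesgue_measure] is a measure for the structure [measurableTypeR R], which has the same
   measurable sets as, but a different display from, the canonical structure of [R]. *)
Definition leb : set R -> \bar R := @lebesgue_measure R.

Let leb0 : leb set0 = 0%E. Proof. exact: measure0. Qed.
Let leb_ge0 A : (0 <= leb A)%E. Proof. exact: measure_ge0. Qed.
Let leb_semi_sigma_additive : semi_sigma_additive leb.
Proof. exact: (@measure_semi_sigma_additive _ _ _ (@lebesgue_measure R)). Qed.

HB.instance Definition _ := isMeasure.Build _ _ _ leb leb0 leb_ge0 leb_semi_sigma_additive.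

Let leb_sigma_finite : sigma_finite setT leb.
Proof. exact: (@sigma_finiteT _ _ _ (@lebesgue_measure R)). Qed.

HB.instance Definition _ := Measure_isSigmaFinite.Build _ _ _ leb leb_sigma_finite.

Definition leb2 : set (plane R) -> \bar R := product_measure1 leb leb.

HB.instance Definition _ := Measure.on leb2.

Lemma leb2X (A B : set R) : measurable A -> measurable B ->
  leb2 (A `*` B) = (leb A * leb B)%E.
Proof. by move=> mA mB; rewrite /leb2 product_measure1E. Qed.

Lemma leb_itv (a b : R) (c d : bool) : a <= b ->
  leb [set` Interval (BSide c a) (BSide d b)] = (b - a)%:E.
Proof.
move=> ab; rewrite /leb lebesgue_measure_itv/= lte_fin; case: ifPn => //.
by rewrite -leNgt => ba; rewrite (_ : b = a) ?subrr//; apply/eqP; rewrite eq_le ba.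
Qed.

Definition box (r : R) : set (plane R) := [set x | `|x| <= r].

Lemma measurable_box (r : R) : measurable (box r).
Proof.
have -> : box r = `[- r, r] `*` `[- r, r].
  by apply/seteqP; split => [x|x]; rewrite /box/= le_pair_norm !in_itv/= -!ler_norml;
    [move=> /andP|move=> [-> ->]].
by apply: measurableX; exact: measurable_itv.
Qed.

Lemma leb2_square (c : plane R) (r : R) : 0 <= r ->
  leb2 [set x : plane R | `|x - c| <= r] = ((2 * r) ^+ 2)%:E.
Proof.
move=> r0.
have -> : [set x : plane R | `|x - c| <= r] = `[c.1 - r, c.1 + r] `*` `[c.2 - r, c.2 + r].
  apply/seteqP; split => [x|x]; rewrite /box/= le_pair_norm !in_itv/= !ler_distl.
    by move=> /andP.
  by move=> [-> ->].
have e (d : R) : d - r <= d + r by rewrite lerD2l ge0_cp.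
rewrite leb2X; [|exact: measurable_itv..].
by rewrite !leb_itv// -EFinM; congr EFin; ring.
Qed.

Lemma leb2_box_lty (r : R) : (leb2 (box r) < +oo)%E.
Proof.
have [r0|r0] := leP 0 r.
  by have := leb2_square 0 r0; under eq_set do rewrite subr0; rewrite /box => ->; rewrite ltry.
rewrite (_ : (box r) = set0) ?measure0// -subset0 => x /= xr.
by have := le_lt_trans xr r0; rewrite ltNge normr_ge0.
Qed.

Let leb2_sigma_finite : sigma_finite setT leb2.
Proof.
exists (fun n : nat => box n%:R).
  apply/esym; rewrite -subTset => x _; exists (Num.bound `|x|) => //=.
  by apply/ltW/archi_boundP.
by move=> n; split; [exact: measurable_box|exact: leb2_box_lty].
Qed.

HB.instance Definition _ := Measure_isSigmaFinite.Build _ _ _ leb2 leb2_sigma_finite.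

(** The same measure seen on the product of the structures that carry [lebesgue_measure], where it
    can be compared with [lebesgue2] by uniqueness of product measures. *)
Definition leb2' : set (measurableTypeR R * measurableTypeR R)%type -> \bar R := leb2.

Let leb2'0 : leb2' set0 = 0%E. Proof. exact: measure0. Qed.
Let leb2'_ge0 A : (0 <= leb2' A)%E. Proof. exact: measure_ge0. Qed.
Let leb2'_semi_sigma_additive : semi_sigma_additive leb2'.
Proof. exact: (@measure_semi_sigma_additive _ _ _ leb2). Qed.

HB.instance Definition _ := isMeasure.Build _ _ _ leb2' leb2'0 leb2'_ge0 leb2'_semi_sigma_additive.

Lemma lebesgue2E (A : set (plane R)) : measurable A -> lebesgue2 A = leb2 A.
Proof.
move=> mA; apply: (@product_measure_unique _ _ _ _ _ lebesgue_measure lebesgue_measure leb2') => //.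
by move=> B C mB mC; exact: leb2X.
Qed.

Lemma leb_shift (a : R) (A : set R) : measurable A ->
  leb ((fun x : R => x + a) @^-1` A) = leb A.
Proof.
move=> mA.
have mf : measurable_fun setT ((fun x : R => x + a) : measurableTypeR R -> measurableTypeR R).
  by apply: (@measurable_funD _ R R).
rewrite -[LHS]/(pushforward (@lebesgue_measure R)
  ((fun x : R => x + a) : measurableTypeR R -> measurableTypeR R) A).
apply/esym; apply: lebesgue_measure_unique => // _ [[x y] /= _ <-].
rewrite /pushforward (_ : _ @^-1` _ = `]x - a, y - a]%classic); last first.
  by apply/seteqP; split => z /=; rewrite !in_itv/= ltrBlDr lerBrDr.
rewrite !lebesgue_measure_itv/= !lte_fin ltrD2r; case: ifPn => // _.
by rewrite -!EFinB; congr EFin; ring.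
Qed.

Lemma measurable_shift a : measurable_fun setT (fun x : plane R => x + a).
Proof.
apply: measurable_fun_pair => /=.
  by apply: measurable_funD => //; exact: measurable_fst.
by apply: measurable_funD => //; exact: measurable_snd.
Qed.

Lemma leb2_shift a (A : set (plane R)) : measurable A ->
  leb2 ((fun x => x + a) @^-1` A) = leb2 A.
Proof.
move=> mA; rewrite -[LHS]/(pushforward leb2 (fun x : plane R => x + a) A).
have ms := measurable_shift a.
apply/esym; rewrite {1}/leb2.
apply: (@product_measure_unique _ _ _ _ _ leb leb (pushforward leb2 (fun x : plane R => x + a))) => // B C mB mC.
change (leb2 ((fun x : plane R => x + a) @^-1` (B `*` C)) = (leb B * leb C)%E).
rewrite (_ : _ @^-1` _ =
  ((fun x : R => x + a.1) @^-1` B) `*` ((fun x : R => x + a.2) @^-1` C)); last first.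
  by apply/seteqP; split => z /=.
have mp (c : R) (D : set R) : measurable D -> measurable ((fun x : R => x + c) @^-1` D).
  by move=> mD; rewrite -[X in measurable X]setTI; exact: (measurable_funD).
by rewrite leb2X ?leb_shift//; exact: mp.
Qed.

Lemma integral_leb2_shift a (f : plane R -> \bar R) : measurable_fun setT f ->
  leb2.-integrable setT (fun x => f (x + a)) ->
  (\int[leb2]_x f (x + a)%R = \int[leb2]_x f x)%E.
Proof.
move=> mf If.
have := @integral_pushforward _ _ _ _ _ _ (measurable_shift a) leb2 setT f mf If measurableT.
rewrite preimage_setT => <-; apply: eq_measure_integral => [|ms A mA _].
  exact: measurable_shift.
exact: leb2_shift.
Qed.

(** For planar Lebesgue measure, which is infinite, this class plays the role of [bmeas] for finite
    measures. *)
Definition bsupp (f : plane R -> R) := bmeas f /\ exists r, forall x, r < `|x| -> f x = 0.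

Lemma bsupp_integrable f : bsupp f -> leb2.-integrable setT (EFin \o f).
Proof.
move=> [bf [r hr]].
have mD := measurable_box r.
have [C C0 hC] := bmeas_bound bf.
have : leb2.-integrable (box r) (EFin \o f).
  apply: measurable_bounded_integrable => //; first exact: leb2_box_lty.
    by apply: measurable_funS (bmeas_meas bf).
  exists C; split; first exact: num_real.
  by move=> M CM x _ /=; rewrite (le_trans (hC x))// ltW.
move=> /(integrable_mkcond _ mD); apply: eq_integrable => // x _.
rewrite patchE; case: ifPn => //; rewrite notin_setE/= => /negP; rewrite -ltNge => /hr.
by rewrite /= => ->.
Qed.

Lemma bsuppD f g : bsupp f -> bsupp g -> bsupp (fun x => f x + g x).
Proof.
move=> [bf [r hr]] [bg [s hs]]; split; first exact: bmeasD.
exists (Num.max r s) => x; rewrite gt_max => /andP[rx sx].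
by rewrite hr// hs// addr0.
Qed.

Lemma bsuppMl f g : bmeas f -> bsupp g -> bsupp (fun x => f x * g x).
Proof.
move=> bf [bg [s hs]]; split; first exact: bmeasM.
by exists s => x /hs ->; rewrite mulr0.
Qed.

Lemma bsuppMr f g : bsupp f -> bmeas g -> bsupp (fun x => f x * g x).
Proof.
move=> [bf [s hs]] bg; split; first exact: bmeasM.
by exists s => x /hs ->; rewrite mul0r.
Qed.

Lemma bsuppB f g : bsupp f -> bsupp g -> bsupp (fun x => f x - g x).
Proof.
move=> bf bg; have := bsuppD bf (bsuppMl (bmeas_cst _ (-1)) bg).
by under eq_fun do rewrite mulN1r.
Qed.

Lemma bsupp_norm f : bsupp f -> bsupp (fun x => `|f x|).
Proof.
move=> [bf [r hr]]; split; first exact: bmeas_norm.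
by exists r => x /hr ->; rewrite normr0.
Qed.

Lemma bsupp_shift f a : bsupp f -> bsupp (fun x => f (x + a)).
Proof.
move=> [[mf [C hC]] [r hr]]; split.
  split; last by exists C => x.
  by apply: (measurableT_comp mf); exact: measurable_shift.
exists (r + `|a|) => x; rewrite -ltrBrDr => h; apply: hr.
by rewrite (lt_le_trans h)// -[X in `|X| - _](addrK a) lerBlDr (le_trans (ler_normB _ _)).
Qed.

Lemma sRint_shift f a : bsupp f -> \int[leb2]_x f (x + a) = \int[leb2]_x f x.
Proof.
move=> bf; rewrite /Rintegral; congr fine.
apply: (@integral_leb2_shift a (EFin \o f)).
  by apply/measurable_EFinP; case: bf => [[]].
exact: (bsupp_integrable (bsupp_shift a bf)).
Qed.

End lebesgue_plane.

(** * Mollification and Lipschitz approximation *)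

Section kernels.
Context {R : realType}.
Implicit Types (u v : R -> R) (x y a : plane R).

Lemma is_derive_quadratic_dir {V W : normedModType R} (f : V -> W) (x v : V) (d : W) C :
  (forall h : R, `|f (h *: v + x) - f x - h *: d| <= C * h ^+ 2) -> is_derive x v f d.
Proof.
move=> hf; have [D E] : is_derive (0 : R) (1 : R) (fun h : R => f (h *: v + x)) d.
  by apply: (@is_derive_quadratic _ _ _ _ _ C) => h; rewrite add0r scale0r add0r; exact: hf.
have cv : h^-1 *: (f (h *: v + x) - f x) @[h --> 0^'] --> d.
  rewrite -E; apply: cvg_trans D; apply: near_eq_cvg; apply: nearW => h /=.
  by rewrite addr0 [h *: (1 : R)]mulr1 scale0r add0r.
by split; [apply/cvg_ex; eexists; exact: cv|exact: cvg_lim cv].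
Qed.

Lemma continuous_at_lipschitz {V W : normedModType R} (f : V -> W) (x : V) (K : R) :
  (forall y : V, `|y - x| <= 1 -> `|f y - f x| <= K * `|y - x|) -> {for x, continuous f}.
Proof.
move=> hK; have K0 : 0 < `|K| + 1 by rewrite ltr_pwDr.
apply/cvgrPdist_le => e e0; have e1 : 0 < e / (`|K| + 1) by rewrite divr_gt0.
near=> y; rewrite distrC.
have y1 : `|y - x| <= 1 by rewrite distrC; near: y; apply: (@cvgr_dist_le _ _ _ _ _ idfun x) => //; exact: cvg_id.
rewrite (le_trans (hK _ y1))// (@le_trans _ _ ((`|K| + 1) * `|y - x|))//.
  by rewrite ler_wpM2r// (le_trans (ler_norm _))// lerDl.
rewrite mulrC -ler_pdivlMr// distrC; near: y; apply: (@cvgr_dist_le _ _ _ _ _ idfun x) => //; exact: cvg_id.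
Unshelve. all: by end_near. Qed.

Lemma csl_continuous e u : compact_smooth_line e u -> continuous u.
Proof. by move=> [h _]; exact: (h 0%N). Qed.

Lemma csl_bounded e u : compact_smooth_line e u -> exists2 C, 0 <= C & forall t, `|u t| <= C.
Proof.
move=> cu.
have [C C0 hC] := compact_norm_bound (@segment_compact R (- e) e) (csl_continuous cu).
exists C => // t; have [te|et] := leP `|t| e; last by rewrite cu.2// normr0.
by apply: hC; rewrite /= in_itv/= -ler_norml.
Qed.

Lemma csl_is_derive e u t : compact_smooth_line e u -> is_derive t (1 : R) u (derive1 u t).
Proof. by move=> [h _]; have [d _] := h 1%N; rewrite derive1E; exact/derivableP. Qed.

Lemma csl_lip e u : compact_smooth_line e u ->
  exists2 C, 0 <= C & forall s t, `|u s - u t| <= C * `|s - t|.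
Proof.
move=> cu; have [C C0 hC] := csl_bounded (compact_smooth_line_derive cu).
exists C => // s t; have [c _ ->] := MVT_itv t s (fun z => csl_is_derive z cu).
by rewrite normrM ler_wpM2r.
Qed.

Lemma csl_quadratic e u : compact_smooth_line e u ->
  exists2 C, 0 <= C & forall t h, `|u (t + h) - u t - h * derive1 u t| <= C * h ^+ 2.
Proof.
move=> cu; have [C C0 hC] := csl_lip (compact_smooth_line_derive cu).
exists C => // t h; have [c hc ->] := MVT_itv t (t + h) (fun z => csl_is_derive z cu).
rewrite [t + h]addrC addrK mulrC -mulrBr normrM.
have -> : C * h ^+ 2 = `|h| * (C * `|h|).
  by rewrite -real_normK ?num_real//; ring.
rewrite ler_wpM2l// (le_trans (hC _ _))// ler_wpM2l//.
have /andP[c1 c2] := hc; rewrite ler_distl; move: c1 c2.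
rewrite ge_min le_max => /orP[c1|c1] /orP[c2|c2];
  have := ler_norm h; have := ler_norm (- h); rewrite normrN; lra.
Qed.

(** With product kernels a partial derivative replaces one factor by its derivative, so the
    smoothness of convolutions is an induction over pairs of factors. *)
Definition tensor u v x : R := u x.1 * v x.2.

Lemma tensor_bmeas e u v : compact_smooth_line e u -> compact_smooth_line e v ->
  bmeas (tensor u v).
Proof.
move=> cu cv.
have [C C0 hC] := csl_bounded cu; have [D D0 hD] := csl_bounded cv.
split; last by exists (C * D) => x; rewrite normrM ler_pM.
apply: measurable_funM.
  by apply: measurableT_comp; [exact: continuous_measurable_fun (csl_continuous cu)|exact: measurable_fst].
by apply: measurableT_comp; [exact: continuous_measurable_fun (csl_continuous cv)|exact: measurable_snd].
Qed.

Lemma tensor_supp e u v x : compact_smooth_line e u -> compact_smooth_line e v ->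
  e < `|x| -> tensor u v x = 0.
Proof.
move=> [_ cu] [_ cv]; rewrite pair_normE lt_max /tensor => /orP[/cu->|/cv->].
  by rewrite mul0r.
by rewrite mulr0.
Qed.

Lemma tensor_taylor e u v : compact_smooth_line e u -> compact_smooth_line e v ->
  exists2 C, 0 <= C & forall x a, `|tensor u v (x + a) - tensor u v x -
    (a.1 * tensor (derive1 u) v x + a.2 * tensor u (derive1 v) x)| <= C * `|a| ^+ 2.
Proof.
move=> cu cv.
have [B B0 hB] := csl_bounded cu; have [B' B'0 hB'] := csl_bounded (compact_smooth_line_derive cu).
have [D D0 hD] := csl_bounded cv; have [L L0 hL] := csl_lip cv.
have [Q Q0 hQ] := csl_quadratic cu; have [P P0 hP] := csl_quadratic cv.
exists (Q * D + B * P + B' * L); first by rewrite !addr_ge0// mulr_ge0.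
move=> [s t] [a c]; rewrite /tensor/=.
set r1 := u (s + a) - u s - a * derive1 u s; set r2 := v (t + c) - v t - c * derive1 v t.
have -> : u (s + a) * v (t + c) - u s * v t - (a * (derive1 u s * v t) + c * (u s * derive1 v t))
  = r1 * v (t + c) + u s * r2 + a * (derive1 u s * (v (t + c) - v t)).
  by rewrite /r1 /r2; ring.
have h1 : `|a| <= `|(a, c) : plane R| by exact: (pair_norm1 (a, c)).
have h2 : `|c| <= `|(a, c) : plane R| by exact: (pair_norm2 (a, c)).
set N := `|(a, c)| in h1 h2 *.
have N0 : 0 <= N by exact: normr_ge0.
have sq (z : R) : `|z| <= N -> z ^+ 2 <= N ^+ 2.
  by move=> zN; rewrite -real_normK ?num_real// lerXn2r// nnegrE.
rewrite (le_trans (ler_normD _ _))// (le_trans (lerD (ler_normD _ _) (lexx _)))//.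
rewrite [leRHS]mulrDl; apply: lerD; [rewrite [leRHS]mulrDl; apply: lerD|]; rewrite normrM.
- by rewrite mulrAC ler_pM// (le_trans (hQ _ _))// ler_wpM2l// sq.
- by rewrite -mulrA ler_pM// (le_trans (hP _ _))// ler_wpM2l// sq.
- rewrite [X in _ * X]normrM [leRHS](_ : _ = N * (B' * (L * N))); last by ring.
  rewrite ler_pM ?mulr_ge0// ler_pM// (le_trans (hL _ _))// ler_wpM2l//.
  by rewrite addrAC subrr add0r.
Qed.

Definition conv (f : plane R -> R) u v x : R := \int[leb2]_y (f y * tensor u v (x - y)).

Lemma tensor_refl_bmeas e u v x : compact_smooth_line e u -> compact_smooth_line e v ->
  bmeas (fun y => tensor u v (x - y)).
Proof.
move=> cu cv; have [mt [C hC]] := tensor_bmeas cu cv; split; last by exists C => y.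
apply: (measurableT_comp mt); apply: measurable_fun_pair => /=.
  by apply: measurable_funB => //; exact: measurable_fst.
by apply: measurable_funB => //; exact: measurable_snd.
Qed.

Lemma tensor_refl_bsupp e u v x : compact_smooth_line e u -> compact_smooth_line e v ->
  bsupp (fun y => tensor u v (x - y)).
Proof.
move=> cu cv; split; first exact: tensor_refl_bmeas cu cv.
exists (e + `|x|) => y h; apply: (tensor_supp cu cv).
by rewrite distrC (lt_le_trans _ (lerB_dist _ _))// ltrBrDr.
Qed.

Lemma sRintD (f g : plane R -> R) : bsupp f -> bsupp g ->
  \int[leb2]_x (f x + g x) = \int[leb2]_x f x + \int[leb2]_x g x.
Proof. by move=> bf bg; rewrite RintegralD//; exact: bsupp_integrable. Qed.

Lemma sRintB (f g : plane R -> R) : bsupp f -> bsupp g ->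
  \int[leb2]_x (f x - g x) = \int[leb2]_x f x - \int[leb2]_x g x.
Proof. by move=> bf bg; rewrite RintegralB//; exact: bsupp_integrable. Qed.

Lemma sRintZ c (f : plane R -> R) : bsupp f ->
  \int[leb2]_x (c * f x) = c * \int[leb2]_x f x.
Proof. by move=> bf; rewrite RintegralZl//; exact: bsupp_integrable. Qed.

Lemma sRint_norm_le (f g : plane R -> R) : bsupp f -> bsupp g -> (forall x, `|f x| <= g x) ->
  `|\int[leb2]_x f x| <= \int[leb2]_x g x.
Proof.
move=> bf bg fg; rewrite (le_trans (le_normr_Rintegral _ (bsupp_integrable bf)))//.
by apply: le_Rintegral => //; apply: bsupp_integrable => //; exact: bsupp_norm.
Qed.

Section convolution.
Variables (f : plane R -> R).
Hypothesis bf : bsupp f.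

Lemma conv_integrand e u v x : compact_smooth_line e u -> compact_smooth_line e v ->
  bsupp (fun y => f y * tensor u v (x - y)).
Proof. by move=> cu cv; apply: bsuppMr => //; exact: tensor_refl_bmeas cu cv. Qed.

(** The second-order expansion of the kernel is integrated against f, of which only the integral of
    the absolute value matters. Derivatives and continuity of convolutions are read off from this
    estimate. *)
Lemma conv_taylor e u v : compact_smooth_line e u -> compact_smooth_line e v ->
  exists2 C, 0 <= C & forall x a, `|conv f u v (x + a) - conv f u v x -
    (a.1 * conv f (derive1 u) v x + a.2 * conv f u (derive1 v) x)| <= C * `|a| ^+ 2.
Proof.
move=> cu cv; have [C C0 hC] := tensor_taylor cu cv.
have cu' := compact_smooth_line_derive cu; have cv' := compact_smooth_line_derive cv.
exists (C * \int[leb2]_y `|f y|).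
  by rewrite mulr_ge0//; apply: Rintegral_ge0.
move=> x a; rewrite /conv.
have b1 x' := conv_integrand x' cu cv.
have b2 := conv_integrand x cu' cv; have b3 := conv_integrand x cu cv'.
have z1 := bsuppMl (bmeas_cst _ a.1) b2; have z2 := bsuppMl (bmeas_cst _ a.2) b3.
have K2 := bsuppB (bsuppB (b1 (x + a)) (b1 x)) (bsuppD z1 z2).
rewrite -(sRintZ a.1 b2) -(sRintZ a.2 b3) -(sRintD z1 z2) -(sRintB (b1 (x + a)) (b1 x)).
rewrite -(sRintB (bsuppB (b1 (x + a)) (b1 x)) (bsuppD z1 z2)).
rewrite mulrAC -sRintZ; last exact: bsupp_norm.
apply: sRint_norm_le => //; first exact/bsuppMl/bsupp_norm/bf/bmeas_cst.
move=> y; rewrite [X in `|X|](_ : _ = f y * (tensor u v (x - y + a) - tensor u v (x - y) -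
   (a.1 * tensor (derive1 u) v (x - y) + a.2 * tensor u (derive1 v) (x - y)))).
  by rewrite normrM mulrC ler_wpM2r.
rewrite (_ : x + a - y = x - y + a) 1?addrAC//.
by move: (tensor _ _ _) (tensor _ _ _) (tensor _ _ _) (tensor _ _ _) => A B D D'; ring.
Qed.

Lemma conv_is_derive1 e u v x : compact_smooth_line e u -> compact_smooth_line e v ->
  is_derive x ((1, 0) : plane R) (conv f u v) (conv f (derive1 u) v x).
Proof.
move=> cu cv; have [C C0 hC] := conv_taylor cu cv.
apply: (is_derive_quadratic_dir (C := C)) => h.
have := hC x (h *: ((1, 0) : plane R)).
rewrite normrZ exprMn real_normK ?num_real// [x + _]addrC /= [h *: (1 : R)]mulr1 scaler0 mul0r addr0.
move=> /le_trans; apply; rewrite ler_wpM2l// ler_piMr ?sqr_ge0// exprn_ile1//.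
by rewrite le_pair_norm/= normr1 normr0 lexx ler01.
Qed.

Lemma conv_is_derive2 e u v x : compact_smooth_line e u -> compact_smooth_line e v ->
  is_derive x ((0, 1) : plane R) (conv f u v) (conv f u (derive1 v) x).
Proof.
move=> cu cv; have [C C0 hC] := conv_taylor cu cv.
apply: (is_derive_quadratic_dir (C := C)) => h.
have := hC x (h *: ((0, 1) : plane R)).
rewrite normrZ exprMn real_normK ?num_real// [x + _]addrC /= [h *: (1 : R)]mulr1 scaler0 mul0r add0r.
move=> /le_trans; apply; rewrite ler_wpM2l// ler_piMr ?sqr_ge0// exprn_ile1//.
by rewrite le_pair_norm/= normr1 normr0 lexx ler01.
Qed.

Lemma conv_bounded e u v : compact_smooth_line e u -> compact_smooth_line e v ->
  exists2 C, 0 <= C & forall x, `|conv f u v x| <= C.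
Proof.
move=> cu cv; have [C C0 hC] := bmeas_bound (tensor_bmeas cu cv).
exists (C * \int[leb2]_y `|f y|).
  by rewrite mulr_ge0//; apply: Rintegral_ge0.
move=> x; rewrite -sRintZ; last exact: bsupp_norm.
apply: sRint_norm_le; [exact: conv_integrand cu cv|exact/bsuppMl/bsupp_norm/bf/bmeas_cst|].
by move=> y; rewrite normrM mulrC ler_wpM2r.
Qed.

Lemma conv_continuous e u v : compact_smooth_line e u -> compact_smooth_line e v ->
  continuous (conv f u v).
Proof.
move=> cu cv x; have [C C0 hC] := conv_taylor cu cv.
have [A A0 hA] := conv_bounded (compact_smooth_line_derive cu) cv.
have [B B0 hB] := conv_bounded cu (compact_smooth_line_derive cv).
suff : exists K, forall y, `|y - x| <= 1 -> `|conv f u v y - conv f u v x| <= K * `|y - x|.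
  by move=> [K hK]; exact: continuous_at_lipschitz hK.
exists (C + A + B) => y y1.
have := hC x (y - x); rewrite [x + _]addrC subrK; set a := y - x in y1 *.
set z := a.1 * _ + _; set w := conv f u v y - _ => h.
have hz : `|z| <= (A + B) * `|a|.
  rewrite /z (le_trans (ler_normD _ _))// !normrM mulrDl lerD// mulrC ler_pM//.
    exact: pair_norm1.
  exact: pair_norm2.
have h' : `|w - z| <= C * `|a|.
  by rewrite (le_trans h)// ler_wpM2l// expr2 ler_piMl.
have -> : w = (w - z) + z by rewrite subrK.
by rewrite (le_trans (ler_normD _ _))// (le_trans (lerD h' hz))// -mulrDl addrA.
Qed.

Lemma conv_smooth e u v : compact_smooth_line e u -> compact_smooth_line e v ->
  smooth (conv f u v).
Proof.
move=> cu cv n; elim: n u v cu cv => [|n ih] u v cu cv; first exact: conv_continuous cu cv.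
have cu' := compact_smooth_line_derive cu; have cv' := compact_smooth_line_derive cv.
split.
- exact: conv_continuous cu cv.
- by move=> x; have [] := conv_is_derive1 x cu cv.
- by move=> x; have [] := conv_is_derive2 x cu cv.
- rewrite (_ : d1 _ = conv f (derive1 u) v); first exact: ih.
  by apply/funext => x; have [_] := conv_is_derive1 x cu cv.
- rewrite (_ : d2 _ = conv f u (derive1 v)); first exact: ih.
  by apply/funext => x; have [_] := conv_is_derive2 x cu cv.
Qed.

End convolution.

Definition mollifier (e : R) u v := [/\ compact_smooth_line e u, compact_smooth_line e v,
  (forall x, 0 <= tensor u v x) & forall x, \int[leb2]_y tensor u v (x - y) = 1].

Lemma mollifier_exists e : 0 < e -> exists u v, mollifier e u v.
Proof.
move=> e0; have cb := compact_smooth_bump e.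
pose c := \int[leb2]_y tensor (smooth_bump e) (smooth_bump e) (0 - y).
have cE x : \int[leb2]_y tensor (smooth_bump e) (smooth_bump e) (x - y) = c.
  have := sRint_shift (- x) (tensor_refl_bsupp 0 cb cb); rewrite -/c => <-.
  by apply: eq_Rintegral => y _; congr tensor; rewrite sub0r opprD opprK addrC.
have t0 x : 0 <= tensor (smooth_bump e) (smooth_bump e) x by rewrite mulr_ge0// smooth_bump_ge0.
have e2 : 0 < e / 2 by rewrite divr_gt0.
have c0 : 0 < c.
  (* On the box of radius e / 2 the numbers e + s and e - s are at least e / 2 in each coordinate,
     so the kernel, a product of four values of [flat 1], is at least k there. *)
  pose k : R := flat 1 (e / 2) ^+ 4.
  have f0 : 0 < flat 1 (e / 2) :> R.
    by rewrite /flat e2 hornerC mul1r expR_gt0.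
  have k0 : 0 < k by rewrite exprn_gt0.
  have fm (s : R) : e / 2 <= s -> flat 1 (e / 2) <= flat 1 s.
    move=> es; have s0 := lt_le_trans e2 es.
    by rewrite /flat e2 s0 !hornerC !mul1r ler_expR lerN2 lef_pV2.
  have fb (s : R) : `|s| <= e / 2 -> flat 1 (e / 2) ^+ 2 <= smooth_bump e s.
    by rewrite ler_norml expr2 => /andP[h1 h2]; apply: ler_pM; rewrite ?(ltW f0)//; apply: fm; lra.
  have bI1 : bsupp (\1_(box (e / 2)) : plane R -> R).
    split; first by apply: bmeas_indic; exact: measurable_box.
    exists (e / 2) => y h; rewrite indicE memNset//=.
    by rewrite /box/= => h'; move: h; rewrite ltNge h'.
  have bI : bsupp (fun y : plane R => k * \1_(box (e / 2)) y).
    by apply: bsuppMl => //; exact: bmeas_cst.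
  have I0 : 0 < \int[leb2]_y (k * \1_(box (e / 2)) y).
    rewrite sRintZ// mulr_gt0// /Rintegral integral_indic//; last exact: measurable_box.
    rewrite setIT [X in fine X](_ : _ = ((2 * (e / 2)) ^+ 2)%:E).
      by rewrite /= exprn_gt0// mulr_gt0.
    rewrite -(leb2_square 0 (ltW e2)); congr (leb2 _).
    by apply/seteqP; split => x /=; rewrite /box/= subr0.
  rewrite (lt_le_trans I0)// /c.
  apply: le_Rintegral => //; [exact: bsupp_integrable|exact: (bsupp_integrable (tensor_refl_bsupp 0 cb cb))|].
  move=> y _; rewrite indicE; case: (boolP (y \in _)) => [|_]; last by rewrite mulr0 t0.
  rewrite inE /box/= mulr1 le_pair_norm => /andP[y1 y2].
  rewrite /tensor /k -[4%N]/(2 + 2)%N exprD.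
  by rewrite ler_pM ?exprn_ge0 ?(ltW f0)// fb//= sub0r normrN.
(* Dividing one of the two factors by c normalises the product kernel. *)
have cc : compact_smooth_line e (fun t => c^-1 * smooth_bump e t).
  split; last by move=> t /cb.2 ->; rewrite mulr0.
  move=> n; apply: (@Cn_lineM R n (cst c^-1)); last exact: cb.1.
  exact: Cn_line_cst.
exists (smooth_bump e), (fun t => c^-1 * smooth_bump e t); split => //.
- by move=> x; rewrite /tensor mulrCA; apply: mulr_ge0; [rewrite invr_ge0 ltW|exact: t0].
- move=> x; under eq_Rintegral => y _.
    rewrite /tensor mulrCA; over.
  by rewrite sRintZ ?cE ?mulVf ?gt_eqF//; exact: (tensor_refl_bsupp x cb cb).
Qed.

Section mollification.
Variables (f : plane R -> R) (e : R) (u v : R -> R).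
Hypotheses (bf : bsupp f) (mol : mollifier e u v).

Let cu : compact_smooth_line e u. Proof. by case: mol. Qed.
Let cv : compact_smooth_line e v. Proof. by case: mol. Qed.
Let t0 x : 0 <= tensor u v x. Proof. by case: mol. Qed.
Let t1 x : \int[leb2]_y tensor u v (x - y) = 1. Proof. by case: mol. Qed.

Lemma conv_near x (a eta : R) : (forall y, `|x - y| <= e -> `|f y - a| <= eta) ->
  `|conv f u v x - a| <= eta.
Proof.
move=> h; have bt := tensor_refl_bsupp x cu cv.
have -> : conv f u v x - a = \int[leb2]_y ((f y - a) * tensor u v (x - y)).
  under eq_Rintegral do rewrite mulrBl.
  rewrite sRintB; [|exact: conv_integrand cu cv|by apply: bsuppMl => //; exact: bmeas_cst].
  by rewrite sRintZ// t1 mulr1.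
rewrite -[leRHS]mulr1 -(t1 x) -sRintZ//; apply: sRint_norm_le.
- by apply: bsuppMl => //; apply: bmeasB; [case: bf|exact: bmeas_cst].
- by apply: bsuppMl => //; exact: bmeas_cst.
move=> y; rewrite normrM (ger0_norm (t0 _)).
have [xy|xy] := leP `|x - y| e; first by rewrite ler_wpM2r// h.
by rewrite (tensor_supp cu cv xy) !mulr0.
Qed.

Lemma conv_eq0 x : (forall y, `|x - y| <= e -> f y = 0) -> conv f u v x = 0.
Proof.
move=> h; apply/eqP; rewrite -normr_le0 -[X in `|X|]subr0; apply: conv_near => y xy.
by rewrite h// subr0 normr0.
Qed.

Lemma conv_bsupp_out r x : (forall y, r < `|y| -> f y = 0) -> r + e < `|x| -> conv f u v x = 0.
Proof.
move=> f0 rx; apply: conv_eq0 => y xy; apply: f0.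
rewrite -(ltrD2r e) (lt_le_trans rx)// -lerBlDl (le_trans (lerB_dist _ _))//.
Qed.

Lemma conv_test_function : test_function (conv f u v).
Proof.
split; first exact: conv_smooth cu cv.
have [_ [r hr]] := bf; exists (box (r + e)); first exact: compact_box.
move=> x /negP; rewrite /box/= -ltNge => h; exact: (conv_bsupp_out hr).
Qed.

Lemma conv_directional x d (c0 eta Lf : R) : 0 <= eta ->
  (forall y z, `|f y - f z| <= Lf * `|y - z|) ->
  (forall y, `|x - y| <= e -> forall eps, 0 < eps -> exists N : nat, forall n, (N <= n)%N ->
     `|n.+1%:R * (f (y + n.+1%:R^-1 *: d) - f y) - c0| <= eta + eps) ->
  `|d.1 * d1 (conv f u v) x + d.2 * d2 (conv f u v) x - c0| <= eta.
Proof.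
move=> eta0 fL hq.
have -> : d1 (conv f u v) x = conv f (derive1 u) v x by have [_] := conv_is_derive1 bf x cu cv.
have -> : d2 (conv f u v) x = conv f u (derive1 v) x by have [_] := conv_is_derive2 bf x cu cv.
set D := d.1 * _ + d.2 * _.
have bt := tensor_refl_bsupp x cu cv.
pose q (n : nat) y := n.+1%:R * (f (y + n.+1%:R^-1 *: d) - f y).
have bq n : bmeas (q n).
  by apply: bmeasZ; apply: bmeasB; [case: (bsupp_shift (n.+1%:R^-1 *: d) bf)|case: bf].
have qb n y : `|q n y| <= Lf * `|d|.
  rewrite /q normrM ger0_norm// -ler_pdivlMl// (le_trans (fL _ _))//.
  by rewrite addrAC subrr add0r normrZ ger0_norm ?invr_ge0// mulrCA.
(* The excess of the error over eta. It tends to 0 pointwise where the kernel lives, and its average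
   [G n] tends to 0 by dominated convergence. *)
pose g n y := Num.max (`|q n y - c0| - eta) 0.
have bg n : bmeas (g n).
  split.
    apply: measurable_maxr => //; apply: measurable_funB => //; apply: measurableT_comp => //.
    by apply: measurable_funB => //; case: (bq n).
  exists (Lf * `|d| + `|c0|) => y; rewrite ger0_norm ?le_max ?lexx ?orbT// ge_max.
  rewrite addr_ge0 ?(le_trans (normr_ge0 _) (qb 0%N 0))// andbT.
  by rewrite lerBlDr ler_wpDr// (le_trans (ler_normB _ _))// lerD.
have g0 n y : 0 <= g n y by rewrite le_max lexx orbT.
pose G n := \int[leb2]_y (g n y * tensor u v (x - y)).
have Gcvg : G n @[n --> \oo] --> 0.
  have gt n : bsupp (fun y => g n y * tensor u v (x - y)) by apply: bsuppMl.
  have gb n y : `|g n y * tensor u v (x - y)| <= (Lf * `|d| + `|c0|) * tensor u v (x - y).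
    rewrite normrM (ger0_norm (t0 _)) ler_wpM2r// ger0_norm// /g ge_max.
    rewrite addr_ge0 ?(le_trans (normr_ge0 _) (qb 0%N 0))// andbT.
    by rewrite lerBlDr ler_wpDr// (le_trans (ler_normB _ _))// lerD.
  have [|||||_ _ h] := @dominated_convergence _ _ _ leb2 setT measurableT
    (fun n y => (g n y * tensor u v (x - y))%:E) (cst 0)
    (fun y => ((Lf * `|d| + `|c0|) * tensor u v (x - y))%:E).
  - by move=> n; apply/measurable_EFinP; case: (gt n) => [[]].
  - exact: measurable_cst.
  - apply: aeW => y _; apply: cvg_EFin; first exact: nearW.
    have [xy|xy] := leP `|x - y| e; last first.
      under eq_fun do rewrite (tensor_supp cu cv xy) mulr0.
      exact: cvg_cst.
    rewrite -[X in _ --> X](mul0r (tensor u v (x - y))); apply: cvgMr_tmp.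
    apply/cvgrPdist_le => eps eps0; have [N hN] := hq y xy eps eps0.
    exists N => // n Nn; rewrite sub0r normrN ger0_norm// /g ge_max (ltW eps0) andbT.
    by rewrite lerBlDl; exact: hN.
  - by apply: (bsupp_integrable (bsuppMl (bmeas_cst _ _) bt)).
  - by apply: aeW => y n _; rewrite /= lee_fin.
  move: h; rewrite integral0 => /fine_cvgP[_]; apply: cvg_trans.
  by apply: near_eq_cvg; apply: nearW.
have [C C0 hC] := conv_taylor bf cu cv.
have key n : `|D - c0| <= C * `|d| ^+ 2 / n.+1%:R + (eta + G n).
  have n0 : 0 < n.+1%:R :> R by [].
  (* Translation invariance moves the difference quotient from the kernel to f. *)
  have E : n.+1%:R * (conv f u v (x + n.+1%:R^-1 *: d) - conv f u v x) =
     \int[leb2]_y (q n y * tensor u v (x - y)).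
    have i1 := conv_integrand bf (x + n.+1%:R^-1 *: d) cu cv.
    have i2 := bsupp_shift (n.+1%:R^-1 *: d) i1.
    have i3 := conv_integrand bf x cu cv.
    rewrite /conv -(sRint_shift (n.+1%:R^-1 *: d) i1) -(sRintB i2 i3) -sRintZ; last exact: bsuppB.
    apply: eq_Rintegral => y _; rewrite /q -mulrA mulrBl; congr (_ * (_ * tensor _ _ _ - _)).
    by rewrite opprD addrACA subrr addr0.
  have h1 : `|D - \int[leb2]_y (q n y * tensor u v (x - y))| <= C * `|d| ^+ 2 / n.+1%:R.
    rewrite -E distrC; have := hC x (n.+1%:R^-1 *: d).
    rewrite normrZ ger0_norm ?invr_ge0//= => h.
    have -> : n.+1%:R * (conv f u v (x + n.+1%:R^-1 *: d) - conv f u v x) - D =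
      n.+1%:R * (conv f u v (x + n.+1%:R^-1 *: d) - conv f u v x -
       (n.+1%:R^-1 *: d.1 * conv f (derive1 u) v x + n.+1%:R^-1 *: d.2 * conv f u (derive1 v) x)).
      by rewrite /D /GRing.scale/=; field.
    rewrite normrM ger0_norm// -ler_pdivlMl// (le_trans h)//.
    by rewrite le_eqVlt; apply/orP; left; apply/eqP; field.
  have h2 : `|\int[leb2]_y (q n y * tensor u v (x - y)) - c0| <= eta + G n.
    have -> : c0 = \int[leb2]_y (c0 * tensor u v (x - y)) by rewrite sRintZ// t1 mulr1.
    have -> : eta = \int[leb2]_y (eta * tensor u v (x - y)) by rewrite sRintZ// t1 mulr1.
    have b0 c : bsupp (fun y => c * tensor u v (x - y)) by apply: bsuppMl => //; exact: bmeas_cst.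
    have bg' := bsuppMl (bg n) bt; have bq' := bsuppMl (bq n) bt.
    rewrite /G -sRintD// -sRintB//; apply: sRint_norm_le; [exact: bsuppB|exact: bsuppD|].
    move=> y; rewrite -mulrBl -mulrDl normrM (ger0_norm (t0 _)) ler_wpM2r//.
    by rewrite -lerBlDl le_max lexx.
  by rewrite (le_trans (ler_distD _ _ _) (lerD h1 h2)).
have lim : C * `|d| ^+ 2 / n.+1%:R + (eta + G n) @[n --> \oo] --> C * `|d| ^+ 2 * 0 + (eta + 0).
  apply: cvgD; last by apply: cvgD => //; exact: cvg_cst.
  by apply: cvgM; [exact: cvg_cst|exact: cvg_harmonic].
rewrite mulr0 add0r addr0 in lim.
by apply: (cvgr_to_ge lim); apply: nearW.
Qed.

End mollification.

End kernels.

Section distance.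
Context {R : realType} {V : normedModType R}.
Implicit Types (C : set V) (x y : V).

Definition setdist C x : R := inf [set `|x - y| | y in C].

Let has_lb C x : has_lbound [set `|x - y| | y in C].
Proof. by exists 0 => _ [y _ <-]. Qed.

Lemma setdist_le C x y : C y -> setdist C x <= `|x - y|.
Proof. by move=> Cy; apply: (ge_inf (has_lb C x)); exists y. Qed.

Lemma setdist_ge0 C x : C !=set0 -> 0 <= setdist C x.
Proof. by move=> [y Cy]; apply: lb_le_inf; [exists `|x - y|, y|move=> _ [z _ <-]]. Qed.

Lemma setdist_lip C x y : C !=set0 -> `|setdist C x - setdist C y| <= `|x - y|.
Proof.
move=> C0.
have key z w : setdist C z <= `|z - w| + setdist C w.
  rewrite -lerBlDl; apply: lb_le_inf.
    by have [c Cc] := C0; exists `|w - c|, c.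
  move=> _ [c Cc <-]; rewrite lerBlDl (le_trans (setdist_le _ Cc))//.
  exact: ler_distD.
rewrite ler_distl; apply/andP; split; last by have := key x y; rewrite addrC.
by have := key y x; rewrite distrC lerBlDl.
Qed.

Lemma setdist_gt0 (O : set V) x : open O -> ~` O !=set0 -> O x -> 0 < setdist (~` O) x.
Proof.
move=> oO [c Oc] Ox; have /nbhs_ballP[e /= e0 eO] : nbhs x O by exact: open_nbhs_nbhs.
apply: (lt_le_trans e0); apply: lb_le_inf; first by exists `|x - c|, c.
move=> _ [y Oy <-]; rewrite leNgt; apply/negP => xy; apply/Oy/eO.
by rewrite -ball_normE/=.
Qed.

End distance.

Section lipschitz_approximation.
Context {R : realType}.
Implicit Types (x y : plane R) (A B O : set (plane R)) (f g : plane R -> R).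

Definition unit_lip f := (forall x, 0 <= f x <= 1) /\
  exists2 L, 0 <= L & forall x y, `|f x - f y| <= L * `|x - y|.

Lemma lip_continuous f L : (forall x y, `|f x - f y| <= L * `|x - y|) -> continuous f.
Proof. by move=> fL x; apply: (@continuous_at_lipschitz _ _ _ _ _ L) => y _. Qed.

Lemma unit_lip_bmeas f : unit_lip f -> bmeas f.
Proof.
move=> [f01 [L L0 fL]]; split; first by apply: continuous_measurable_plane; exact: (lip_continuous fL).
by exists 1 => x; have /andP[h1 h2] := f01 x; rewrite ger0_norm.
Qed.

Definition clamp (a : R) : R := Num.max 0 (Num.min a 1).

Lemma clamp01 a : 0 <= clamp a <= 1.
Proof. by rewrite /clamp le_max lexx/= ge_max ler01 ge_min lexx orbT. Qed.

Lemma clamp_lip a b : `|clamp a - clamp b| <= `|a - b|.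
Proof.
have E c : clamp c = clip (1 / 2) (c - 1 / 2) + 1 / 2.
  rewrite /clamp /clip /Num.max /Num.min.
  by case: ifPn; rewrite -?leNgt; case: ifPn; rewrite -?leNgt; case: ifPn;
     rewrite -?leNgt; case: ifPn; rewrite -?leNgt; lra.
rewrite !E opprD addrACA subrr addr0 (le_trans (clip_lip _ _ _))//.
by rewrite opprB addrA subrK.
Qed.

Lemma clamp_ge1 a : 1 <= a -> clamp a = 1.
Proof. by move=> a1; rewrite /clamp (min_idPr a1) (max_idPr ler01). Qed.

Lemma clamp_le0 a : a <= 0 -> clamp a = 0.
Proof.
by move=> a0; rewrite /clamp; apply/max_idPl; rewrite ge_min a0.
Qed.

Lemma unit_lip_clamp (h : plane R -> R) L : 0 <= L -> (forall x y, `|h x - h y| <= L * `|x - y|) ->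
  unit_lip (fun x => clamp (h x)).
Proof.
move=> L0 hL; split; first by move=> x; exact: clamp01.
by exists L => // x y; rewrite (le_trans (clamp_lip _ _)).
Qed.

Lemma unit_lipM f g : unit_lip f -> unit_lip g -> unit_lip (fun x => f x * g x).
Proof.
move=> [f01 [L L0 fL]] [g01 [K K0 gK]]; split.
  move=> x; have /andP[a b] := f01 x; have /andP[c d] := g01 x.
  by rewrite mulr_ge0//= mulr_ile1.
exists (L + K); first exact: addr_ge0.
move=> x y; have -> : f x * g x - f y * g y = (f x - f y) * g x + f y * (g x - g y) by ring.
have one (h : plane R -> R) z : (forall x, 0 <= h x <= 1) -> `|h z| <= 1.
  by move=> /(_ z)/andP[h0 h1]; rewrite ger0_norm.
rewrite (le_trans (ler_normD _ _))// [leRHS]mulrDl; apply: lerD; rewrite normrM.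
  by rewrite -[leRHS]mulr1 ler_pM// one.
by rewrite -[leRHS]mul1r ler_pM// one.
Qed.

Lemma sigma_open : @measurable _ (plane R) = <<s [set O : set (plane R) | open O] >>.
Proof.
apply/seteqP; split; last first.
  apply: smallest_sub; first exact: sigma_algebra_measurable.
  by move=> O; exact: open_measurable_plane.
pose T := g_sigma_algebraType [set O : set (plane R) | open O].
have m1 : measurable_fun [set: T] (fst : T -> R).
  apply: (measurability _ (RGenOpens.measurableE R)).
  move=> _ [_ [a [b ->] <-]]; rewrite setTI; apply: sub_sigma_algebra.
  by apply: open_comp; [move=> x _; exact: cvg_fst|exact: interval_open].
have m2 : measurable_fun [set: T] (snd : T -> R).
  apply: (measurability _ (RGenOpens.measurableE R)).
  move=> _ [_ [a [b ->] <-]]; rewrite setTI; apply: sub_sigma_algebra.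
  by apply: open_comp; [move=> x _; exact: cvg_snd|exact: interval_open].
have m : measurable_fun [set: T] (fun x : T => (x.1, x.2) : plane R) by exact: measurable_fun_pair.
move=> A mA; have := m measurableT A mA; rewrite setTI.
by rewrite (_ : _ @^-1` A = A)//; apply/seteqP; split => -[].
Qed.

Variable m : {finite_measure set (plane R) -> \bar R}.

Let approx B := forall eps, 0 < eps -> exists2 f, unit_lip f & \int[m]_x `|f x - \1_B x| <= eps.

(** The shift by 1 makes the function vanish at every point within distance 1 / k of the complement,
    which leaves room for mollification inside O. *)
Definition open_cutoff O (k : nat) x := clamp (k%:R * setdist (~` O) x - 1).

Lemma open_cutoff_lip O k : ~` O !=set0 -> unit_lip (open_cutoff O k).
Proof.
move=> O0; apply: (@unit_lip_clamp _ k%:R) => // x y.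
rewrite opprB addrA subrK -mulrBr normrM ger0_norm// ler_wpM2l//.
exact: setdist_lip.
Qed.

Lemma open_cutoff_cvg O x : open O -> ~` O !=set0 -> open_cutoff O k x @[k --> \oo] --> (\1_O x : R).
Proof.
move=> oO O0; rewrite indicE; case: (boolP (x \in O)) => [|xO].
  rewrite inE => Ox; have d0 := setdist_gt0 oO O0 Ox.
  apply: cvg_near_cst; exists (Num.bound (2 / setdist (~` O) x)) => // k /= Nk.
  rewrite /open_cutoff clamp_ge1// lerBrDr -(natrD _ 1 1) -ler_pdivrMr//.
  rewrite (le_trans (ltW (archi_boundP _)))//; first by rewrite divr_ge0// ltW.
  by rewrite ler_nat.
apply: cvg_near_cst; apply: nearW => k; rewrite /open_cutoff clamp_le0//.
move: xO; rewrite notin_setE => Ox.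
have := @setdist_le _ _ (~` O) x x Ox; rewrite subrr normr0 => h.
have -> : setdist (~` O) x = 0 by apply/eqP; rewrite eq_le h setdist_ge0.
by rewrite mulr0 sub0r lerN10.
Qed.

Lemma open_cutoff_Rint O B : open O -> ~` O !=set0 -> measurable B -> B `<=` O ->
  \int[m]_x `|open_cutoff O k x * \1_B x - \1_B x| @[k --> \oo] --> 0.
Proof.
move=> oO O0 mB BO; rewrite -(bRint0 m).
have bk k : bmeas (fun x => open_cutoff O k x * \1_B x - \1_B x).
  have bB := bmeas_indic R mB.
  apply: bmeasB => //; apply: bmeasM => //; exact/unit_lip_bmeas/open_cutoff_lip.
apply: (@bRint_cvg _ _ _ m _ _ 1).
- by move=> k; case: (bmeas_norm (bk k)).
- exact: measurable_cst.
- move=> k x; rewrite normr_id -{2}[\1_B x]mul1r -mulrBl normrM.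
  have /andP[h1 h2] := (open_cutoff_lip k O0).1 x.
  rewrite mulr_ile1//; first by rewrite ler_norml; apply/andP; split; lra.
  by rewrite indicE; case: (_ \in _); rewrite ?normr1 ?normr0.
- move=> x; have h : open_cutoff O k x * \1_B x - \1_B x @[k --> \oo] --> (\1_O x * \1_B x - \1_B x : R).
    apply: cvgB; last exact: cvg_cst.
    by apply: cvgMr_tmp; exact: open_cutoff_cvg.
  have Z : \1_O x * \1_B x - \1_B x = 0 :> R; last first.
    by have := cvg_norm h; rewrite Z normr0; exact.
  rewrite !indicE; case: (boolP (x \in B)) => xB; last by rewrite /= mulr0 subrr.
  by rewrite mem_set ?mulr1 ?subrr//; apply: BO; rewrite inE in xB.
Qed.

Lemma approx_open O : open O -> approx O.
Proof.
move=> oO eps eps0; have [OT|O0] := eqVneq (~` O) set0.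
  exists (fun=> 1); first by split; [move=> x; rewrite ler01 lexx|exists 0 => // x y; rewrite subrr normr0 mul0r].
  rewrite (_ : O = setT); last by rewrite -(setCK O) OT setC0.
  under eq_Rintegral do rewrite indicE in_setT subrr normr0.
  by rewrite bRint0 ltW.
move/set0P: O0 => O0.
have mO := open_measurable_plane oO.
have /cvgrPdist_le/(_ _ eps0)[N _ /(_ N (leqnn _))] := open_cutoff_Rint oO O0 mO (@subset_refl _ O).
rewrite sub0r normrN => h; exists (open_cutoff O N); first exact: open_cutoff_lip.
rewrite (le_trans _ (le_trans (ler_norm _) h))// le_eqVlt; apply/orP; left; apply/eqP.
apply: eq_Rintegral => x _; congr (`|_ - _|).
rewrite indicE; case: (boolP (x \in O)) => [|xO]; first by rewrite mulr1.
rewrite mulr0 /open_cutoff clamp_le0//; move: xO; rewrite notin_setE => Ox.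
have := @setdist_le _ _ (~` O) x x Ox; rewrite subrr normr0 => h'.
have -> : setdist (~` O) x = 0 by apply/eqP; rewrite eq_le h' setdist_ge0.
by rewrite mulr0 sub0r lerN10.
Qed.

Lemma approx_setC B : measurable B -> approx B -> approx (~` B).
Proof.
move=> mB aB eps eps0; have [f [f01 [L L0 fL]] h] := aB eps eps0.
exists (fun x => 1 - f x).
  split; first by move=> x; have /andP[] := f01 x; move=> h0 h1; rewrite subr_ge0 h1 lerBlDr lerDl.
  by exists L => // x y; rewrite (_ : _ - _ = - (f x - f y)) ?normrN//; ring.
rewrite (le_trans _ h)// le_eqVlt; apply/orP; left; apply/eqP.
apply: eq_Rintegral => x _; rewrite !indicE in_setC.
by case: (x \in B) => /=; [rewrite subr0 distrC|rewrite subr0 addrAC subrr add0r normrN].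
Qed.

(** Half of eps is spent on keeping finitely many of the sets, the other half is shared among their
    approximations. The sum of these may exceed 1; clamping it does not increase its distance to the
    indicator of the finite union. *)
Lemma approx_bigcup (F : (set (plane R))^nat) : (forall n, measurable (F n)) ->
  trivIset setT F -> (forall n, approx (F n)) -> approx (\bigcup_n F n).
Proof.
move=> mF tF aF eps eps0; have e2 : 0 < eps / 2 by rewrite divr_gt0.
pose B := \bigcup_n F n; have mB : measurable B by exact: bigcup_measurable.
pose S N x : R := \sum_(i < N) \1_(F i) x.
have SE N x : S N x = \1_(\bigcup_(i in `I_N) F i) x.
  rewrite /S indicE; case: (boolP (x \in _)) => [|].
    rewrite inE => -[i /= iN Fx]; rewrite (bigD1 (Ordinal iN))//= indicE mem_set// big1 ?addr0//.
    move=> k ki; rewrite indicE memNset// => Fkx; move/eqP: ki; apply; apply: val_inj => /=.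
    by apply: (tF _ _ I I); exists x.
  rewrite notin_setE => Nx; rewrite big1// => i _; rewrite indicE memNset// => Fx.
  by apply: Nx; exists i => /=.
have bS N : bmeas (S N) by apply: bmeas_sum => i; exact: bmeas_indic.
have S01 N x : 0 <= S N x <= 1 by rewrite SE indicE; case: (_ \in _); rewrite /= ?lexx ler01.
have cS x : S N x @[N --> \oo] --> (\1_B x : R).
  apply: cvg_near_cst; case: (pselect (B x)) => [[n _ Fx]|Bx].
    exists n.+1 => // N /= nN; rewrite SE !indicE !mem_set//; first by exists n.
    by exists n.
  by apply: nearW => N; rewrite SE !indicE !memNset// => -[n _ Fx]; apply: Bx; exists n.
have : \int[m]_x `|S N x - \1_B x| @[N --> \oo] --> 0.
  rewrite -(bRint0 m); apply: (@bRint_cvg _ _ _ m _ _ 1).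
  - by move=> N; apply: bmeas_meas; apply: bmeas_norm; apply: bmeasB => //; exact: bmeas_indic.
  - exact: measurable_cst.
  - move=> N x; rewrite normr_id; have /andP[s0 s1] := S01 N x.
    by rewrite ler_norml indicE; case: (_ \in _) => /=; apply/andP; split; lra.
  - move=> x; have := cvg_norm (cvgB (cS x) (@cvg_cst _ (\1_B x : R) _ _ _)).
    by rewrite subrr normr0; exact.
move=> /cvgrPdist_le/(_ _ e2)[N _ /(_ N (leqnn _))]; rewrite sub0r normrN => hN.
have ed : 0 < eps / 2 / N.+1%:R by rewrite divr_gt0.
have /choice[f hf] : forall i, exists f, unit_lip f /\ \int[m]_x `|f x - \1_(F i) x| <= eps / 2 / N.+1%:R.
  by move=> i; have [f fl h] := aF i _ ed; exists f.
pose h x := \sum_(i < N) f i x.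
have [L L0 hL] : exists2 L, 0 <= L & forall x y, `|h x - h y| <= L * `|x - y|.
  have /choice[l hl] : forall i, exists l, 0 <= l /\ forall x y, `|f i x - f i y| <= l * `|x - y|.
    by move=> i; have [[_ [l l0 lP]] _] := hf i; exists l.
  exists (\sum_(i < N) l i); first by apply: sumr_ge0 => i _; have [] := hl i.
  move=> x y; rewrite /h -sumrB mulr_suml (le_trans (ler_norm_sum _ _ _))// ler_sum// => i _.
  by have [_] := hl i; exact.
have bh : bmeas h by apply: bmeas_sum => i; apply: unit_lip_bmeas; case: (hf i).
exists (fun x => clamp (h x)); first exact: unit_lip_clamp hL.
have bB := bmeas_indic R mB.
have bc : bmeas (fun x => clamp (h x)) by exact/unit_lip_bmeas/unit_lip_clamp/hL.
have pt x : `|clamp (h x) - \1_B x| <= `|S N x - \1_B x| + \sum_(i < N) `|f i x - \1_(F i) x|.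
  rewrite [leRHS]addrC (_ : clamp (h x) - _ = clamp (h x) - clamp (S N x) + (S N x - \1_B x)).
    rewrite (le_trans (ler_normD _ _))// lerD2r (le_trans (clamp_lip _ _))//.
    by rewrite /h /S -sumrB ler_norm_sum.
  have -> : clamp (S N x) = S N x.
    have /andP[s0 s1] := S01 N x.
    by rewrite /clamp (min_idPl s1) (max_idPr s0).
  by rewrite addrA subrK.
have bi i : bmeas (fun x => `|f i x - \1_(F i) x|).
  by apply: bmeas_norm; apply: bmeasB; [apply: unit_lip_bmeas; case: (hf i)|exact: bmeas_indic].
have bSB : bmeas (fun x => `|S N x - \1_B x|) by apply: bmeas_norm; exact: bmeasB.
apply: (@le_trans _ _ (\int[m]_x (`|S N x - \1_B x| + \sum_(i < N) `|f i x - \1_(F i) x|))).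
  by apply: bRint_le => //; [apply: bmeas_norm; exact: bmeasB|apply: bmeasD => //; exact: bmeas_sum].
rewrite bRintD//; last exact: bmeas_sum.
rewrite bRint_sum// [leRHS]splitr; apply: lerD.
  by rewrite (le_trans _ hN)// ler_norm.
apply: (@le_trans _ _ (\sum_(i < N) (eps / 2 / N.+1%:R))).
  by apply: ler_sum => i _; case: (hf i).
rewrite sumr_const card_ord -[X in X <= _]mulr_natr -mulrA; apply: ler_piMr; first exact: ltW.
by rewrite ler_pdivrMl// mulr1 ler_nat.
Qed.

(** The sets that can be approximated form a Dynkin class containing the open sets, which are stable
    under intersection and generate the sigma-algebra. *)
Lemma lipschitz_approx B : measurable B -> approx B.
Proof.
rewrite sigma_open => mB; have := @dynkin_induction _ _ _ approx sigma_open; apply => //.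
- exact: openI.
- exact/approx_open/openT.
- exact: approx_open.
- exact: approx_setC.
- exact: approx_bigcup.
Qed.

Lemma open_cutoff_eq0 O k x : ~` O !=set0 -> k%:R * setdist (~` O) x <= 1 -> open_cutoff O k x = 0.
Proof. by move=> O0 h; rewrite /open_cutoff clamp_le0// lerBlDr add0r. Qed.

Lemma test_approx O B r eps : open O -> O `<=` box r -> measurable B -> B `<=` O -> 0 < eps ->
  exists phi : plane R -> R, [/\ test_function phi, forall x, 0 <= phi x <= 1,
    forall x, ~ O x -> phi x = 0 & \int[m]_x `|phi x - \1_B x| <= eps].
Proof.
move=> oO Or mB BO eps0.
have O0 : ~` O !=set0.
  exists (`|r| + 1, 0) => /Or; rewrite /box /= le_pair_norm /= => /andP[+ _].
  rewrite ger0_norm ?addr_ge0// leNgt => /negP; apply.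
  by rewrite ltr_pwDr// ler_norm.
have e3 : 0 < eps / 3 by rewrite divr_gt0.
have [g gl hg] := lipschitz_approx mB e3.
have /cvgrPdist_le/(_ _ e3)[k _ /(_ k (leqnn _))] := open_cutoff_Rint oO O0 mB BO.
rewrite sub0r normrN => /(le_trans (ler_norm _)) hk.
have cl := open_cutoff_lip k O0; have fl := unit_lipM cl gl.
pose f (x : plane R) : R := open_cutoff O k x * g x.
have bf : bmeas f by exact: unit_lip_bmeas.
have [f01 [L L0 fL]] := fl.
have sO x : ~ O x -> setdist (~` O) x <= 0.
  by move=> Ox; rewrite (le_trans (@setdist_le _ _ (~` O) x x Ox))// subrr normr0.
have f0 x : ~ O x -> f x = 0.
  move=> Ox; rewrite /f open_cutoff_eq0 ?mul0r//.
  by rewrite (@le_trans _ _ 0)// mulr_ge0_le0// sO.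
have sf : bsupp f.
  by split=> //; exists r => x rx; apply: f0 => /Or; rewrite /box/= leNgt rx.
pose M := fine (m setT); have M0 : 0 <= M by exact: fine_ge0.
have LM : 0 < L * M + 1 by rewrite ltr_wpDl// mulr_ge0.
(* The first bound keeps the mollified function supported in O. The second makes the mollification
   error [L * e], integrated over the total mass M, at most eps / 3. *)
pose e := Num.min (k.+1%:R^-1) (eps / 3 / (L * M + 1)).
have e0 : 0 < e by rewrite lt_min invr_gt0 ltr0n divr_gt0.
have [u [v mol]] := mollifier_exists e0.
exists (conv f u v); have tf := conv_test_function sf mol; split=> //.
(* The bounds 0 and 1 say that f is within 1 / 2 of the constant 1 / 2, a property that averaging
   preserves. *)
- move=> x; have : `|conv f u v x - 1 / 2| <= 1 / 2.
    apply: (conv_near sf mol) => y _; have /andP[h0 h1] := f01 y.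
    by rewrite ler_norml /f; apply/andP; split; lra.
  by rewrite ler_norml => /andP[h0 h1]; apply/andP; split; lra.
- move=> x Ox; apply: (conv_eq0 sf mol) => y xy.
  rewrite /f open_cutoff_eq0 ?mul0r//.
  apply: (@le_trans _ _ (k%:R * k.+1%:R^-1)).
    rewrite ler_wpM2l// (le_trans (@setdist_le _ _ (~` O) y x Ox))// distrC (le_trans xy)//.
    by rewrite ge_min lexx.
  by rewrite ler_pdivrMr// mul1r ler_nat.
have cf x : `|conv f u v x - f x| <= L * e.
  apply: (conv_near sf mol) => y xy; rewrite distrC.
  by rewrite (le_trans (fL _ _))// ler_wpM2l.
have bc : bmeas (conv f u v).
  split; first by apply: continuous_measurable_plane; case: tf => /(_ 0).
  exists (L * e + 1) => x; rewrite -[conv _ _ _ _](subrK (f x)) (le_trans (ler_normD _ _))// lerD//.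
  by have /andP[h0 h1] := f01 x; rewrite ger0_norm.
have bB := bmeas_indic R mB.
have bo := unit_lip_bmeas cl; have bg := unit_lip_bmeas gl.
have b1 : bmeas (fun x => `|g x - \1_B x|) by apply: bmeas_norm; exact: bmeasB.
have b2 : bmeas (fun x => `|open_cutoff O k x * \1_B x - \1_B x|).
  by apply: bmeas_norm; apply: bmeasB => //; exact: bmeasM.
have b3 := bmeas_cst (plane R) (L * e).
have pt x : `|conv f u v x - \1_B x| <= L * e +
    (`|g x - \1_B x| + `|open_cutoff O k x * \1_B x - \1_B x|).
  rewrite -[_ - \1_B x](subrKA (f x)) (le_trans (ler_normD _ _))// lerD//.
  rewrite -[_ - \1_B x](subrKA (open_cutoff O k x * \1_B x)) (le_trans (ler_normD _ _))// lerD//.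
  rewrite /f -mulrBr normrM ler_piMl//.
  by have /andP[h0 h1] := cl.1 x; rewrite ger0_norm.
apply: (le_trans (bRint_le m _ _ pt)).
- by apply: bmeas_norm; exact: bmeasB.
- by apply: bmeasD => //; exact: bmeasD.
rewrite bRintD//; last exact: bmeasD.
rewrite bRintD// Rintegral_cst//.
have h1 : L * e * M <= eps / 3.
  apply: (@le_trans _ _ (L * (eps / 3 / (L * M + 1)) * M)).
    by rewrite ler_wpM2r// ler_wpM2l// ge_min lexx orbT.
  rewrite mulrAC mulrCA -[leRHS]mulr1 -mulrA; apply: ler_wpM2l; first exact: ltW.
  by rewrite mulrA ler_pdivrMr// mul1r lerDl.
have -> : eps = eps / 3 + (eps / 3 + eps / 3) by field.
by rewrite lerD// lerD.
Qed.

End lipschitz_approximation.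

(** * The weak equation along the flow *)

Section uniform_taylor.
Context {R : realType} {A : Type} (P : A -> Prop).
Implicit Types (F G : A -> R -> R) (D : A -> R).

(** Second-order expansion in h with one constant for all parameters a. Uniformity is what permits
    integrating the expansion over the plane afterwards. *)
Definition utaylor F D := exists2 C, 0 <= C & forall a, P a ->
  [/\ `|F a 0| <= C, `|D a| <= C &
      forall h : R, `|h| <= 1 -> `|F a h - F a 0 - h * D a| <= C * h ^+ 2].

Lemma utaylorM F G DF DG : utaylor F DF -> utaylor G DG ->
  utaylor (fun a h => F a h * G a h) (fun a => DF a * G a 0 + F a 0 * DG a).
Proof.
move=> [B B0 hB] [C C0 hC]; have BC := mulr_ge0 B0 C0.
(* The three terms of the remainder below contribute 1, 3 and 2 times [B * C]. *)
exists (6 * (B * C)); first by rewrite mulr_ge0.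
move=> a Pa; have [f0 df hf] := hB a Pa; have [g0 dg hg] := hC a Pa; split.
- by rewrite normrM (le_trans (ler_pM _ _ f0 g0))// ler_peMl// ler1n.
- rewrite (le_trans (ler_normD _ _))// !normrM.
  rewrite (@le_trans _ _ (B * C + B * C))//; first by rewrite lerD// ler_pM.
  by move: (B * C) BC => z z0; lra.
move=> h h1; have {}hf := hf h h1; have {}hg := hg h h1.
set rf := F a h - F a 0 - h * DF a in hf; set rg := G a h - G a 0 - h * DG a in hg.
have h2 : h ^+ 2 <= 1 by rewrite -real_normK ?num_real// exprn_ile1.
have h20 : 0 <= h ^+ 2 by exact: sqr_ge0.
have -> : F a h * G a h - F a 0 * G a 0 - h * (DF a * G a 0 + F a 0 * DG a) =
    h ^+ 2 * (DF a * DG a) + (rf * (G a 0 + h * DG a + rg) + (F a 0 + h * DF a) * rg).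
  by rewrite /rf /rg; ring.
have e1 : `|h ^+ 2 * (DF a * DG a)| <= h ^+ 2 * (B * C).
  by rewrite normrM ger0_norm// ler_wpM2l// normrM ler_pM.
have hD (d c : R) : `|d| <= c -> `|h * d| <= c.
  by move=> dc; rewrite normrM -[leRHS]mul1r ler_pM.
have e2 : `|rf * (G a 0 + h * DG a + rg)| <= (B * h ^+ 2) * (C + C + C).
  rewrite normrM ler_pM// (le_trans (ler_normD _ _))// lerD//.
    by rewrite (le_trans (ler_normD _ _))// lerD// hD.
  by rewrite (le_trans hg)// ler_piMr.
have e3 : `|(F a 0 + h * DF a) * rg| <= (B + B) * (C * h ^+ 2).
  by rewrite normrM ler_pM// (le_trans (ler_normD _ _))// lerD// hD.
rewrite (le_trans (ler_normD _ _))// (le_trans (lerD e1 (le_trans (ler_normD _ _) (lerD e2 e3))))//.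
by rewrite le_eqVlt; apply/orP; left; apply/eqP; ring.
Qed.

Lemma utaylor_lip F D : utaylor F D -> exists2 C, 0 <= C &
  forall a h, P a -> `|h| <= 1 -> `|F a h - F a 0| <= C * `|h|.
Proof.
move=> [C C0 hC]; exists (C + C); first exact: addr_ge0.
move=> a h Pa h1; have [_ dC /(_ h h1) hh] := hC a Pa.
rewrite -[_ - F a 0](subrK (h * D a)) (le_trans (ler_normD _ _))// [leRHS]mulrDl; apply: lerD.
  by rewrite (le_trans hh)// -real_normK ?num_real// ler_wpM2l// expr2 ler_piMl.
by rewrite normrM mulrC ler_wpM2r.
Qed.

End uniform_taylor.

Section blip.
Context {R : realType}.
Implicit Types (f g : plane R -> R).

Definition blip f := exists2 C, 0 <= C &
  (forall x, `|f x| <= C) /\ forall x y, `|f x - f y| <= C * `|x - y|.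

Lemma blipM f g : blip f -> blip g -> blip (fun x => f x * g x).
Proof.
move=> [B B0 [fB fL]] [C C0 [gC gL]]; have BC := mulr_ge0 B0 C0.
exists (B * C + B * C); first exact: addr_ge0.
split=> [x|x y].
  by rewrite normrM (le_trans (ler_pM _ _ (fB x) (gC x)))// lerDl.
have -> : f x * g x - f y * g y = (f x - f y) * g x + f y * (g x - g y) by ring.
rewrite (le_trans (ler_normD _ _))// [leRHS]mulrDl; apply: lerD; rewrite normrM.
  by rewrite mulrAC ler_pM.
by rewrite -mulrA ler_pM.
Qed.

Lemma blipD f g : blip f -> blip g -> blip (fun x => f x + g x).
Proof.
move=> [B B0 [fB fL]] [C C0 [gC gL]]; exists (B + C); first exact: addr_ge0.
split=> [x|x y]; first by rewrite (le_trans (ler_normD _ _))// lerD.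
by rewrite opprD addrACA [leRHS]mulrDl (le_trans (ler_normD _ _))// lerD.
Qed.

Lemma blipN f : blip f -> blip (fun x => - f x).
Proof.
move=> [B B0 [fB fL]]; exists B => //; split=> [x|x y]; first by rewrite normrN.
by rewrite -opprD normrN.
Qed.

Lemma blip_cst c : blip (fun=> c).
Proof. by exists `|c| => //; split=> // x y; rewrite subrr normr0 mulr_ge0. Qed.

Lemma blip_sum (I : Type) (s : seq I) (F : I -> plane R -> R) :
  (forall i, blip (F i)) -> blip (fun x => \sum_(i <- s) F i x).
Proof.
move=> bF; elim: s => [|i s ih].
  by under eq_fun do rewrite big_nil; exact: blip_cst.
by under eq_fun do rewrite big_cons; exact: blipD.
Qed.

Lemma blip_comp f (u : plane R -> plane R) L : 0 <= L ->
  (forall x y, `|u x - u y| <= L * `|x - y|) -> blip f -> blip (f \o u).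
Proof.
move=> L0 uL [B B0 [fB fL]]; exists (B + B * L); first by rewrite addr_ge0// mulr_ge0.
split=> [x|x y] /=; first by rewrite (le_trans (fB _))// lerDl mulr_ge0.
rewrite (le_trans (fL _ _))// [leRHS]mulrDl (@le_trans _ _ (B * L * `|x - y|))//.
  by rewrite -mulrA ler_wpM2l.
by rewrite lerDr mulr_ge0.
Qed.

Lemma blip_bmeas f : blip f -> bmeas f.
Proof.
move=> [B B0 [fB fL]]; split; last by exists B.
by apply: continuous_measurable_plane; exact: lip_continuous fL.
Qed.

End blip.

Section test_functions.
Context {R : realType}.
Implicit Types (phi : plane R -> R) (x y v : plane R).

Lemma near0_d1 phi (O : set (plane R)) x : open O -> (forall y, O y -> phi y = 0) -> O x ->
  d1 phi x = 0 /\ d2 phi x = 0.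
Proof.
move=> oO O0 Ox.
have key v : 'D_v phi x = 0.
  rewrite (@near_eq_derive _ _ _ phi (cst 0)) ?derive_cst//.
  near=> y; rewrite O0//; near: y.
  exact: open_nbhs_nbhs.
by split; exact: key.
Unshelve. all: by end_near. Qed.

Lemma test_function_d phi : test_function phi -> test_function (d1 phi) /\ test_function (d2 phi).
Proof.
move=> [sp [K cK hK]].
have oK : open (~` K) by apply: closed_openC; exact: compact_closed.
have z x : ~ K x -> d1 phi x = 0 /\ d2 phi x = 0.
  by move=> Kx; apply: (near0_d1 oK).
split; (split; [by move=> n; case: (sp n.+1)|exists K => // x /z[]//]).
Qed.

Lemma test_function_bounded phi : test_function phi -> exists2 C, 0 <= C & forall x, `|phi x| <= C.
Proof.
move=> [sp [K cK hK]]; have [C C0 hC] := compact_norm_bound cK (sp 0%N).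
exists C => // x; have [Kx|Kx] := pselect (K x); first exact: hC.
by rewrite hK// normr0.
Qed.

(** Mean value theorem along a vertical and then a horizontal segment. The exact formula with nearby
    intermediate points yields both the Lipschitz bound and the second-order expansion. *)
Lemma test_function_slices phi x v : test_function phi -> exists a b,
  [/\ `|a - (x + v)| <= `|v|, `|b - x| <= `|v| &
  phi (x + v) - phi x = v.1 * d1 phi a + v.2 * d2 phi b].
Proof.
move=> [/(_ 1%N)[_ D1 D2 _ _] _].
have [c hc E1] := MVT_itv x.1 (x.1 + v.1) (fun z => derivable_slice1 (D1 (z, x.2 + v.2))).
have [d hd E2] := MVT_itv x.2 (x.2 + v.2) (fun z => derivable_slice2 (D2 (x.1, z))).
have sub (p w c' : R) : Num.min p (p + w) <= c' <= Num.max p (p + w) -> `|c' - p| <= `|w| /\ `|c' - (p + w)| <= `|w|.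
  move=> h; split; first apply: (@norm_between _ 0 w).
  - by rewrite normr0.
  - by [].
  - by move: h; rewrite /Num.min /Num.max; case: ifP; case: ifP => + + /andP[]; rewrite ?subr0; lra.
  apply: (@norm_between _ (- w) 0).
  - by rewrite normrN.
  - by rewrite normr0.
  - by move: h; rewrite /Num.min /Num.max; case: ifP; case: ifP => + + /andP[]; rewrite ?subr0; lra.
exists (c, x.2 + v.2), (x.1, d); split.
- rewrite le_pair_norm /= subrr normr0 normr_ge0 andbT (le_trans (sub _ _ _ hc).2)//.
  exact: pair_norm1.
- rewrite le_pair_norm /= subrr normr0 normr_ge0 (le_trans (sub _ _ _ hd).1)//.
  exact: pair_norm2.
have -> : x + v = (x.1 + v.1, x.2 + v.2) by [].
have -> : phi x = phi (x.1, x.2) by case: (x).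
rewrite -[LHS](subrKA (phi (x.1, x.2 + v.2))) E1 E2 [x.1 + _]addrC [x.2 + _]addrC !addrK.
by rewrite [X in X + _]mulrC [X in _ + X]mulrC.
Qed.

Lemma test_function_blip phi : test_function phi -> blip phi.
Proof.
move=> tp; have [t1 t2] := test_function_d tp.
have [C C0 hC] := test_function_bounded tp.
have [C1 C10 hC1] := test_function_bounded t1; have [C2 C20 hC2] := test_function_bounded t2.
exists (C + (C1 + C2)); first by rewrite !addr_ge0.
split=> [x|x y]; first by rewrite (le_trans (hC x))// lerDl addr_ge0.
have [a [c [_ _]]] := test_function_slices y (x - y) tp.
rewrite [y + _]addrC subrK => ->; rewrite (@le_trans _ _ ((C1 + C2) * `|x - y|))//.
  rewrite (le_trans (ler_normD _ _))// [leRHS]mulrDl; apply: lerD; rewrite normrM mulrC ler_pM//.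
    exact: pair_norm1.
  exact: pair_norm2.
by rewrite ler_wpM2r// lerDr.
Qed.

Lemma test_function_taylor phi : test_function phi -> exists2 C, 0 <= C & forall x v,
  `|phi (x + v) - phi x - (v.1 * d1 phi x + v.2 * d2 phi x)| <= C * `|v| ^+ 2.
Proof.
move=> tp; have [t1 t2] := test_function_d tp.
have [B B0 [_ fB]] := test_function_blip t1; have [C C0 [_ fC]] := test_function_blip t2.
exists (B * 2 + C); first by rewrite addr_ge0// mulr_ge0.
move=> x v; have [a [c [ha hc ->]]] := test_function_slices x v tp.
rewrite opprD addrACA -!mulrBr (le_trans (ler_normD _ _))// [leRHS]mulrDl expr2; apply: lerD; rewrite normrM.
  rewrite mulrCA ler_pM//; first exact: pair_norm1.
  rewrite (le_trans (fB _ _))// -mulrA ler_wpM2l//.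
  rewrite -[a - x](subrKA (x + v)) (le_trans (ler_normD _ _))//.
  by rewrite [x + v - x]addrAC subrr add0r mulr2n mulrDl mul1r lerD.
rewrite mulrCA ler_pM//; first exact: pair_norm2.
by rewrite (le_trans (fC _ _))// ler_wpM2l.
Qed.

End test_functions.

Section weak_equation.
Context {R : realType} {m k : nat}.
Variables (b : plane R -> plane R) (H : plane R -> 'M[R]_m) (K : plane R -> 'M[R]_(m, k)).
Variables (al be : {finite_measure set (plane R) -> \bar R}).
Variables (s : plane R -> 'cV[R]_m) (u : plane R -> 'cV[R]_k).
Implicit Types (f g : plane R -> R) (x y : plane R).

(* [al] and [be] stand for |mu_j| and |mu_k| on a box, [s] and [u] for their polar
   functions, and [g] for the derivative of [f] along the field [b]. *)
Definition weak_form i g f : R :=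
  - (\int[al]_x (g x * s x i 0)) +
  (\sum_l \int[al]_x (H x i l * f x * s x l 0) + \sum_l \int[be]_x (K x i l * f x * u x l 0)).

Definition weak_eq r := forall i phi, test_function phi -> (forall x, r < `|x| -> phi x = 0) ->
  weak_form i (vfield b phi) phi = 0.

Hypothesis b1 : blip (fun x => (b x).1).
Hypothesis b2 : blip (fun x => (b x).2).
Hypothesis HH : forall i j, blip (fun x => H x i j).
Hypothesis KK : forall i j, blip (fun x => K x i j).
Hypothesis ss : forall i, bmeas (fun x => s x i 0).
Hypothesis uu : forall i, bmeas (fun x => u x i 0).

Lemma uRint_cvg (mu : {finite_measure set (plane R) -> \bar R}) (w_ : nat -> plane R -> R) w c C :
  (forall n, bmeas (w_ n)) -> bmeas w -> bmeas c ->
  (forall n x, `|w_ n x - w x| <= C / n.+1%:R) ->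
  \int[mu]_x (w_ n x * c x) @[n --> \oo] --> \int[mu]_x (w x * c x).
Proof.
move=> bw_ bw bc wC.
have [D D0 hD] := bmeas_bound bw; have [E E0 hE] := bmeas_bound bc.
have C0 : 0 <= C by have := le_trans (normr_ge0 _) (wC 0%N 0); rewrite divr1.
apply: (@bRint_cvg _ _ _ mu _ _ ((C + D) * E)).
- by move=> n; apply: bmeas_meas; exact: bmeasM.
- by apply: bmeas_meas; exact: bmeasM.
- move=> n x; rewrite normrM ler_pM// -[w_ n x](subrK (w x)) (le_trans (ler_normD _ _))// lerD//.
  by rewrite (le_trans (wC n x))// ler_piMr// invf_le1// ler1n.
- move=> x; apply: cvgMr_tmp; apply/cvgrPdist_le => eps eps0.
  exists (Num.bound (C / eps)) => // n /= Nn; rewrite distrC (le_trans (wC n x))//.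
  rewrite ler_pdivrMr// -ler_pdivrMl// mulrC (le_trans (ltW (archi_boundP _)))//; first by rewrite divr_ge0// ltW.
  by rewrite ler_nat (leq_trans Nn).
Qed.

Lemma vfield_bmeas phi : test_function phi -> bmeas (vfield b phi).
Proof.
move=> tp; have [/test_function_blip/blip_bmeas t1 /test_function_blip/blip_bmeas t2] := test_function_d tp.
by apply: bmeasD; apply: bmeasM => //; exact: blip_bmeas.
Qed.

(** Admits Lipschitz functions f with Lipschitz derivative g along b as test functions. The
    mollified functions are genuine test functions, and by [conv_directional] their derivatives
    along b converge uniformly to g, which suffices for every term of the equation. *)
Lemma weak_eq_ext f g r r' C i : r < r' -> weak_eq r' -> blip f -> blip g ->
  (forall x, r < `|x| -> f x = 0) ->
  (forall x h, `|h| <= 1 -> `|f (x + h *: b x) - f x - h * g x| <= C * h ^+ 2) ->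
  weak_form i g f = 0.
Proof.
move=> rr' hw bf bg f0 fgC.
have [Lf Lf0 [_ fL]] := bf; have [Lg Lg0 [_ gL]] := bg.
have [B1 B10 [_ b1L]] := b1; have [B2 B20 [_ b2L]] := b2.
have bL x y : `|b x - b y| <= (B1 + B2) * `|x - y|.
  rewrite le_pair_norm /=; apply/andP; split.
    by rewrite (le_trans (b1L _ _))// ler_wpM2r// lerDl.
  by rewrite (le_trans (b2L _ _))// ler_wpM2r// lerDr.
have d0 : 0 < r' - r by rewrite subr_gt0.
(* The gap between r and r' is the room available for enlarging the support. *)
pose e n : R := (r' - r) / n.+1%:R.
have e0 n : 0 < e n by rewrite divr_gt0.
have ele n : e n <= r' - r by rewrite ler_piMr ?(ltW d0)// invf_le1// ler1n.
have sf : bsupp f by split; [exact: blip_bmeas|exists r].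
have /choice[p hp] : forall n, exists p : (R -> R) * (R -> R), mollifier (e n) p.1 p.2.
  by move=> n; have [a [c h]] := mollifier_exists (e0 n); exists (a, c).
pose F n := conv f (p n).1 (p n).2.
have tF n : test_function (F n) by exact: conv_test_function sf (hp n).
have F0 n x : r' < `|x| -> F n x = 0.
  move=> rx; apply: (conv_bsupp_out sf (hp n) f0).
  by rewrite (le_lt_trans _ rx)// -lerBrDl.
have FC n x : `|F n x - f x| <= Lf * (r' - r) / n.+1%:R.
  apply: (conv_near sf (hp n)) => y xy.
  rewrite distrC in xy; rewrite (le_trans (fL _ _))// -mulrA ler_wpM2l//.
(* Within distance [e n] of x the direction b changes by at most [(B1 + B2) * e n], which costs a
   factor Lf, and g changes by at most [Lg * e n]. *)
pose Q := (Lf * (B1 + B2) + Lg) * (r' - r).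
have vC n x : `|vfield b (F n) x - g x| <= Q / n.+1%:R.
  apply: (@conv_directional _ f (e n) _ _ sf (hp n) x (b x) (g x) _ Lf) => //.
    by rewrite divr_ge0// mulr_ge0 ?(ltW d0)// addr_ge0// mulr_ge0// addr_ge0.
  move=> y xy eps eps0; exists (Num.bound (`|C| / eps)) => N hN.
  pose h : R := N.+1%:R^-1; have h0 : 0 < h by rewrite invr_gt0.
  have h1 : `|h| <= 1 by rewrite ger0_norm ?(ltW h0)// invf_le1// ler1n.
  have hE (z : R) : N.+1%:R * z = z / h by rewrite invrK mulrC.
  rewrite -/h hE.
  have -> : (f (y + h *: b x) - f y) / h - g x =
     (f (y + h *: b x) - f (y + h *: b y)) / h + (f (y + h *: b y) - f y - h * g y) / h + (g y - g x).
    by field; rewrite gt_eqF.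
  have yx : `|y - x| <= e n by rewrite distrC.
  have t1 : `|(f (y + h *: b x) - f (y + h *: b y)) / h| <= Lf * (B1 + B2) * e n.
    rewrite normrM normfV (gtr0_norm h0) ler_pdivrMr// (le_trans (fL _ _))//.
    rewrite opprD addrACA subrr add0r -scalerBr normrZ (gtr0_norm h0) mulrCA [leRHS]mulrC.
    rewrite ler_wpM2l ?(ltW h0)// -[leRHS]mulrA ler_wpM2l// (le_trans (bL _ _))// ler_wpM2l//.
    exact: addr_ge0.
  have t2 : `|(f (y + h *: b y) - f y - h * g y) / h| <= eps.
    rewrite normrM normfV (gtr0_norm h0) ler_pdivrMr// (le_trans (fgC y h h1))//.
    rewrite expr2 mulrA ler_wpM2r ?(ltW h0)//.
    rewrite (@le_trans _ _ (`|C| * h))//; first by rewrite ler_wpM2r ?(ltW h0)// ler_norm.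
    rewrite ler_pdivrMr// mulrC -ler_pdivrMr// (le_trans (ltW (archi_boundP _)))//; first by rewrite divr_ge0// ltW.
    by rewrite ler_nat (leq_trans hN).
  have t3 : `|g y - g x| <= Lg * e n by rewrite (le_trans (gL _ _))// ler_wpM2l.
  rewrite (le_trans (ler_normD _ _))// (le_trans (lerD (le_trans (ler_normD _ _) (lerD t1 t2)) t3))//.
  by rewrite /Q /e le_eqVlt; apply/orP; left; apply/eqP; ring.
have bFn n := blip_bmeas (test_function_blip (tF n)).
have wcv : weak_form i (vfield b (F n)) (F n) @[n --> \oo] --> weak_form i g f.
  have fE (c f' : plane R -> R) (w : plane R -> R) :
      (fun x => c x * f' x * w x) = (fun x => f' x * (c x * w x)).
    by apply/funext => x; rewrite mulrA [_ * f' x]mulrC.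
  have c1 : (- \int[al]_x (vfield b (F n) x * s x i 0)) @[n --> \oo] --> - \int[al]_x (g x * s x i 0).
    apply: cvgN; apply: (uRint_cvg (C := Q)) => //; last exact: blip_bmeas.
    by move=> n; exact: vfield_bmeas.
  have c2 l : \int[al]_x (H x i l * F n x * s x l 0) @[n --> \oo] --> \int[al]_x (H x i l * f x * s x l 0).
    rewrite fE; under eq_fun do rewrite fE.
    apply: (uRint_cvg (C := Lf * (r' - r))) => //; first exact: blip_bmeas.
    by apply: bmeasM => //; exact: blip_bmeas.
  have c3 l : \int[be]_x (K x i l * F n x * u x l 0) @[n --> \oo] --> \int[be]_x (K x i l * f x * u x l 0).
    rewrite fE; under eq_fun do rewrite fE.
    apply: (uRint_cvg (C := Lf * (r' - r))) => //; first exact: blip_bmeas.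
    by apply: bmeasM => //; exact: blip_bmeas.
  have cs (J : finType) (q : J -> nat -> R) (w : J -> R) :
      (forall l, q l n @[n --> \oo] --> w l) -> \sum_l q l n @[n --> \oo] --> \sum_l w l.
    by move=> qw; apply: cvg_big => [|l _]; [exact: add_continuous|exact: qw].
  have c4 := cs _ (fun l n => \int[al]_x (H x i l * F n x * s x l 0)) _ c2.
  have c5 := cs _ (fun l n => \int[be]_x (K x i l * F n x * u x l 0)) _ c3.
  exact: (cvgD c1 (cvgD c4 c5)).
have E : (fun n => weak_form i (vfield b (F n)) (F n)) = (fun=> 0).
  by apply/funext => n; rewrite hw//; exact: F0.
by rewrite E in wcv; exact: (cvg_unique _ wcv (cvg_cst _)).
Qed.

End weak_equation.

Lemma mulmx_entry_le {R : realType} {m n p : nat} (A : 'M[R]_(m, n)) (B : 'M[R]_(n, p)) a c i j :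
  `|A| <= a -> `|B| <= c -> `|(A *m B) i j| <= n%:R * a * c.
Proof.
move=> Aa Bc; apply: le_trans (mx_norm_entry _ i j) _; apply: le_trans (mulmx_norm _ _) _.
by rewrite -!mulrA ler_wpM2l// ler_pM.
Qed.

Lemma mx_entryB {R : zmodType} {m n : nat} (A B : 'M[R]_(m, n)) i j : (A - B) i j = A i j - B i j.
Proof. by rewrite !mxE. Qed.

Lemma mx_entryD {R : nmodType} {m n : nat} (A B : 'M[R]_(m, n)) i j : (A + B) i j = A i j + B i j.
Proof. by rewrite mxE. Qed.

Lemma mx_entryN {R : zmodType} {m n : nat} (A : 'M[R]_(m, n)) i j : (- A) i j = - A i j.
Proof. by rewrite mxE. Qed.

Lemma mx_entryZ {R : pzRingType} {m n : nat} (a : R) (A : 'M[R]_(m, n)) i j : (a *: A) i j = a * A i j.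
Proof. by rewrite mxE. Qed.

Section duhamel.
Context {R : realType} {m k : nat}.
Variables (b : plane R -> plane R) (H : plane R -> 'M[R]_m) (K : plane R -> 'M[R]_(m, k)).
Variables (al be : {finite_measure set (plane R) -> \bar R}).
Variables (s : plane R -> 'cV[R]_m) (u : plane R -> 'cV[R]_k).
Variables (r' T : R) (phi : R -> plane R -> plane R) (W : R -> plane R -> 'M[R]_m) (L M C : R).
Implicit Types (x y : plane R) (f : plane R -> R).

Let bt x := b (clip2 r' x).
Let Ht x := H (clip2 r' x).
Let Kt x := K (clip2 r' x).

Hypothesis ch : characteristics b H r' T phi W L M C.
Hypothesis T1 : 1 <= T.
Hypothesis b1 : blip (fun x => (bt x).1).
Hypothesis b2 : blip (fun x => (bt x).2).
Hypothesis HH : forall i j, blip (fun x => Ht x i j).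
Hypothesis KK : forall i j, blip (fun x => Kt x i j).
Hypothesis ss : forall i, bmeas (fun x => s x i 0).
Hypothesis uu : forall i, bmeas (fun x => u x i 0).
Hypothesis weak : weak_eq bt Ht Kt al be s u r'.

Let P (a : R * plane R) := `|a.1| <= T.

Variables (g : plane R -> R) (i : 'I_m).
Hypothesis tg : test_function g.

(** For fixed i these are the entries of the i-th row of g(phi_t) W_t. Testing the l-th component of
    the equation with the l-th entry and summing over l gives the i-th component of the transported
    vector integral. *)
Definition pullback t l x := g (phi t x) * W t x i l.

Let dpull t l x := vfield bt g (phi t x) * W t x i l +
  g (phi t x) * - (Ht (phi t x) *m W t x) i l.

Let vfield_blip : blip (vfield bt g).
Proof.
have [/test_function_blip t1 /test_function_blip t2] := test_function_d tg.
by apply: blipD; apply: blipM.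
Qed.

Let C0 := char_C0 ch.
Let M0 := char_M0 ch.

Let h2_le (h : R) : `|h| <= 1 -> `|h| ^+ 2 = h ^+ 2.
Proof. by rewrite real_normK ?num_real. Qed.

Let utaylor_g : utaylor P (fun a h => g (phi (a.1 + h) a.2)) (fun a => vfield bt g (phi a.1 a.2)).
Proof.
have [G G0 [gB _]] := test_function_blip tg.
have [V V0 [vB _]] := vfield_blip.
have [Q Q0 hQ] := test_function_taylor tg.
have [t1 t2] := test_function_d tg.
have [D1 D10 hD1] := test_function_bounded t1; have [D2 D20 hD2] := test_function_bounded t2.
have q0 : 0 <= Q * M ^+ 2 by rewrite mulr_ge0// sqr_ge0.
have d0 : 0 <= (D1 + D2) * C by rewrite mulr_ge0// addr_ge0.
exists (G + V + (Q * M ^+ 2 + (D1 + D2) * C)); first by rewrite !addr_ge0.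
move=> a _; split.
- by rewrite (le_trans (gB _))// -!addrA lerDl !addr_ge0.
- by rewrite (le_trans (vB _))// addrAC lerDr !addr_ge0.
move=> h _; rewrite addr0; set y := phi a.1 a.2.
set v := phi (a.1 + h) a.2 - y.
have vM : `|v| <= `|h| * M by have := char_time ch a.1 (a.1 + h) a.2; rewrite addrAC subrr add0r.
have yv : y + v = phi (a.1 + h) a.2 by rewrite /v addrC subrK.
have E1 := hQ y v; rewrite yv in E1.
have E2 := char_exp ch a.1 h a.2; rewrite -/y -/v -/(bt y) in E2.
have -> : g (phi (a.1 + h) a.2) - g y - h * vfield bt g y =
   (g (phi (a.1 + h) a.2) - g y - (v.1 * d1 g y + v.2 * d2 g y)) +
   ((v - h *: bt y).1 * d1 g y + (v - h *: bt y).2 * d2 g y).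
  by rewrite /vfield /= /GRing.scale/=; ring.
rewrite (le_trans (ler_normD _ _))// (@le_trans _ _ (Q * M ^+ 2 * h ^+ 2 + (D1 + D2) * C * h ^+ 2))//; last first.
  by rewrite -mulrDl ler_wpM2r ?sqr_ge0// lerDr addr_ge0.
apply: lerD.
  have -> : Q * M ^+ 2 * h ^+ 2 = Q * (`|h| * M) ^+ 2.
    by rewrite exprMn real_normK ?num_real//; ring.
  apply: (le_trans E1); apply: ler_wpM2l => //.
  by apply: lerXn2r => //; rewrite nnegrE// mulr_ge0.
rewrite (le_trans (ler_normD _ _))// -mulrA [leRHS]mulrDl; apply: lerD; rewrite normrM mulrC; apply: ler_pM => //.
  exact: le_trans (pair_norm1 _) E2.
exact: le_trans (pair_norm2 _) E2.
Qed.

Let Ht_bounded : exists2 B, 0 <= B & forall x, `|Ht x| <= B.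
Proof.
have /choice[B hB] : forall p : 'I_m * 'I_m, exists B, 0 <= B /\ forall x, `|Ht x p.1 p.2| <= B.
  by move=> p; have [B B0 [hB _]] := HH p.1 p.2; exists B.
exists (\sum_p B p); first by apply: sumr_ge0 => p _; case: (hB p).
move=> x; apply: le_mx_norm; first by apply: sumr_ge0 => p _; case: (hB p).
move=> i' j'; have [_ /(_ x)/= h] := hB (i', j'); rewrite (le_trans h)// (bigD1 (i', j'))//= lerDl.
by apply: sumr_ge0 => p _; case: (hB p).
Qed.

Let utaylor_W l : utaylor P (fun a h => W (a.1 + h) a.2 i l)
  (fun a => - (Ht (phi a.1 a.2) *m W a.1 a.2) i l).
Proof.
have [B B0 HB] := Ht_bounded.
have e0 : 0 <= m%:R * B * C by rewrite !mulr_ge0.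
exists (C + m%:R * B * C); first by rewrite addr_ge0.
move=> a Pa; have Wb := charW_bound ch a.2 Pa; split.
- by rewrite addr0 (le_trans (mx_norm_entry _ _ _))// (le_trans Wb)// lerDl.
- by rewrite normrN (le_trans (mulmx_entry_le _ _ (HB _) Wb))// lerDr.
move=> h h1; have E := charW_exp ch h a.2 Pa.
rewrite addr0 mulrN opprK (@le_trans _ _ (C * h ^+ 2))//; last by rewrite ler_wpM2r ?sqr_ge0// lerDl.
by rewrite (le_trans _ (le_trans (mx_norm_entry _ i l) E))// mx_entryD mx_entryB mx_entryZ.
Qed.

Let utaylor_pull l : utaylor P (fun a h => pullback (a.1 + h) l a.2) (fun a => dpull a.1 l a.2).
Proof.
have := utaylorM utaylor_g (utaylor_W l).
by under [X in utaylor _ _ X -> _]eq_fun do rewrite !addr0.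
Qed.

Let PT (x : plane R) := True.

Let phi_lip h x : `|phi h x - x| <= `|h| * M.
Proof. by have := char_time ch 0 h x; rewrite (char0 ch) subr0. Qed.

(** Derivative of [W t] along the flow, with t fixed. The cocycle law
    [W (t + h) x = W t (phi h x) *m W h x] expresses it through the derivatives of W in time at t
    and at 0; the second one accounts for the term [W t x *m Ht x]. *)
Let utaylor_Wflow t l : `|t| <= T -> utaylor PT (fun x h => W t (phi h x) i l)
  (fun x => (W t x *m Ht x - Ht (phi t x) *m W t x) i l).
Proof.
move=> tT; have [B B0 HB] := Ht_bounded.
have Wb x := charW_bound ch x tT.
have e0 : 0 <= m%:R * C * B + m%:R * B * C by rewrite addr_ge0 ?mulr_ge0.
have e1 : 0 <= C + m%:R * C * C + m%:R * (C * M) * B by rewrite !addr_ge0 ?mulr_ge0.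
exists ((C + (m%:R * C * B + m%:R * B * C)) + (C + m%:R * C * C + m%:R * (C * M) * B)).
  by rewrite !addr_ge0 ?mulr_ge0.
move=> x _; split.
- by rewrite (char0 ch) (le_trans (mx_norm_entry _ _ _))// (le_trans (Wb _))// -!addrA lerDl !addr_ge0 ?mulr_ge0.
- rewrite (@le_trans _ _ (m%:R * C * B + m%:R * B * C))//; last first.
    by rewrite -addrA addrCA lerDl addr_ge0.
  by rewrite mx_entryB (le_trans (ler_normB _ _))// lerD//; apply: mulmx_entry_le.
move=> h h1; rewrite (char0 ch).
have hT : `|h| <= T by exact: le_trans h1 T1.
set V := W t (phi h x).
have E1 := charW_exp ch h x tT.
have T0 : `|0 : R| <= T by rewrite normr0 (le_trans ler01 T1).
have E2 := charW_exp ch h x T0.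
rewrite (char0 ch) (charW0 ch) mulmx1 add0r in E2.
have E3 : `|V - W t x| <= C * M * `|h|.
  by rewrite (le_trans (charW_lip ch _ _ tT))// -mulrA ler_wpM2l// mulrC phi_lip.
have E4 : W (t + h) x = V *m W h x by rewrite addrC (charWD ch _ hT tT).
have -> : V i l - W t x i l - h * (W t x *m Ht x - Ht (phi t x) *m W t x) i l =
    (W (t + h) x - W t x + h *: (Ht (phi t x) *m W t x)) i l
    - (V *m (W h x - 1%:M + h *: Ht x)) i l + h * ((V - W t x) *m Ht x) i l.
  rewrite E4 mulmxDr mulmxBr mulmx1 mulmxBl -scalemxAr !(mx_entryD, mx_entryN, mx_entryZ).
  by move: ((_ *m _) i l) ((_ *m _) i l) ((_ *m _) i l) ((_ *m _) i l) => c1 c2 c3 c4; ring.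
rewrite (@le_trans _ _ ((C + m%:R * C * C + m%:R * (C * M) * B) * h ^+ 2))//; last first.
  by rewrite ler_wpM2r ?sqr_ge0// lerDr addr_ge0.
rewrite mulrDl (le_trans (ler_normD _ _))//; apply: lerD.
  rewrite mulrDl (le_trans (ler_normB _ _))//; apply: lerD.
    exact: le_trans (mx_norm_entry _ _ _) E1.
  by rewrite -mulrA; apply: mulmx_entry_le; [exact: Wb|exact: E2].
rewrite normrM mulrC -[h ^+ 2]real_normK ?num_real// expr2 [leRHS]mulrA ler_wpM2r//.
apply: (le_trans (mulmx_entry_le i l E3 (HB x))).
by rewrite le_eqVlt; apply/orP; left; apply/eqP; ring.
Qed.

Let PTI x : PT x. Proof. by []. Qed.

Let wpull t l x := vfield bt g (phi t x) * W t x i l +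
  g (phi t x) * (W t x *m Ht x - Ht (phi t x) *m W t x) i l.

Let utaylor_pull_flow t l : `|t| <= T ->
  utaylor PT (fun x h => pullback t l (phi h x)) (fun x => wpull t l x).
Proof.
move=> tT.
have tg' : utaylor PT (fun x h => g (phi (t + h) x)) (fun x => vfield bt g (phi t x)).
  by have [D D0 hD] := utaylor_g; exists D => // x _; exact: (hD (t, x)).
have [D D0 hD] := utaylorM tg' (utaylor_Wflow l tT).
exists D => // x Px; have [h1 h2 h3] := hD x Px.
split=> [||h hh].
- by rewrite /pullback (char0 ch); rewrite addr0 (char0 ch) in h1.
- by rewrite addr0 (char0 ch) in h2.
have := h3 h hh; rewrite addr0 (char0 ch) /pullback.
by rewrite -(charD ch) [h + t]addrC.
Qed.

Let W_blip t j l : `|t| <= T -> blip (fun x => W t x j l).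
Proof.
move=> tT; exists C => //; split=> [x|x y].
  by rewrite (le_trans (mx_norm_entry _ _ _))// (charW_bound ch).
by rewrite -mx_entryB (le_trans (mx_norm_entry _ _ _))// (charW_lip ch).
Qed.

Let comp_phi_blip t f : blip f -> blip (fun x => f (phi t x)).
Proof.
move=> bf; apply: (@blip_comp _ f (phi t) (expR (`|t| * L))) => //.
by move=> x y; exact: (char_lip ch).
Qed.

Lemma pullback_blip t l : `|t| <= T -> blip (pullback t l).
Proof.
move=> tT; apply: blipM; last exact: W_blip.
by apply: comp_phi_blip; exact: test_function_blip.
Qed.

Let mulmx_blip (A B : plane R -> 'M[R]_m) : (forall j l, blip (fun x => A x j l)) ->
  (forall j l, blip (fun x => B x j l)) -> forall j l, blip (fun x => (A x *m B x) j l).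
Proof.
move=> bA bB j l; under eq_fun do rewrite mxE.
by apply: blip_sum => q; exact: blipM.
Qed.

Let wpull_blip t l : `|t| <= T -> blip (wpull t l).
Proof.
move=> tT; apply: blipD; apply: blipM.
- by apply: comp_phi_blip; exact: vfield_blip.
- exact: W_blip.
- by apply: comp_phi_blip; exact: test_function_blip.
under eq_fun do rewrite mx_entryB; apply: blipD; last apply: blipN.
  by apply: mulmx_blip => // j q; exact: W_blip.
apply: mulmx_blip => j q; last exact: W_blip.
by apply: (@comp_phi_blip t (fun x => Ht x j q)).
Qed.

Let weak_pull t r : `|t| <= T -> r < r' -> (forall x, r < `|x| -> g (phi t x) = 0) ->
  forall l, weak_form Ht Kt al be s u l (wpull t l) (pullback t l) = 0.
Proof.
move=> tT rr' g0 l.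
have [Lp Lp0 [_ pL]] := pullback_blip l tT.
have [D D0 hD] := utaylor_pull_flow l tT.
apply: (@weak_eq_ext R m k bt Ht Kt al be s u b1 b2 HH KK ss uu _ _ r r' (Lp * C + D)) => //.
- exact: pullback_blip.
- exact: wpull_blip.
- by move=> x rx; rewrite /pullback g0// mul0r.
move=> x h h1; have [_ _ /(_ h h1)] := hD x (PTI x); rewrite (char0 ch) => E.
(* The derivative is known along the flow, whereas [weak_eq_ext] asks for it along the straight
   line. The two points differ by O(h^2), and the pullback is Lipschitz. *)
have -> : pullback t l (x + h *: bt x) - pullback t l x - h * wpull t l x =
  (pullback t l (x + h *: bt x) - pullback t l (phi h x)) +
  (pullback t l (phi h x) - pullback t l x - h * wpull t l x) by ring.
rewrite (le_trans (ler_normD _ _))// mulrDl lerD//.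
rewrite (le_trans (pL _ _))// -mulrA ler_wpM2l// distrC.
have := char_exp ch 0 h x; rewrite add0r (char0 ch).
by rewrite opprD addrA.
Qed.

Definition pairing t := \sum_l \int[al]_x (pullback t l x * s x l 0).

Definition coupling t := \sum_l \sum_j \int[be]_x (Kt x l j * pullback t l x * u x j 0).

Let bpull t l : `|t| <= T -> bmeas (pullback t l).
Proof. by move=> tT; apply: blip_bmeas; exact: pullback_blip. Qed.

Let dpull_blip t l : `|t| <= T -> blip (dpull t l).
Proof.
move=> tT; apply: blipD; apply: blipM.
- by apply: comp_phi_blip; exact: vfield_blip.
- exact: W_blip.
- by apply: comp_phi_blip; exact: test_function_blip.
apply: blipN; apply: mulmx_blip => j q; last exact: W_blip.
by apply: (@comp_phi_blip t (fun x => Ht x j q)).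
Qed.

(** The derivative of the pullback along b exceeds its derivative in time by a term containing W H.
    After summation over l and an exchange of the two sums, this term cancels the zeroth-order term
    of the equation, and only the coupling with the other measure survives. *)
Let dpairing t r : `|t| <= T -> r < r' -> (forall x, r < `|x| -> g (phi t x) = 0) ->
  \sum_l \int[al]_x (dpull t l x * s x l 0) = coupling t.
Proof.
move=> tT rr' g0; have := weak_pull tT rr' g0.
have bH j l := blip_bmeas (HH j l).
have bp l := bpull l tT; have bd l := blip_bmeas (dpull_blip l tT).
have Es l : \int[al]_x (wpull t l x * s x l 0) =
    \int[al]_x (dpull t l x * s x l 0) + \sum_j \int[al]_x (Ht x j l * pullback t j x * s x l 0).
  rewrite -bRint_sum; last by move=> j; apply: bmeasM => //; exact: bmeasM.
  rewrite -bRintD; [|exact: bmeasM|by apply: bmeas_sum => j; apply: bmeasM => //; exact: bmeasM].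
  apply: eq_Rintegral => x _; rewrite -mulr_suml -mulrDl; congr (_ * _).
  rewrite /wpull /dpull mx_entryB mulrDr addrA addrAC; congr (_ + _).
  rewrite mxE mulr_sumr; apply: eq_bigr => j _; rewrite /pullback; ring.
move=> w; have : \sum_l weak_form Ht Kt al be s u l (wpull t l) (pullback t l) = 0.
  by rewrite big1.
rewrite /weak_form big_split/= big_split/= sumrN.
have -> : \sum_l \int[al]_x (wpull t l x * s x l 0) =
    \sum_l (\int[al]_x (dpull t l x * s x l 0) + \sum_j \int[al]_x (Ht x j l * pullback t j x * s x l 0)).
  by apply: eq_bigr => l _; exact: Es.
rewrite big_split/= opprD -addrA [X in _ + (- X + _)]exchange_big/= addKr.
by move/eqP; rewrite addrC subr_eq0 => /eqP <-.
Qed.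

Let pull_bounded l : exists2 D, 0 <= D & forall t x, `|t| <= T -> `|pullback t l x| <= D.
Proof.
have [G G0 hG] := test_function_bounded tg; exists (G * C); first exact: mulr_ge0.
move=> t x tT; rewrite normrM ler_pM// (le_trans (mx_norm_entry _ _ _))//.
exact: (charW_bound ch).
Qed.

Lemma pairing_taylor r : r < r' -> exists2 D, 0 <= D & forall t h, `|t| + 1 <= T -> `|h| <= 1 ->
  (forall x, r < `|x| -> g (phi t x) = 0) ->
  `|pairing (t + h) - pairing t - h * coupling t| <= D * h ^+ 2.
Proof.
move=> rr'.
have /choice[D hD] : forall l, exists D, 0 <= D /\ forall t h x, `|t| <= T -> `|h| <= 1 ->
    `|pullback (t + h) l x - pullback t l x - h * dpull t l x| <= D * h ^+ 2.
  move=> l; have [D D0 hD] := utaylor_pull l; exists D; split=> // t h x tT h1.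
  by have [_ _ /(_ h h1)] := hD (t, x) tT; rewrite /= addr0.
have /choice[S hS] : forall l, exists S, 0 <= S /\ forall x, `|s x l 0| <= S.
  by move=> l; have [S S0 hS] := bmeas_bound (ss l); exists S.
pose mu := fine (al setT); have mu0 : 0 <= mu by exact: fine_ge0.
exists (\sum_l D l * S l * mu).
  by apply: sumr_ge0 => l _; rewrite !mulr_ge0//; [case: (hD l)|case: (hS l)].
move=> t h tT1 h1 g0.
have tT : `|t| <= T by rewrite (le_trans _ tT1)// lerDl.
have thT : `|t + h| <= T by rewrite (le_trans (ler_normD _ _))// (le_trans _ tT1)// lerD2l.
rewrite -(dpairing tT rr' g0) /pairing mulr_sumr -!sumrB mulr_suml (le_trans (ler_norm_sum _ _ _))//.
apply: ler_sum => l _.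
have bp := bpull l tT; have bq := bpull l thT; have bd := blip_bmeas (dpull_blip l tT).
have -> : \int[al]_x (pullback (t + h) l x * s x l 0) - \int[al]_x (pullback t l x * s x l 0) -
    h * \int[al]_x (dpull t l x * s x l 0) =
    \int[al]_x ((pullback (t + h) l x - pullback t l x - h * dpull t l x) * s x l 0).
  rewrite -bRintZ; last exact: bmeasM.
  rewrite -bRintB; try exact: bmeasM.
  rewrite -bRintB; [|by apply: bmeasB; exact: bmeasM|by apply: bmeasZ; exact: bmeasM].
  by apply: eq_Rintegral => x _; rewrite mulrBl mulrBl mulrA.
rewrite (_ : D l * S l * mu * h ^+ 2 = D l * h ^+ 2 * S l * mu); last by ring.
apply: bRint_bound.
  by apply: bmeasM => //; apply: bmeasB; [exact: bmeasB|exact: bmeasZ].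
move=> x; rewrite normrM; apply: ler_pM => //; last by case: (hS l).
by have [_] := hD l; exact.
Qed.

Lemma coupling_lip : exists2 D, 0 <= D & forall t h, `|t| + 1 <= T -> `|h| <= 1 ->
  `|coupling (t + h) - coupling t| <= D * `|h|.
Proof.
have /choice[D hD] : forall l, exists D, 0 <= D /\ forall t h x, `|t| <= T -> `|h| <= 1 ->
    `|pullback (t + h) l x - pullback t l x| <= D * `|h|.
  move=> l; have [D D0 hD] := utaylor_lip (utaylor_pull l); exists D; split=> // t h x tT h1.
  by have := hD (t, x) h tT h1; rewrite /= addr0.
have bK l j : bmeas (fun x => Kt x l j * u x j 0) by apply: bmeasM => //; exact: blip_bmeas.
have /choice[S hS] : forall p : 'I_m * 'I_k, exists S, 0 <= S /\ forall x, `|Kt x p.1 p.2 * u x p.2 0| <= S.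
  by move=> p; have [S S0 hS] := bmeas_bound (bK p.1 p.2); exists S.
pose mu := fine (be setT); have mu0 : 0 <= mu by exact: fine_ge0.
exists (\sum_l \sum_j D l * S (l, j) * mu).
  by apply: sumr_ge0 => l _; apply: sumr_ge0 => j _; rewrite !mulr_ge0//; [case: (hD l)|case: (hS (l, j))].
move=> t h tT1 h1.
have tT : `|t| <= T by rewrite (le_trans _ tT1)// lerDl.
have thT : `|t + h| <= T by rewrite (le_trans (ler_normD _ _))// (le_trans _ tT1)// lerD2l.
rewrite /coupling -!sumrB mulr_suml (le_trans (ler_norm_sum _ _ _))//.
apply: ler_sum => l _; rewrite -!sumrB mulr_suml (le_trans (ler_norm_sum _ _ _))//.
apply: ler_sum => j _.
have bp := bpull l tT; have bq := bpull l thT; have bKt := blip_bmeas (KK l j).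
rewrite -bRintB; try by apply: bmeasM => //; exact: bmeasM.
rewrite (_ : D l * S (l, j) * mu * `|h| = D l * `|h| * S (l, j) * mu); last by ring.
apply: bRint_bound; first by apply: bmeasB; apply: bmeasM => //; exact: bmeasM.
move=> x; have -> : Kt x l j * pullback (t + h) l x * u x j 0 - Kt x l j * pullback t l x * u x j 0 =
  (pullback (t + h) l x - pullback t l x) * (Kt x l j * u x j 0) by ring.
rewrite normrM; apply: ler_pM => //; last by have [_] := hS (l, j); exact.
by have [_] := hD l; exact.
Qed.

End duhamel.

(** * Push-forwards, sums and products of finite measures *)

Section finite_measure_operations.
Context {R : realType}.

Section push.
Context d1 d2 (T1 : measurableType d1) (T2 : measurableType d2).
Variables (m : {finite_measure set T1 -> \bar R}) (f : T1 -> T2).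
Hypothesis mf : measurable_fun setT f.

(** The proof of measurability is an argument, so that the measure structure can be attached to the
    term itself. *)
Definition fpush of measurable_fun setT f : set T2 -> \bar R := fun A => m (f @^-1` A).

Let mpre A : measurable A -> measurable (f @^-1` A).
Proof. by move=> mA; rewrite -[X in measurable X]setTI; exact: mf. Qed.

Let fpush0 : fpush mf set0 = 0%E.
Proof. by rewrite /fpush preimage_set0 measure0. Qed.

Let fpush_ge0 A : (0 <= fpush mf A)%E. Proof. exact: measure_ge0. Qed.

Let fpush_sigma : semi_sigma_additive (fpush mf).
Proof.
move=> F mF tF mUF; rewrite /fpush preimage_bigcup.
apply: measure_semi_sigma_additive.
- by move=> n; exact: mpre.
- apply/trivIsetP => /= i j _ _ ij; rewrite -preimage_setI.
  by move/trivIsetP : tF => /(_ _ _ _ _ ij) ->//; rewrite preimage_set0.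
- by rewrite -preimage_bigcup; exact: mpre.
Qed.

HB.instance Definition _ := isMeasure.Build _ _ _ (fpush mf) fpush0 fpush_ge0 fpush_sigma.

Let fpush_fin : fin_num_fun (fpush mf).
Proof. by move=> A mA; apply: fin_num_measure; exact: mpre. Qed.

HB.instance Definition _ := Measure_isFinite.Build _ _ _ (fpush mf) fpush_fin.

Lemma bRint_push (g : T2 -> R) : bmeas g -> \int[fpush mf]_y g y = \int[m]_x g (f x).
Proof.
move=> bg; rewrite /Rintegral; congr fine.
have mg : measurable_fun setT (EFin \o g) by apply/measurable_EFinP; case: bg.
have ig : m.-integrable (f @^-1` setT) ((EFin \o g) \o f).
  rewrite preimage_setT; apply: bmeas_integrable; case: bg => mg' [C hC].
  by split; [exact: measurableT_comp|exists C => x; exact: hC].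
by have := integral_pushforward mf mg ig measurableT; rewrite preimage_setT.
Qed.

End push.

Section add.
Context d (T : measurableType d) (m1 m2 : {finite_measure set T -> \bar R}).

Definition fadd : set T -> \bar R := measure_add m1 m2.

HB.instance Definition _ := Measure.on fadd.

Let fadd_fin : fin_num_fun fadd.
Proof. by move=> A mA; rewrite /fadd measure_addE fin_numD !fin_num_measure. Qed.

HB.instance Definition _ := Measure_isFinite.Build _ _ _ fadd fadd_fin.

Lemma bRint_add (g : T -> R) : bmeas g -> (forall x, 0 <= g x) ->
  \int[fadd]_y g y = \int[m1]_x g x + \int[m2]_x g x.
Proof.
move=> bg g0; apply: EFin_inj; rewrite EFinD !bRint_EFin// ge0_integral_measure_add//.
  by move=> x _; rewrite lee_fin.
by apply/measurable_EFinP; case: bg.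
Qed.

End add.

Section product.
Context d1 d2 (T1 : measurableType d1) (T2 : measurableType d2).
Variables (m1 : {finite_measure set T1 -> \bar R}) (m2 : {finite_measure set T2 -> \bar R}).

Definition fprod : set (T1 * T2) -> \bar R := product_measure1 m1 m2.

HB.instance Definition _ := Measure.on fprod.

Let fprod_fin : fin_num_fun fprod.
Proof.
move=> A mA; rewrite ge0_fin_numE//.
apply: (@le_lt_trans _ _ (fprod setT)); first by apply: le_measure; rewrite ?inE.
by rewrite -setXTT /fprod product_measure1E// lte_mul_pinfty// ?fin_num_measure// ltey_eq fin_num_measure.
Qed.

HB.instance Definition _ := Measure_isFinite.Build _ _ _ fprod fprod_fin.

Lemma bmeas_xsection (g : T1 * T2 -> R) x : bmeas g -> bmeas (fun y => g (x, y)).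
Proof.
move=> [mg [C hC]]; split; last by exists C.
by apply: (measurableT_comp mg); exact: measurable_pair1.
Qed.

Lemma bmeas_ysection (g : T1 * T2 -> R) y : bmeas g -> bmeas (fun x => g (x, y)).
Proof.
move=> [mg [C hC]]; split; last by exists C.
by apply: (measurableT_comp mg); exact: measurable_pair2.
Qed.

Lemma bmeas_Rint (g : T1 * T2 -> R) : bmeas g -> (forall z, 0 <= g z) ->
  bmeas (fun x => \int[m2]_y g (x, y)).
Proof.
move=> bg g0; split.
  have : measurable_fun setT (fun x => \int[m2]_y (g (x, y))%:E)%E.
    apply: (@measurable_fun_fubini_tonelli_F _ _ _ _ _ m2 (EFin \o g)).
      by apply/measurable_EFinP; case: bg.
    by move=> z; rewrite lee_fin.
  by move=> /(measurableT_comp (@fine_measurable R setT measurableT)).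
have [_ [C hC]] := bg; exists (C * fine (m2 setT)) => x.
by apply: bRint_bound => //; exact: bmeas_xsection.
Qed.

Lemma bRint_fprod (g : T1 * T2 -> R) : bmeas g -> (forall z, 0 <= g z) ->
  \int[fprod]_z g z = \int[m1]_x \int[m2]_y g (x, y).
Proof.
move=> bg g0; apply: EFin_inj; rewrite !bRint_EFin//; last exact: bmeas_Rint.
rewrite -[LHS]/(\int[product_measure1 m1 m2]_z (EFin \o g) z)%E fubini_tonelli1//.
- by apply: eq_integral => x _; rewrite bRint_EFin//; exact: bmeas_xsection.
- by apply/measurable_EFinP; case: bg.
Qed.

Lemma bRint_fprod2 (g : T1 * T2 -> R) : bmeas g -> (forall z, 0 <= g z) ->
  (\int[fprod]_z (g z)%:E = \int[m2]_y (\int[m1]_x g (x, y))%:E)%E.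
Proof.
move=> bg g0.
rewrite -[LHS]/(\int[product_measure1 m1 m2]_z (EFin \o g) z)%E fubini_tonelli1//; first 1 last.
- by apply/measurable_EFinP; case: bg.
rewrite [LHS](fubini_tonelli (m1 := m1) (m2 := m2) (EFin \o g)).
- by apply: eq_integral => x _; rewrite bRint_EFin//; exact: bmeas_ysection.
- by apply/measurable_EFinP; case: bg.
- by move=> z; rewrite lee_fin.
Qed.

End product.

End finite_measure_operations.

Lemma ge0_integral_mfrestr {R : realType} d (T : measurableType d)
    (m : {measure set T -> \bar R}) (D : set T) (mD : measurable D) (mDoo : (m D < +oo)%E)
    (f : T -> \bar R) : measurable_fun setT f -> (forall x, 0 <= f x)%E ->
  (\int[mfrestr mD mDoo]_x f x = \int[m]_(x in D) f x)%E.
Proof.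
move=> mf f0; rewrite -(setUv D) ge0_integral_setU//=; first last.
- by rewrite disj_set2E setICr.
- by rewrite setUv.
- exact: measurableC.
rewrite [X in (_ + X)%E]null_set_integral ?adde0//; first last.
- by rewrite -[LHS]/(m (~` D `&` D)) setICl measure0.
- exact: measurable_funTS.
- exact: measurableC.
apply: eq_measure_integral => A mA AD.
by rewrite -[LHS]/(m (A `&` D)) setIidl.
Qed.

Section fundamental_theorem.
Context {R : realType}.

Lemma is_derive_quadratic_near (f : R -> R) (t d C : R) :
  (forall h, `|h| <= 1 -> `|f (t + h) - f t - h * d| <= C * h ^+ 2) -> is_derive t (1 : R) f d.
Proof.
move=> hf; pose f' u := if `|u - t| <= 1 then f u else f t + (u - t) * d.
have f't : f' t = f t by rewrite /f' subrr normr0 ler01.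
have : is_derive t (1 : R) f' d.
  apply: (@is_derive_quadratic _ _ _ _ _ `|C|) => h; rewrite f't /f' [t + h - t]addrAC subrr add0r.
  case: ifPn => h1.
    by rewrite (le_trans (hf h h1))// ler_wpM2r ?sqr_ge0// ler_norm.
  by rewrite /GRing.scale/= [f t + _ - f t]addrAC subrr add0r subrr normr0 mulr_ge0// sqr_ge0.
apply: near_eq_is_derive.
near=> u; have ut : `|u - t| <= 1; last by rewrite /f' ut.
rewrite distrC; near: u.
by apply: (@cvgr_dist_le _ _ _ _ _ idfun t) => //; exact: cvg_id.
Unshelve. all: by end_near. Qed.

(** The derivative k is continuous by its Lipschitz bound, but the majorant g is only asked to be
    measurable: it will be a space integral depending on t. *)
Lemma FTC_bound (f k g : R -> R) a b D : a < b ->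
  (forall t h, a <= t <= b -> `|h| <= 1 -> `|f (t + h) - f t - h * k t| <= D * h ^+ 2) ->
  (forall t h, a <= t <= b -> `|h| <= 1 -> `|k (t + h) - k t| <= D * `|h|) ->
  measurable_fun setT g -> (forall t, 0 <= g t) -> (forall t, a <= t <= b -> `|k t| <= g t) ->
  (`|f b - f a|%:E <= \int[leb]_(t in `[a, b]) (g t)%:E)%E.
Proof.
move=> ab hf hk mg g0 kg.
have df t : a <= t <= b -> is_derive t (1 : R) f (k t).
  by move=> tab; apply: (@is_derive_quadratic_near _ _ _ D) => h; exact: hf.
have cf t : a <= t <= b -> {for t, continuous f}.
  by move=> /df[d _]; apply: differentiable_continuous; exact/derivable1_diffP.
have aab : a <= a <= b by rewrite lexx ltW.
have bab : a <= b <= b by rewrite lexx ltW.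
have ck : {within `[a, b], continuous k}.
  apply: continuous_in_subspaceT => t; rewrite inE /= in_itv/= => tab.
  apply: (@continuous_at_lipschitz _ R R k t D) => y yt.
  by have := hk t (y - t) tab yt; rewrite [t + _]addrC subrK.
have E : (\int[@lebesgue_measure R]_(t in `[a, b]) (k t)%:E = (f b)%:E - (f a)%:E)%E.
  apply: continuous_FTC2 => //.
  - split.
    + by move=> t; rewrite in_itv/= => /andP[h1 h2]; have [] := df t; rewrite ?(ltW h1) ?(ltW h2).
    + exact: cvg_at_right_filter (cf a aab).
    + exact: cvg_at_left_filter (cf b bab).
  - move=> t; rewrite in_itv/= => /andP[h1 h2]; rewrite derive1E.
    by have [] := df t; rewrite ?(ltW h1) ?(ltW h2).
have mk : measurable_fun (`[a, b] : set (measurableTypeR R)) k by exact: subspace_continuous_measurable_fun.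
rewrite -abse_EFin EFinB -E (le_trans (le_abse_integral _ _ _))//; first exact/measurable_EFinP.
apply: (@le_trans _ _ (\int[@lebesgue_measure R]_(t in `[a, b]) (g t)%:E)%E).
  apply: ge0_le_integral => //.
  - by apply: measurableT_comp => //; exact/measurable_EFinP.
  - apply/measurable_EFinP; exact: (@measurable_funTS _ _ R R `[a, b]%classic g mg).
(* The identity map carries [lebesgue_measure] to [leb], which differ only by the measurable
   structure on the line. *)
have mid : @measurable_fun _ _ (measurableTypeR R) R setT id by move=> _ A mA; rewrite setTI.
have := @ge0_integral_pushforward _ _ (measurableTypeR R) R R id mid (@lebesgue_measure R) `[a, b]%classic (EFin \o g).
move=> h; rewrite -[leLHS]h//.
- by apply/measurable_EFinP; exact: measurable_funTS.
- by move=> t _; rewrite lee_fin.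
Qed.

End fundamental_theorem.

Section sweep.
Context {R : realType}.

Lemma leb_itv_lty (a b : R) : (leb `[a, b]%classic < +oo)%E.
Proof.
have [ab|ba] := leP a b; first by rewrite leb_itv// ltry.
by rewrite set_itv_ge ?measure0// bnd_simp -ltNge.
Qed.

Definition lebI (a b : R) : set R -> \bar R :=
  mfrestr (measurable_itv `[a, b]) (leb_itv_lty a b).

HB.instance Definition _ a b := Measure.on (lebI a b).
HB.instance Definition _ a b := FiniteMeasure.on (lebI a b).

Lemma measurable_flow (phi : R -> plane R -> plane R) M L : 0 <= M ->
  (forall s t x, `|phi t x - phi s x| <= `|t - s| * M) ->
  (forall t x y, `|phi t x - phi t y| <= expR (`|t| * L) * `|x - y|) ->
  measurable_fun setT (fun z : R * plane R => phi z.1 z.2).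
Proof.
move=> M0 phiT phiL.
have cphi : continuous (fun z : R * plane R => phi z.1 z.2).
  move=> z; apply: (@continuous_at_lipschitz _ (R * plane R)%type (plane R) _ z (M + expR (`|z.1| * L))) => y _.
  rewrite -(subrKA (phi z.1 y.2)) (le_trans (ler_normD _ _))// [leRHS]mulrDl; apply: lerD.
    by rewrite (le_trans (phiT _ _ _))// mulrC ler_wpM2l// prod_normE le_max lexx.
  by rewrite (le_trans (phiL _ _ _))// ler_wpM2l ?expR_ge0// prod_normE le_max lexx orbT.
have E : (fun z : R * plane R => phi z.1 z.2) = (fun z => ((phi z.1 z.2).1, (phi z.1 z.2).2)).
  by apply/funext => z; case: (phi _ _).
rewrite E; apply: measurable_fun_pair; apply: continuous_measurable_Rplane => z;
  apply: (continuous_comp (cphi z)); [exact: cvg_fst|exact: cvg_snd].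
Qed.

End sweep.

(** One of the two equations on a box: al is the measure transported along b, with direction s, and
    be is the measure that enters through the coupling K. The other equation has the two roles
    exchanged. *)
Record transport_system {R : realType} {m k : nat} (b : plane R -> plane R)
    (H : plane R -> 'M[R]_m) (K : plane R -> 'M[R]_(m, k))
    (al be : {finite_measure set (plane R) -> \bar R})
    (s : plane R -> 'cV[R]_m) (u : plane R -> 'cV[R]_k) (r T : R)
    (phi : R -> plane R -> plane R) (W : R -> plane R -> 'M[R]_m) (L M C : R) : Prop :=
  TransportSystem {
  ts_char : characteristics b H r T phi W L M C ;
  ts_T1 : 1 <= T ;
  ts_b1 : blip (fun x => (b (clip2 r x)).1) ;
  ts_b2 : blip (fun x => (b (clip2 r x)).2) ;
  ts_H : forall i j, blip (fun x => H (clip2 r x) i j) ;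
  ts_K : forall i j, blip (fun x => K (clip2 r x) i j) ;
  ts_s : forall i, bmeas (fun x => s x i 0) ;
  ts_u : forall i, bmeas (fun x => u x i 0) ;
  ts_weak : weak_eq (fun x => b (clip2 r x)) (fun x => H (clip2 r x)) (fun x => K (clip2 r x))
    al be s u r }.

Section transport.
Context {R : realType} {m k : nat}.
Variables (b : plane R -> plane R) (H : plane R -> 'M[R]_m) (K : plane R -> 'M[R]_(m, k)).
Variables (al be : {finite_measure set (plane R) -> \bar R}).
Variables (s : plane R -> 'cV[R]_m) (u : plane R -> 'cV[R]_k).
Variables (r' T : R) (phi : R -> plane R -> plane R) (W : R -> plane R -> 'M[R]_m) (L M C : R).
Hypothesis ts : transport_system b H K al be s u r' T phi W L M C.
Implicit Types (x y : plane R).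

Let ch := ts_char ts.

Lemma char_measurable : measurable_fun setT (fun z : R * plane R => phi z.1 z.2).
Proof. exact: (measurable_flow (char_M0 ch) (char_time ch) (char_lip ch)). Qed.

Lemma char_measurable_at t : measurable_fun setT (phi t).
Proof.
exact: (measurableT_comp char_measurable (measurable_pair1 t)).
Qed.

(** Integral over the times t in [a, c] of the push-forwards of be by phi_t. This is the measure for
    which the integral of |g| bounds the accumulated effect of the coupling. *)
Definition sweep (a c : R) : set (plane R) -> \bar R := fpush (fprod (lebI a c) be) char_measurable.

HB.instance Definition _ a c := Measure.on (sweep a c).
HB.instance Definition _ a c := FiniteMeasure.on (sweep a c).

Lemma bRint_sweep a c (f : plane R -> R) : bmeas f -> (forall x, 0 <= f x) ->
  (\int[sweep a c]_x f x)%:E = (\int[leb]_(t in `[a, c]) (\int[be]_x f (phi t x))%:E)%E.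
Proof.
move=> bf f0.
have bF : bmeas (fun z : R * plane R => f (phi z.1 z.2)).
  by case: bf => mf [D hD]; split; [exact: measurableT_comp mf char_measurable|exists D].
rewrite /sweep bRint_push// bRint_fprod//.
have bG := bmeas_Rint be bF (fun z => f0 _).
rewrite bRint_EFin// ge0_integral_mfrestr//.
  by apply/measurable_EFinP; case: bG.
by move=> t; rewrite lee_fin; exact: bRint_ge0.
Qed.

Lemma sweep0P a c (B : set (plane R)) : measurable B ->
  {ae leb, forall t : R, a <= t <= c -> be (phi t @^-1` B) = 0%E} -> sweep a c B = 0%E.
Proof.
move=> mB h; have bB := bmeas_indic R mB.
rewrite -(bRint_indic _ mB) bRint_sweep//.
apply/eqP; rewrite eq_le; apply/andP; split; last first.
  by apply: integral_ge0 => t _; rewrite lee_fin; exact: bRint_ge0.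
have bF : bmeas (fun z : R * plane R => \1_B (phi z.1 z.2) : R).
  by case: bB => mf [D hD]; split; [exact: measurableT_comp mf char_measurable|exists D].
rewrite (ae_eq_integral (cst 0%E))//.
- by rewrite integral0.
- apply: measurable_funTS; apply/measurable_EFinP.
  by case: (bmeas_Rint be bF (fun z => _)) => // z; rewrite indicE.
apply: filterS h => t ht; rewrite /= in_itv/= => tac.
have mt : measurable (phi t @^-1` B).
  by rewrite -[X in measurable X]setTI; exact: char_measurable_at.
by rewrite (_ : (fun x => \1_B (phi t x)) = \1_(phi t @^-1` B))// bRint_indic// ht.
Qed.

Lemma coupling_bound : exists2 D, 0 <= D & forall g i t, test_function g -> `|t| <= T ->
  `|coupling K be u r' phi W g i t| <= D * \int[be]_x `|g (phi t x)|.
Proof.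
have bK l j : bmeas (fun x => K (clip2 r' x) l j * u x j 0).
  by apply: bmeasM; [exact/blip_bmeas/(ts_K ts)|exact: (ts_u ts)].
have /choice[S hS] : forall p : 'I_m * 'I_k, exists S, 0 <= S /\
    forall x, `|K (clip2 r' x) p.1 p.2 * u x p.2 0| <= S.
  by move=> p; have [S S0 hS] := bmeas_bound (bK p.1 p.2); exists S.
have C0 := char_C0 ch.
exists (\sum_l \sum_j S (l, j) * C).
  by apply: sumr_ge0 => l _; apply: sumr_ge0 => j _; rewrite mulr_ge0//; case: (hS (l, j)).
move=> g i t tg tT; rewrite /coupling.
have bp l := blip_bmeas (pullback_blip ch i tg l tT).
have bg : bmeas (fun x => `|g (phi t x)|).
  apply: bmeas_norm; have [mg [D hD]] := blip_bmeas (test_function_blip tg).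
  by split; [exact: measurableT_comp mg (char_measurable_at t)|exists D].
rewrite mulr_suml (le_trans (ler_norm_sum _ _ _))//.
apply: ler_sum => l _; rewrite mulr_suml (le_trans (ler_norm_sum _ _ _))//.
apply: ler_sum => j _.
rewrite -bRintZ//; apply: bRint_norm_le.
- by apply: bmeasM; [apply: bmeasM => //; exact/blip_bmeas/(ts_K ts)|exact: (ts_u ts)].
- exact: bmeasZ.
move=> x; rewrite mulrAC normrM -mulrA [leRHS]mulrA -[leRHS]mulrA; apply: ler_pM => //.
  by have [_] := hS (l, j); exact.
rewrite /pullback normrM mulrC ler_wpM2r// (le_trans (mx_norm_entry _ _ _))//.
exact: (charW_bound ch).
Qed.

(** Integrates the derivative of the pairing, which is the coupling, over [a, c]. The constant does
    not depend on g, so the bound survives when g approaches an indicator. *)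
Lemma pairing_sweep r : r < r' -> exists2 D, 0 <= D & forall g i a c, test_function g ->
  a < c -> `|a| + 1 <= T -> `|c| + 1 <= T ->
  (forall t x, a <= t <= c -> r < `|x| -> g (phi t x) = 0) ->
  `|pairing al s phi W g i c - pairing al s phi W g i a| <= D * \int[sweep a c]_x `|g x|.
Proof.
move=> rr'; have [D D0 hD] := coupling_bound; exists D => // g i a c tg ac aT cT g0.
have tT t : a <= t <= c -> `|t| + 1 <= T.
  move=> /andP[h1 h2]; rewrite -lerBrDr ler_norml; apply/andP; split.
    by rewrite (le_trans _ h1)// lerNl lerBrDr (le_trans _ aT)// lerD2r -normrN ler_norm.
  by rewrite (le_trans h2)// lerBrDr (le_trans _ cT)// lerD2r ler_norm.
have tT' t : a <= t <= c -> `|t| <= T by move=> /tT; apply: le_trans; rewrite lerDl.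
have [A A0 hA] := pairing_taylor ch (ts_T1 ts) (ts_b1 ts) (ts_b2 ts) (ts_H ts) (ts_K ts)
  (ts_s ts) (ts_u ts) (ts_weak ts) i tg rr'.
have [E E0 hE] := coupling_lip be ch (ts_b1 ts) (ts_b2 ts) (ts_H ts) (ts_K ts) (ts_u ts) i tg.
have bg : bmeas (fun x => `|g x|) by apply: bmeas_norm; exact/blip_bmeas/test_function_blip.
have bF : bmeas (fun z : R * plane R => `|g (phi z.1 z.2)|).
  by case: bg => mf [B hB]; split; [exact: measurableT_comp mf char_measurable|exists B => z; exact: hB].
have bG := bmeas_Rint be bF (fun z => normr_ge0 _).
rewrite -lee_fin EFinM bRint_sweep// -ge0_integralZl//=.
- apply: (@FTC_bound _ _ (coupling K be u r' phi W g i) _ _ _ (A + E)) => //.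
  + move=> t h tac h1; rewrite (le_trans (hA t h (tT _ tac) h1 (fun x => g0 t x tac)))//.
    by rewrite ler_wpM2r ?sqr_ge0// lerDl.
  + by move=> t h tac h1; rewrite (le_trans (hE t h (tT _ tac) h1))// ler_wpM2r// lerDr.
  + by case: (bmeasZ D bG).
  + by move=> t; rewrite mulr_ge0//; exact: bRint_ge0.
  + by move=> t tac; apply: hD => //; exact: tT'.
- by apply: measurable_funTS; apply/measurable_EFinP; case: bG.
- by move=> t _; rewrite lee_fin; exact: bRint_ge0.
Qed.

(** A function g supported here has all pullbacks g(phi_t), for t in [a, c], supported in the box of
    radius r, as the weak equation requires. The set is open, so [test_approx] applies to its Borel
    subsets. *)
Definition confined (a c r : R) : set (plane R) :=
  [set y | forall t, a <= t <= c -> `|phi (- t) y| < r].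

Lemma confined_open a c r : a <= c -> open (confined a c r).
Proof.
move=> ac; rewrite openE => y yG.
have cf : {within `[a, c], continuous (fun t => `|phi (- t) y|)}.
  apply: continuous_subspaceT => t.
  apply: (@continuous_at_lipschitz _ R R _ t M) => t' _.
  rewrite (le_trans (ler_dist_dist _ _))// (le_trans (char_time ch _ _ _))//.
  by rewrite mulrC -opprD normrN.
have [t0] := EVT_max ac cf; rewrite in_itv/= => t0ac hmax.
pose A := Num.max `|a| `|c|.
pose eta := (r - `|phi (- t0) y|) / (expR (A * `|L|) + 1).
have e1 : 0 < expR (A * `|L|) + 1 by rewrite ltr_wpDl// expR_ge0.
have eta0 : 0 < eta by rewrite divr_gt0// subr_gt0 yG.
apply/nbhs_ballP; exists eta => // z; rewrite -ball_normE/= => yz t tac.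
have tA : `|t| <= A.
  move: tac => /andP[h1 h2]; rewrite ler_norml /A; apply/andP; split.
    by rewrite (le_trans _ h1)// lerNl le_max -normrN ler_norm.
  by rewrite (le_trans h2)// le_max ler_norm orbT.
have E : `|phi (- t) z - phi (- t) y| < r - `|phi (- t0) y|.
  rewrite (le_lt_trans (char_lip ch _ _ _))//.
  apply: (@le_lt_trans _ _ (expR (A * `|L|) * `|z - y|)).
    rewrite ler_wpM2r// ler_expR normrN.
    by rewrite (@le_trans _ _ (`|t| * `|L|))// ?ler_wpM2l ?ler_wpM2r ?ler_norm.
  apply: (@le_lt_trans _ _ ((expR (A * `|L|) + 1) * `|z - y|)).
    by rewrite ler_wpM2r// lerDl.
  by rewrite mulrC -ltr_pdivlMr// distrC.
have tac' : t \in `[a, c] by rewrite in_itv.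
rewrite -[phi (- t) z](subrK (phi (- t) y)) (le_lt_trans (ler_normD _ _))//.
by rewrite -ltrBrDr (lt_le_trans E)// lerD2l lerN2 hmax.
Qed.

Lemma confined_box a c r : a <= c -> confined a c r `<=` box (r + `|a| * M).
Proof.
move=> ac y yG; have aac : a <= a <= c by rewrite lexx.
have := yG _ aac; rewrite /box/= => h.
have := char_time ch (- a) 0 y; rewrite (char0 ch) sub0r opprK => h2.
rewrite -[y](subrK (phi (- a) y)) (le_trans (ler_normD _ _))// addrC lerD// ltW//.
Qed.

(** The i-th component, at B, of the push-forward by phi_t of the vector measure with density W_t s
    with respect to al. *)
Definition carried i (B : set (plane R)) t : R :=
  \sum_l \int[al]_x (\1_B (phi t x) * W t x i l * s x l 0).

Let bcomp_phi t (f : plane R -> R) : bmeas f -> bmeas (fun x => f (phi t x)).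
Proof.
by move=> [mf [D hD]]; split; [exact: measurableT_comp mf (char_measurable_at t)|exists D].
Qed.

Let bs i : bmeas (fun x => s x i 0). Proof. exact: (ts_s ts). Qed.

Lemma carried_pairing : exists2 D, 0 <= D & forall g i B t, test_function g -> measurable B ->
  `|t| <= T ->
  `|carried i B t - pairing al s phi W g i t| <= D * \int[fpush al (char_measurable_at t)]_x `|g x - \1_B x|.
Proof.
have /choice[S hS] : forall l, exists S, 0 <= S /\ forall x, `|s x l 0| <= S.
  by move=> l; have [S S0 hS] := bmeas_bound (bs l); exists S.
have C0 := char_C0 ch.
exists (\sum_l C * S l); first by apply: sumr_ge0 => l _; rewrite mulr_ge0//; case: (hS l).
move=> g i B t tg mB tT; rewrite /carried /pairing -sumrB mulr_suml (le_trans (ler_norm_sum _ _ _))//.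
have bB := bmeas_indic R mB; have bg := blip_bmeas (test_function_blip tg).
have bW l : bmeas (fun x => W t x i l).
  split; last first.
    by exists C => x; rewrite (le_trans (mx_norm_entry _ _ _))// (charW_bound ch).
  apply: continuous_measurable_plane; apply: (@lip_continuous _ _ C) => x y.
  by rewrite -mx_entryB (le_trans (mx_norm_entry _ _ _))// (charW_lip ch).
have bd : bmeas (fun x => `|g x - \1_B x|) by apply: bmeas_norm; exact: bmeasB.
apply: ler_sum => l _; rewrite bRint_push// -bRintB.
- rewrite -bRintZ; last exact: (bcomp_phi t bd).
  apply: bRint_norm_le.
  + apply: bmeasB; apply: bmeasM => //; apply: bmeasM => //; [exact: (bcomp_phi t bB)|exact: (bcomp_phi t bg)].
  + by apply: bmeasZ; exact: (bcomp_phi t bd).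
  move=> x; rewrite /pullback -mulrBl -mulrBl !normrM distrC -mulrA mulrC.
  apply: ler_wpM2r => //; apply: ler_pM => //; last by case: (hS l).
  by rewrite (le_trans (mx_norm_entry _ _ _))// (charW_bound ch).
- by apply: bmeasM => //; apply: bmeasM => //; exact: (bcomp_phi t bB).
- by apply: bmeasM => //; apply: bmeasM => //; exact: (bcomp_phi t bg).
Qed.

(** The indicator of B is approximated by test functions supported in the confined set. Since the
    sweep of be does not charge B, the bound of [pairing_sweep] tends to 0 with the approximation
    error. *)
Lemma transport_set i a c r (B : set (plane R)) : r < r' -> a < c -> `|a| + 1 <= T -> `|c| + 1 <= T ->
  measurable B -> B `<=` confined a c r ->
  {ae leb, forall t : R, a <= t <= c -> be (phi t @^-1` B) = 0%E} ->
  carried i B c = carried i B a.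
Proof.
move=> rr' ac aT cT mB BG /(sweep0P mB) B0.
have [D D0 hD] := pairing_sweep rr'; have [E E0 hE] := carried_pairing.
have aT' : `|a| <= T by rewrite (le_trans _ aT)// lerDl.
have cT' : `|c| <= T by rewrite (le_trans _ cT)// lerDl.
pose pa := fpush al (char_measurable_at a); pose pc := fpush al (char_measurable_at c).
(* One test function has to be close to the indicator for three measures: the images of al at both
   end times and the sweep. It is chosen for their sum. *)
pose nu := fadd (fadd pa pc) (sweep a c).
apply/eqP; rewrite -subr_eq0 -normr_le0; apply/ler_addgt0Pr => eps eps0.
have F0 : 0 < E + D + E + 1 by rewrite ltr_wpDl// !addr_ge0.
have e1 : 0 < eps / (E + D + E + 1) by rewrite divr_gt0.
have [g [tg g01 g0 hg]] := test_approx nu (@confined_open a c r (ltW ac)) (@confined_box a c r (ltW ac)) mB BG e1.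
have bg := blip_bmeas (test_function_blip tg); have bB := bmeas_indic R mB.
have bd : bmeas (fun x => `|g x - \1_B x|) by apply: bmeas_norm; exact: bmeasB.
have d0 x : 0 <= `|g x - \1_B x| by [].
move: hg; rewrite /nu bRint_add// bRint_add// => hg.
have i1 : 0 <= \int[pa]_x `|g x - \1_B x| by exact: bRint_ge0.
have i2 : 0 <= \int[pc]_x `|g x - \1_B x| by exact: bRint_ge0.
have i3 : 0 <= \int[sweep a c]_x `|g x - \1_B x| by exact: bRint_ge0.
have hc := hE g i B c tg mB cT'; have ha := hE g i B a tg mB aT'.
have hs : `|pairing al s phi W g i c - pairing al s phi W g i a| <= D * \int[sweep a c]_x `|g x|.
  apply: (hD g i a c tg ac aT cT) => t x tac rx; apply: g0 => /(_ t tac).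
  by rewrite (charK ch) ltNge (ltW rx).
have hg' : \int[sweep a c]_x `|g x| <= \int[sweep a c]_x `|g x - \1_B x|.
  have -> : \int[sweep a c]_x `|g x - \1_B x| = \int[sweep a c]_x (`|g x - \1_B x| + \1_B x).
    have I0 : \int[sweep a c]_x (\1_B x : R) = 0.
      by apply: EFin_inj; exact: (etrans (bRint_indic _ mB) B0).
    by rewrite bRintD//; rewrite [X in _ = _ + X]I0 addr0.
  apply: bRint_le; [exact: bmeas_norm|exact: bmeasD|].
  move=> x; rewrite -{1}[g x](subrK (\1_B x)) (le_trans (ler_normD _ _))// lerD2l.
  by rewrite ger0_norm// indicE.
have -> : carried i B c - carried i B a = (carried i B c - pairing al s phi W g i c) +
   (pairing al s phi W g i c - pairing al s phi W g i a) - (carried i B a - pairing al s phi W g i a).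
  by ring.
rewrite add0r (le_trans (ler_normB _ _))// (le_trans (lerD (ler_normD _ _) (lexx _)))//.
rewrite -/pa in ha; rewrite -/pc in hc.
move: (\int[pa]_x _) (\int[pc]_x _) (\int[sweep a c]_x `|g x - _|) i1 i2 i3 hg ha hc hg' => x1 x2 x3 i1 i2 i3 hg ha hc hg'.
apply: (@le_trans _ _ ((E + D + E + 1) * (eps / (E + D + E + 1)))); last by rewrite mulrC divfK// gt_eqF.
apply: (@le_trans _ _ ((E + D + E + 1) * (x1 + x2 + x3))); last by rewrite ler_wpM2l// ltW.
have h3 := le_trans hs (ler_wpM2l D0 hg').
apply: (le_trans (lerD (lerD hc h3) ha)).
have -> : (E + D + E + 1) * (x1 + x2 + x3) = E * x2 + D * x3 + E * x1 +
  (E * (x1 + x2 + x3) + E * x3 + D * (x1 + x2) + (x1 + x2 + x3)) by ring.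
by rewrite lerDl !addr_ge0// mulr_ge0// !addr_ge0.
Qed.

End transport.

(** * Absolute continuity of averages along two independent flows *)

Section absolute_continuity.
Context {R : realType}.

Lemma bmeas_Rint_swap d1 d2 (T1 : measurableType d1) (T2 : measurableType d2)
    (m1 : {finite_measure set T1 -> \bar R}) (g : T1 * T2 -> R) : bmeas g -> (forall z, 0 <= g z) ->
  bmeas (fun y => \int[m1]_x g (x, y)).
Proof.
move=> bg g0; have bg' : bmeas (fun z : T2 * T1 => g (z.2, z.1)).
  case: bg => mg [C hC]; split; last by exists C.
  by apply: (measurableT_comp mg); apply: measurable_fun_pair.
exact: (bmeas_Rint m1 bg' (fun z => g0 _)).
Qed.

Lemma bRint_swap d1 d2 (T1 : measurableType d1) (T2 : measurableType d2)
    (m1 : {finite_measure set T1 -> \bar R}) (m2 : {finite_measure set T2 -> \bar R})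
    (g : T1 * T2 -> R) : bmeas g -> (forall z, 0 <= g z) ->
  \int[m1]_x \int[m2]_y g (x, y) = \int[m2]_y \int[m1]_x g (x, y).
Proof.
move=> bg g0; rewrite -bRint_fprod//; apply: EFin_inj.
by rewrite (bRint_EFin _ (bmeas_Rint_swap m1 bg g0)) bRint_EFin// bRint_fprod2.
Qed.

Variables (rho : {finite_measure set (plane R) -> \bar R}) (C : R).
Hypothesis C0 : 0 <= C.
Hypothesis squares : forall (z : plane R) (e : R), 0 < e -> e <= 1 ->
  (rho [set x : plane R | (`|x - z| <= e)%R] <= (C * e ^+ 2)%:E)%E.
Implicit Types (x y : plane R).

Let lam (n : R) : {finite_measure set (plane R) -> \bar R} :=
  mfrestr (measurable_box n) (leb2_box_lty n).

Let sq e x y : R := if `|x - y| <= e then 1 else 0.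

Let sq_ge0 e x y : 0 <= sq e x y. Proof. by rewrite /sq; case: ifP. Qed.

Let sqE e y : (fun x => sq e x y) = \1_[set x : plane R | `|x - y| <= e].
Proof.
apply/funext => x; rewrite /sq indicE; case: ifPn => h; first by rewrite mem_set.
by rewrite memNset//; exact/negP.
Qed.

Let square_bmeas e : bmeas (fun z : plane R * plane R => sq e z.1 z.2 : R).
Proof.
split; last by exists 1 => z; rewrite /sq; case: ifP; rewrite ?normr1 ?normr0.
pose S : set (plane R * plane R) := [set z | `|z.1.1 - z.2.1| <= e] `&` [set z | `|z.1.2 - z.2.2| <= e].
have mS : measurable S.
  have m1 : measurable_fun setT (fun z : plane R * plane R => `|z.1.1 - z.2.1|).
    apply: measurableT_comp => //; apply: measurable_funB.
      exact: (measurableT_comp measurable_fst measurable_fst).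
    exact: (measurableT_comp measurable_fst measurable_snd).
  have m2 : measurable_fun setT (fun z : plane R * plane R => `|z.1.2 - z.2.2|).
    apply: measurableT_comp => //; apply: measurable_funB.
      exact: (measurableT_comp measurable_snd measurable_fst).
    exact: (measurableT_comp measurable_snd measurable_snd).
  have mle (h : plane R * plane R -> R) : measurable_fun setT h -> measurable [set z | h z <= e].
    by move=> /(_ measurableT _ (measurable_itv `]-oo, e])); rewrite setTI set_itvE.
  by apply: measurableI; exact: mle.
rewrite (_ : (fun z => _) = \1_S); first exact: measurable_indic.
apply/funext => z; rewrite indicE /sq le_pair_norm /=.
by case: ifPn => [/andP h|/negP h]; [rewrite mem_set|rewrite memNset// => -[h1 h2]; apply: h; apply/andP].
Qed.

Lemma measurable_square (e : R) x : measurable [set y : plane R | `|y - x| <= e].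
Proof.
have [h _] := bmeas_ysection x (square_bmeas e).
have := h measurableT [set 1] (measurable_set1 _); rewrite setTI.
congr measurable; apply/seteqP; split => y /=; rewrite /sq; last by move=> ->.
by case: ifP => // _ /eqP; rewrite eq_sym oner_eq0.
Qed.

(** The value f(x) is at most the mean of f over the square of half-side e around x, plus L e.
    Integrating against rho, exchanging the integrals and using the bound on the rho-mass of squares
    gives the inequality up to O(e); the 4 is the area [(2 * e) ^+ 2] divided by [e ^+ 2]. *)
Let lip_integral_le f n : unit_lip f -> (forall x, n < `|x| -> f x = 0) ->
  4 * \int[rho]_x f x <= C * \int[lam n]_x f x.
Proof.
move=> fl f0; have [f01 [L L0 fL]] := fl; have bf := unit_lip_bmeas fl.
have fge x : 0 <= f x by have /andP[] := f01 x.
pose P := fine (rho setT); have P0 : 0 <= P by exact: fine_ge0.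
have key e : 0 < e -> e <= 1 -> 4 * \int[rho]_x f x <= C * \int[lam n]_x f x + 4 * L * P * e.
  move=> e0 e1; have e20 : 0 < e ^+ 2 by exact: exprn_gt0.
  have bg : bmeas (fun z : plane R * plane R => f z.2 * sq e z.1 z.2).
    apply: bmeasM; last exact: square_bmeas.
    by case: bf => mf [D hD]; split; [exact: measurableT_comp mf measurable_snd|exists D].
  have g0 (z : plane R * plane R) : 0 <= f z.2 * sq e z.1 z.2 by rewrite mulr_ge0.
  have low x : (f x - L * e) * (2 * e) ^+ 2 <= \int[lam n]_y (f y * sq e x y).
    have [fx|fx] := leP (f x - L * e) 0.
      rewrite (@le_trans _ _ 0)//; first by rewrite mulr_le0_ge0// sqr_ge0.
      by apply: bRint_ge0 => y; rewrite mulr_ge0.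
    pose Q := [set y : plane R | `|y - x| <= e].
    have fy y : Q y -> f x - L * e <= f y.
      move=> yx; rewrite lerBlDr -lerBlDl (le_trans (ler_norm _))// (le_trans (fL _ _))//.
      by rewrite ler_wpM2l// distrC.
    (* In this case f is positive on the whole square, which therefore lies in the box: restricting
       Lebesgue measure to the box loses nothing. *)
    have Qn : Q `<=` box n.
      move=> y /fy h; rewrite /box/= leNgt; apply/negP => /f0 y0.
      by move: (lt_le_trans fx h); rewrite y0 ltxx.
    have mQ : measurable Q.
      exact: measurable_square.
    have lQ : \int[lam n]_y (\1_Q y : R) = (2 * e) ^+ 2.
      apply: EFin_inj; rewrite bRint_indic// -(leb2_square x (ltW e0)).
      by rewrite -[LHS]/(leb2 (Q `&` box n)) setIidl.
    rewrite -lQ -bRintZ; last exact: bmeas_indic.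
    apply: bRint_le; [exact/bmeasZ/bmeas_indic|exact: (bmeas_xsection x bg)|].
    move=> y; rewrite indicE /sq distrC; case: ifPn => yx.
      by rewrite mem_set// !mulr1; exact: fy.
    by rewrite memNset ?mulr0//; exact/negP.
  have bl : bmeas (fun x => (f x - L * e) * (2 * e) ^+ 2).
    by apply: bmeasM; [apply: bmeasB => //|]; exact: bmeas_cst.
  have := bRint_le rho bl (bmeas_Rint (lam n) bg g0) low.
  rewrite (bRint_swap rho (lam n) bg g0) => h1.
  have h2 : \int[lam n]_y \int[rho]_x (f y * sq e x y) <= \int[lam n]_y (C * e ^+ 2 * f y).
    apply: bRint_le; [|exact: bmeasZ|].
      exact: (bmeas_Rint_swap rho bg).
    move=> y; rewrite bRintZ; last exact: (bmeas_ysection y (square_bmeas e)).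
    rewrite mulrC ler_wpM2r// -lee_fin.
    by rewrite sqE bRint_indic; [exact: squares|exact: measurable_square].
  have := le_trans h1 h2; rewrite bRintZ//.
  under eq_Rintegral do rewrite mulrC.
  rewrite bRintZ; last by apply: bmeasB => //; exact: bmeas_cst.
  rewrite bRintB//; last exact: bmeas_cst.
  rewrite Rintegral_cst// -/P => h3.
  rewrite -(ler_pM2l e20).
  move: (\int[rho]_x f x) (\int[lam n]_x f x) h3 => I J h3.
  rewrite -subr_ge0 in h3; rewrite -subr_ge0.
  apply: (le_trans h3); rewrite le_eqVlt; apply/orP; left; apply/eqP; ring.
have F0 : 0 < 4 * L * P + 1 by rewrite ltr_wpDl// !mulr_ge0.
apply/ler_addgt0Pr => eps eps0.
pose e := Num.min 1 (eps / (4 * L * P + 1)).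
have e0 : 0 < e by rewrite lt_min ltr01 divr_gt0.
have e1 : e <= 1 by rewrite ge_min lexx.
rewrite (le_trans (key e e0 e1))// lerD2l.
apply: (@le_trans _ _ ((4 * L * P + 1) * (eps / (4 * L * P + 1)))); last by rewrite mulrC divfK// gt_eqF.
by apply: ler_pM; rewrite ?(ltW e0) ?lerDl ?mulr_ge0// ge_min lexx orbT.
Qed.

(** On a bounded piece B of N, a Lipschitz function close to the indicator of B for rho plus
    Lebesgue measure has small Lebesgue integral. By [lip_integral_le] its rho-integral is small
    too, which forces rho(B) = 0. *)
Lemma ac_of_squares (N : set (plane R)) : measurable N -> leb2 N = 0%E -> rho N = 0%E.
Proof.
move=> mN N0.
have key n : rho (N `&` box n) = 0%E.
  pose B := N `&` box n; have mB : measurable B by apply: measurableI => //; exact: measurable_box.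
  apply/eqP; rewrite -measure_le0; change (rho B <= 0)%E; rewrite -(bRint_indic rho mB) lee_fin.
  apply/ler_addgt0Pr => eps eps0; rewrite add0r.
  have F0 : 0 < C + 1 by rewrite ltr_wpDl.
  have e0 : 0 < eps / (C + 1) by rewrite divr_gt0.
  have [f fl hf] := lipschitz_approx (fadd rho (lam (n + 1))) mB e0.
  (* Equal to 1 on the box of radius n, which contains B, and to 0 outside the box of radius n + 1,
     as [lip_integral_le] requires. *)
  pose chi (x : plane R) := clamp (n + 1 - `|x|).
  have cl : unit_lip chi.
    apply: (@unit_lip_clamp _ _ 1) => // x y.
    have -> : n + 1 - `|x| - (n + 1 - `|y|) = `|y| - `|x| by ring.
    by rewrite mul1r distrC ler_dist_dist.
  have gl := unit_lipM fl cl; have bg := unit_lip_bmeas gl; have bB := bmeas_indic R mB.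
  have g0 x : n + 1 < `|x| -> f x * chi x = 0.
    by move=> nx; rewrite /chi clamp_le0 ?mulr0// subr_le0 ltW.
  have pt x : `|f x * chi x - \1_B x| <= `|f x - \1_B x|.
    rewrite indicE; have [xB|xB] := boolP (x \in B).
      have := xB; rewrite inE => -[_ xn].
      have -> : chi x = 1 by rewrite /chi clamp_ge1// lerBrDr [leRHS]addrC lerD2l.
      by rewrite mulr1.
    by rewrite !subr0 normrM ler_piMr//; have /andP[h0 h1] := cl.1 x; rewrite ger0_norm.
  have bd : bmeas (fun x => `|f x * chi x - \1_B x|) by apply: bmeas_norm; exact: bmeasB.
  have bd' : bmeas (fun x => `|f x - \1_B x|).
    by apply: bmeas_norm; apply: bmeasB => //; exact: unit_lip_bmeas.
  have := le_trans (bRint_le _ bd bd' pt) hf; rewrite bRint_add// => h.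
  have h4 := lip_integral_le gl g0.
  have i1 : 0 <= \int[rho]_x `|f x * chi x - \1_B x| by exact: bRint_ge0.
  have i2 : 0 <= \int[lam (n + 1)]_x `|f x * chi x - \1_B x| by exact: bRint_ge0.
  have lB : \int[lam (n + 1)]_x (\1_B x : R) = 0.
    apply: EFin_inj; rewrite bRint_indic// -[LHS]/(leb2 (B `&` box (n + 1))).
    apply/eqP; rewrite -measure_le0 -N0; apply: le_measure; rewrite ?inE//.
      by apply: measurableI => //; exact: measurable_box.
    by move=> x [[]].
  have h5 : \int[lam (n + 1)]_x (f x * chi x) <= \int[lam (n + 1)]_x `|f x * chi x - \1_B x|.
    have E5 : \int[lam (n + 1)]_x (`|f x * chi x - \1_B x| + \1_B x) =
        \int[lam (n + 1)]_x `|f x * chi x - \1_B x|.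
      by rewrite bRintD//; rewrite [X in _ + X = _]lB addr0.
    rewrite -E5; apply: bRint_le => //; first exact: bmeasD.
    by move=> x; rewrite -lerBlDr ler_norm.
  have h6 : \int[rho]_x (\1_B x : R) <= \int[rho]_x `|f x * chi x - \1_B x| + \int[rho]_x (f x * chi x).
    rewrite -bRintD//; apply: bRint_le => //; first exact: bmeasD.
    by move=> x; rewrite -lerBlDr distrC ler_norm.
  move: (\int[rho]_x `|_|) (\int[lam (n + 1)]_x `|_|) (\int[rho]_x \1_B x)
    (\int[rho]_x (f x * chi x)) (\int[lam (n + 1)]_x (f x * chi x)) i1 i2 h h4 h5 h6
    => x1 x2 x3 x4 x5 i1 i2 h h4 h5 h6.
  have -> : eps = (C + 1) * (eps / (C + 1)) by rewrite mulrC divfK// gt_eqF.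
  apply: (@le_trans _ _ ((C + 1) * (x1 + x2))); last by rewrite ler_wpM2l// ltW.
  have h7 : C * x5 <= C * x2 by exact: ler_wpM2l.
  have h8 : 0 <= C * x1 by exact: mulr_ge0.
  have h9 : 0 <= C * x2 by exact: mulr_ge0.
  rewrite mulrDl mul1r mulrDr.
  move: (C * x5) (C * x2) (C * x1) h4 h7 h8 h9 => c5 c2 c1 h4 h7 h8 h9; lra.
apply/eqP; rewrite -measure_le0.
have E : N = \bigcup_n (N `&` box n%:R).
  apply/seteqP; split => [x Nx|x [n _ []]//].
  by exists (Num.bound `|x|) => //; split => //; rewrite /box/= ltW// archi_boundP.
have mNn n : measurable (N `&` box n%:R) by apply: measurableI => //; exact: measurable_box.
rewrite {1}E (le_trans (measure_sigma_subadditive _ _ _ (@subset_refl _ _)))//.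
  exact: bigcup_measurable.
by rewrite eseries0// => n _ _; exact: key.
Qed.

End absolute_continuity.

Section almost_everywhere.
Context {R : realType}.

Lemma bRint_ae0 d (T : measurableType d) (m : {finite_measure set T -> \bar R}) (f : T -> R) :
  bmeas f -> (forall x, 0 <= f x) -> \int[m]_x f x = 0 -> {ae m, forall x, f x = 0}.
Proof.
move=> bf f0 If.
have mf : measurable_fun setT (EFin \o f) by apply/measurable_EFinP; case: bf.
have [h _] := ae_eq_integral_abs m measurableT mf.
have : (\int[m]_x `|(EFin \o f) x| = 0)%E.
  under eq_integral do rewrite /= ger0_norm//.
  by rewrite -bRint_EFin// If.
by move=> /h; apply: filterS => x /(_ I) [].
Qed.

Lemma ae_lebI (a c : R) (P : R -> Prop) : {ae lebI a c, forall t, P t} ->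
  {ae leb, forall t, a <= t <= c -> P t}.
Proof.
move=> [A [mA A0 PA]]; exists (A `&` `[a, c]%classic); split.
- by apply: measurableI => //; exact: measurable_itv.
- exact: A0.
move=> t /= nP; split; last by rewrite /= in_itv/=; apply: contrapT => h; apply: nP => /h.
by apply: PA => /= Pt; exact: nP.
Qed.

Lemma dist_itv (a c p q : R) : a <= p <= c -> a <= q <= c -> `|p - q| <= c - a.
Proof. by move=> /andP[h1 h2] /andP[h3 h4]; rewrite ler_norml; apply/andP; split; lra. Qed.

Lemma ae_cover (d : R) (P : R -> Prop) : 0 < d ->
  (forall a, {ae leb, forall t, a <= t <= a + d -> P t}) -> {ae leb, forall t, P t}.
Proof.
move=> d0 h.
have : (@leb R).-negligible (\bigcup_n (~` [set t : R | n%:R * d <= t <= n%:R * d + d -> P t] `|`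
    ~` [set t : R | - (n.+1%:R * d) <= t <= - (n.+1%:R * d) + d -> P t])).
  by apply: negligible_bigcup => n; apply: negligibleU; exact: h.
apply: negligibleS => t /= nP.
have archi (x : R) : 0 <= x -> exists n : nat, n%:R * d <= x <= n%:R * d + d.
  move=> x0; have xd : 0 <= x / d by rewrite divr_ge0// ltW.
  have [n /andP[n1 n2]] : exists n : nat, n%:R <= x / d < n.+1%:R.
    exists (Num.truncn (x / d)); exact: truncn_itv.
  have E : n%:R * d + d = n.+1%:R * d by rewrite -natr1 mulrDl mul1r.
  by exists n; rewrite E -ler_pdivlMr// n1/= -ler_pdivrMr// ltW.
have [t0|t0] := leP 0 t.
  by have [n hn] := archi t t0; exists n => //; left => /(_ hn).
have [n /andP[n1 n2]] := archi (- t) ltac:(rewrite oppr_ge0; exact: ltW).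
exists n => //; right => /= hP; apply/nP/hP.
by rewrite lerNl -natr1 mulrDl mul1r n2/= opprD subrK lerNr.
Qed.

Lemma ae_exists_lt (c : R) (P : R -> Prop) : 0 < c ->
  {ae leb, forall t, 0 <= t <= c -> P t} -> exists2 t, 0 < t <= c & P t.
Proof.
move=> c0 [A [mA A0 PA]]; apply: contrapT => h.
have : (leb `]0%R, c]%classic <= leb A)%E.
  apply: le_measure; rewrite ?inE//.
  move=> t; rewrite /= in_itv/= => /andP[t0 tc]; apply: PA => /= Pt; apply: h.
  by exists t; rewrite ?t0//; apply: Pt; rewrite (ltW t0).
by rewrite A0 leb_itv ?(ltW c0)// subr0 lee_fin leNgt c0.
Qed.

End almost_everywhere.

Section two_flows.
Context {R : realType} {m1 m2 : nat}.
Variables (b1 b2 : plane R -> plane R) (H1 : plane R -> 'M[R]_m1) (H2 : plane R -> 'M[R]_m2).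
Variables (r T1 T2 : R) (phi1 phi2 : R -> plane R -> plane R).
Variables (W1 : R -> plane R -> 'M[R]_m1) (W2 : R -> plane R -> 'M[R]_m2).
Variables (L1 M1 C1 L2 M2 C2 B kap : R).
Hypothesis ch1 : characteristics b1 H1 r T1 phi1 W1 L1 M1 C1.
Hypothesis ch2 : characteristics b2 H2 r T2 phi2 W2 L2 M2 C2.
Hypothesis B0 : 0 <= B.
Hypothesis b1L : forall x y : plane R, `|b1 (clip2 r x) - b1 (clip2 r y)| <= B * `|x - y|.
Hypothesis kap0 : 0 < kap.
Hypothesis indep : forall (y : plane R) (p q : R),
  kap * Num.max `|p| `|q| <= `|p *: b1 (clip2 r y) + q *: b2 (clip2 r y)|.
Implicit Types (x y z : plane R).

Let split_difference (v w y k1 k2 k3 : plane R) :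
  k2 + k3 = (v - y) - ((v - w - k1) + (k1 - k2) + (w - y - k3)).
Proof.
move: v w y k1 k2 k3 => [v v'] [w w'] [y y'] [k1 k1'] [k2 k2'] [k3 k3'].
by apply: injective_projections => /=; ring.
Qed.

Definition double_flow (q : R * R) x := phi1 q.1 (phi2 q.2 x).

(** Undoing phi1 at time t costs its Lipschitz constant and reduces to small times. There the
    displacement is p b1 + q b2 up to a quadratic error, and d is chosen so that this error takes at
    most half of the lower bound given by independence. *)
Lemma double_flow_expanding : exists2 d, 0 < d & forall x (t s p q : R), `|p| <= d -> `|q| <= d ->
  kap / 2 * Num.max `|p| `|q| <=
    expR (`|t| * L1) * `|double_flow (t + p, s + q) x - double_flow (t, s) x|.
Proof.
have M20 := char_M0 ch2; have C10 := char_C0 ch1; have C20 := char_C0 ch2.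
(* Quadratic errors of the two flows, plus the change of b1 between the point and its image under
   phi2 at time q, whose distance is at most [|q| * M2]. *)
pose C' := C1 + B * M2 + C2; have C'0 : 0 <= C' by rewrite !addr_ge0// mulr_ge0.
have C'1 : 0 < C' + 1 by rewrite ltr_wpDl.
exists (kap / 2 / (C' + 1)); first by rewrite !divr_gt0.
move=> x t s p q pd qd; pose mx := Num.max `|p| `|q|.
have mxd : mx <= kap / 2 / (C' + 1) by rewrite ge_max pd.
have pm : `|p| <= mx by rewrite le_max lexx.
have qm : `|q| <= mx by rewrite le_max lexx orbT.
have mx0 : 0 <= mx by exact: le_trans pm.
pose y := phi2 s x; pose w := phi2 q y.
have -> : double_flow (t + p, s + q) x = phi1 t (phi1 p w).
  by rewrite /double_flow /= (charD ch2) [t + p]addrC (charD ch1).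
rewrite /double_flow /= -/y.
have h1 : `|phi1 p w - y| <= expR (`|t| * L1) * `|phi1 t (phi1 p w) - phi1 t y|.
  have := char_lip ch1 (- t) (phi1 t (phi1 p w)) (phi1 t y).
  by rewrite !(charK ch1) normrN.
apply: le_trans h1.
have wy : `|w - y| <= `|q| * M2.
  by have := char_time ch2 0 q y; rewrite (char0 ch2) subr0.
have e1 : `|phi1 p w - w - p *: b1 (clip2 r w)| <= C1 * mx ^+ 2.
  have := char_exp ch1 0 p w; rewrite add0r (char0 ch1) => h; apply: (le_trans h).
  rewrite ler_wpM2l// -[p ^+ 2]real_normK ?num_real//; apply: lerXn2r => //; exact: nnegrE.
have e2 : `|w - y - q *: b2 (clip2 r y)| <= C2 * mx ^+ 2.
  have := char_exp ch2 0 q y; rewrite add0r (char0 ch2) => h; apply: (le_trans h).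
  rewrite ler_wpM2l// -[q ^+ 2]real_normK ?num_real//; apply: lerXn2r => //; exact: nnegrE.
have e3 : `|p *: (b1 (clip2 r w) - b1 (clip2 r y))| <= B * M2 * mx ^+ 2.
  rewrite normrZ expr2 mulrA mulrC ler_pM// (le_trans (b1L _ _))// -mulrA ler_wpM2l//.
  by rewrite (le_trans wy)// mulrC ler_wpM2l.
have := indep y p q; rewrite -/mx => ind.
have E : p *: b1 (clip2 r y) + q *: b2 (clip2 r y) = (phi1 p w - y) -
   ((phi1 p w - w - p *: b1 (clip2 r w)) + p *: (b1 (clip2 r w) - b1 (clip2 r y)) +
    (w - y - q *: b2 (clip2 r y))).
  by rewrite scalerBr; exact: split_difference.
rewrite E in ind.
have := le_trans ind (ler_normB _ _) => {}ind.
have e4 := le_trans (ler_normD _ _) (lerD (le_trans (ler_normD _ _) (lerD e1 e3)) e2).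
have e5 : C1 * mx ^+ 2 + B * M2 * mx ^+ 2 + C2 * mx ^+ 2 <= kap / 2 * mx.
  rewrite -!mulrDl -/C' expr2 mulrA ler_wpM2r//.
  apply: (@le_trans _ _ ((C' + 1) * (kap / 2 / (C' + 1)))).
    by rewrite ler_pM// lerDl.
  by rewrite mulrC divfK// gt_eqF.
have := le_trans ind (lerD (lexx _) (le_trans e4 e5)).
have -> : kap * mx = kap / 2 * mx + kap / 2 * mx by field.
by rewrite lerD2r.
Qed.

Variable al : {finite_measure set (plane R) -> \bar R}.

Let dfm : measurable_fun setT (fun z : R * R * plane R => double_flow z.1 z.2).
Proof.
have mf1 := measurable_flow (char_M0 ch1) (char_time ch1) (char_lip ch1).
have mf2 := measurable_flow (char_M0 ch2) (char_time ch2) (char_lip ch2).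
have h2 := measurableT_comp mf2 (measurable_fun_pair
  (measurableT_comp measurable_snd (@measurable_fst _ _ (R * R)%type (plane R))) measurable_snd).
exact: (measurableT_comp mf1 (measurable_fun_pair
  (measurableT_comp measurable_fst (@measurable_fst _ _ (R * R)%type (plane R))) h2)).
Qed.

Let win (a c d : R) := fprod (lebI a c) (lebI 0 d).
Let swp2 (a c d : R) := fpush (fprod (fprod (lebI a c) (lebI 0 d)) al) dfm.

Let lebI_le a c (A : set R) : measurable A -> (lebI a c A <= leb A)%E.
Proof.
move=> mA; rewrite /lebI /mfrestr /mrestr; apply: le_measure; rewrite ?inE//.
by apply: measurableI => //; exact: measurable_itv.
Qed.

Let lebI_out (a c : R) : lebI a c (~` `[a, c]%classic) = 0%E.
Proof. by rewrite /lebI /mfrestr /mrestr setICl measure0. Qed.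

Let winX a c d (X Y : set R) : measurable X -> measurable Y ->
  win a c d (X `*` Y) = (lebI a c X * lebI 0 d Y)%E.
Proof. by move=> mX mY; exact: product_measure1E. Qed.

Let win_le a c d (S : set (R * R)) q e : measurable S -> 0 <= e ->
  (forall p, S p -> a <= p.1 <= c -> 0 <= p.2 <= d -> `|p.1 - q.1| <= e /\ `|p.2 - q.2| <= e) ->
  (win a c d S <= ((2 * e) ^+ 2)%:E)%E.
Proof.
move=> mS e0 hS.
pose X1 := `[q.1 - e, q.1 + e]%classic; pose X2 := `[q.2 - e, q.2 + e]%classic.
pose Y1 := ~` `[a, c]%classic; pose Y2 := ~` `[0%R, d]%classic.
have mX1 : measurable X1 by exact: measurable_itv.
have mX2 : measurable X2 by exact: measurable_itv.
have mY1 : measurable Y1 by apply: measurableC; exact: measurable_itv.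
have mY2 : measurable Y2 by apply: measurableC; exact: measurable_itv.
have SX : S `<=` (X1 `*` X2) `|` ((Y1 `*` setT) `|` (setT `*` Y2)).
  move=> p Sp; have [h1|h1] := boolP (a <= p.1 <= c); last first.
    by right; left; split => //=; rewrite /Y1 /= in_itv/=; exact/negP.
  have [h2|h2] := boolP (0 <= p.2 <= d); last first.
    by right; right; split => //=; rewrite /Y2 /= in_itv/=; exact/negP.
  have [k1 k2] := hS p Sp h1 h2; left; split; rewrite /X1 /X2 /= in_itv/= -ler_distlC distrC //.
have mY : measurable ((Y1 `*` setT) `|` (setT `*` Y2) : set (R * R)).
  by apply: measurableU; exact: measurableX.
apply: (@le_trans _ _ (win a c d ((X1 `*` X2) `|` ((Y1 `*` setT) `|` (setT `*` Y2))))).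
  by apply: le_measure; rewrite ?inE//; apply: measurableU => //; exact: measurableX.
apply: (le_trans (measureU2 _ (measurableX mX1 mX2) mY)).
have -> : ((2 * e) ^+ 2)%:E = ((2 * e) ^+ 2)%:E + 0 :> \bar R by rewrite adde0.
apply: leeD.
  change (win a c d (X1 `*` X2) <= ((2 * e) ^+ 2)%:E)%E.
  rewrite winX// expr2 EFinM.
  have l1 (p : R) : (leb `[(p - e)%R, (p + e)%R]%classic = (2 * e)%:E)%E.
    rewrite leb_itv; last by rewrite lerD2l (le_trans _ e0)// oppr_le0.
    by congr (_%:E); ring.
  by apply: lee_pmul => //; [rewrite -(l1 q.1)|rewrite -(l1 q.2)]; exact: lebI_le.
apply: (le_trans (measureU2 _ (measurableX mY1 measurableT) (measurableX measurableT mY2))).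
change (win a c d (Y1 `*` setT) + win a c d (setT `*` Y2) <= 0)%E.
by rewrite !winX// !lebI_out mul0e mule0 adde0.
Qed.

(** For a fixed x, two pairs of times that bring x into the same square are O(e) apart because the
    double flow is expanding. The set of such pairs thus has measure O(e^2), and integrating over x
    with Tonelli multiplies this by the mass of al. *)
Lemma double_flow_squares : exists2 d0, 0 < d0 & forall a c d, a <= c -> c - a <= d0 -> 0 <= d -> d <= d0 ->
  exists2 D, 0 <= D & forall (z : plane R) (e : R), 0 < e -> e <= 1 ->
  (swp2 a c d [set x : plane R | (`|x - z| <= e)%R] <= (D * e ^+ 2)%:E)%E.
Proof.
have [d0 d00 hd] := double_flow_expanding; exists d0 => // a c d ac cad d0' dd.
pose E := expR (Num.max `|a| `|c| * `|L1|); have E0 : 0 < E by exact: expR_gt0.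
pose A := fine (al setT); have A0 : 0 <= A by exact: fine_ge0.
(* Two points of the square are at distance at most 2 e, so expansion bounds the differences of
   times by [4 * E / kap * e], the half-side of a square of times. *)
exists ((2 * (4 * E / kap)) ^+ 2 * A); first by rewrite mulr_ge0// sqr_ge0.
move=> z e e0 e1; pose Q := [set x : plane R | (`|x - z| <= e)%R].
have mQ : measurable Q by exact: measurable_square.
have bQ := bmeas_indic R mQ.
have bF : bmeas (fun w : R * R * plane R => \1_Q (double_flow w.1 w.2) : R).
  by case: bQ => mf [D hD]; split; [exact: measurableT_comp mf dfm|exists D].
have F0 (w : R * R * plane R) : 0 <= \1_Q (double_flow w.1 w.2) :> R by rewrite indicE.
have E1 := esym (bRint_indic (fpush (fprod (fprod (lebI a c) (lebI 0 d)) al) dfm) mQ).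
rewrite (bRint_push _ _ bQ) (bRint_fprod _ _ bF F0) (bRint_swap _ _ bF F0) in E1.
change (swp2 a c d Q <= ((2 * (4 * E / kap)) ^+ 2 * A * e ^+ 2)%:E)%E.
rewrite [swp2 a c d Q]E1 lee_fin.
rewrite (le_trans (ler_norm _))//.
pose eta := 4 * E / kap * e; have eta0 : 0 <= eta by rewrite mulr_ge0 ?(ltW e0)// divr_ge0 ?(ltW kap0)// mulr_ge0// ltW.
have -> : (2 * (4 * E / kap)) ^+ 2 * A * e ^+ 2 = (2 * eta) ^+ 2 * A by rewrite /eta; ring.
apply: bRint_bound; first exact: (bmeas_Rint_swap _ bF F0).
move=> x; rewrite ger0_norm; last exact: bRint_ge0.
pose S := [set q : R * R | Q (double_flow q x)].
have mS : measurable S.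
  rewrite -[X in measurable X]setTI.
  exact: (measurableT_comp dfm (measurable_pair2 x)) mQ.
rewrite -lee_fin (_ : (fun q => \1_Q (double_flow q x)) = \1_S)// bRint_indic//.
have [[q [Sq h1 h2]]|nq] := pselect (exists q, [/\ S q, a <= q.1 <= c & 0 <= q.2 <= d]); last first.
  apply: (@win_le a c d S (0, 0)) => // p Sp h1 h2; exfalso; apply: nq; by exists p.
apply: (@win_le a c d S q) => // p Sp h1' h2'.
have k1 : `|p.1 - q.1| <= d0.
  exact: le_trans (dist_itv h1' h1) cad.
have k2 : `|p.2 - q.2| <= d0.
  by apply: le_trans dd; rewrite -[leRHS]subr0; exact: dist_itv h2' h2.
have := hd x q.1 q.2 (p.1 - q.1) (p.2 - q.2) k1 k2.
have -> : (q.1 + (p.1 - q.1), q.2 + (p.2 - q.2)) = p.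
  by rewrite addrC subrK addrC subrK; case: (p).
have -> : (q.1, q.2) = q by case: (q).
have h3 : `|double_flow p x - double_flow q x| <= 2 * e.
  rewrite -(subrKA z) (le_trans (ler_normD _ _))// mulr2n mulrDl mul1r lerD//.
  by rewrite distrC.
have qL : expR (`|q.1| * L1) <= E.
  rewrite ler_expR; apply: (@le_trans _ _ (`|q.1| * `|L1|)); first by rewrite ler_wpM2l// ler_norm.
  rewrite ler_wpM2r// ler_norml; move: h1 => /andP[k3 k4]; apply/andP; split.
    by rewrite (le_trans _ k3)// lerNl le_max -normrN ler_norm.
  by rewrite (le_trans k4)// le_max ler_norm orbT.
move=> h4.
have h5 : Num.max `|p.1 - q.1| `|p.2 - q.2| <= eta.
  rewrite -(ler_pM2l (divr_gt0 kap0 (ltr0n R 2))) (le_trans h4)//.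
  have -> : kap / 2%:R * eta = E * (2 * e) by rewrite /eta; field; rewrite gt_eqF.
  by rewrite ler_pM// expR_ge0.
by split; apply: le_trans h5; rewrite le_max lexx ?orbT.
Qed.

(** Expansion is local in time, so the times t are treated in windows of length d0, which [ae_cover]
    glues together. In each window the averaged measure is absolutely continuous, and Tonelli turns
    its vanishing on N into a statement for almost every pair of times. *)
Lemma double_flow_null : exists2 d0, 0 < d0 & forall d (N : set (plane R)), 0 <= d -> d <= d0 ->
  measurable N -> leb2 N = 0%E ->
  {ae leb, forall t : R, {ae leb, forall q : R, 0 <= q <= d ->
    al (phi2 q @^-1` (phi1 t @^-1` N)) = 0%E}}.
Proof.
have [d0 d00 h] := double_flow_squares; exists d0 => // d N d0' dd mN N0.
apply: (ae_cover d00) => a.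
have aad : a <= a + d0 by rewrite lerDl ltW.
have [D D0 hD] : exists2 D, 0 <= D & forall (z : plane R) (e : R), 0 < e -> e <= 1 ->
    (swp2 a (a + d0) d [set x : plane R | (`|x - z| <= e)%R] <= (D * e ^+ 2)%:E)%E.
  by apply: h => //; rewrite addrC addKr.
have E0 := ac_of_squares (rho := fpush (fprod (fprod (lebI a (a + d0)) (lebI 0 d)) al) dfm) D0 hD mN N0.
have bN := bmeas_indic R mN.
have bF : bmeas (fun w : R * R * plane R => \1_N (double_flow w.1 w.2) : R).
  by case: bN => mf [M hM]; split; [exact: measurableT_comp mf dfm|exists M].
have F0 (w : R * R * plane R) : 0 <= \1_N (double_flow w.1 w.2) :> R by rewrite indicE.
have bG := bmeas_Rint al bF F0.
have G0 (q : R * R) : 0 <= \int[al]_x (\1_N (double_flow q x) : R) by exact: bRint_ge0.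
have E1 := bRint_indic (fpush (fprod (fprod (lebI a (a + d0)) (lebI 0 d)) al) dfm) mN.
rewrite E0 (bRint_push _ _ bN) (bRint_fprod _ _ bF F0) in E1.
have {}E1 := EFin_inj E1; rewrite (bRint_fprod _ _ bG G0) in E1.
have bI := bmeas_Rint (lebI 0 d) bG G0.
apply: ae_lebI; apply: filterS (bRint_ae0 bI (fun t => bRint_ge0 _ _) E1) => //.
move=> t Et; apply: ae_lebI.
have bt := bmeas_xsection t bG.
apply: filterS (bRint_ae0 bt (fun q => G0 (t, q)) Et) => q Eq.
have mS : measurable (phi2 q @^-1` (phi1 t @^-1` N)).
  have := measurableT_comp dfm (measurable_pair1 (t, q)) => /(_ measurableT _ mN).
  by rewrite setTI.
  by rewrite -(bRint_indic al mS); congr (_%:E); exact: Eq.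
by move=> t x; apply: bRint_ge0 => y; rewrite indicE.
Qed.

End two_flows.

(** * Polar densities along the flow *)

Section polar_decomposition.
Context {R : realType} d (T : measurableType d).
Variables (al ka : {finite_measure set T -> \bar R}).

Lemma bmeas_ext (v w : T -> R) : bmeas v -> bmeas w ->
  (forall A, measurable A -> \int[al]_x (\1_A x * v x) = \int[ka]_x (\1_A x * w x)) ->
  forall h, bmeas h -> \int[al]_x (h x * v x) = \int[ka]_x (h x * w x).
Proof.
move=> bv bw hA.
pose Del h := \int[al]_x (h x * v x) - \int[ka]_x (h x * w x).
have DelB c A h : measurable A -> bmeas h -> Del (fun x => h x - c * \1_A x) = Del h.
  move=> mA bh; have bA := bmeas_indic R mA.
  have E (mu : {finite_measure set T -> \bar R}) z : bmeas z ->
      \int[mu]_x ((h x - c * \1_A x) * z x) = \int[mu]_x (h x * z x) - c * \int[mu]_x (\1_A x * z x).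
    move=> bz; rewrite -bRintZ; last exact: bmeasM.
    rewrite -bRintB; [|exact: bmeasM|by apply: bmeasZ; exact: bmeasM].
    by apply: eq_Rintegral => x _; rewrite mulrBl mulrA.
  by rewrite /Del !E// hA// opprB addrACA [- _ + _]addrC addrACA subrr addr0.
have [V V0 hV] := bmeas_bound bv; have [U U0 hU] := bmeas_bound bw.
pose K := V * fine (al setT) + U * fine (ka setT).
have K0 : 0 <= K by rewrite addr_ge0// mulr_ge0// fine_ge0.
have DelK h a : bmeas h -> (forall x, 0 <= h x <= a) -> `|Del h| <= a * K.
  move=> bh ha; rewrite (le_trans (ler_normB _ _))// /K mulrDr !mulrA lerD//; apply: bRint_bound;
    try exact: bmeasM; move=> x; have /andP[h0 h1] := ha x; rewrite normrM ler_pM// ger0_norm//.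
(* Subtracting [a / 2] on [{h >= a / 2}] leaves [Del h] unchanged and halves the
   range of [h]. *)
have halve n h a : bmeas h -> (forall x, 0 <= h x <= a) -> `|Del h| <= a / 2 ^+ n * K.
  elim: n h a => [|n ih] h a bh ha; first by rewrite expr0 divr1; exact: DelK.
  pose A := [set x | a / 2 <= h x].
  have mA : measurable A.
    by have := bh.1 measurableT _ (measurable_itv `[a / 2, +oo[); rewrite setTI set_itvE.
  rewrite -(DelB (a / 2) A)// exprS invfM mulrA; apply: ih.
    by apply: bmeasB => //; exact/bmeasZ/bmeas_indic.
  move=> x; have /andP[h0 h1] := ha x; rewrite indicE; case: (boolP (x \in A)).
    by rewrite inE /A /= mulr1 subr_ge0 => ->; rewrite lerBlDr -splitr.
  by rewrite notin_setE /A/= mulr0 subr0 h0/= => /negP; rewrite -ltNge => /ltW.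
have Del0 h a : bmeas h -> (forall x, 0 <= h x <= a) -> Del h = 0.
  move=> bh ha; apply/eqP; rewrite -normr_le0.
  have cv : a / 2 ^+ n * K @[n --> \oo] --> (0 : R).
    have := @cvg_geometric R (a * K) (2^-1) _ => /(_ _).
    rewrite ger0_norm; last by rewrite invr_ge0.
    rewrite invf_lt1 ?ltr1n// => /(_ isT); apply: cvg_trans; apply: near_eq_cvg; apply: nearW => n /=.
    by rewrite exprVn mulrAC.
  by apply: (cvgr_to_ge cv); apply: nearW => n; exact: halve.
move=> h bh; have [C C0 hC] := bmeas_bound bh.
apply/eqP; rewrite -subr_eq0 -/(Del h) -(DelB (- C) setT h)//.
rewrite (Del0 _ (C + C))//; first by apply: bmeasB => //; exact/bmeasZ/bmeas_indic.
move=> x; rewrite indicE in_setT mulr1 opprK; have := hC x; rewrite ler_norml => /andP[h1 h2].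
by rewrite -lerBlDr sub0r h1 lerD2r.
Qed.

Variables (m : nat) (f g : T -> 'cV[R]_m) (D : set T).
Hypothesis bf : forall i, bmeas (fun x => f x i 0).
Hypothesis bg : forall i, bmeas (fun x => g x i 0).
Hypothesis mD : measurable D.
Hypothesis fg : forall A i, measurable A -> A `<=` D ->
  \int[al]_x (\1_A x * f x i 0) = \int[ka]_x (\1_A x * g x i 0).
Hypothesis g_le1 : forall x, enorm (g x) <= 1.
Hypothesis g_eq1 : {ae ka, forall x, enorm (g x) = 1}.
Hypothesis f_neq0 : {ae al, forall x, f x != 0}.

Let dot (u v : 'cV[R]_m) := \sum_i u i 0 * v i 0.

Let enorm2 (u : 'cV[R]_m) : enorm u ^+ 2 = dot u u.
Proof.
rewrite /enorm sqr_sqrtr; last by apply: sumr_ge0 => i _; exact: sqr_ge0.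
by apply: eq_bigr => i _; rewrite expr2.
Qed.

Let dot_bmeas (u v : T -> 'cV[R]_m) : (forall i, bmeas (fun x => u x i 0)) ->
  (forall i, bmeas (fun x => v x i 0)) -> bmeas (fun x => dot (u x) (v x)).
Proof. by move=> bu bv; apply: bmeas_sum => i; exact: bmeasM. Qed.

Let fg_ext h A i : bmeas h -> measurable A -> A `<=` D ->
  \int[al]_x (\1_A x * h x * f x i 0) = \int[ka]_x (\1_A x * h x * g x i 0).
Proof.
move=> bh mA AD; have bA := bmeas_indic R mA.
have := @bmeas_ext (fun x => \1_A x * f x i 0) (fun x => \1_A x * g x i 0) _ _ _ h bh.
have E (mu : {finite_measure set T -> \bar R}) (z : T -> R) :
    \int[mu]_x (h x * (\1_A x * z x)) = \int[mu]_x (\1_A x * h x * z x).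
  by apply: eq_Rintegral => x _; rewrite mulrCA mulrA.
rewrite !E; apply; [exact: bmeasM|exact: bmeasM|].
move=> B mB; have := @fg (B `&` A) i (measurableI _ _ mB mA) (subset_trans (@subIsetr _ _ _) AD).
have E2 (mu : {finite_measure set T -> \bar R}) (z : T -> R) :
    \int[mu]_x (\1_B x * (\1_A x * z x)) = \int[mu]_x (\1_(B `&` A) x * z x).
  by apply: eq_Rintegral => x _; rewrite indicI /= mulrA.
by rewrite !E2.
Qed.

Let fg_dot (h : T -> 'cV[R]_m) A : (forall i, bmeas (fun x => h x i 0)) -> measurable A -> A `<=` D ->
  \int[al]_x (\1_A x * dot (h x) (f x)) = \int[ka]_x (\1_A x * dot (h x) (g x)).
Proof.
move=> bh mA AD; have bA := bmeas_indic R mA.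
have E (mu : {finite_measure set T -> \bar R}) (z : T -> 'cV[R]_m) : (forall i, bmeas (fun x => z x i 0)) ->
    \int[mu]_x (\1_A x * dot (h x) (z x)) = \sum_i \int[mu]_x (\1_A x * h x i 0 * z x i 0).
  move=> bz; rewrite -bRint_sum; last by move=> i; apply: bmeasM => //; exact: bmeasM.
  by apply: eq_Rintegral => x _; rewrite mulr_sumr; apply: eq_bigr => i _; rewrite mulrA.
by rewrite !E//; apply: eq_bigr => i _; exact: fg_ext.
Qed.

(** On D the vector measures f al and g ka coincide. Tested against suitable multiples of f and g,
    this identity forces equality in the Cauchy-Schwarz inequality for f and g, al-almost
    everywhere. *)
Lemma polar_unique : {ae al, forall x, D x -> g x = (enorm (f x))^-1 *: f x}.
Proof.
have bD := bmeas_indic R mD.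
have bff := dot_bmeas bf bf; have bgf := dot_bmeas bg bf.
have dotC u v : dot u v = dot v u by apply: eq_bigr => i _; rewrite mulrC.
have dotZ a u v : dot (a *: u) v = a * dot u v.
  by rewrite /dot mulr_sumr; apply: eq_bigr => i _; rewrite mxE mulrA.
have gg1 : {ae ka, forall x, dot (g x) (g x) = 1}.
  by apply: filterS g_eq1 => x gx; rewrite -enorm2 gx expr1n.
have cs x : dot (g x) (f x) ^+ 2 <= dot (f x) (f x).
  have := cauchy_schwarz (g x) (f x); rewrite -/(dot (g x) (f x)).
  have -> : \sum_i g x i 0 ^+ 2 = enorm (g x) ^+ 2 by rewrite enorm2; apply: eq_bigr => i _; rewrite expr2.
  have -> : \sum_i f x i 0 ^+ 2 = dot (f x) (f x) by apply: eq_bigr => i _; rewrite expr2.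
  move=> /le_trans; apply; rewrite ler_piMl//; first by rewrite -enorm2 sqr_ge0.
  by rewrite exprn_ile1// enorm_ge0.
have I1 := fg_dot bf mD (@subset_refl _ D).
(* Testing with (g.f) g and using |g| = 1 for ka gives the same value as testing with f in [I1].
   Hence |f|^2 and (g.f)^2 have equal al-integrals over D, while the second never exceeds the
   first. *)
have I2 : \int[al]_x (\1_D x * dot (g x) (f x) ^+ 2) = \int[ka]_x (\1_D x * dot (f x) (g x)).
  have bh i : bmeas (fun x => (dot (g x) (f x) *: g x) i 0).
    by under eq_fun do rewrite mxE; exact: bmeasM.
  have := fg_dot bh mD (@subset_refl _ D).
  have -> : (fun x => \1_D x * dot (dot (g x) (f x) *: g x) (f x)) = (fun x => \1_D x * dot (g x) (f x) ^+ 2).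
    by apply/funext => x; rewrite dotZ expr2.
  move=> ->.
  have b1 : bmeas (fun x => \1_D x * dot (dot (g x) (f x) *: g x) (g x)).
    by apply: bmeasM => //; exact: dot_bmeas.
  have b2 : bmeas (fun x => \1_D x * dot (f x) (g x)).
    by apply: bmeasM => //; exact: dot_bmeas.
  apply: EFin_inj; rewrite !bRint_EFin//; apply: ae_eq_integral => //.
  - by apply/measurable_EFinP; case: b1.
  - by apply/measurable_EFinP; case: b2.
  by apply: filterS gg1 => x gx _; rewrite dotZ gx mulr1 dotC.
have a1 : {ae al, forall x, D x -> dot (g x) (f x) ^+ 2 = dot (f x) (f x)}.
  have b3 : bmeas (fun x => \1_D x * (dot (f x) (f x) - dot (g x) (f x) ^+ 2)).
    by apply: bmeasM => //; apply: bmeasB => //; apply: bmeasM.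
  have p3 x : 0 <= \1_D x * (dot (f x) (f x) - dot (g x) (f x) ^+ 2).
    by rewrite mulr_ge0 ?subr_ge0// indicE.
  have : \int[al]_x (\1_D x * (dot (f x) (f x) - dot (g x) (f x) ^+ 2)) = 0.
    under eq_Rintegral do rewrite mulrBr.
    rewrite bRintB; [|exact: bmeasM|by apply: bmeasM => //; exact: bmeasM].
    by rewrite I1 I2 subrr.
  move=> /(bRint_ae0 b3 p3); apply: filterS => x + Dx.
  by rewrite indicE mem_set// mul1r => /eqP; rewrite subr_eq0 => /eqP.
(* The sign is fixed by testing with g on the set where g.f is negative: the integral becomes that
   of |g|^2 against ka, which is nonnegative. *)
have a2 : {ae al, forall x, D x -> 0 <= dot (g x) (f x)}.
  pose A := D `&` [set x | dot (g x) (f x) < 0].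
  have mA : measurable A.
    apply: measurableI => //.
    by have := bgf.1 measurableT _ (measurable_itv `]-oo, 0[); rewrite setTI set_itvE.
  have bA := bmeas_indic R mA.
  have b4 : bmeas (fun x => - (\1_A x * dot (g x) (f x))) by apply: bmeasN; exact: bmeasM.
  have p4 x : 0 <= - (\1_A x * dot (g x) (f x)).
    rewrite indicE; case: (boolP (x \in A)) => [|_]; last by rewrite mul0r oppr0.
    by rewrite inE mul1r oppr_ge0 => -[_ /= /ltW].
  have : \int[al]_x (- (\1_A x * dot (g x) (f x))) = 0.
    apply/eqP; rewrite eq_le bRint_ge0// andbT.
    have -> : \int[al]_x (- (\1_A x * dot (g x) (f x))) = - \int[al]_x (\1_A x * dot (g x) (f x)).
      by under eq_Rintegral do rewrite -mulN1r; rewrite bRintZ ?mulN1r//; exact: bmeasM.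
    rewrite oppr_le0 fg_dot//; last by move=> x [].
    by apply: bRint_ge0 => x; rewrite -enorm2 mulr_ge0 ?sqr_ge0// indicE.
  move=> /(bRint_ae0 b4 p4); apply: filterS => x + Dx.
  case: (ltP (dot (g x) (f x)) 0) => // gf0.
  by rewrite indicE mem_set// mul1r => /eqP; rewrite oppr_eq0 lt_eqF.
apply: filterS3 a1 a2 f_neq0 => x k1 k2 k3 Dx.
have {}k1 := k1 Dx; have {}k2 := k2 Dx.
have gfE : dot (g x) (f x) = enorm (f x).
  by apply/eqP; rewrite -(@eqrXn2 _ 2)// ?enorm_ge0// k1 enorm2.
have n0 : enorm (f x) != 0.
  apply: contra k3 => /eqP n0; apply/eqP/matrixP => i j; rewrite ord1 mxE.
  have := enorm2 (f x); rewrite n0 expr0n/= => /esym/eqP; rewrite psumr_eq0; last first.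
    by move=> k _; rewrite -expr2 sqr_ge0.
  by move=> /allP/(_ i (mem_index_enum _)); rewrite /= mulf_eq0 orbb => /eqP.
(* Equality case: the square of | |f| g - f | is at most 0 once g.f = |f| and |g| <= 1 are
   inserted. *)
have z : dot (enorm (f x) *: g x - f x) (enorm (f x) *: g x - f x) <= 0.
  have -> : dot (enorm (f x) *: g x - f x) (enorm (f x) *: g x - f x) =
      enorm (f x) ^+ 2 * dot (g x) (g x) - 2 * enorm (f x) * dot (g x) (f x) + dot (f x) (f x).
    rewrite /dot !mulr_sumr -sumrB -big_split/=; apply: eq_bigr => i _; rewrite !mxE; ring.
  rewrite gfE -!enorm2 -mulrA -expr2 mulrDl mul1r opprD addrA addrNK subr_le0 -[leRHS]mulr1.
  by rewrite ler_wpM2l ?sqr_ge0// exprn_ile1// enorm_ge0.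
have fE : f x = enorm (f x) *: g x.
  apply/eqP; rewrite eq_sym -subr_eq0; apply/eqP/matrixP => i j; rewrite ord1 [RHS]mxE.
  have : dot (enorm (f x) *: g x - f x) (enorm (f x) *: g x - f x) == 0.
    by rewrite eq_le z/=; apply: sumr_ge0 => k _; rewrite -expr2 sqr_ge0.
  rewrite psumr_eq0; last by move=> k _; rewrite -expr2 sqr_ge0.
  by move=> /allP/(_ i (mem_index_enum _)); rewrite /= mulf_eq0 orbb => /eqP.
by rewrite [X in _ *: X]fE scalerA mulVf// scale1r.
Qed.

End polar_decomposition.
Lemma ae_shift {R : realType} (a : R) (P : R -> Prop) : {ae leb, forall t, P t} ->
  {ae leb, forall t : R, P (t + a)}.
Proof.
move=> [A [mA A0 PA]]; exists ((fun t => t + a) @^-1` A); split.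
- rewrite -[X in measurable X]setTI; exact: (measurable_funD (@measurable_id _ _ setT) (measurable_cst a)).
- by rewrite leb_shift.
- by move=> t nP; apply: PA.
Qed.

(** * The two coupled equations on a box *)

Section coupled_systems.
Context {R : realType} {m1 m2 : nat}.
Variables (b1 b2 : plane R -> plane R).
Variables (H11 : plane R -> 'M[R]_m1) (H12 : plane R -> 'M[R]_(m1, m2)).
Variables (H22 : plane R -> 'M[R]_m2) (H21 : plane R -> 'M[R]_(m2, m1)).
Variables (al be : {finite_measure set (plane R) -> \bar R}).
Variables (s : plane R -> 'cV[R]_m1) (u : plane R -> 'cV[R]_m2).
Variables (r' T : R) (phi1 phi2 : R -> plane R -> plane R).
Variables (W1 : R -> plane R -> 'M[R]_m1) (W2 : R -> plane R -> 'M[R]_m2).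
Variables (L1 M1 C1 L2 M2 C2 kap : R).
Hypothesis ts1 : transport_system b1 H11 H12 al be s u r' T phi1 W1 L1 M1 C1.
Hypothesis ts2 : transport_system b2 H22 H21 be al u s r' T phi2 W2 L2 M2 C2.
Hypothesis T2 : 2 <= T.
Hypothesis u_nz : {ae be, forall x, u x != 0}.
Hypothesis kap0 : 0 < kap.
Hypothesis indep : forall (y : plane R) (p q : R),
  kap * Num.max `|p| `|q| <= `|p *: b1 (clip2 r' y) + q *: b2 (clip2 r' y)|.
Implicit Types (x y : plane R) (A B N : set (plane R)).

Let ch1 := ts_char ts1.
Let ch2 := ts_char ts2.

Let mphi2 t B : measurable B -> measurable (phi2 t @^-1` B).
Proof.
by move=> mB; rewrite -[X in measurable X]setTI; exact: (char_measurable_at ts2 t).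
Qed.

Let mphi1 t B : measurable B -> measurable (phi1 t @^-1` B).
Proof.
by move=> mB; rewrite -[X in measurable X]setTI; exact: (char_measurable_at ts1 t).
Qed.

Lemma bRint_null (mu : {finite_measure set (plane R) -> \bar R}) B (f : plane R -> R) :
  measurable B -> mu B = 0%E -> bmeas f -> (forall x, ~ B x -> f x = 0) -> \int[mu]_x f x = 0.
Proof.
move=> mB B0 bf f0; have [D D0 hD] := bmeas_bound bf; have bB := bmeas_indic R mB.
apply/eqP; rewrite -normr_le0.
have I0 : \int[mu]_x (D * \1_B x) = 0.
  by rewrite bRintZ//; rewrite (_ : \int[mu]_x \1_B x = 0) ?mulr0//; apply: EFin_inj; exact: (etrans (bRint_indic _ mB) B0).
rewrite -I0; apply: bRint_norm_le => //; first exact: bmeasZ.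
move=> x; rewrite indicE; case: (boolP (x \in B)) => [_|]; first by rewrite mulr1.
by rewrite notin_setE => /f0 ->; rewrite normr0 mulr0.
Qed.

(** Each component of u vanishes almost everywhere on B, as one sees by testing on the part of B
    where it has a given sign; but u is nonzero almost everywhere. *)
Lemma null_of_integrals B : measurable B ->
  (forall i B', measurable B' -> B' `<=` B -> \int[be]_x (\1_B' x * u x i 0) = 0) -> be B = 0%E.
Proof.
move=> mB hB; have bu := ts_u ts1.
have half (sg : R) i : (forall B', measurable B' -> B' `<=` B -> \int[be]_x (\1_B' x * (sg * u x i 0)) = 0) ->
    {ae be, forall x, B x -> sg * u x i 0 <= 0}.
  move=> h; pose B' := B `&` [set x | 0 < sg * u x i 0].
  have bsu : bmeas (fun x => sg * u x i 0) by exact/bmeasZ/bu.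
  have mB' : measurable B'.
    apply: measurableI => //.
    by have := (bsu.1) measurableT _ (measurable_itv `]0, +oo[); rewrite setTI set_itvE.
  have bf : bmeas (fun x => \1_B' x * (sg * u x i 0)) by apply: bmeasM => //; exact: bmeas_indic.
  have f0 x : 0 <= \1_B' x * (sg * u x i 0).
    rewrite indicE; case: (boolP (x \in B')) => [|_]; last by rewrite mul0r.
    by rewrite inE => -[_ /= /ltW]; rewrite mul1r.
  have := bRint_ae0 bf f0 (h B' mB' (@subIsetl _ _ _)).
  apply: filterS => x + Bx; rewrite indicE.
  case: (boolP (x \in B')) => [_|]; first by rewrite mul1r => ->.
  by rewrite notin_setE => nB' _; rewrite leNgt; apply/negP => h0; apply: nB'.
have ui i : {ae be, forall x, B x -> u x i 0 = 0}.
  have h1 := half 1 i; have h2 := half (-1) i.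
  have {}h1 : {ae be, forall x, B x -> 1 * u x i 0 <= 0}.
    by apply: h1 => B' mB' B'B; under eq_Rintegral do rewrite mul1r; exact: hB.
  have {}h2 : {ae be, forall x, B x -> -1 * u x i 0 <= 0}.
    apply: h2 => B' mB' B'B.
    have bf : bmeas (fun x => \1_B' x * u x i 0) by apply: bmeasM => //; exact: bmeas_indic.
    have := bRintZ be (-1) bf; rewrite hB// mulr0 => <-.
    by apply: eq_Rintegral => x _; rewrite mulrCA.
  apply: filterS2 h1 h2 => x k1 k2 Bx; apply/eqP; rewrite eq_le.
  have := k1 Bx; rewrite mul1r => -> /=.
  by have := k2 Bx; rewrite mulN1r oppr_le0.
have uz : {ae be, forall x, B x -> u x = 0}.
  have : {ae be, forall x i, B x -> u x i 0 = 0}.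
    have : be.-negligible (\bigcup_(i in [set: nat]) (~` [set x | forall k : 'I_m2, k = i :> nat -> B x -> u x k 0 = 0])).
      apply: negligible_bigcup => i; have [im|im] := ltnP i m2.
        have := ui (Ordinal im); rewrite /almost_everywhere; apply: negligibleS => x /= h h'.
        apply: h => k ki Bx; rewrite (_ : k = Ordinal im)//; last exact: val_inj.
        exact: h'.
      rewrite (_ : ~` _ = set0); first exact: negligible_set0.
      rewrite -subset0 => x /=; apply => k ki; have := ltn_ord k.
      by rewrite ki ltnNge im.
    apply: negligibleS => x /= h; apply: contrapT => nh; apply: h => i Bx.
    apply: contrapT => ux; apply: nh; exists (i : nat) => //= h.
    by apply: ux; exact: h.
  by apply: filterS => x h Bx; apply/matrixP => i j; rewrite ord1 mxE; exact: h.
apply/negligibleP => //.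
have : {ae be, forall x, ~ B x}.
  by apply: filterS2 u_nz uz => x k1 k2 Bx; move: k1; rewrite k2// eqxx.
rewrite /almost_everywhere; apply: negligibleS => x Bx /=; exact.
Qed.

(** Along b2 it is be that is transported and al that couples. Nullity of al on the preimages of B
    makes the carried vector measure constant in q on the subsets of B, and nullity of be at one
    small q makes it 0; at q = 0 it is u be itself. *)
Lemma flow_density r : r < r' -> exists2 d, 0 < d & forall d' B, 0 < d' -> d' <= d ->
  measurable B -> B `<=` box r ->
  {ae leb, forall q : R, 0 <= q <= d' -> al (phi2 q @^-1` B) = 0%E /\ be (phi2 q @^-1` B) = 0%E} ->
  be B = 0%E.
Proof.
move=> rr'; have M20 := char_M0 ch2; have M21 : 0 < M2 + 1 by rewrite ltr_wpDl.
have d0 : 0 < r' - r by rewrite subr_gt0.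
pose r1 := r + (r' - r) / 2.
have r1r' : r1 < r'.
  by rewrite /r1 -ltrBrDl ltr_pdivrMr// ltr_pMr// ltr1n.
have rd0 : 0 < (r' - r) / 2 by rewrite divr_gt0.
(* At speed at most M2, a point of the box of radius r does not reach the radius [r1], halfway to
   r', within this time. The bound 1 keeps the times within T, since T is at least 2. *)
exists (Num.min 1 ((r' - r) / 2 / (M2 + 1))).
  by rewrite lt_min ltr01 divr_gt0.
move=> d' B d'0; rewrite le_min => /andP[d'1 d'M] mB Br aeB.
have [q /andP[q0 qd] [_ beq]] := ae_exists_lt d'0 aeB.
apply: null_of_integrals => // i B' mB' B'B.
have le0 (mu : {finite_measure set (plane R) -> \bar R}) t : mu (phi2 t @^-1` B) = 0%E -> mu (phi2 t @^-1` B') = 0%E.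
  move=> h; apply: (subset_measure0 (mphi2 t mB') (mphi2 t mB)) => //.
  by move=> x /B'B.
have conf : B' `<=` confined phi2 0 q r1.
  move=> y /B'B/Br yr t /andP[t0 tq].
  have h := char_time ch2 0 (- t) y; rewrite (char0 ch2) subr0 normrN ger0_norm// in h.
  rewrite -[phi2 (- t) y](subrK y) (le_lt_trans (ler_normD _ _))// addrC /r1.
  apply: ler_ltD => //; apply: (le_lt_trans h).
  apply: (@le_lt_trans _ _ ((r' - r) / 2 / (M2 + 1) * M2)).
    by rewrite ler_wpM2r// (le_trans tq)// (le_trans qd).
  by rewrite mulrAC ltr_pdivrMr// ltr_pM2l// ltrDl.
have E := @transport_set _ _ _ _ _ _ _ _ _ _ _ _ _ _ _ _ _ ts2 i 0 q r1 B' r1r' q0.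
have {}E : carried be u phi2 W2 i B' q = carried be u phi2 W2 i B' 0.
  apply: E => //.
  - by rewrite normr0 add0r (le_trans _ T2)// ler1n.
  - by rewrite ger0_norm ?(ltW q0)// (le_trans _ T2)// mulr2n lerD2r (le_trans qd).
  apply: filterS aeB => t ht /andP[t0 tq]; apply: le0.
  by have [] := ht; rewrite ?t0 ?(le_trans tq).
have E0 : carried be u phi2 W2 i B' 0 = \int[be]_x (\1_B' x * u x i 0).
  rewrite /carried (bigD1 i)//= [X in _ + X]big1 ?addr0.
    by apply: eq_Rintegral => x _; rewrite (char0 ch2) (charW0 ch2) mxE eqxx mulr1.
  move=> l li; rewrite -[RHS](bRint0 be); apply: eq_Rintegral => x _.
  by rewrite (charW0 ch2) mxE eq_sym (negbTE li) mulr0 mul0r.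
rewrite -E0 -E /carried big1// => l _.
apply: (bRint_null (mphi2 q mB')); first exact: le0.
  apply: bmeasM; last exact: (ts_u ts1).
  apply: bmeasM; first exact: (bmeas_indic R (mphi2 q mB')).
  have qT : `|q| <= T by rewrite ger0_norm ?(ltW q0)// (le_trans qd)// (le_trans d'1)// (ts_T1 ts2).
  split; last by exists C2 => x; rewrite (le_trans (mx_norm_entry _ _ _))// (charW_bound ch2).
  apply: continuous_measurable_plane; apply: (@lip_continuous _ _ C2) => x y.
  by rewrite -mx_entryB (le_trans (mx_norm_entry _ _ _))// (charW_lip ch2).
by move=> x nx; rewrite indicE memNset// !mul0r.
Qed.

(** For almost every t, the double-flow result, applied to both al and be, shows that phi1_t^-1(N)
    has null preimages under almost every small time of the second flow; [flow_density] then removes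
    that flow. The intersection with a box provides the confinement that it needs. *)
Lemma coupling_null r N : r < r' -> measurable N -> leb2 N = 0%E ->
  {ae leb, forall t : R, be (box r `&` phi1 t @^-1` N) = 0%E}.
Proof.
move=> rr' mN N0; have [d d0 hd] := flow_density rr'.
have [B1 B10 [_ b1L]] := ts_b1 ts1; have [B2 B20 [_ b2L]] := ts_b2 ts1.
have BL x y : `|b1 (clip2 r' x) - b1 (clip2 r' y)| <= (B1 + B2) * `|x - y|.
  rewrite le_pair_norm /=; apply/andP; split.
    by rewrite (le_trans (b1L _ _))// ler_wpM2r// lerDl.
  by rewrite (le_trans (b2L _ _))// ler_wpM2r// lerDr.
have BB0 := addr_ge0 B10 B20.
have [da da0 ha] := double_flow_null ch1 ch2 BB0 BL kap0 indep al.
have [db db0 hb] := double_flow_null ch1 ch2 BB0 BL kap0 indep be.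
pose e := Num.min d (Num.min da db).
have e0 : 0 < e by rewrite !lt_min d0 da0.
have ed : e <= d by rewrite ge_min lexx.
have ea : e <= da by rewrite ge_min ge_min lexx orbT.
have eb : e <= db by rewrite ge_min ge_min lexx !orbT.
apply: filterS2 (ha e N (ltW e0) ea mN N0) (hb e N (ltW e0) eb mN N0) => t h1 h2.
have mB : measurable (box r `&` phi1 t @^-1` N).
  by apply: measurableI; [exact: measurable_box|exact: mphi1].
apply: (hd e) => //.
apply: filterS2 h1 h2 => q k1 k2 qe.
have sub (mu : {finite_measure set (plane R) -> \bar R}) : mu (phi2 q @^-1` (phi1 t @^-1` N)) = 0%E ->
    mu (phi2 q @^-1` (box r `&` phi1 t @^-1` N)) = 0%E.
  move=> h; apply: (subset_measure0 (mphi2 q mB) (mphi2 q (mphi1 t mN))) => //.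
  by move=> x [].
by split; apply: sub; [exact: k1|exact: k2].
Qed.

Hypothesis s_le1 : forall x, enorm (s x) <= 1.
Hypothesis s_eq1 : {ae al, forall x, enorm (s x) = 1}.

Let carried0 i B : carried al s phi1 W1 i B 0 = \int[al]_x (\1_B x * s x i 0).
Proof.
rewrite /carried (bigD1 i)//= [X in _ + X]big1 ?addr0.
  by apply: eq_Rintegral => x _; rewrite (char0 ch1) (charW0 ch1) mxE eqxx mulr1.
move=> l li; rewrite -[RHS](bRint0 al); apply: eq_Rintegral => x _.
by rewrite (charW0 ch1) mxE eq_sym (negbTE li) mulr0 mul0r.
Qed.

(** Transport of null sets says that W_q s al and the density s(phi_q) with respect to the image of
    al under phi_(-q) define the same vector measure on the confined part of N; [polar_unique]
    concludes. *)
Lemma flow_polar r q N : r < r' -> `|q| + 1 <= T -> measurable N -> leb2 N = 0%E ->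
  {ae al, forall x, N x -> (forall t, Num.min 0 q <= t <= Num.max 0 q -> `|phi1 t x| < r) ->
    s (phi1 q x) = (enorm (W1 q x *m s x))^-1 *: (W1 q x *m s x)}.
Proof.
move=> rr' qT mN N0.
(* [transport_set] needs a time interval of positive length. *)
have [->|q0] := eqVneq q 0.
  apply: filterS s_eq1 => x sx _ _.
  by rewrite (char0 ch1) (charW0 ch1) mul1mx sx invr1 scale1r.
(* The interval between 0 and q, whatever the sign of q; since a + c = q, the map t |-> q - t
   exchanges its end points. *)
pose a := Num.min 0 q; pose c := Num.max 0 q.
have ac : a < c by rewrite /a /c; case: (ltgtP 0 q) q0 => //; rewrite ?eqxx.
have acq : a + c = q by rewrite addr_min_max add0r.
have qT' : `|q| <= T by rewrite (le_trans _ qT)// lerDl.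
have aT : `|a| + 1 <= T.
  by rewrite /a; case: (ltgtP 0 q) => // _; rewrite normr0 add0r (ts_T1 ts1).
have cT : `|c| + 1 <= T.
  by rewrite /c; case: (ltgtP 0 q) => // _; rewrite normr0 add0r (ts_T1 ts1).
pose G := confined phi1 a c r.
have mG : measurable G by apply: open_measurable_plane; exact: (confined_open ts1 (ltW ac)).
pose D := N `&` phi1 q @^-1` G.
have mD : measurable D by apply: measurableI => //; exact: mphi1.
have nullB := coupling_null rr' mN N0.
have W_bmeas i l : bmeas (fun x => W1 q x i l).
  split; last by exists C1 => x; rewrite (le_trans (mx_norm_entry _ _ _))// (charW_bound ch1).
  apply: continuous_measurable_plane; apply: (@lip_continuous _ _ C1) => x y.
  by rewrite -mx_entryB (le_trans (mx_norm_entry _ _ _))// (charW_lip ch1).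
have bs i : bmeas (fun x => s x i 0) by exact: (ts_s ts1).
have bsq i : bmeas (fun x => s (phi1 q x) i 0).
  have [mf [M hM]] := bs i; split; last by exists M => x; exact: hM.
  exact: (measurableT_comp mf (char_measurable_at ts1 q)).
have bf i : bmeas (fun x => (W1 q x *m s x) i 0).
  by under eq_fun do rewrite mxE; apply: bmeas_sum => l; exact: bmeasM.
(* The mass of A for ka is the mass of phi_q(A) for al: both measures are brought back to the
   initial points. *)
pose ka := fpush al (char_measurable_at ts1 (- q)).
have fg A i : measurable A -> A `<=` D ->
    \int[al]_x (\1_A x * (W1 q x *m s x) i 0) = \int[ka]_x (\1_A x * s (phi1 q x) i 0).
  move=> mA AD; pose B := phi1 (- q) @^-1` A.
  have mB : measurable B by exact: mphi1.
  have BA : phi1 q @^-1` B = A by rewrite /B; apply/seteqP; split => x /=; rewrite (charK ch1).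
  have BG : B `<=` G.
    by move=> y /AD[_]; rewrite /= (charNK ch1).
  have := @transport_set _ _ _ _ _ _ _ _ _ _ _ _ _ _ _ _ _ ts1 i a c r B rr' ac aT cT mB BG.
  have h : {ae leb, forall t : R, a <= t <= c -> be (phi1 t @^-1` B) = 0%E}.
    (* Here B is the image of A, a subset of N, under phi_q, so phi_t^-1(B) lies in phi_(t -
       q)^-1(N): the exceptional times are translated by q. *)
    apply: filterS (ae_shift (- q) nullB) => t ht tac.
    apply: (subset_measure0 (mphi1 t mB) _ _ ht).
      by apply: measurableI; [exact: measurable_box|exact: mphi1].
    move=> x Bx; split.
      by have := BG _ Bx t tac; rewrite (charK ch1) /box/= => /ltW.
    by have [+ _] := AD _ Bx; rewrite /= -(charD ch1).
  move=> /(_ h) E.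
  have {}E : carried al s phi1 W1 i B q = carried al s phi1 W1 i B 0.
    by move: E; rewrite /a /c; case: (ltgtP 0 q) q0.
  have bA := bmeas_indic R mA.
  have -> : \int[al]_x (\1_A x * (W1 q x *m s x) i 0) = carried al s phi1 W1 i B q.
    rewrite /carried -bRint_sum.
      apply: eq_Rintegral => x _; rewrite mxE mulr_sumr; apply: eq_bigr => l _.
      by rewrite mulrA -BA.
    move=> l; apply: bmeasM => //; apply: bmeasM => //.
    exact: (bmeas_indic R (mphi1 q mB)).
  rewrite E carried0 bRint_push; last exact: bmeasM.
  by apply: eq_Rintegral => x _; rewrite (charNK ch1).
have g1 : {ae ka, forall x, enorm (s (phi1 q x)) = 1}.
  have [A [mA A0 hA]] := s_eq1; exists (phi1 q @^-1` A); split; first exact: mphi1.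
    change (al (phi1 (- q) @^-1` (phi1 q @^-1` A)) = 0%E).
    rewrite (_ : _ @^-1` _ = A)//; apply/seteqP; split => x /=; by rewrite (charNK ch1).
  by move=> x /= h; apply: hA.
have f0 : {ae al, forall x, W1 q x *m s x != 0}.
  apply: filterS s_eq1 => x sx; apply/eqP => Ws.
  have /mulmx1C E := charW_inv ch1 x qT'.
  have : s x = 0 by rewrite -[s x]mul1mx -E -mulmxA Ws mulmx0.
  by move=> s0; move: sx; rewrite s0 enorm0 => /esym/eqP; rewrite oner_eq0.
have := polar_unique bf bsq mD fg (fun x => s_le1 _) g1 f0.
apply: filterS => x h Nx hx; apply: h; split => // t tac /=.
rewrite -(charD ch1); apply: hx; rewrite -/a -/c -acq.
move: tac => /andP[h1 h2]; rewrite -addrA lerDl subr_ge0 h2 addrC.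
by rewrite -addrA gerDl addrC subr_le0.
Qed.

End coupled_systems.

(** * Vector Radon measures and their polar functions *)

Section variation_bounds.
Context {R : realType}.
Implicit Types (A B F : set (plane R)) (g : set (plane R) -> R).

Lemma bounded_borel_box A (r : R) : measurable A -> A `<=` box r -> bounded_borel A.
Proof.
move=> mA Ar; split => //; exists r; split; first exact: num_real.
by move=> M rM x /Ar xr; exact: le_trans xr (ltW rM).
Qed.

Lemma variation_ge g A : g set0 = 0 -> (forall B, 0 <= g B) -> bounded_borel A ->
  ((g A)%:E <= variation g A)%E.
Proof.
move=> g0 gge bA; apply: ereal_sup_ubound; exists (fun k => if k == 0%N then A else set0).
  split.
  - by move=> k; case: ifP => // _; exact: bounded_borel0.
  - move=> i j _ _; case: ifP => [/eqP ->|_]; case: ifP => [/eqP ->|_] // [x []] //.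
  - by move=> k; case: ifP => _ x.
rewrite (nneseries_split 0 1); last by move=> k _; rewrite lee_fin.
by rewrite add0n big_nat1/= eseries0 ?adde0// => -[|k] // _ _; rewrite /= g0.
Qed.

Lemma variation_le_integral (m : {measure set (plane R) -> \bar R}) g (h : plane R -> \bar R) A :
  (forall B, 0 <= g B) -> measurable A -> measurable_fun setT h -> (forall x, 0 <= h x)%E ->
  (forall F, bounded_borel F -> F `<=` A -> ((g F)%:E <= \int[m]_(x in F) h x)%E) ->
  (variation g A <= \int[m]_(x in A) h x)%E.
Proof.
move=> gge mA mh h0 gh; apply: ge_ereal_sup => _ [F [bF tF FA] <-].
have mF k : measurable (F k) by case: (bF k).
apply: (@le_trans _ _ (\sum_(0 <= k <oo) \int[m]_(x in F k) h x)%E).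
  apply: lee_lim.
  - by apply: is_cvg_nneseries => k _ _; rewrite lee_fin.
  - by apply: is_cvg_nneseries => k _ _; apply: integral_ge0.
  - by apply: nearW => n; apply: lee_sum => k _; exact: gh.
rewrite -ge0_integral_bigcup//; last by apply: measurable_funTS.
  apply: ge0_subset_integral => //.
  - exact: bigcup_measurable.
  - exact: measurable_funTS.
  - by move=> x [k _ /FA].
Qed.

Lemma integral_mfrestr0 (m : {measure set (plane R) -> \bar R}) D (mD : measurable D)
    (mDoo : (m D < +oo)%E) (f : plane R -> R) : bmeas f -> (forall x, ~ D x -> f x = 0) ->
  \int[mfrestr mD mDoo]_x f x = \int[m]_x f x.
Proof.
move=> [mf _] f0; rewrite /Rintegral; congr fine.
have mE : measurable_fun setT (EFin \o f) by exact/measurable_EFinP.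
rewrite integralE [RHS]integralE.
have key (h : plane R -> \bar R) : measurable_fun setT h -> (forall x, 0 <= h x)%E ->
    (forall x, ~ D x -> h x = 0%E) -> (\int[mfrestr mD mDoo]_x h x = \int[m]_x h x)%E.
  move=> mh h0 hD; rewrite ge0_integral_mfrestr// integral_mkcond; apply: eq_integral => x _.
  rewrite patchE; case: ifPn => //; rewrite notin_setE => /hD ->//.
congr (_ - _)%E; apply: key.
- exact: measurable_funepos.
- by move=> x; exact: funepos_ge0.
- by move=> x Dx; rewrite funeposE f0// maxxx.
- exact: measurable_funeneg.
- by move=> x; exact: funeneg_ge0.
- by move=> x Dx; rewrite funenegE f0// oppe0 maxxx.
Qed.

Lemma bRint_setE d (T : measurableType d) (m : {finite_measure set T -> \bar R}) (A : set T) (f : T -> R) :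
  measurable A -> bmeas f ->
  ((\int[m]_x (\1_A x * f x))%:E = \int[m]_(x in A) (f x)%:E)%E.
Proof.
move=> mA bf; rewrite bRint_EFin; last by apply: bmeasM => //; exact: bmeas_indic.
rewrite [RHS]integral_mkcond; apply: eq_integral => x _; rewrite patchE indicE.
by case: (x \in A); rewrite ?mul1r ?mul0r.
Qed.

Lemma ae_mfrestr d (T : measurableType d) (m : {measure set T -> \bar R}) (D : set T) (mD : measurable D)
    (mDoo : (m D < +oo)%E) (P : T -> Prop) : {ae mfrestr mD mDoo, forall x, P x} ->
  {ae m, forall x, D x -> P x}.
Proof.
move=> [A [mA A0 PA]]; exists (A `&` D); split; [exact: measurableI|exact: A0|].
move=> x /= nP; split; last by apply: contrapT => nD; apply: nP.
by apply: PA => /= Px; exact: nP.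
Qed.

End variation_bounds.

Section polar_facts.
Context {R : realType} {m : nat}.
Variables (mu : vradon R m) (sigma : plane R -> 'cV[R]_m).
Hypothesis pol : polar mu sigma.
Implicit Types (A B F : set (plane R)) (x : plane R).

Let ms i : measurable_fun setT (fun x => sigma x i 0). Proof. by have [h _] := pol; exact: h. Qed.

Lemma enorm_le_sum (v : 'cV[R]_m) : enorm v <= \sum_i `|v i 0|.
Proof.
have s0 : 0 <= \sum_i `|v i 0| by apply: sumr_ge0.
rewrite -(@ler_pXn2r _ 2)// ?nnegrE ?enorm_ge0// /enorm sqr_sqrtr; last first.
  by apply: sumr_ge0 => i _; exact: sqr_ge0.
rewrite [leRHS]expr2 mulr_suml; apply: ler_sum => i _.
rewrite -[leLHS]real_normK ?num_real// expr2 ler_wpM2l//.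
by rewrite (bigD1 i)//= lerDl sumr_ge0.
Qed.

Lemma entry_le_enorm (v : 'cV[R]_m) i : `|v i 0| <= enorm v.
Proof.
rewrite -(@ler_pXn2r _ 2)// ?nnegrE ?enorm_ge0// /enorm sqr_sqrtr; last first.
  by apply: sumr_ge0 => j _; exact: sqr_ge0.
rewrite real_normK ?num_real// (bigD1 i)//= lerDl; apply: sumr_ge0 => j _; exact: sqr_ge0.
Qed.

Lemma enorm_eq0 (v : 'cV[R]_m) : (enorm v == 0) = (v == 0).
Proof.
apply/eqP/eqP => [v0|->]; last exact: enorm0.
apply/matrixP => i j; rewrite ord1 mxE; apply/eqP.
by rewrite -normr_le0 (le_trans (entry_le_enorm v i))// v0.
Qed.

Lemma tv_ge A : bounded_borel A -> ((enorm (mu A))%:E <= tv mu A)%E.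
Proof. by apply: variation_ge => [|B]; [rewrite vm0 enorm0|exact: enorm_ge0]. Qed.

(** The integral in [polar] has a finite value, and the difference of the integrals of the positive
    and negative parts is finite only when both of them are. *)
Lemma polar_integrable A i : bounded_borel A ->
  (tv mu).-integrable A (fun x => (sigma x i 0)%:E).
Proof.
move=> bA; apply/integrableP; split; first by apply/measurable_EFinP; exact: measurable_funTS.
have [_ /(_ A i bA)] := pol; rewrite integralE => E.
have : (mu A i 0)%:E \is a fin_num by [].
rewrite -E fin_numB => /andP[fp fn].
have mE : measurable_fun A (fun x => (sigma x i 0)%:E) by apply/measurable_EFinP; exact: measurable_funTS.
have [mA _] := bA.
under eq_integral do rewrite -/((abse \o (fun x => (sigma x i 0)%:E)) _) fune_abse.
rewrite ge0_integralD//.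
- by rewrite lte_add_pinfty// ltey_eq ?fp ?fn.
- exact: measurable_funepos.
- exact: measurable_funeneg.
Qed.

(** The finiteness of |mu| on bounded sets is extracted from the polar identity: each |mu F| is at
    most the integral over F of the sum of the |sigma_i|, hence so is the variation, and this
    integral is finite on A. *)
Lemma tv_lty A : bounded_borel A -> (tv mu A < +oo)%E.
Proof.
move=> bA; have [mA _] := bA.
have mh : measurable_fun setT (fun x => (\sum_i `|sigma x i 0|)%:E).
  by apply/measurable_EFinP; apply: measurable_sum => i; exact: measurableT_comp.
apply: (@le_lt_trans _ _ (\int[tv mu]_(x in A) (\sum_i `|sigma x i 0|)%:E)%E).
  apply: variation_le_integral => //.
  - by move=> B; exact: enorm_ge0.
  - by move=> x; rewrite lee_fin sumr_ge0.
  move=> F bF _; have [mF _] := bF.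
  apply: (@le_trans _ _ (\sum_i `|mu F i 0|)%:E); first by rewrite lee_fin enorm_le_sum.
  under eq_integral do rewrite -sumEFin.
  rewrite ge0_integral_sum//; last first.
    by move=> i; apply/measurable_EFinP; apply: measurable_funTS; exact: measurableT_comp.
  rewrite -sumEFin; apply: lee_sum => i _.
  have [_ /(_ F i bF) E] := pol; rewrite -abse_EFin -E; apply: le_abse_integral => //.
  by apply/measurable_EFinP; exact: measurable_funTS.
under eq_integral do rewrite -sumEFin.
rewrite ge0_integral_sum//; last first.
  by move=> i; apply/measurable_EFinP; apply: measurable_funTS; exact: measurableT_comp.
apply: lte_sum_pinfty => i _.
by have /integrableP[_] := polar_integrable i bA.
Qed.

Definition tv_box (r : R) : set (plane R) -> \bar R :=
  mfrestr (measurable_box r) (tv_lty (bounded_borel_box (measurable_box r) (@subset_refl _ (box r)))).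

HB.instance Definition _ r := Measure.on (tv_box r).
HB.instance Definition _ r := FiniteMeasure.on (tv_box r).

Lemma ae_tv_box r (P : plane R -> Prop) : {ae tv_box r, forall x, P x} ->
  {ae tv mu, forall x, box r x -> P x}.
Proof. exact: ae_mfrestr. Qed.

Variable r : R.
Let al : {finite_measure set (plane R) -> \bar R} := tv_box r.

Let al_in A : A `<=` box r -> al A = tv mu A.
Proof. by move=> Ar; change (tv mu (A `&` box r) = tv mu A); rewrite setIidl. Qed.

Let al_out : al (~` box r) = 0%E.
Proof. by change (tv mu (~` box r `&` box r) = 0%E); rewrite setICl measure0. Qed.

Let Rint_mu A i (f : plane R -> R) : measurable A -> A `<=` box r -> bmeas f ->
  {ae tv mu, forall x, A x -> f x = sigma x i 0} -> \int[al]_x (\1_A x * f x) = mu A i 0.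
Proof.
move=> mA Ar bf fs; have bA := bmeas_indic R mA.
rewrite /al /tv_box integral_mfrestr0; first last.
- by move=> x xr; rewrite indicE memNset ?mul0r// => /Ar.
- exact: bmeasM.
have [_ /(_ A i (bounded_borel_box mA Ar)) E] := pol.
apply: EFin_inj; rewrite -E /Rintegral.
have -> : (\int[tv mu]_x (\1_A x * f x)%:E = \int[tv mu]_(x in A) (f x)%:E)%E.
  rewrite [RHS]integral_mkcond; apply: eq_integral => x _; rewrite patchE indicE.
  by case: (x \in A); rewrite ?mul1r ?mul0r.
have -> : (\int[tv mu]_(x in A) (f x)%:E = \int[tv mu]_(x in A) (sigma x i 0)%:E)%E.
  apply: ae_eq_integral => //.
  - by apply/measurable_EFinP; apply: measurable_funTS; case: bf.
  - by apply/measurable_EFinP; exact: measurable_funTS.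
  - by apply: filterS fs => x h Ax; rewrite h.
by rewrite E.
Qed.

Let box_le (M : R) := [set x | forall i, `|sigma x i 0| <= M].

Let mbox_le M : measurable (box_le M).
Proof.
rewrite (_ : box_le M = \bigcap_(i in [set: 'I_m]) [set x | `|sigma x i 0| <= M]); last first.
  by apply/seteqP; split => [x h i _|x h i]; [exact: h|exact: (h i I)].
apply: fin_bigcap_measurable => // i _.
have := measurableT_comp (@normr_measurable R setT) (ms i).
by move=> /(_ measurableT _ (measurable_itv `]-oo, M])); rewrite setTI set_itvE.
Qed.

Let dot_le (u v : 'cV[R]_m) : \sum_i u i 0 * v i 0 <= enorm u * enorm v.
Proof.
apply: le_trans (ler_norm _) _.
rewrite -(@ler_pXn2r _ 2)// ?nnegrE ?mulr_ge0 ?enorm_ge0// real_normK ?num_real// exprMn.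
by rewrite /enorm !sqr_sqrtr ?cauchy_schwarz//; apply: sumr_ge0 => i _; exact: sqr_ge0.
Qed.

(** On this set E the integral of c.sigma is c.mu(E), at most |c| |mu|(E). Hence the nonnegative
    function c.sigma - |c| has integral at most 0 over E. The bound M on the entries keeps the
    integrands bounded. *)
Let direction_null (c : 'cV[R]_m) M :
  al.-negligible (box r `&` box_le M `&` [set x | enorm c < \sum_i c i 0 * sigma x i 0]).
Proof.
pose D := box r `&` box_le M; have mD : measurable D by apply: measurableI; [exact: measurable_box|exact: mbox_le].
have bD := bmeas_indic R mD.
pose f i x := \1_D x * sigma x i 0.
have bf i : bmeas (f i).
  split; first by apply: measurable_funM => //; exact: measurable_indic.
  exists `|M| => x; rewrite /f indicE; case: (boolP (x \in D)) => [|_]; last by rewrite mul0r normr0.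
  by rewrite inE mul1r => -[_ /(_ i)] h; rewrite (le_trans h)// ler_norm.
set E := (X in al.-negligible X).
have mE : measurable E.
  apply: measurableI => //.
  have : measurable_fun setT (fun x => \sum_i c i 0 * sigma x i 0).
    by apply: measurable_sum => i; exact: measurable_funM.
  by move=> /(_ measurableT _ (measurable_itv `]enorm c, +oo[)); rewrite setTI set_itvE.
have Er : E `<=` box r by move=> x [[]].
have bE := bmeas_indic R mE.
have bs : bmeas (fun x => \sum_i c i 0 * f i x) by apply: bmeas_sum => i; exact: bmeasZ.
have bh : bmeas (fun x => \1_E x * (\sum_i c i 0 * f i x - enorm c)).
  by apply: bmeasM => //; apply: bmeasB => //; exact: bmeas_cst.
have fE x i : E x -> f i x = sigma x i 0 by move=> [Dx _]; rewrite /f indicE mem_set// mul1r.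
have h0 x : 0 <= \1_E x * (\sum_i c i 0 * f i x - enorm c).
  rewrite indicE; case: (boolP (x \in E)) => [|_]; last by rewrite mul0r.
  rewrite inE mul1r subr_ge0 => Ex; under eq_bigr do rewrite fE//.
  by case: Ex => _ /= /ltW.
have aE : (fine (al E))%:E = al E by rewrite fineK// fin_num_measure.
have muE : enorm (mu E) <= fine (al E).
  by rewrite -lee_fin aE al_in//; apply: tv_ge; exact: bounded_borel_box Er.
have If : \int[al]_x (\1_E x * (\sum_i c i 0 * f i x - enorm c)) = 0.
  apply/eqP; rewrite eq_le bRint_ge0// andbT.
  have -> : \int[al]_x (\1_E x * (\sum_i c i 0 * f i x - enorm c)) =
      \sum_i c i 0 * mu E i 0 - enorm c * fine (al E).
    have IE : \int[al]_x (\1_E x : R) = fine (al E) by apply: EFin_inj; rewrite bRint_indic.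
    rewrite -IE -bRintZ//.
    have -> : \sum_i c i 0 * mu E i 0 = \int[al]_x (\sum_i c i 0 * (\1_E x * f i x)).
      rewrite bRint_sum; last by move=> i; apply: bmeasZ; exact: bmeasM.
      apply: eq_bigr => i _; rewrite bRintZ; last exact: bmeasM.
      by congr (_ * _); apply/esym; apply: Rint_mu => //; apply: aeW => x Ex; exact: fE.
    rewrite -bRintB; [|by apply: bmeas_sum => i; apply: bmeasZ; exact: bmeasM|exact: bmeasZ].
    apply: eq_Rintegral => x _; rewrite mulrBr [enorm c * _]mulrC; congr (_ - _).
    by rewrite mulr_sumr; apply: eq_bigr => i _; rewrite mulrCA.
  by rewrite subr_le0 (le_trans (dot_le _ _))// ler_wpM2l// enorm_ge0.
have := bRint_ae0 bh h0 If; apply: negligibleS => x Ex /=.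
rewrite indicE mem_set// mul1r => /eqP; rewrite subr_eq0 => /eqP.
under eq_bigr do rewrite fE//.
by case: Ex => _ /= /[swap] ->; rewrite ltxx.
Qed.

(* Countably many directions detect the vectors of norm > 1, so that
   [direction_null] shows [enorm (sigma x) <= 1] almost everywhere. *)
Let rat_direction (v : 'cV[R]_m) : 1 < enorm v -> exists c : 'cV[rat]_m,
  enorm (map_mx ratr c : 'cV[R]_m) < \sum_i (map_mx ratr c : 'cV[R]_m) i 0 * v i 0.
Proof.
move=> v1; pose S := \sum_i `|v i 0|; have S0 : 0 <= S by exact: sumr_ge0.
have F0 : 0 < S + m%:R + 1 by rewrite ltr_wpDl// addr_ge0.
(* A rational vector c within eta of v in each coordinate satisfies |c| <= |v| + eta m and c.v >=
   |v|^2 - eta S. This eta makes the first bound smaller than the second. *)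
pose eta := (enorm v ^+ 2 - enorm v) / (S + m%:R + 1).
have d0 : 0 < enorm v ^+ 2 - enorm v.
  by rewrite subr_gt0 expr2 ltr_pMr// (lt_trans ltr01).
have eta0 : 0 < eta by rewrite divr_gt0.
have /choice[q hq] : forall i, exists q : rat, `|ratr q - v i 0| <= eta.
  move=> i; have [q] : exists q : rat, ratr q \in `](v i 0 - eta), (v i 0 + eta)[.
    by apply: rat_in_itvoo; rewrite ltrBlDr -addrA ltrDl addr_gt0.
  by rewrite in_itv/= => /andP[q1 q2]; exists q; rewrite ler_distl !ltW.
exists (\col_i q i).
set c : 'cV[R]_m := map_mx ratr _.
have cE i : c i 0 = ratr (q i) by rewrite !mxE.
have c1 : enorm c <= enorm v + eta * m%:R.
  rewrite -[c](subrK v) addrC (le_trans (ler_enormD _ _))// lerD2l (le_trans (enorm_le_sum _))//.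
  rewrite (@le_trans _ _ (\sum_(i < m) eta))//; last by rewrite sumr_const card_ord mulr_natr.
  by apply: ler_sum => i _; rewrite mx_entryB cE.
have c2 : enorm v ^+ 2 - eta * S <= \sum_i c i 0 * v i 0.
  have -> : enorm v ^+ 2 = \sum_i v i 0 ^+ 2.
    by rewrite /enorm sqr_sqrtr//; apply: sumr_ge0 => i _; exact: sqr_ge0.
  rewrite /S mulr_sumr -sumrB; apply: ler_sum => i _.
  rewrite lerBlDr -lerBlDl expr2 -mulrBl (le_trans (ler_norm _))// normrM ler_wpM2r//.
  by rewrite distrC cE.
rewrite (le_lt_trans c1)// (lt_le_trans _ c2)// -subr_gt0.
have E : eta * (S + m%:R + 1) = enorm v ^+ 2 - enorm v by rewrite divfK// gt_eqF.
have -> : enorm v ^+ 2 - eta * S - (enorm v + eta * m%:R) = enorm v ^+ 2 - enorm v - eta * (S + m%:R) by ring.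
by rewrite -E -mulrBr addrAC subrr add0r mulr1.
Qed.

(* a bounded everywhere-defined version of [sigma], which is equal to it almost
   everywhere *)
Definition unit_part x : 'cV[R]_m := if \sum_i sigma x i 0 ^+ 2 <= 1 then sigma x else 0.

Lemma unit_part_id x : unit_part x != 0 -> unit_part x = sigma x.
Proof. by rewrite /unit_part; case: ifP; rewrite ?eqxx. Qed.

Lemma unit_part_le1 x : enorm (unit_part x) <= 1.
Proof.
rewrite /unit_part; case: ifPn => h; last by rewrite enorm0.
by rewrite /enorm -sqrtr1 ler_wsqrtr.
Qed.

Let mS : measurable_fun setT (fun x => \sum_i sigma x i 0 ^+ 2).
Proof. by apply: measurable_sum => i; exact: measurable_funX. Qed.

Lemma unit_part_bmeas i : bmeas (fun x => unit_part x i 0).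
Proof.
split; last by exists 1 => x; rewrite (le_trans (entry_le_enorm _ _))// unit_part_le1.
have mD : measurable [set x | \sum_i sigma x i 0 ^+ 2 <= 1].
  by have := mS measurableT (measurable_itv `]-oo, 1]); rewrite setTI set_itvE.
rewrite (_ : (fun x => _) = (fun x => \1_[set x | \sum_i sigma x i 0 ^+ 2 <= 1] x * sigma x i 0)).
  by apply: measurable_funM => //; exact: measurable_indic.
apply/funext => x; rewrite /unit_part indicE; case: ifPn => h.
  by rewrite mem_set// mul1r.
by rewrite memNset ?mul0r ?mxE//; exact/negP.
Qed.

Let enorm_gt1 x : (enorm (sigma x) <= 1) = (\sum_i sigma x i 0 ^+ 2 <= 1).
Proof.
have s0 : 0 <= \sum_i sigma x i 0 ^+ 2 by apply: sumr_ge0 => i _; exact: sqr_ge0.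
by rewrite -(@ler_pXn2r _ 2)// ?nnegrE ?enorm_ge0// expr1n /enorm sqr_sqrtr.
Qed.

Let unit_part_ae : {ae tv mu, forall x, box r x -> unit_part x = sigma x}.
Proof.
apply: ae_tv_box.
have : al.-negligible ((~` box r) `|` \bigcup_n (if unpickle n is Some (c, M) then
    box r `&` box_le (M : nat)%:R `&` [set x | enorm (map_mx ratr (c : 'cV[rat]_m) : 'cV[R]_m) <
      \sum_i (map_mx ratr c : 'cV[R]_m) i 0 * sigma x i 0] else set0)).
  apply: negligibleU; first by apply/negligibleP => //; apply: measurableC; exact: measurable_box.
  apply: negligible_bigcup => n; case: unpickle => [[c M]|]; last exact: negligible_set0.
  exact: direction_null.
apply: negligibleS => x /= h; have [xr|xr] := pselect (box r x); last by left.
right; move: h; rewrite /unit_part; case: ifPn => // h _.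
have v1 : 1 < enorm (sigma x) by rewrite ltNge enorm_gt1.
have [c hc] := rat_direction v1.
exists (pickle (c, Num.bound (enorm (sigma x)))) => //; rewrite pickleK; split=> //; split=> // i.
by rewrite (le_trans (entry_le_enorm _ _))// ltW// archi_boundP// enorm_ge0.
Qed.

Lemma Rint_unit_part A i : measurable A -> A `<=` box r ->
  \int[al]_x (\1_A x * unit_part x i 0) = mu A i 0.
Proof.
move=> mA Ar; apply: Rint_mu => //; first exact: unit_part_bmeas.
by apply: filterS unit_part_ae => x h /Ar /h ->.
Qed.

Let enorm_bmeas : bmeas (fun x => enorm (unit_part x)).
Proof.
split; last by exists 1 => x; rewrite ger0_norm ?enorm_ge0// unit_part_le1.
apply: (measurableT_comp (continuous_measurable_fun (@sqrt_continuous R))).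
apply: measurable_sum => i; apply: measurable_funX.
by case: (unit_part_bmeas i).
Qed.

(** After multiplication by |mu F|, the left side is the integral over F of the scalar product of
    the vector mu F with the density, and Cauchy-Schwarz applies pointwise. *)
Let enorm_mu_le F : measurable F -> F `<=` box r ->
  enorm (mu F) <= \int[al]_x (\1_F x * enorm (unit_part x)).
Proof.
move=> mF Fr; have bF := bmeas_indic R mF.
have J0 : 0 <= \int[al]_x (\1_F x * enorm (unit_part x)).
  by apply: bRint_ge0 => x; rewrite mulr_ge0 ?enorm_ge0// indicE.
have [v0|v0] := leP (enorm (mu F)) 0; first exact: le_trans J0.
rewrite -(ler_pM2l v0) -bRintZ; last exact: bmeasM.
have -> : enorm (mu F) * enorm (mu F) = \int[al]_x (\sum_i mu F i 0 * (\1_F x * unit_part x i 0)).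
  rewrite bRint_sum; last by move=> i; apply: bmeasZ; apply: bmeasM => //; exact: unit_part_bmeas.
  rewrite -expr2 /enorm sqr_sqrtr; last by apply: sumr_ge0 => i _; exact: sqr_ge0.
  apply: eq_bigr => i _; rewrite bRintZ; last by apply: bmeasM => //; exact: unit_part_bmeas.
  by rewrite Rint_unit_part// expr2.
apply: bRint_le.
- by apply: bmeas_sum => i; apply: bmeasZ; apply: bmeasM => //; exact: unit_part_bmeas.
- by apply: bmeasZ; exact: bmeasM.
move=> x; rewrite mulrCA.
have -> : \sum_i mu F i 0 * (\1_F x * unit_part x i 0) = \1_F x * \sum_i mu F i 0 * unit_part x i 0.
  by rewrite mulr_sumr; apply: eq_bigr => i _; rewrite mulrCA.
by rewrite ler_wpM2l ?dot_le// indicE.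
Qed.

(** On the set E where the norm is below 1, the definition of the variation and [enorm_mu_le] bound
    |mu|(E) by the integral of that norm over E. So the integral of the positive function 1 -
    |sigma| over E is at most 0. *)
Lemma unit_part_eq1 : {ae al, forall x, enorm (unit_part x) = 1}.
Proof.
pose E := box r `&` [set x | enorm (unit_part x) < 1].
have mE : measurable E.
  apply: measurableI; first exact: measurable_box.
  by have := enorm_bmeas.1 measurableT _ (measurable_itv `]-oo, 1[); rewrite setTI set_itvE.
have Er : E `<=` box r by move=> x [].
have bE := bmeas_indic R mE.
have b1 : bmeas (fun x => \1_E x * (1 - enorm (unit_part x))).
  by apply: bmeasM => //; apply: bmeasB => //; exact: bmeas_cst.
have p1 x : 0 <= \1_E x * (1 - enorm (unit_part x)).
  by rewrite mulr_ge0 ?subr_ge0 ?unit_part_le1// indicE.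
have le : (al E <= (\int[al]_x (\1_E x * enorm (unit_part x)))%:E)%E.
  rewrite al_in// bRint_setE//; apply: variation_le_integral => //.
  - by move=> B; exact: enorm_ge0.
  - by apply/measurable_EFinP; case: enorm_bmeas.
  - by move=> x; rewrite lee_fin enorm_ge0.
  move=> F [mF _] FE; rewrite -bRint_setE// lee_fin; apply: enorm_mu_le => //.
  by move=> x /FE/Er.
have I0 : \int[al]_x (\1_E x * (1 - enorm (unit_part x))) = 0.
  apply/eqP; rewrite eq_le bRint_ge0// andbT.
  under eq_Rintegral do rewrite mulrBr mulr1.
  rewrite bRintB//; last exact: bmeasM.
  by rewrite subr_le0 -lee_fin bRint_indic.
have nout : al.-negligible (~` box r).
  by apply/negligibleP => //; apply: measurableC; exact: measurable_box.
have hb : {ae al, forall x, box r x}.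
  by move: nout; apply: negligibleS => x.
apply: filterS2 hb (bRint_ae0 b1 p1 I0) => x xr.
have le1 := unit_part_le1 x.
rewrite indicE; case: (boolP (x \in E)) => [_|].
  by rewrite mul1r => /eqP; rewrite subr_eq0 => /eqP <-.
rewrite notin_setE => nE _; apply/eqP; rewrite eq_le le1 leNgt; apply/negP => lt1.
by apply: nE.
Qed.

(** The sign of w gives a Hahn decomposition: the variation is bounded above by the integral of the
    positive part of w, and the single set where w is nonnegative already attains it. *)
Let jordan (g : set (plane R) -> R) (w : plane R -> R) : bmeas w -> g set0 = 0 ->
  (forall B, 0 <= g B) ->
  (forall F, measurable F -> F `<=` box r -> g F = Num.max (\int[al]_x (\1_F x * w x)) 0) ->
  forall A, measurable A -> A `<=` box r ->
  variation g A = (\int[al]_x (\1_A x * Num.max (w x) 0))%:E.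
Proof.
move=> bw g0 gge gE A mA Ar.
have bw0 : bmeas (fun x => Num.max (w x) 0).
  case: bw => mw [C hC]; split; first exact: measurable_maxr.
  exists C => x; rewrite /Num.max; case: ifP => _; last exact: hC.
  by rewrite normr0 (le_trans _ (hC x)).
have wx x : w x <= Num.max (w x) 0 by rewrite le_max lexx.
have w0x x : 0 <= Num.max (w x) 0 by rewrite le_max lexx orbT.
apply/eqP; rewrite eq_le; apply/andP; split.
  rewrite bRint_setE//; apply: variation_le_integral => //.
  - by apply/measurable_EFinP; case: bw0.
  move=> F [mF _] FA; have bF := bmeas_indic R mF.
  rewrite -bRint_setE// lee_fin gE//; last by move=> x /FA/Ar.
  rewrite ge_max; apply/andP; split; last by apply: bRint_ge0 => x; rewrite mulr_ge0// indicE.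
  by apply: bRint_le; [exact: bmeasM|exact: bmeasM|move=> x; rewrite ler_wpM2l// indicE].
pose A' := A `&` [set x | 0 <= w x].
have mA' : measurable A'.
  apply: measurableI => //.
  by have := bw.1 measurableT _ (measurable_itv `[0, +oo[); rewrite setTI set_itvE.
have A'r : A' `<=` box r by move=> x [/Ar].
apply: (@le_trans _ _ (variation g A')); last by apply: le_variation => x [].
apply: (@le_trans _ _ (g A')%:E); last by apply: variation_ge => //; exact: bounded_borel_box A'r.
rewrite lee_fin gE// le_max; apply/orP; left.
rewrite le_eqVlt; apply/orP; left; apply/eqP; apply: eq_Rintegral => x _.
rewrite !indicE; case: (boolP (x \in A)) => [|]; last first.
  by rewrite notin_setE mul0r => nA; rewrite memNset ?mul0r// => -[].
rewrite inE mul1r => Ax; case: (leP 0 (w x)) => w0.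
  by rewrite mem_set ?mul1r//.
by rewrite memNset ?mul0r// => -[_ /=]; rewrite leNgt w0.
Qed.

Let density_Rint (p : {measure set (plane R) -> \bar R}) (w f : plane R -> R) : bmeas w -> bmeas f ->
  (forall A, measurable A -> A `<=` box r -> p A = (\int[al]_x (\1_A x * w x))%:E) ->
  (forall x, ~ box r x -> f x = 0) -> \int[p]_x f x = \int[al]_x (f x * w x).
Proof.
move=> bw bf pE f0; have mb := @measurable_box R r.
have poo : (p (box r) < +oo)%E by rewrite pE// ltry.
rewrite -(integral_mfrestr0 mb poo bf f0).
have := @bmeas_ext R _ _ (mfrestr mb poo) al (fun=> 1) w (bmeas_cst _ 1) bw _ f bf.
under eq_Rintegral do rewrite mulr1.
apply => A mA; under eq_Rintegral do rewrite mulr1.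
apply: EFin_inj; rewrite bRint_indic//.
have mAr : measurable (A `&` box r) by exact: measurableI.
change (p (A `&` box r) = (\int[al]_x (\1_A x * w x))%:E).
rewrite pE//; congr (_%:E); apply/eqP; rewrite eq_sym -subr_eq0.
have bA := bmeas_indic R mA; have bAr := bmeas_indic R mAr.
rewrite -bRintB; try exact: bmeasM.
apply/eqP; apply: (bRint_null (measurableC mb) al_out).
  by apply: bmeasB; exact: bmeasM.
move=> x /contrapT xr; rewrite -mulrBl !indicE.
rewrite (_ : (x \in A `&` box r) = (x \in A)) ?subrr ?mul0r//.
by rewrite in_setI (mem_set xr) andbT.
Qed.

Lemma vint_unit_part i (f : plane R -> R) : bmeas f -> (forall x, ~ box r x -> f x = 0) ->
  vint mu i f = \int[al]_x (f x * unit_part x i 0).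
Proof.
move=> bf f0; have bu := unit_part_bmeas i; have bnu := bmeasN bu.
have max_bmeas (w : plane R -> R) : bmeas w -> bmeas (fun x => Num.max (w x) 0).
  case=> mw [C hC]; split; first exact: measurable_maxr.
  exists C => x; rewrite /Num.max; case: ifP => _; last exact: hC.
  by rewrite normr0 (le_trans _ (hC x)).
have bp := max_bmeas _ bu; have bn := max_bmeas _ bnu.
rewrite /vint (density_Rint (p := posv mu i) bp bf _ f0); last first.
  move=> A mA Ar; apply: jordan => //.
  - by rewrite vm0 mxE maxxx.
  - by move=> B; rewrite le_max lexx orbT.
  - by move=> F mF Fr; rewrite Rint_unit_part.
rewrite (density_Rint (p := negv mu i) bn bf _ f0); last first.
  move=> A mA Ar; apply: jordan => //.
  - by rewrite vm0 mxE oppr0 maxxx.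
  - by move=> B; rewrite le_max lexx orbT.
  move=> F mF Fr; have bF := bmeas_indic R mF; congr (Num.max _ 0).
  rewrite -Rint_unit_part// -mulN1r -bRintZ; last exact: bmeasM.
  by apply: eq_Rintegral => x _; rewrite mulN1r mulrN.
rewrite -bRintB; try exact: bmeasM.
apply: eq_Rintegral => x _; rewrite -mulrBr; congr (_ * _).
case: (leP (unit_part x i 0) 0) => h.
  by rewrite max_l ?oppr_ge0// sub0r opprK.
by rewrite max_r ?oppr_le0 ?(ltW h)// subr0.
Qed.

End polar_facts.

(** The absolutely continuous part does not charge N, so mu and mus coincide on Borel subsets of N,
    while mus does not charge the complement of N. Nullity for |mu| inside N therefore passes to
    |mus|. *)
Lemma singular_null {R : realType} {m : nat} (mu mus : vradon R m) (N A : set (plane R)) (mua : vradon R m) :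
  (forall B : set (plane R), bounded_borel B -> mu B = mua B + mus B) ->
  tv mua N = 0%E -> tv mus (~` N) = 0%E -> measurable N -> measurable A ->
  tv mu (A `&` N) = 0%E -> tv mus A = 0%E.
Proof.
move=> muE aN sN mN mA AN.
have mAN : measurable (A `&` N) by exact: measurableI.
have s1 : tv mus (A `&` N) = 0%E.
  apply/eqP; rewrite -measure_le0; apply: ge_ereal_sup => _ [F [bF tF FA] <-].
  rewrite eseries0// => k _ _.
  have FN : F k `<=` N by move=> x /FA[].
  have mFk : measurable (F k) by case: (bF k).
  have le0 (nu : vradon R m) B : measurable B -> F k `<=` B -> tv nu B = 0%E -> nu (F k) = 0.
    move=> mB FB nB.
    have : tv nu (F k) = 0%E by exact: (subset_measure0 mFk mB FB nB).
    move=> E; have := tv_ge nu (bF k); rewrite E lee_fin => h.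
    apply/matrixP => i j; rewrite ord1 mxE; apply/eqP; rewrite -normr_le0.
    exact: le_trans (entry_le_enorm _ i) h.
  have := muE _ (bF k); rewrite (le0 mu _ mAN (FA k) AN) (le0 mua _ mN FN aN) add0r => <-.
  by rewrite enorm0.
have s2 : tv mus (A `\` N) = 0%E.
  apply: (subset_measure0 _ (measurableC mN) _ sN); first exact: measurableD.
  by move=> x [].
rewrite (_ : A = (A `&` N) `|` (A `\` N)); last by rewrite setUIDK.
apply/eqP; rewrite -measure_le0 (le_trans (measureU2 _ mAN (measurableD mA mN)))//.
change (tv mus (A `&` N) + tv mus (A `\` N) <= 0)%E.
by rewrite s1 s2 adde0.
Qed.

(** * Localization to boxes *)

Section boxes.
Context {R : realType}.
Implicit Types (x y : plane R) (r : R).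

Lemma continuous_box_bound {V : normedModType R} (f : plane R -> V) r : continuous f ->
  exists2 M, 0 <= M & forall x, `|x| <= r -> `|f x| <= M.
Proof. by move=> cf; have [M M0 h] := compact_norm_bound (@compact_box R r) cf; exists M. Qed.

Lemma blip_clip2 (f : plane R -> R) r L : 0 <= r -> 0 <= L -> continuous f ->
  (forall x y, `|x| <= r -> `|y| <= r -> `|f x - f y| <= L * `|x - y|) ->
  blip (fun x => f (clip2 r x)).
Proof.
move=> r0 L0 cf fL; have [M M0 fM] := continuous_box_bound r cf.
exists (L + M); first exact: addr_ge0.
split=> [x|x y]; first by rewrite (le_trans (fM _ (clip2_le x r0)))// lerDr.
rewrite (le_trans (fL _ _ (clip2_le x r0) (clip2_le y r0)))//.
by rewrite ler_pM ?clip2_lip// lerDl.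
Qed.

Lemma blip_clip2_plane (b : plane R -> plane R) r : 0 <= r -> Cn 1 b ->
  blip (fun x => (b (clip2 r x)).1) /\ blip (fun x => (b (clip2 r x)).2).
Proof.
move=> r0 bC; have [L L0 bL] := Cn1_lipschitz_plane r bC; case: bC => cb _ _ _ _.
split.
- apply: (@blip_clip2 (fun x => (b x).1) r L) => // [x|x y xr yr].
    by apply: continuous_comp; [exact: cb|exact: cvg_fst].
  exact: le_trans (pair_norm1 (b x - b y)) (bL _ _ xr yr).
- apply: (@blip_clip2 (fun x => (b x).2) r L) => // [x|x y xr yr].
    by apply: continuous_comp; [exact: cb|exact: cvg_snd].
  exact: le_trans (pair_norm2 (b x - b y)) (bL _ _ xr yr).
Qed.

Lemma blip_clip2_matrix m n (H : plane R -> 'M[R]_(m, n)) r i j : 0 <= r -> Cn 1 H ->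
  blip (fun x => H (clip2 r x) i j).
Proof.
move=> r0 HC; have [L L0 HL] := Cn1_lipschitz_matrix r HC; case: HC => cH _ _ _ _.
apply: (@blip_clip2 (fun x => H x i j) r L) => // [x|x y xr yr].
  exact: (continuous_comp (cH x) (@coord_continuous _ _ _ i j _)).
by rewrite -mx_entryB; apply: le_trans (mx_norm_entry _ _ _) (HL _ _ xr yr).
Qed.

(** Cramer's rule expresses p and q through the vector p b1 + q b2 divided by the determinant, whose
    inverse is bounded on the compact box. *)
Lemma uniform_independence (b1 b2 : plane R -> plane R) r : 0 <= r ->
  continuous b1 -> continuous b2 ->
  (forall x p q, p *: b1 x + q *: b2 x = 0 -> p = 0 /\ q = 0) ->
  exists2 kap, 0 < kap & forall y p q,
    kap * Num.max `|p| `|q| <= `|p *: b1 (clip2 r y) + q *: b2 (clip2 r y)|.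
Proof.
move=> r0 c1 c2 ind.
pose det x := (b1 x).1 * (b2 x).2 - (b1 x).2 * (b2 x).1.
have cfst (f : plane R -> plane R) : continuous f -> continuous (fun x => (f x).1).
  by move=> cf x; apply: continuous_comp; [exact: cf|exact: cvg_fst].
have csnd (f : plane R -> plane R) : continuous f -> continuous (fun x => (f x).2).
  by move=> cf x; apply: continuous_comp; [exact: cf|exact: cvg_snd].
have cdet : continuous det.
  move=> x; apply: cvgB; apply: cvgM.
  - exact: (cfst _ c1).
  - exact: (csnd _ c2).
  - exact: (csnd _ c1).
  - exact: (cfst _ c2).
(* If the determinant vanished, two relations with coefficients taken from the coordinates would
   force b2 x = 0, and then the relation 0 b1 + 1 b2 = 0 contradicts independence. *)
have detN0 x : det x != 0.
  apply/eqP => d0.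
  have h1 : (b2 x).2 *: b1 x + (- (b1 x).2) *: b2 x = 0.
    apply: injective_projections.
      change ((b2 x).2 * (b1 x).1 + - (b1 x).2 * (b2 x).1 = 0); rewrite -d0 /det; ring.
    change ((b2 x).2 * (b1 x).2 + - (b1 x).2 * (b2 x).2 = 0); ring.
  have h2 : (b2 x).1 *: b1 x + (- (b1 x).1) *: b2 x = 0.
    apply: injective_projections.
      change ((b2 x).1 * (b1 x).1 + - (b1 x).1 * (b2 x).1 = 0); ring.
    change ((b2 x).1 * (b1 x).2 + - (b1 x).1 * (b2 x).2 = 0); rewrite -[RHS]oppr0 -d0 /det; ring.
  have [e1 /eqP] := ind _ _ _ h1; rewrite oppr_eq0 => /eqP e2.
  have [e3 _] := ind _ _ _ h2.
  have : 0 *: b1 x + 1 *: b2 x = 0.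
    by rewrite scale0r add0r scale1r; apply: injective_projections.
  by move=> /ind[_ /eqP]; rewrite oner_eq0.
have [D D0 hD] : exists2 D, 0 <= D & forall x, `|x| <= r -> `|(det x)^-1| <= D.
  by apply: continuous_box_bound => x; apply: cvgV => //; exact: cdet.
have [M1 M10 hM1] := continuous_box_bound r c1.
have [M2 M20 hM2] := continuous_box_bound r c2.
exists ((D * (2 * (M1 + M2)) + 1)^-1); first by rewrite invr_gt0 ltr_wpDl// !mulr_ge0// addr_ge0.
move=> y p q; set x := clip2 r y; have xr : `|x| <= r by exact: clip2_le.
rewrite ler_pdivrMl; last by rewrite ltr_wpDl// !mulr_ge0// addr_ge0.
set v := p *: b1 x + q *: b2 x.
have v1 : `|v.1| <= `|v| by exact: pair_norm1.
have v2 : `|v.2| <= `|v| by exact: pair_norm2.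
have key (g e1 e2 M : R) : g * det x = v.1 * e1 + v.2 * e2 -> `|e1| <= M -> `|e2| <= M ->
    M <= M1 + M2 -> `|g| <= (D * (2 * (M1 + M2)) + 1) * `|v|.
  move=> E h1 h2 hM.
  have -> : g = (v.1 * e1 + v.2 * e2) * (det x)^-1 by rewrite -E mulfK.
  rewrite normrM [leLHS]mulrC [leRHS]mulrDl mul1r (@le_trans _ _ (D * (2 * (M1 + M2)) * `|v|)) ?lerDl//.
  rewrite -mulrA ler_pM ?hD// (le_trans (ler_normD _ _))// !normrM.
  have hh (a e : R) : `|a| <= `|v| -> `|e| <= M -> `|a| * `|e| <= (M1 + M2) * `|v|.
    by move=> ha he; rewrite mulrC ler_pM// (le_trans he).
  rewrite (_ : 2 * (M1 + M2) * `|v| = (M1 + M2) * `|v| + (M1 + M2) * `|v|); last by ring.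
  by rewrite lerD// hh.
have v1E : v.1 = p * (b1 x).1 + q * (b2 x).1 by [].
have v2E : v.2 = p * (b1 x).2 + q * (b2 x).2 by [].
rewrite ge_max; apply/andP; split.
- apply: (key p (b2 x).2 (- (b2 x).1) M2); rewrite ?normrN ?lerDr//.
  + by rewrite v1E v2E /det; ring.
  + exact: le_trans (pair_norm2 _) (hM2 _ xr).
  + exact: le_trans (pair_norm1 _) (hM2 _ xr).
- apply: (key q (- (b1 x).2) (b1 x).1 M1); rewrite ?normrN ?lerDl//.
  + by rewrite v1E v2E /det; ring.
  + exact: le_trans (pair_norm2 _) (hM1 _ xr).
  + exact: le_trans (pair_norm1 _) (hM1 _ xr).
Qed.

Lemma test_function_d_off (phi : plane R -> R) r x :
  (forall y, r < `|y| -> phi y = 0) -> r < `|x| -> d1 phi x = 0 /\ d2 phi x = 0.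
Proof.
move=> phi0 xr; apply: (@near0_d1 _ phi [set y | r < `|y|]) => //.
rewrite (_ : [set y : plane R | r < `|y|] = (fun y : plane R => `|y|) @^-1` `]r, +oo[%classic); last first.
  by apply/seteqP; split => y; rewrite /= in_itv/= andbT.
by apply: open_comp => [y _|]; [exact: norm_continuous|exact: rray_open].
Qed.

Lemma vfield_off (b : plane R -> plane R) (phi : plane R -> R) r x :
  (forall y, r < `|y| -> phi y = 0) -> r < `|x| -> vfield b phi x = 0.
Proof. by move=> phi0 /(test_function_d_off phi0)[e1 e2]; rewrite /vfield e1 e2 !mulr0 addr0. Qed.

Lemma vfield_clip2 (b : plane R -> plane R) (phi : plane R -> R) r x :
  (forall y, r < `|y| -> phi y = 0) -> vfield b phi x = vfield (fun y => b (clip2 r y)) phi x.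
Proof.
move=> phi0; have [xr|xr] := leP `|x| r; first by rewrite /vfield clip2_id.
by rewrite !(vfield_off _ phi0 xr).
Qed.

End boxes.

Lemma sum_ord2 {V : nmodType} (F : 'I_2 -> V) (j k : 'I_2) : k != j -> \sum_i F i = F j + F k.
Proof.
move=> kj; rewrite (bigD1 j)//= (bigD1 k)//= big1 ?addr0// => i /andP[].
by case: j k i kj => [[|[|?]] ?] [[|[|?]] ?] [[|[|?]] ?].
Qed.

Section assembly.
Context {R : realType} (m : 'I_2 -> nat).
Variables (b : 'I_2 -> plane R -> plane R) (H : forall j k : 'I_2, plane R -> 'M[R]_(m j, m k)).
Variables (mu : forall j : 'I_2, vradon R (m j)) (sigma : forall j : 'I_2, plane R -> 'cV[R]_(m j)).
Hypothesis b_smooth : forall j, smooth (b j).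
Hypothesis H_smooth : forall j k, smooth (H j k).
Hypothesis mu_sol : weak_solution b H mu.
Hypothesis pol : forall j, polar (mu j) (sigma j).
Implicit Types (x : plane R).

(** For a test function vanishing outside the box, clipping the coefficients changes nothing, and
    [vint_unit_part] turns the Jordan integrals into integrals against the finite measures carried
    by the box. *)
Let box_weak_eq (j k : 'I_2) (r : R) : 0 <= r -> k != j ->
  weak_eq (fun x => b j (clip2 r x)) (fun x => H j j (clip2 r x)) (fun x => H j k (clip2 r x))
    (tv_box (pol j) r) (tv_box (pol k) r) (unit_part (sigma j)) (unit_part (sigma k)) r.
Proof.
move=> r0 kj i phi tphi phi0; have := mu_sol i tphi.
have off x : ~ box r x -> r < `|x| by move=> /negP; rewrite -ltNge.
have [b1 b2] := blip_clip2_plane r0 (b_smooth j 1).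
have vE : vfield (b j) phi = vfield (fun x => b j (clip2 r x)) phi.
  by apply/funext => x; exact: vfield_clip2.
have HE l : forall c d, vint (mu l) d (fun x => H j l x c d * phi x) =
    \int[tv_box (pol l) r]_x (H j l (clip2 r x) c d * phi x * unit_part (sigma l) x d 0).
  move=> c d; rewrite (_ : (fun x => H j l x c d * phi x) = (fun x => H j l (clip2 r x) c d * phi x)).
    apply: vint_unit_part => [|x /off /phi0 ->]; last by rewrite mulr0.
    by apply: blip_bmeas; apply: blipM; [exact: (blip_clip2_matrix c d r0 (H_smooth j l 1))|exact: test_function_blip].
  apply/funext => x; have [xr|xr] := leP `|x| r; first by rewrite clip2_id.
  by rewrite phi0// !mulr0.
rewrite vE (vint_unit_part (pol j) (r := r)); first last.
- by move=> x /off xr; rewrite (vfield_off _ phi0).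
- exact: vfield_bmeas.
rewrite (sum_ord2 _ kj).
have SE l : \sum_d vint (mu l) d (fun x => H j l x i d * phi x) =
    \sum_d \int[tv_box (pol l) r]_x (H j l (clip2 r x) i d * phi x * unit_part (sigma l) x d 0).
  by apply: eq_bigr => d _; exact: HE.
by rewrite !SE.
Qed.

Lemma transport_system_box (j k : 'I_2) (r T : R) : 0 <= r -> 1 <= T -> k != j ->
  exists phi W L M C, transport_system (b j) (H j j) (H j k) (tv_box (pol j) r) (tv_box (pol k) r)
    (unit_part (sigma j)) (unit_part (sigma k)) r T phi W L M C.
Proof.
move=> r0 T1 kj.
have [Lb Lb0 bL] := Cn1_lipschitz_plane r (b_smooth j 1).
have [LH LH0 HL] := Cn1_lipschitz_matrix r (H_smooth j j 1).
have [Mb _ bM] := continuous_box_bound r (b_smooth j 0).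
have [MH _ HM] := continuous_box_bound r (H_smooth j j 0).
have [phi [W [L [M [C ch]]]]] := characteristics_box r0 (le_trans ler01 T1) Lb0 LH0 bL HL bM HM.
exists phi, W, L, M, C; have [b1 b2] := blip_clip2_plane r0 (b_smooth j 1).
split=> //.
- by move=> c d; apply: blip_clip2_matrix => //; exact: (H_smooth j j 1).
- by move=> c d; apply: blip_clip2_matrix => //; exact: (H_smooth j k 1).
- by move=> i; exact: unit_part_bmeas.
- by move=> i; exact: unit_part_bmeas.
- exact: box_weak_eq.
Qed.

Lemma flow_line_polar (b_indep : forall x (c : 'I_2 -> R), \sum_(j < 2) c j *: b j x = 0 -> forall j, c j = 0)
    (j : 'I_2) (q : R) (n : nat) (N : set (plane R)) : measurable N -> leb2 N = 0%E ->
  {ae tv (mu j), forall x0, N x0 -> forall (t0 t1 : R) (x : R -> plane R) w,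
    t0 < 0 < t1 -> t0 < q < t1 -> - (`|q| + 2) <= t0 -> t1 <= `|q| + 2 ->
    flow_line (b j) (H j j) x0 (sigma j x0) t0 t1 x w -> (forall t, t0 < t < t1 -> `|x t| <= n%:R) ->
    sigma j (x q) = (enorm (w q))^-1 *: w q}.
Proof.
move=> mN N0; have [k kj] : exists k : 'I_2, k != j by exists (rev_ord j); case: j => [[|[|?]] ?].
have jk : j != k by rewrite eq_sym.
(* A line bounded by n satisfies the strict bound by r, and r < r' leaves room for mollification.
   The choice of T gives T >= 2 and |q| + 1 <= T, and covers the time intervals allowed in the
   statement. *)
pose r : R := n%:R + 1; pose r' : R := n%:R + 2; pose T := `|q| + 2.
have r'0 : 0 <= r' by rewrite addr_ge0.
have rr : r < r' by rewrite ltrD2l (ltr_nat R 1 2).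
have T2 : 2 <= T by rewrite lerDr.
have T1 : 1 <= T by rewrite (le_trans _ T2)// (ler_nat R 1 2).
have qT : `|q| + 1 <= T by rewrite lerD2l (ler_nat R 1 2).
have [phi1 [W1 [L1 [M1 [C1 ts1]]]]] := transport_system_box r'0 T1 kj.
have [phi2 [W2 [L2 [M2 [C2 ts2]]]]] := transport_system_box r'0 T1 jk.
have [kap kap0 ind] : exists2 kap, 0 < kap & forall y p q,
    kap * Num.max `|p| `|q| <= `|p *: b j (clip2 r' y) + q *: b k (clip2 r' y)|.
  apply: uniform_independence => //; [exact: (b_smooth j 0)|exact: (b_smooth k 0)|].
  move=> x p p' E.
  have := b_indep x (fun i => if i == j then p else p').
  rewrite (sum_ord2 _ kj) eqxx (negbTE kj) => /(_ E) h.
  by split; [have := h j; rewrite eqxx|have := h k; rewrite (negbTE kj)].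
have u_nz : {ae tv_box (pol k) r', forall x, unit_part (sigma k) x != 0}.
  apply: filterS (unit_part_eq1 (pol k) r') => x e1.
  by rewrite -enorm_eq0 e1 oner_eq0.
have e1 := unit_part_eq1 (pol j) r'.
have := flow_polar ts1 ts2 T2 u_nz kap0 ind (unit_part_le1 (sigma j)) e1 rr qT mN N0.
move=> fp.
move: (ae_tv_box e1) (ae_tv_box fp); apply: filterS2 => x0 u1 h Nx0 t0 t1 x w t00 t0q Tt0 t1T fl bd.
have ch := ts_char ts1.
have bd' t : t0 < t < t1 -> `|x t| <= r' by move=> /bd /le_trans; apply; rewrite lerDl.
have xphi t : t0 < t < t1 -> x t = phi1 t x0 by move=> ht; have [] := char_flow_line ch t00 ht Tt0 t1T fl bd'.
have [xq wq] := char_flow_line ch t00 t0q Tt0 t1T fl bd'.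
have [x0E _ _] := fl.
have bx0 : box r' x0 by rewrite /box/= -x0E; exact: bd'.
have {}u1 := u1 bx0.
have uE : unit_part (sigma j) x0 = sigma j x0.
  by apply: unit_part_id; rewrite -enorm_eq0 u1 oner_eq0.
have {}h := h bx0 Nx0; rewrite uE -wq -xq in h.
(* The resolvent is invertible and the initial direction has norm 1. This makes the value of
   [unit_part] at the end point nonzero, hence equal to [sigma j] there. *)
have wq0 : w q != 0.
  apply/eqP => w0; have := charW_inv ch (t := q) x0.
  have qT' : `|q| <= T by rewrite lerDl.
  move=> /(_ qT') /mulmx1C E; move: u1; rewrite uE -[sigma j x0]mul1mx -E -mulmxA -wq w0 mulmx0 enorm0.
  by move=> /esym/eqP; rewrite oner_eq0.
have phi_lt t : Num.min 0 q <= t <= Num.max 0 q -> `|phi1 t x0| < r.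
  move=> /andP[mt tM]; have ht : t0 < t < t1.
    case/andP: t00 => p1 p2; case/andP: t0q => p3 p4.
    by rewrite (lt_le_trans _ mt) ?lt_min ?p1//= (le_lt_trans tM)// gt_max p2.
  by rewrite -xphi// (le_lt_trans (bd _ ht))// ltrDl.
rewrite -h//; apply/esym/unit_part_id; rewrite h//.
by rewrite scaler_eq0 negb_or invr_eq0 enorm_eq0 wq0.
Qed.

End assembly.

Theorem theorem5p2 (R : realType) (m : 'I_2 -> nat)
    (b : 'I_2 -> plane R -> plane R)
    (H : forall j k : 'I_2, plane R -> 'M[R]_(m j, m k))
    (mu mus : forall j : 'I_2, vradon R (m j))
    (sigma : forall j : 'I_2, plane R -> 'cV[R]_(m j))
    (b_smooth : forall j, smooth (b j))
    (H_smooth : forall j k, smooth (H j k))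
    (mu_sol : weak_solution b H mu)
    (b_indep : forall (x : plane R) (c : 'I_2 -> R),
      \sum_(j < 2) c j *: b j x = 0 -> forall j, c j = 0)
    (sigma_polar : forall j, polar (mu j) (sigma j))
    (mus_singular : forall j, singular_part (mu j) (mus j)) :
  forall j : 'I_2,
    ae_flow_invariant (tv (mus j)) (b j) (H j j)
      [set (x, sigma j x) | x in [set: plane R]].
Proof.
move=> j q; have [mua [muE mua_ac [N [mN N0 sN]]]] := mus_singular j.
have lN : leb2 N = 0%E by rewrite -lebesgue2E.
have aN : tv mua N = 0%E.
  apply: (mua_ac N) => // A mA AN; rewrite lebesgue2E//.
  exact: (subset_measure0 mA mN AN lN).
(* The exceptional set for mus consists of the one for mu, which is negligible inside N, and of the
   complement of N, which mus does not charge. *)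
have flow n : {ae tv (mus j), forall x0, forall (t0 t1 : R) (x : R -> plane R) w,
    t0 < 0 < t1 -> t0 < q < t1 -> - (`|q| + 2) <= t0 -> t1 <= `|q| + 2 ->
    flow_line (b j) (H j j) x0 (sigma j x0) t0 t1 x w -> (forall t, t0 < t < t1 -> `|x t| <= n%:R) ->
    sigma j (x q) = (enorm (w q))^-1 *: w q}.
  have [A [mA A0 hA]] := flow_line_polar b_smooth H_smooth mu_sol sigma_polar b_indep j q n mN lN.
  exists (A `|` ~` N); split.
  - by apply: measurableU => //; exact: measurableC.
  - have sA : tv (mus j) A = 0%E.
      apply: (singular_null muE aN sN mN mA).
      by apply: (subset_measure0 _ mA _ A0); [exact: measurableI|move=> x []].
    apply/eqP; rewrite -measure_le0 (le_trans (measureU2 _ mA (measurableC mN)))//.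
    change (tv (mus j) A + tv (mus j) (~` N) <= 0)%E.
    by rewrite sA sN adde0.
  move=> x0 /= nP; have [Nx|] := pselect (N x0); last by right.
  by left; apply: hA => /= h; apply: nP; exact: h.
(* The size of the box depends on the flow line, hence on x0, so the exceptional sets of all boxes
   are put together. *)
move/ae_foralln: flow; apply: filterS => x0 flow w0 [y _ [-> <-]] t0 t1 x w t00 t0q [xE wE dE].
(* The line may be unbounded near t0 and t1. The shrunken interval still contains 0 and q and lies
   in a compact part of (t0, t1), where x is bounded; the shift by 1 keeps it within |q| + 2. *)
pose t0' := Num.max ((t0 + Num.min 0 q) / 2) (Num.min 0 q - 1).
pose t1' := Num.min ((t1 + Num.max 0 q) / 2) (Num.max 0 q + 1).
have [m0 M0 mq Mq] : [/\ Num.min 0 q <= 0, 0 <= Num.max 0 q, Num.min 0 q <= q & q <= Num.max 0 q].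
  by rewrite !ge_min !le_max !lexx !orbT.
have [mN' MN'] : - `|q| <= Num.min 0 q /\ Num.max 0 q <= `|q|.
  split; first by rewrite le_min oppr_le0 normr_ge0 lerNl -normrN ler_norm.
  by rewrite ge_max normr_ge0 ler_norm.
have t0m : t0 < Num.min 0 q by rewrite lt_min; case/andP: t00 => ->; case/andP: t0q => ->.
have Mt1 : Num.max 0 q < t1 by rewrite gt_max; case/andP: t00 => _ ->; case/andP: t0q => _ ->.
have h1 : t0 < t0' by rewrite /t0' lt_max; apply/orP; left; lra.
have h2 : t0' < Num.min 0 q by rewrite /t0' gt_max; apply/andP; split; lra.
have h3 : Num.max 0 q < t1' by rewrite /t1' lt_min; apply/andP; split; lra.
have h4 : t1' < t1 by rewrite /t1' gt_min; apply/orP; left; lra.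
have h5 : - (`|q| + 2) <= t0' by rewrite /t0' le_max; apply/orP; right; lra.
have h6 : t1' <= `|q| + 2 by rewrite /t1' ge_min; apply/orP; right; lra.
have [n hn] : exists n : nat, forall t, t0' < t < t1' -> `|x t| <= n%:R.
  have cx : {within `[t0', t1'], continuous x}.
    apply: continuous_in_subspaceT => t; rewrite inE/= in_itv/= => /andP[a1 a2].
    have [dx _] := dE t ltac:(by apply/andP; split; lra).
    by apply: differentiable_continuous; apply/derivable1_diffP; exact: ex_derive.
  have /compact_bounded[M [_ hM]] := continuous_compact cx (@segment_compact R t0' t1').
  exists (Num.bound `|M + 1|) => t /andP[a1 a2].
  apply: (@le_trans _ _ (M + 1)); last by rewrite (le_trans (ler_norm _))// ltW// archi_boundP.
  apply: (hM _ _ (x t)); first by rewrite ltrDl.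
  by exists t => //; rewrite /= in_itv/= !ltW.
exists (x q) => //; congr pair; apply: (flow n t0' t1' x w) => //.
- by apply/andP; split; lra.
- by apply/andP; split; lra.
- by split => // t /andP[a1 a2]; apply: dE; apply/andP; split; lra.
Qed.
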